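(* Let $f\in C^r(\mathbb{R},\mathbb{R})$ ($r$ a sufficiently large integer) satisfy: $f(0)=f'(0)=\dots=f^{(p-1)}(0)=0$ and $f^{(p)}(0)=a\,p!\neq 0$ for some even integer $p\geq 2$; and moreover $f^{(d)}(0)=b\,d!\neq 0$ for some odd integer $d<2p-1$, with $f^{(r')}(0)=0$ for every odd integer $r'<d$. Then there exists a constant $C_{11}=C_{11}(f)>0$ such that for every $\omega\in\mathcal{W}$ and every integer $n\geq 1$ satisfying $$\frac{(|\omega-1|\,n^2)^{(p-1)/(d-1)}}{\gamma_\omega}\leq C_{11},$$ and with $\omega>1$ if $b>0$ (resp. $\omega<1$ if $b<0$), the equation $$u_{tt}-u_{xx}+f(u)=0,\qquad u(t,0)=u(t,\pi)=0$$ possesses at least one pair of even (in time) periodic classical $C^2$ solutions of minimal period $2\pi/(n\omega)$.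
   Context: For $\gamma>0$, $W_\gamma:=\{\omega\in\mathbb{R} : |\omega l-j|\geq \gamma/l \text{ for all integers } l\geq 1,\ j\geq 0 \text{ with } j\neq l\}$; $\mathcal{W}:=\bigcup_{\gamma>0}W_\gamma$; for $\omega\in\mathcal{W}$, $\gamma_\omega:=\max\{\gamma : \omega\in W_\gamma\}$. A solution $u(t,x)$ is even in time if $u(-t,x)=u(t,x)$. A ''pair'' of solutions refers to $u(t,x)$ and $u(t+\pi,\pi-x)$, which are both solutions. *)

(* Defs.v *)
From Stdlib Require Import Reals Factorial.
From Coquelicot Require Import Coquelicot.
Open Scope R_scope.

Definition Ck (r : nat) (f : R -> R) : Prop :=
  forall k : nat, (k <= r)%nat ->
    forall x : R, ex_derive_n f k x /\ continuous (Derive_n f k) x.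

Definition in_W (gamma omega : R) : Prop :=
  forall l j : nat, (1 <= l)%nat -> j <> l ->
    Rabs (omega * INR l - INR j) >= gamma / INR l.

(* g is gamma_omega := max { gamma > 0 : omega in W_gamma }
   (its existence with g > 0 is exactly omega in the union W). *)
Definition is_gamma_omega (omega g : R) : Prop :=
  0 < g /\ in_W g omega /\
  (forall gamma, 0 < gamma -> in_W gamma omega -> gamma <= g).

Definition pd_t (u : R -> R -> R) (t x : R) : R := Derive (fun s => u s x) t.
Definition pd_x (u : R -> R -> R) (t x : R) : R := Derive (fun y => u t y) x.

Definition joint_cont (g : R -> R -> R) (t x : R) : Prop :=
  continuous (fun z : R * R => g (fst z) (snd z)) (t, x).

(* u is C^2 (jointly in (t,x)) on an open set containing the closed strip;
   here on all of R^2. *)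
Definition C2_2d (u : R -> R -> R) : Prop :=
  forall t x : R,
    ex_derive (fun s => u s x) t /\ ex_derive (fun y => u t y) x /\
    ex_derive (fun s => pd_t u s x) t /\ ex_derive (fun y => pd_t u t y) x /\
    ex_derive (fun s => pd_x u s x) t /\ ex_derive (fun y => pd_x u t y) x /\
    joint_cont u t x /\ joint_cont (pd_t u) t x /\ joint_cont (pd_x u) t x /\
    joint_cont (pd_t (pd_t u)) t x /\ joint_cont (pd_x (pd_t u)) t x /\
    joint_cont (pd_t (pd_x u)) t x /\ joint_cont (pd_x (pd_x u)) t x.

Definition is_classical_solution (f : R -> R) (u : R -> R -> R) : Prop :=
  C2_2d u /\
  (forall t x, 0 <= x <= PI ->
     pd_t (pd_t u) t x - pd_x (pd_x u) t x + f (u t x) = 0) /\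
  (forall t, u t 0 = 0 /\ u t PI = 0).

Definition even_in_time (u : R -> R -> R) : Prop :=
  forall t x, 0 <= x <= PI -> u (- t) x = u t x.

Definition time_periodic (u : R -> R -> R) (T : R) : Prop :=
  forall t x, 0 <= x <= PI -> u (t + T) x = u t x.

Definition minimal_time_period (u : R -> R -> R) (T : R) : Prop :=
  0 < T /\ time_periodic u T /\
  (forall T', 0 < T' < T -> ~ time_periodic u T').

Definition good_solution (f : R -> R) (T : R) (u : R -> R -> R) : Prop :=
  is_classical_solution f u /\ even_in_time u /\ minimal_time_period u T.

(* Main.v *)
(* Put u(t,x) = delta U(n omega t, x), phi(y) = f(delta y)/delta and eps = (omega^2 - 1) n^2, with delta fixed by
   b delta^(d-1) = eps, so that n^2 omega^2 U_tt - U_xx + phi(U) = 0 is to be solved with U 2 pi-periodic and even in t.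
   Modes cos(kt) sin(jx) with j = nk are resonant (space V), the others span W.

   The equation is first collocated on a finite grid, where every integral is a finite average. The modes with j <> nk
   have divisors bounded below by a multiple of gamma, and phi' = O(delta^(p-1)) is small against gamma, so the
   W-equation is solved by a contraction w = w(v). What is left on V is the gradient of a functional with quadratic part |v|^2/2. The even
   Taylor terms of f average to zero against V (substitute (t,x) -> (t + n pi, pi - x)), the odd term of order d has
   coefficient exactly eps, and the rest is O(delta^(2p-2) + delta^d), which is small against eps because d < 2p - 1.
   The reduced functional is thus a small perturbation of |v|^2/2 - avg(v^(d+1))/(d+1), whose minimum on its Nehari set
   is a critical point; comparison with an explicit competitor keeps its first coefficient away from zero.

   The solutions satisfy bounds on second derivatives that do not depend on the grid size M, so a subsequence converges
   in C^2 as M -> oo. The limit solves the equation, and the nonzero first mode makes its period minimal. *)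

Require Import Defs.
From Stdlib Require Import Reals Factorial.
From Stdlib Require Import List Psatz Permutation ZArith Bool Cantor Ranalysis5 IndefiniteDescription FunctionalExtensionality.
From Coquelicot Require Import Coquelicot.
Open Scope R_scope.

(** The delicate point is the size of [w]. Inversion on W costs [1/ga], so a direct estimate gives
    [w = O(A/ga)] with [A] of order [delta^(p-1)], and a feedback on V of order [A^2/ga]. As
    [p < d], smallness of [A/ga] does not make this small against [eps], of order [delta^(d-1)]. The
    way out: a nearly resonant mode off V has [|om - 1| n k >= 1/2], a time frequency so high that
    one time derivative of [phi(v)] pays for the divisor, because [|om - 1| n <= ga]. Hence
    [w = O(A)], the feedback is [O(A^2)], and [2p - 2 > d - 1] suffices.

    On the grid Parseval is orthogonality of sampled cosines and sines, a derivative is a finite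
    difference, and the fixed point and the Nehari minimum both come from one compactness statement.
    The price is that every bound needed in the limit must be independent of [M]. The recurring
    numeral 7 is [6 + 1], the sup bounds for [v] and [w]. *)

(** * Finite sums over lists *)

Definition lsum {T : Type} (l : list T) (F : T -> R) : R :=
  fold_right (fun a s => F a + s) 0 l.

Section Lsum.
Context {T : Type}.
Implicit Types (l : list T) (F G : T -> R).

Lemma lsum_cons a l F : lsum (a :: l) F = F a + lsum l F.
Proof. reflexivity. Qed.

Lemma lsum_ext l F G : (forall a, In a l -> F a = G a) -> lsum l F = lsum l G.
Proof.
induction l as [|a l IH]; intros H; [reflexivity|].
rewrite !lsum_cons, (H a (or_introl eq_refl)), IH; [reflexivity|].
intros b Hb; apply H; right; exact Hb.
Qed.

Lemma lsum_le l F G : (forall a, In a l -> F a <= G a) -> lsum l F <= lsum l G.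
Proof.
induction l as [|a l IH]; intros H; [apply Rle_refl|].
rewrite !lsum_cons.
apply Rplus_le_compat; [apply H; left; reflexivity|apply IH; intros b Hb; apply H; right; exact Hb].
Qed.

Lemma lsum_plus l F G : lsum l (fun a => F a + G a) = lsum l F + lsum l G.
Proof. induction l as [|a l IH]; [cbn; lra|]; rewrite !lsum_cons, IH; lra. Qed.

Lemma lsum_minus l F G : lsum l (fun a => F a - G a) = lsum l F - lsum l G.
Proof. induction l as [|a l IH]; [cbn; lra|]; rewrite !lsum_cons, IH; lra. Qed.

Lemma lsum_opp l F : lsum l (fun a => - F a) = - lsum l F.
Proof. induction l as [|a l IH]; [cbn; lra|]; rewrite !lsum_cons, IH; lra. Qed.

Lemma lsum_scal l c F : lsum l (fun a => c * F a) = c * lsum l F.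
Proof. induction l as [|a l IH]; [cbn; lra|]; rewrite !lsum_cons, IH; lra. Qed.

Lemma lsum_scal_r l c F : lsum l (fun a => F a * c) = lsum l F * c.
Proof. induction l as [|a l IH]; [cbn; lra|]; rewrite !lsum_cons, IH; lra. Qed.

Lemma lsum_zero l F : (forall a, In a l -> F a = 0) -> lsum l F = 0.
Proof.
intros H; rewrite (lsum_ext l F (fun a => 0 * 0)) by (intros a Ha; rewrite H by exact Ha; ring).
rewrite lsum_scal; ring.
Qed.

Lemma lsum_nonneg l F : (forall a, In a l -> 0 <= F a) -> 0 <= lsum l F.
Proof.
intros H; rewrite <- (lsum_zero l (fun _ => 0)) by reflexivity.
now apply lsum_le.
Qed.

Lemma lsum_const l c : lsum l (fun _ => c) = INR (length l) * c.
Proof.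
induction l as [|a l IH]; [cbn; ring|].
rewrite lsum_cons, IH; cbn [length]; rewrite S_INR; ring.
Qed.

Lemma lsum_abs l F : Rabs (lsum l F) <= lsum l (fun a => Rabs (F a)).
Proof.
induction l as [|a l IH]; [cbn; rewrite Rabs_R0; lra|].
rewrite !lsum_cons; eapply Rle_trans; [apply Rabs_triang|lra].
Qed.

Lemma lsum_term_le l F a : (forall b, In b l -> 0 <= F b) -> In a l -> F a <= lsum l F.
Proof.
induction l as [|b l IH]; intros H Ha; [easy|].
rewrite lsum_cons; destruct Ha as [->|Ha].
- assert (0 <= lsum l F) by (apply lsum_nonneg; intros c Hc; apply H; right; exact Hc). lra.
- assert (0 <= F b) by (apply H; left; reflexivity).
  assert (F a <= lsum l F) by (apply IH; [intros c Hc; apply H; right; exact Hc|exact Ha]). lra.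
Qed.

Lemma lsum_app l l' F : lsum (l ++ l') F = lsum l F + lsum l' F.
Proof. induction l as [|a l IH]; [symmetry; apply Rplus_0_l|]; cbn [app]; rewrite !lsum_cons, IH; ring. Qed.

Lemma lsum_perm l l' F : Permutation l l' -> lsum l F = lsum l' F.
Proof. induction 1; rewrite ?lsum_cons in *; [reflexivity|congruence|ring|congruence]. Qed.

Lemma lsum_filter l (p : T -> bool) F :
  lsum l F = lsum (filter p l) F + lsum (filter (fun a => negb (p a)) l) F.
Proof.
induction l as [|a l IH]; [cbn; lra|].
cbn [filter]; destruct (p a); cbn [negb]; rewrite !lsum_cons, IH; lra.
Qed.

Lemma lsum_single l F a :
  NoDup l -> In a l -> (forall b, In b l -> b <> a -> F b = 0) -> lsum l F = F a.
Proof.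
induction l as [|c l IH]; intros Hn Ha H; [easy|].
inversion_clear Hn as [|? ? Hc Hl]; rewrite lsum_cons; destruct Ha as [->|Ha].
- rewrite lsum_zero; [ring|].
  intros b Hb; apply H; [right; exact Hb|]; intros ->; exact (Hc Hb).
- rewrite IH; [|exact Hl|exact Ha|intros b Hb; apply H; right; exact Hb].
  rewrite (H c); [ring|left; reflexivity|intros ->; exact (Hc Ha)].
Qed.

Lemma lsum_incl_le l l' F :
  NoDup l -> incl l l' -> (forall a, In a l' -> 0 <= F a) -> lsum l F <= lsum l' F.
Proof.
revert l'; induction l as [|a l IH]; intros l' Hn Hi H.
- now apply lsum_nonneg.
- inversion_clear Hn as [|? ? Ha Hl].
  destruct (in_split a l' (Hi a (or_introl eq_refl))) as (l1 & l2 & ->).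
  assert (E : lsum (l1 ++ a :: l2) F = F a + lsum (l1 ++ l2) F)
    by (rewrite !lsum_app, lsum_cons; lra).
  rewrite E, lsum_cons; apply Rplus_le_compat_l, IH.
  + exact Hl.
  + intros b Hb; assert (Hb' := Hi b (or_intror Hb)).
    apply in_app_or in Hb'; apply in_or_app; destruct Hb' as [Hb'|[->|Hb']]; [now left|now elim Ha|now right].
  + intros b Hb; apply H; apply in_app_or in Hb; apply in_or_app; destruct Hb; [now left|right; now right].
Qed.

Lemma lsum_cauchy_schwarz l F G :
  (lsum l (fun a => F a * G a)) ^ 2 <= lsum l (fun a => F a ^ 2) * lsum l (fun a => G a ^ 2).
Proof.
induction l as [|a l IH]; [cbn; lra|].
rewrite !lsum_cons.
set (x := lsum l _) in *; set (y := lsum l (fun a => F a ^ 2)) in *; set (z := lsum l (fun a => G a ^ 2)) in *.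
assert (Hy : 0 <= y) by (apply lsum_nonneg; intros; apply pow2_ge_0).
assert (Hz : 0 <= z) by (apply lsum_nonneg; intros; apply pow2_ge_0).
assert (H : 2 * (F a * G a) * x <= F a ^ 2 * z + G a ^ 2 * y).
{ assert (Hx : Rabs x <= sqrt y * sqrt z).
  { rewrite <- sqrt_mult by assumption. rewrite <- sqrt_Rsqr_abs. apply sqrt_le_1_alt. unfold Rsqr. lra. }
  assert (E1 : y = sqrt y ^ 2) by (simpl; rewrite Rmult_1_r, sqrt_sqrt; auto).
  assert (E2 : z = sqrt z ^ 2) by (simpl; rewrite Rmult_1_r, sqrt_sqrt; auto).
  rewrite E1, E2.
  apply Rle_trans with (2 * Rabs (F a * G a) * (sqrt y * sqrt z)).
  - rewrite !Rmult_assoc. apply Rmult_le_compat_l; [lra|]. rewrite <- Rmult_assoc.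
    eapply Rle_trans; [apply Rle_abs|]. rewrite (Rabs_mult (F a * G a) x).
    apply Rmult_le_compat_l; [apply Rabs_pos|exact Hx].
  - rewrite Rabs_mult.
    rewrite <- (pow2_abs (F a)), <- (pow2_abs (G a)).
    assert (0 <= (Rabs (F a) * sqrt z - Rabs (G a) * sqrt y) ^ 2) by apply pow2_ge_0. nra. }
nra.
Qed.

End Lsum.

Lemma lsum_map {T U : Type} (h : T -> U) (l : list T) (F : U -> R) :
  lsum (map h l) F = lsum l (fun a => F (h a)).
Proof. induction l as [|a l IH]; [reflexivity|]; cbn [map]; now rewrite !lsum_cons, IH. Qed.

Lemma lsum_exchange {T U : Type} (l : list T) (l' : list U) (F : T -> U -> R) :
  lsum l (fun a => lsum l' (fun b => F a b)) = lsum l' (fun b => lsum l (fun a => F a b)).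
Proof.
induction l as [|a l IH].
- cbn; symmetry; now apply lsum_zero.
- rewrite lsum_cons, IH, <- lsum_plus; now apply lsum_ext.
Qed.

Lemma lsum_list_prod {T U : Type} (l : list T) (l' : list U) (F : T * U -> R) :
  lsum (list_prod l l') F = lsum l (fun a => lsum l' (fun b => F (a, b))).
Proof.
induction l as [|a l IH]; [reflexivity|].
cbn [list_prod]; now rewrite lsum_app, lsum_map, IH.
Qed.

Lemma lsum_prod_mult {T U : Type} (l : list T) (l' : list U) (F : T -> R) (G : U -> R) :
  lsum (list_prod l l') (fun p => F (fst p) * G (snd p)) = lsum l F * lsum l' G.
Proof.
rewrite lsum_list_prod, <- lsum_scal_r; apply lsum_ext; intros a _.
cbn [fst snd]; apply lsum_scal.
Qed.

Lemma NoDup_list_prod {T U : Type} (l : list T) (l' : list U) :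
  NoDup l -> NoDup l' -> NoDup (list_prod l l').
Proof.
intros H H'; induction H as [|a l Ha Hl IH]; [constructor|].
cbn [list_prod]; apply NoDup_app.
- apply FinFun.Injective_map_NoDup; [intros x y E; congruence|exact H'].
- exact IH.
- intros [x y] Hx Hy. apply in_map_iff in Hx; destruct Hx as (z & E & _).
  inversion E; subst. apply in_prod_iff in Hy; tauto.
Qed.

Lemma lsum_seq_S N F : lsum (seq 0 (S N)) F = lsum (seq 0 N) F + F N.
Proof. rewrite seq_S, lsum_app; cbn; ring. Qed.

Lemma lsum_seq_shift N F : lsum (seq 0 N) (fun m => F (S m)) = lsum (seq 0 N) F - F 0%nat + F N.
Proof. induction N as [|N IH]; [cbn; ring|]; rewrite !lsum_seq_S, IH; ring. Qed.

Lemma lsum_seq_rev N F : lsum (seq 0 N) (fun m => F (N - S m)%nat) = lsum (seq 0 N) F.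
Proof.
induction N as [|N IH]; [reflexivity|].
rewrite (lsum_seq_S N F), <- IH.
change (seq 0 (S N)) with (0%nat :: seq 1 N).
rewrite lsum_cons, <- seq_shift, lsum_map.
replace (S N - 1)%nat with N by lia.
rewrite Rplus_comm; f_equal.
Qed.

Lemma lsum_seq_split N1 N2 F :
  lsum (seq 0 (N1 + N2)) F = lsum (seq 0 N1) F + lsum (seq 0 N2) (fun m => F (N1 + m)%nat).
Proof.
rewrite seq_app, lsum_app; f_equal; cbn [Nat.add].
clear; revert N1; induction N2 as [|N IH]; intros N1; [reflexivity|].
cbn [seq]; rewrite !lsum_cons, (IH (S N1)), <- (seq_shift N 0), lsum_map, Nat.add_0_r.
f_equal. apply lsum_ext; intros; f_equal; lia.
Qed.

Lemma lsum_periodic_shift N s (F : nat -> R) :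
  (forall m, F (m + N)%nat = F m) ->
  lsum (seq 0 N) (fun m => F (m + s)%nat) = lsum (seq 0 N) F.
Proof.
intros H; induction s as [|s IH].
- apply lsum_ext; intros; f_equal; lia.
- rewrite <- IH.
  assert (E := lsum_seq_shift N (fun k => F (k + s)%nat)); cbn beta in E.
  rewrite (lsum_ext _ _ (fun m => F (S m + s)%nat)) by (intros; f_equal; lia).
  rewrite E.
  replace (N + s)%nat with (0 + s + N)%nat by lia. rewrite H. ring.
Qed.

(** * Weighted quadratic norms *)

Definition nrm {T : Type} (l : list T) (w F : T -> R) : R :=
  sqrt (lsum l (fun a => w a * F a ^ 2)).

Section Nrm.
Context {T : Type} (l : list T) (w : T -> R).
Hypothesis w_pos : forall a, In a l -> 0 <= w a.

Lemma nrm_nonneg F : 0 <= nrm l w F.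
Proof. apply sqrt_pos. Qed.

Lemma nrm_arg_nonneg F : 0 <= lsum l (fun a => w a * F a ^ 2).
Proof. apply lsum_nonneg; intros a Ha; apply Rmult_le_pos; [now apply w_pos|apply pow2_ge_0]. Qed.

Lemma nrm_sq F : nrm l w F ^ 2 = lsum l (fun a => w a * F a ^ 2).
Proof. unfold nrm; simpl; rewrite Rmult_1_r; apply sqrt_sqrt, nrm_arg_nonneg. Qed.

Lemma nrm_le_of_sq F B : 0 <= B -> lsum l (fun a => w a * F a ^ 2) <= B ^ 2 -> nrm l w F <= B.
Proof.
intros HB H; unfold nrm; rewrite <- (sqrt_pow2 B HB); now apply sqrt_le_1_alt.
Qed.

Lemma nrm_cauchy_schwarz F G :
  Rabs (lsum l (fun a => w a * (F a * G a))) <= nrm l w F * nrm l w G.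
Proof.
apply Rsqr_incr_0_var; [|apply Rmult_le_pos; apply nrm_nonneg].
rewrite <- Rsqr_abs; unfold Rsqr.
replace (nrm l w F * nrm l w G * (nrm l w F * nrm l w G)) with (nrm l w F ^ 2 * nrm l w G ^ 2) by ring.
rewrite !nrm_sq.
assert (H := lsum_cauchy_schwarz l (fun a => sqrt (w a) * F a) (fun a => sqrt (w a) * G a)).
assert (E : forall X Y : T -> R, lsum l (fun a => sqrt (w a) * X a * (sqrt (w a) * Y a))
   = lsum l (fun a => w a * (X a * Y a))).
{ intros X Y; apply lsum_ext; intros a Ha.
  replace (sqrt (w a) * X a * (sqrt (w a) * Y a)) with (sqrt (w a) * sqrt (w a) * (X a * Y a)) by ring.
  rewrite sqrt_sqrt by now apply w_pos. reflexivity. }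
assert (E2 : forall X : T -> R, lsum l (fun a => (sqrt (w a) * X a) ^ 2) = lsum l (fun a => w a * X a ^ 2)).
{ intros X; rewrite (lsum_ext _ _ (fun a => sqrt (w a) * X a * (sqrt (w a) * X a))) by (intros; ring).
  rewrite E; apply lsum_ext; intros; ring. }
cbn beta in H; rewrite E, !E2 in H. lra.
Qed.

Lemma nrm_triang F G : nrm l w (fun a => F a + G a) <= nrm l w F + nrm l w G.
Proof.
apply nrm_le_of_sq; [apply Rplus_le_le_0_compat; apply nrm_nonneg|].
rewrite (lsum_ext _ _ (fun a => w a * F a ^ 2 + (2 * (w a * (F a * G a)) + w a * G a ^ 2)))
  by (intros; ring).
rewrite !lsum_plus, lsum_scal, <- !nrm_sq.
assert (H := nrm_cauchy_schwarz F G); apply Rabs_le_between in H. nra.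
Qed.

Lemma nrm_le F G : (forall a, In a l -> Rabs (F a) <= Rabs (G a)) -> nrm l w F <= nrm l w G.
Proof.
intros H; apply sqrt_le_1_alt, lsum_le; intros a Ha.
apply Rmult_le_compat_l; [now apply w_pos|].
rewrite <- (pow2_abs (F a)), <- (pow2_abs (G a)); apply pow_incr; split; [apply Rabs_pos|now apply H].
Qed.

Lemma nrm_scal c F : nrm l w (fun a => c * F a) = Rabs c * nrm l w F.
Proof.
unfold nrm; rewrite (lsum_ext _ _ (fun a => c ^ 2 * (w a * F a ^ 2))) by (intros; ring).
rewrite lsum_scal, sqrt_mult by (try apply pow2_ge_0; apply nrm_arg_nonneg).
f_equal. rewrite <- sqrt_Rsqr_abs; f_equal; unfold Rsqr; ring.
Qed.

Lemma nrm_ext F G : (forall a, In a l -> F a = G a) -> nrm l w F = nrm l w G.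
Proof. intros H; unfold nrm; f_equal; apply lsum_ext; intros a Ha; now rewrite H. Qed.

Lemma nrm_triang_minus F G : nrm l w (fun a => F a - G a) <= nrm l w F + nrm l w G.
Proof.
assert (H := nrm_triang F (fun a => (-1) * G a)).
rewrite nrm_scal, Rabs_left in H by lra.
rewrite (nrm_ext _ (fun a => F a + -1 * G a)) by (intros; ring). lra.
Qed.

Lemma nrm_zero F : (forall a, In a l -> F a = 0) -> nrm l w F = 0.
Proof.
intros H; unfold nrm; rewrite lsum_zero; [apply sqrt_0|]; intros a Ha; rewrite H by exact Ha; ring.
Qed.
End Nrm.

(** * Trigonometric sums *)

(** Times [2 sin(th/2)] each cosine is a difference of sines at neighbouring half-integer points, so
    the sum telescopes. *)
Lemma cos_sum_telescope (N : nat) (th s : R) :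
  2 * sin (th / 2) * lsum (seq 0 N) (fun m => cos (INR m * th + s))
  = sin ((INR N - / 2) * th + s) - sin (s - th / 2).
Proof.
induction N as [|N IH].
- cbn [seq]; unfold lsum; cbn [fold_right INR].
  replace ((0 - / 2) * th + s) with (s - th / 2) by field. ring.
- rewrite lsum_seq_S, Rmult_plus_distr_l, IH, S_INR.
  replace ((INR N + 1 - / 2) * th + s) with ((INR N * th + s) + th / 2) by field.
  replace ((INR N - / 2) * th + s) with ((INR N * th + s) - th / 2) by field.
  rewrite sin_plus, sin_minus. ring.
Qed.

Lemma cos_2PI_Z (x : R) (z : Z) : cos (x + 2 * IZR z * PI) = cos x.
Proof.
destruct (Z_le_gt_dec 0 z) as [H|H].
- rewrite <- (Z2Nat.id z H), <- INR_IZR_INZ. apply cos_period.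
- rewrite <- (cos_period (x + 2 * IZR z * PI) (Z.to_nat (- z))).
  f_equal. rewrite INR_IZR_INZ, Z2Nat.id, opp_IZR by lia. ring.
Qed.

Lemma sin_2PI_Z (x : R) (z : Z) : sin (x + 2 * IZR z * PI) = sin x.
Proof.
rewrite <- !cos_shift.
replace (PI / 2 - (x + 2 * IZR z * PI)) with (PI / 2 - x + 2 * IZR (- z) * PI)
  by (rewrite opp_IZR; ring).
apply cos_2PI_Z.
Qed.

Lemma cos_sum_zero (N : nat) (z : Z) (s : R) :
  (0 < N)%nat -> ~ (Z.of_nat N | z)%Z ->
  lsum (seq 0 N) (fun m => cos (2 * PI * IZR z * INR m / INR N + s)) = 0.
Proof.
intros HN Hz.
assert (HN' : 0 < INR N) by now apply lt_0_INR.
set (th := 2 * PI * IZR z / INR N).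
assert (H := cos_sum_telescope N th s).
rewrite (lsum_ext _ _ (fun m => cos (INR m * th + s))) by (intros; f_equal; unfold th; field; lra).
replace ((INR N - / 2) * th + s) with ((s - th / 2) + 2 * IZR z * PI) in H by (unfold th; field; lra).
rewrite sin_2PI_Z, Rminus_diag in H.
apply Rmult_integral in H; destruct H as [H|H]; [|exact H].
exfalso; apply Hz.
assert (H' : sin (th / 2) = 0) by lra.
apply sin_eq_0_0 in H'; destruct H' as [k Hk].
exists k. apply eq_IZR. rewrite mult_IZR, <- INR_IZR_INZ.
apply (Rmult_eq_reg_r PI); [|generalize PI_RGT_0; lra].
replace (IZR k * INR N * PI) with (IZR k * PI * INR N) by ring.
rewrite <- Hk; unfold th; field; lra.
Qed.

Lemma cos_sum_one (N : nat) (z : Z) (s : R) :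
  (0 < N)%nat -> (Z.of_nat N | z)%Z ->
  lsum (seq 0 N) (fun m => cos (2 * PI * IZR z * INR m / INR N + s)) = INR N * cos s.
Proof.
intros HN [k ->].
assert (HN' : 0 < INR N) by now apply lt_0_INR.
rewrite (lsum_ext _ _ (fun _ => cos s)).
- now rewrite lsum_const, length_seq.
- intros m _. rewrite <- (cos_2PI_Z s (k * Z.of_nat m)).
  f_equal. rewrite !mult_IZR, <- !INR_IZR_INZ. field; lra.
Qed.

(** The reflection [i -> 2M - i] fixes 0 and [M]; these two points are counted once, hence the
    correction terms. *)
Lemma seq_half_sum (M : nat) (F : nat -> R) :
  (forall i, (i <= 2 * M)%nat -> F (2 * M - i)%nat = F i) ->
  lsum (seq 0 (2 * M)) F = 2 * lsum (seq 0 M) F - F 0%nat + F M.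
Proof.
intros H. replace (2 * M)%nat with (M + M)%nat by lia.
rewrite lsum_seq_split, <- (lsum_seq_rev M (fun m => F (M + m)%nat)).
rewrite (lsum_ext (seq 0 M) (fun m => F (M + (M - S m))%nat) (fun m => F (S m))).
- rewrite lsum_seq_shift. ring.
- intros m Hm. apply in_seq in Hm. rewrite <- (H (S m)) by lia. f_equal; lia.
Qed.

Lemma cos_cos_prod x y : cos x * cos y = / 2 * (cos (x - y) + cos (x + y)).
Proof. rewrite cos_minus, cos_plus; field. Qed.

Lemma sin_sin_prod x y : sin x * sin y = / 2 * (cos (x - y) - cos (x + y)).
Proof. rewrite cos_minus, cos_plus; field. Qed.

Lemma mod_eqb_small (N z : Z) : (- N < z < N)%Z -> (z mod N =? 0)%Z = (z =? 0)%Z.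
Proof.
intros Hz. destruct (Z.eqb_spec z 0) as [->|Hn]; [rewrite Z.mod_0_l by lia; reflexivity|].
apply Z.eqb_neq; intros E. apply Z.mod_divide in E; [|lia]. destruct E as [q Hq].
assert (C : (q <= -1 \/ q = 0 \/ 1 <= q)%Z) by lia.
destruct C as [C|[C|C]]; [|subst; lia|].
- assert (q * N <= -1 * N)%Z by (apply Z.mul_le_mono_nonneg_r; lia). lia.
- assert (1 * N <= q * N)%Z by (apply Z.mul_le_mono_nonneg_r; lia). lia.
Qed.

Section Trig.
Variable M : nat.
Hypothesis HM : (2 <= M)%nat.

Let Mpos : 0 < INR M.
Proof. apply lt_0_INR; lia. Qed.

Definition tc (k m : nat) : R := cos (PI * INR k * INR m / INR M).
Definition ts (j i : nat) : R := sin (PI * INR j * INR i / INR M).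
(** Mean square of the sampled cosine: for [k = 0] and [k = M] it has modulus 1 at every grid
    point. *)
Definition cc (k : nat) : R := if Nat.eqb k 0 then 1 else if Nat.eqb k M then 1 else / 2.

Lemma INR_2M : INR (2 * M) = 2 * INR M.
Proof. rewrite mult_INR; reflexivity. Qed.

(* [z] plays the role of [k - k'] or [k + k']. *)
Lemma cos_sum_2M (z : Z) (s : R) :
  lsum (seq 0 (2 * M)) (fun m => cos (PI * IZR z * INR m / INR M + s))
  = if (z mod (2 * Z.of_nat M) =? 0)%Z then 2 * INR M * cos s else 0.
Proof.
rewrite (lsum_ext _ _ (fun m => cos (2 * PI * IZR z * INR m / INR (2 * M) + s)))
  by (intros; rewrite INR_2M; f_equal; field; lra).
assert (E : Z.of_nat (2 * M) = (2 * Z.of_nat M)%Z) by lia.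
destruct (Z.eqb_spec (z mod (2 * Z.of_nat M)) 0) as [H|H].
- rewrite cos_sum_one, INR_2M; [reflexivity|lia|rewrite E; apply Z.mod_divide; [lia|exact H]].
- apply cos_sum_zero; [lia|rewrite E; intros D; apply H, Z.mod_divide; [lia|exact D]].
Qed.

(** The phase [s] is carried along for correlations of a function with its time translates. For
    [k = k'] equal to 0 or [M] both the sum and the difference of the frequencies vanish modulo
    [2M], which doubles the value. *)
Lemma tau_orth (k k' : nat) (s : R) : (k <= M)%nat -> (k' <= M)%nat ->
  lsum (seq 0 (2 * M)) (fun m => tc k m * cos (PI * INR k' * INR m / INR M + s))
  = if Nat.eqb k k' then 2 * INR M * cc k * cos s else 0.
Proof.
intros Hk Hk'. unfold tc.
rewrite (lsum_ext _ _ (fun m =>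
   / 2 * (cos (PI * IZR (Z.of_nat k - Z.of_nat k') * INR m / INR M + - s)
          + cos (PI * IZR (Z.of_nat k + Z.of_nat k') * INR m / INR M + s)))).
2:{ intros m _. rewrite cos_cos_prod, minus_IZR, plus_IZR, <- !INR_IZR_INZ.
    f_equal; f_equal; f_equal; field; lra. }
rewrite lsum_scal, lsum_plus, !cos_sum_2M, cos_neg.
assert (D := mod_eqb_small (2 * Z.of_nat M)).
rewrite D by lia. unfold cc.
destruct (Nat.eqb_spec k k') as [<-|Hne].
- rewrite Z.sub_diag, Z.eqb_refl.
  destruct (Nat.eqb_spec k 0) as [->|H0].
  + cbn [Z.of_nat Z.add]. rewrite Z.mod_0_l, Z.eqb_refl by lia. field.
  + destruct (Nat.eqb_spec k M) as [->|H1].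
    * replace (Z.of_nat M + Z.of_nat M)%Z with (2 * Z.of_nat M)%Z by lia.
      rewrite Z_mod_same_full, Z.eqb_refl. field.
    * rewrite D by lia. destruct (Z.eqb_spec (Z.of_nat k + Z.of_nat k) 0); [lia|field].
- destruct (Z.eqb_spec (Z.of_nat k - Z.of_nat k') 0); [lia|].
  rewrite D by lia. destruct (Z.eqb_spec (Z.of_nat k + Z.of_nat k') 0); [lia|ring].
Qed.

Lemma cos_sum_pm (j j' : nat) (s : R) : (0 < j < M)%nat -> (0 < j' < M)%nat ->
  lsum (seq 0 (2 * M)) (fun m => cos (PI * IZR (Z.of_nat j - Z.of_nat j') * INR m / INR M + 0))
  = (if Nat.eqb j j' then 2 * INR M else 0) /\
  lsum (seq 0 (2 * M)) (fun m => cos (PI * IZR (Z.of_nat j + Z.of_nat j') * INR m / INR M + s)) = 0.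
Proof.
intros Hj Hj'.
assert (D := mod_eqb_small (2 * Z.of_nat M)).
rewrite !cos_sum_2M, !D by lia.
rewrite cos_0.
destruct (Z.eqb_spec (Z.of_nat j + Z.of_nat j') 0); [lia|].
destruct (Z.eqb_spec (Z.of_nat j - Z.of_nat j') 0); destruct (Nat.eqb_spec j j'); try lia; lra.
Qed.

Lemma ts_0 j : ts j 0 = 0.
Proof. unfold ts; cbn [INR]; replace (PI * INR j * 0 / INR M) with 0 by (field; lra); apply sin_0. Qed.

Lemma ts_M j : ts j M = 0.
Proof.
unfold ts; replace (PI * INR j * INR M / INR M) with (IZR (Z.of_nat j) * PI)
  by (rewrite <- INR_IZR_INZ; field; lra).
apply sin_eq_0_1; eexists; reflexivity.
Qed.

Lemma ts_sym j i : ts j i = ts i j.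
Proof. unfold ts; f_equal; field; lra. Qed.

Lemma tc_sym j i : tc j i = tc i j.
Proof. unfold tc; f_equal; field; lra. Qed.

Lemma ts_refl j i : (i <= 2 * M)%nat -> ts j (2 * M - i) = - ts j i.
Proof.
intros Hi; unfold ts.
rewrite minus_INR, INR_2M by exact Hi.
replace (PI * INR j * (2 * INR M - INR i) / INR M)
  with (- (PI * INR j * INR i / INR M) + 2 * IZR (Z.of_nat j) * PI)
  by (rewrite <- INR_IZR_INZ; field; lra).
rewrite sin_2PI_Z; apply sin_neg.
Qed.

Lemma tc_refl k m : (m <= 2 * M)%nat -> tc k (2 * M - m) = tc k m.
Proof.
intros Hm; unfold tc.
rewrite minus_INR, INR_2M by exact Hm.
replace (PI * INR k * (2 * INR M - INR m) / INR M)
  with (- (PI * INR k * INR m / INR M) + 2 * IZR (Z.of_nat k) * PI)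
  by (rewrite <- INR_IZR_INZ; field; lra).
rewrite cos_2PI_Z; apply cos_neg.
Qed.

Lemma tc_period k m : tc k (m + 2 * M) = tc k m.
Proof.
unfold tc; rewrite plus_INR, INR_2M.
replace (PI * INR k * (INR m + 2 * INR M) / INR M)
  with (PI * INR k * INR m / INR M + 2 * IZR (Z.of_nat k) * PI)
  by (rewrite <- INR_IZR_INZ; field; lra).
apply cos_2PI_Z.
Qed.

Lemma x_orth (j j' : nat) : (0 < j < M)%nat -> (0 < j' < M)%nat ->
  lsum (seq 0 M) (fun i => ts j i * ts j' i) = if Nat.eqb j j' then INR M / 2 else 0.
Proof.
intros Hj Hj'.
assert (H := seq_half_sum M (fun i => ts j i * ts j' i)).
cbn beta in H. rewrite !ts_0, !ts_M in H.
destruct (cos_sum_pm j j' 0 Hj Hj') as [H1 H2].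
rewrite (lsum_ext (seq 0 (2 * M)) (fun i => ts j i * ts j' i) (fun m =>
   / 2 * (cos (PI * IZR (Z.of_nat j - Z.of_nat j') * INR m / INR M + 0)
          - cos (PI * IZR (Z.of_nat j + Z.of_nat j') * INR m / INR M + 0)))) in H.
2:{ intros m _. unfold ts. rewrite sin_sin_prod, minus_IZR, plus_IZR, <- !INR_IZR_INZ.
    f_equal; f_equal; f_equal; field; lra. }
rewrite lsum_scal, lsum_minus, H1, H2 in H.
assert (E := H ltac:(intros i Hi; rewrite !ts_refl by exact Hi; ring)).
destruct (Nat.eqb j j'); lra.
Qed.

(** A difference of sampled sines is a cosine at the half points times [2 sin(PI j / (2M))]; these
    cosines are orthogonal again. *)
Lemma x_orth_diff (j j' : nat) : (0 < j < M)%nat -> (0 < j' < M)%nat ->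
  lsum (seq 0 M) (fun i => (ts j (S i) - ts j i) * (ts j' (S i) - ts j' i))
  = if Nat.eqb j j' then INR M / 2 * (2 * sin (PI * INR j / (2 * INR M))) ^ 2 else 0.
Proof.
intros Hj Hj'.
set (hc := fun j i : nat => cos (PI * INR j * (INR i + / 2) / INR M)).
assert (E : forall j i, ts j (S i) - ts j i = 2 * sin (PI * INR j / (2 * INR M)) * hc j i).
{ intros q i; unfold ts, hc; rewrite S_INR.
  replace (PI * INR q * (INR i + 1) / INR M)
    with (PI * INR q * (INR i + / 2) / INR M + PI * INR q / (2 * INR M)) by (field; lra).
  replace (PI * INR q * INR i / INR M)
    with (PI * INR q * (INR i + / 2) / INR M - PI * INR q / (2 * INR M)) by (field; lra).
  rewrite sin_plus, sin_minus; ring. }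
set (A := fun j => 2 * sin (PI * INR j / (2 * INR M))).
rewrite (lsum_ext _ _ (fun i => (A j * A j') * (hc j i * hc j' i)))
  by (intros; rewrite !E; unfold A; ring).
rewrite lsum_scal.
(* The reflection [i -> 2M - 1 - i] of the half points has no fixed point, so here the full sum is
   exactly twice the half sum. *)
assert (H : lsum (seq 0 (2 * M)) (fun i => hc j i * hc j' i) = 2 * lsum (seq 0 M) (fun i => hc j i * hc j' i)).
{ replace (2 * M)%nat with (M + M)%nat by lia.
  rewrite lsum_seq_split, <- (lsum_seq_rev M (fun m => hc j (M + m)%nat * hc j' (M + m)%nat)).
  rewrite (lsum_ext _ (fun m => hc j (M + (M - S m))%nat * _) (fun i => hc j i * hc j' i)); [ring|].
  intros i Hi; apply in_seq in Hi.
  assert (R : forall q, hc q (M + (M - S i))%nat = hc q i).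
  { intros q; unfold hc. rewrite plus_INR, minus_INR, S_INR by lia.
    replace (PI * INR q * (INR M + (INR M - (INR i + 1)) + / 2) / INR M)
      with (- (PI * INR q * (INR i + / 2) / INR M) + 2 * IZR (Z.of_nat q) * PI)
      by (rewrite <- INR_IZR_INZ; field; lra).
    rewrite cos_2PI_Z; apply cos_neg. }
  now rewrite !R. }
destruct (cos_sum_pm j j' (PI * (INR j + INR j') / (2 * INR M)) Hj Hj') as [H1 H2].
rewrite (lsum_ext (seq 0 (2 * M)) (fun i => hc j i * hc j' i) (fun m =>
   / 2 * (cos (PI * IZR (Z.of_nat j - Z.of_nat j') * INR m / INR M + PI * (INR j - INR j') / (2 * INR M))
          + cos (PI * IZR (Z.of_nat j + Z.of_nat j') * INR m / INR M + PI * (INR j + INR j') / (2 * INR M))))) in H.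
2:{ intros m _. unfold hc. rewrite cos_cos_prod, minus_IZR, plus_IZR, <- !INR_IZR_INZ.
    f_equal; f_equal; f_equal; field; lra. }
rewrite lsum_scal, lsum_plus, H2 in H.
destruct (Nat.eqb_spec j j') as [<-|Hne].
- rewrite (lsum_ext _ _ (fun m => cos (PI * IZR (Z.of_nat j - Z.of_nat j) * INR m / INR M + 0))) in H
    by (intros; do 2 f_equal; field; lra).
  rewrite H1 in H.
  replace (lsum (seq 0 M) (fun i => hc j i * hc j i)) with (INR M / 2) by lra. unfold A; ring.
- rewrite cos_sum_2M in H.
  destruct (Z.eqb_spec ((Z.of_nat j - Z.of_nat j') mod (2 * Z.of_nat M)) 0) as [D|D].
  + apply Z.eqb_eq in D; rewrite mod_eqb_small in D by lia. lia.
  + replace (lsum (seq 0 M) (fun i => hc j i * hc j' i)) with 0 by lra. ring.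
Qed.

(** Completeness of the cosines. They see only the even part of a function, so the kernel is a Dirac
    mass at [m] plus one at [-m], modulo [2M]. *)
Lemma tau_kernel (m m' : nat) :
  lsum (seq 0 (S M)) (fun k => tc k m * tc k m' / cc k)
  = (if ((Z.of_nat m - Z.of_nat m') mod (2 * Z.of_nat M) =? 0)%Z then INR M else 0)
  + (if ((Z.of_nat m + Z.of_nat m') mod (2 * Z.of_nat M) =? 0)%Z then INR M else 0).
Proof.
(* Dividing by [cc] doubles the interior frequencies, so the weighted sum over [0..M] is the plain
   sum over a full period of frequencies. *)
transitivity (lsum (seq 0 (2 * M)) (fun k => tc k m * tc k m')).
- rewrite seq_half_sum.
  + rewrite lsum_seq_S. unfold cc at 2; rewrite Nat.eqb_refl.
    assert (E : lsum (seq 0 M) (fun k => tc k m * tc k m' / cc k)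
        = 2 * lsum (seq 0 M) (fun k => tc k m * tc k m') - tc 0 m * tc 0 m').
    { assert (ES : seq 0 M = 0%nat :: seq 1 (M - 1))
        by (replace M with (S (M - 1)) at 1 by lia; reflexivity).
      rewrite ES, !lsum_cons.
      rewrite (lsum_ext (seq 1 (M - 1)) (fun k => tc k m * tc k m' / cc k) (fun k => 2 * (tc k m * tc k m'))).
      - rewrite lsum_scal. unfold cc; cbn [Nat.eqb]. field.
      - intros k Hk; apply in_seq in Hk. unfold cc.
        destruct (Nat.eqb_spec k 0); [lia|]. destruct (Nat.eqb_spec k M); [lia|]. field. }
    rewrite E. destruct (Nat.eqb M 0); field.
  + intros k Hk; rewrite !(tc_sym (2 * M - k)), !tc_refl, !(tc_sym k) by exact Hk. reflexivity.
- rewrite (lsum_ext _ _ (fun k =>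
   / 2 * (cos (PI * IZR (Z.of_nat m - Z.of_nat m') * INR k / INR M + 0)
          + cos (PI * IZR (Z.of_nat m + Z.of_nat m') * INR k / INR M + 0)))).
  2:{ intros k _. unfold tc. rewrite cos_cos_prod, minus_IZR, plus_IZR, <- !INR_IZR_INZ.
    f_equal; f_equal; f_equal; field; lra. }
  rewrite lsum_scal, lsum_plus, !cos_sum_2M, cos_0.
  destruct (_ =? 0)%Z; destruct (_ =? 0)%Z; field.
Qed.

End Trig.

(** * The grid and its eigenfunctions *)

(* Modes [(k, j)] with [k <= M], [1 <= j < M], and grid points [(m, i)], standing for time [PI m / M]
   (over a full period) and abscissa [PI i / M]; [ev M s c] is the trigonometric polynomial with
   coefficients [c], translated in time by [s]. *)
Definition Md (M : nat) : list (nat * nat) := list_prod (seq 0 (S M)) (seq 1 (M - 1)).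
Definition Pt (M : nat) : list (nat * nat) := list_prod (seq 0 (2 * M)) (seq 0 M).
Definition wpt (M : nat) (p : nat * nat) : R := / (2 * INR M * INR M).
Definition avg (M : nat) (g : nat * nat -> R) : R := lsum (Pt M) (fun p => wpt M p * g p).
Definition mu (M : nat) (a : nat * nat) : R := cc M (fst a) / 2.

Definition bas (M : nat) (s : R) (a p : nat * nat) : R :=
  cos (PI * INR (fst a) * INR (fst p) / INR M + INR (fst a) * s) * ts M (snd a) (snd p).
Definition ev (M : nat) (s : R) (c : nat * nat -> R) (p : nat * nat) : R :=
  lsum (Md M) (fun a => c a * bas M s a p).
Definition hat (M : nat) (g : nat * nat -> R) (a : nat * nat) : R :=
  avg M (fun p => g p * bas M 0 a p) / mu M a.
(** Eigenvalue of minus the second difference on the frequency [k]; [M^2 thq] is comparable to [k^2]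
    uniformly in [M]. *)
Definition thq (M k : nat) : R := (2 * sin (PI * INR k / (2 * INR M))) ^ 2.

(** The symmetries shared by all modes, and preserved by composition with a function vanishing at 0;
    they characterise the functions recovered from their coefficients. *)
Record grid_class (M : nat) (g : nat * nat -> R) : Prop := {
  gc_period : forall m i, g ((m + 2 * M)%nat, i) = g (m, i);
  gc_even : forall m i, (m <= 2 * M)%nat -> g ((2 * M - m)%nat, i) = g (m, i);
  gc_zero : forall m, g (m, 0%nat) = 0;
  gc_end : forall m, g (m, M) = 0 }.

Lemma in_Md M a : In a (Md M) <-> (fst a <= M /\ 0 < snd a < M)%nat.
Proof.
destruct a as [k j]; unfold Md; rewrite in_prod_iff, !in_seq; cbn [fst snd]; lia.
Qed.

Lemma in_Pt M p : In p (Pt M) <-> (fst p < 2 * M /\ snd p < M)%nat.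
Proof.
destruct p as [k j]; unfold Pt; rewrite in_prod_iff, !in_seq; cbn [fst snd]; lia.
Qed.

Lemma NoDup_Md M : NoDup (Md M).
Proof. apply NoDup_list_prod; apply seq_NoDup. Qed.

Section Grid.
Variable M : nat.
Hypothesis HM : (2 <= M)%nat.

Let Mpos : 0 < INR M.
Proof. apply lt_0_INR; lia. Qed.

Lemma wpt_pos p : 0 < wpt M p.
Proof. unfold wpt; apply Rinv_0_lt_compat; nra. Qed.

Lemma mu_bounds a : / 4 <= mu M a <= / 2.
Proof. unfold mu, cc; destruct (Nat.eqb _ _); [lra|]; destruct (Nat.eqb _ _); lra. Qed.

Lemma mu_mid k j : (0 < k < M)%nat -> mu M (k, j) = / 4.
Proof.
intros H; unfold mu, cc; cbn [fst].
destruct (Nat.eqb_spec k 0); [lia|]; destruct (Nat.eqb_spec k M); [lia|lra].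
Qed.

Lemma avg_ext g h : (forall p, In p (Pt M) -> g p = h p) -> avg M g = avg M h.
Proof. intros H; unfold avg; apply lsum_ext; intros p Hp; now rewrite H. Qed.

Lemma avg_plus g h : avg M (fun p => g p + h p) = avg M g + avg M h.
Proof. unfold avg; rewrite <- lsum_plus; apply lsum_ext; intros; ring. Qed.

Lemma avg_minus g h : avg M (fun p => g p - h p) = avg M g - avg M h.
Proof. unfold avg; rewrite <- lsum_minus; apply lsum_ext; intros; ring. Qed.

Lemma avg_scal c g : avg M (fun p => c * g p) = c * avg M g.
Proof. unfold avg; rewrite <- lsum_scal; apply lsum_ext; intros; ring. Qed.

Lemma avg_le g h : (forall p, In p (Pt M) -> g p <= h p) -> avg M g <= avg M h.
Proof.
intros H; apply lsum_le; intros p Hp; apply Rmult_le_compat_l; [apply Rlt_le, wpt_pos|now apply H].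
Qed.

Lemma avg_const c : avg M (fun _ => c) = c.
Proof.
unfold avg, wpt; rewrite lsum_const; unfold Pt; rewrite length_prod, !length_seq, mult_INR, INR_2M.
field; lra.
Qed.

Lemma avg_lsum {T} (l : list T) (F : T -> nat * nat -> R) :
  avg M (fun p => lsum l (fun a => F a p)) = lsum l (fun a => avg M (F a)).
Proof.
unfold avg; rewrite <- lsum_exchange; apply lsum_ext; intros; now rewrite lsum_scal.
Qed.

Lemma avg_abs g : Rabs (avg M g) <= avg M (fun p => Rabs (g p)).
Proof.
unfold avg; eapply Rle_trans; [apply lsum_abs|]; apply Req_le, lsum_ext; intros p _.
rewrite Rabs_mult, (Rabs_pos_eq (wpt M p)); [reflexivity|apply Rlt_le, wpt_pos].
Qed.

Lemma avg_shift s g : (forall m i, g ((m + 2 * M)%nat, i) = g (m, i)) ->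
  avg M (fun p => g ((fst p + s)%nat, snd p)) = avg M g.
Proof.
intros H; unfold avg, Pt; rewrite !lsum_list_prod.
rewrite (lsum_ext _ _ (fun m => (fun m' => lsum (seq 0 M) (fun i => wpt M (0%nat,0%nat) * g (m', i))) (m + s)%nat)).
2:{ intros m _; apply lsum_ext; intros i _; reflexivity. }
pose (G := fun m' : nat => lsum (seq 0 M) (fun i => wpt M (0%nat,0%nat) * g (m', i))).
change (lsum (seq 0 (2 * M)) (fun m => G (m + s)%nat) =
  lsum (seq 0 (2 * M)) (fun a : nat => lsum (seq 0 M) (fun b : nat => wpt M (a, b) * g (a, b)))).
rewrite lsum_periodic_shift; [reflexivity|].
intros m; unfold G; apply lsum_ext; intros; now rewrite H.
Qed.

Lemma bas_orth s a b : In a (Md M) -> In b (Md M) ->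
  avg M (fun p => bas M 0 a p * bas M s b p)
  = if Nat.eqb (fst a) (fst b) && Nat.eqb (snd a) (snd b) then mu M a * cos (INR (fst a) * s) else 0.
Proof.
destruct a as [k j], b as [k' j']; rewrite !in_Md; cbn [fst snd]; intros Ha Hb.
unfold avg.
pose (F := fun m => tc M k m * cos (PI * INR k' * INR m / INR M + INR k' * s)).
pose (G := fun i => ts M j i * ts M j' i).
rewrite (lsum_ext _ _ (fun p => / (2 * INR M * INR M) * (F (fst p) * G (snd p)))).
2:{ intros p _; unfold F, G, wpt, bas, tc; cbn [fst snd].
    replace (PI * INR k * INR (fst p) / INR M + INR k * 0) with (PI * INR k * INR (fst p) / INR M) by ring. ring. }
rewrite lsum_scal; unfold Pt; rewrite lsum_prod_mult; unfold F, G; rewrite tau_orth, x_orth by lia.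
unfold mu; cbn [fst].
destruct (Nat.eqb_spec k k') as [<-|]; cbn [andb]; [|field; lra].
destruct (Nat.eqb j j'); field; lra.
Qed.

Lemma parseval_ev s c c' :
  avg M (fun p => ev M 0 c p * ev M s c' p)
  = lsum (Md M) (fun a => mu M a * cos (INR (fst a) * s) * (c a * c' a)).
Proof.
unfold ev.
rewrite (avg_ext _ (fun p => lsum (Md M) (fun a => lsum (Md M) (fun b => (c a * c' b) * (bas M 0 a p * bas M s b p))))).
2:{ intros p _; rewrite <- lsum_scal_r; apply lsum_ext; intros a _.
    rewrite <- lsum_scal; apply lsum_ext; intros; ring. }
rewrite avg_lsum; apply lsum_ext; intros a Ha.
rewrite avg_lsum, (lsum_single _ _ a).
- rewrite avg_scal, bas_orth by exact Ha. rewrite !Nat.eqb_refl; cbn [andb]; ring.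
- apply NoDup_Md.
- exact Ha.
- intros b Hb Hne. rewrite avg_scal, bas_orth by assumption.
  destruct a as [k j], b as [k' j']; cbn [fst snd].
  destruct (Nat.eqb_spec k k') as [->|]; cbn [andb]; [|ring].
  destruct (Nat.eqb_spec j j') as [->|]; [now elim Hne|ring].
Qed.

Lemma parseval c c' :
  avg M (fun p => ev M 0 c p * ev M 0 c' p) = lsum (Md M) (fun a => mu M a * (c a * c' a)).
Proof. rewrite parseval_ev; apply lsum_ext; intros; rewrite Rmult_0_r, cos_0; ring. Qed.

Lemma avg_hat g c : avg M (fun p => g p * ev M 0 c p) = lsum (Md M) (fun a => mu M a * (hat M g a * c a)).
Proof.
unfold ev, hat.
rewrite (avg_ext _ (fun p => lsum (Md M) (fun a => c a * (g p * bas M 0 a p)))).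
2:{ intros p _; rewrite <- lsum_scal; apply lsum_ext; intros; ring. }
rewrite avg_lsum; apply lsum_ext; intros a _.
rewrite avg_scal; generalize (mu_bounds a); intros; field; lra.
Qed.

Lemma bas0 a p : bas M 0 a p = tc M (fst a) (fst p) * ts M (snd a) (snd p).
Proof. unfold bas, tc; rewrite Rmult_0_r, Rplus_0_r; reflexivity. Qed.

Lemma bas_grid_class a : grid_class M (bas M 0 a).
Proof.
split; intros; rewrite ?bas0; cbn [fst snd].
- now rewrite tc_period.
- now rewrite tc_refl.
- rewrite ts_0 by exact HM; ring.
- rewrite ts_M by exact HM; ring.
Qed.

Lemma ev_grid_class c : grid_class M (ev M 0 c).
Proof.
unfold ev; split; intros; try (apply lsum_ext; intros a _; f_equal); try (apply lsum_zero; intros a _);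
destruct (bas_grid_class a) as [H1 H2 H3 H4]; [apply H1|now apply H2|rewrite H3; ring|rewrite H4; ring].
Qed.

Lemma grid_class_comp (phi : R -> R) g : phi 0 = 0 -> grid_class M g -> grid_class M (fun p => phi (g p)).
Proof.
intros H0 [H1 H2 H3 H4]; split; intros; [now rewrite H1|now rewrite H2|now rewrite H3|now rewrite H4].
Qed.

Lemma lsum_tau_kernel (F : nat -> R) m :
  (m < 2 * M)%nat -> (forall q, (q <= 2 * M)%nat -> F (2 * M - q)%nat = F q) ->
  lsum (seq 0 (2 * M)) (fun m' => F m' * lsum (seq 0 (S M)) (fun k => tc M k m * tc M k m' / cc M k))
  = 2 * INR M * F m.
Proof.
intros Hm HF.
(* [m2] is the reflected time [-m] reduced to [[0, 2M)]. For [m = 0] and [m = M] it is [m] itself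
   and the two Dirac masses add up. *)
set (m2 := if Nat.eqb m 0 then 0%nat else (2 * M - m)%nat).
rewrite (lsum_ext _ _ (fun m' => (if Nat.eqb m' m then F m' * INR M else 0) + (if Nat.eqb m' m2 then F m' * INR M else 0))).
- rewrite lsum_plus, (lsum_single _ _ m), (lsum_single _ _ m2).
  + rewrite !Nat.eqb_refl.
    assert (E : F m2 = F m).
    { unfold m2; destruct (Nat.eqb_spec m 0) as [->|]; [reflexivity|apply HF; lia]. }
    rewrite E; ring.
  + apply seq_NoDup.
  + apply in_seq; unfold m2; destruct (Nat.eqb_spec m 0); lia.
  + intros b _ Hb; destruct (Nat.eqb_spec b m2); [easy|reflexivity].
  + apply seq_NoDup.
  + apply in_seq; lia.
  + intros b _ Hb; destruct (Nat.eqb_spec b m); [easy|reflexivity].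
- intros m' Hm'; apply in_seq in Hm'.
  rewrite tau_kernel by exact HM.
  rewrite mod_eqb_small by lia.
  assert (E : ((Z.of_nat m + Z.of_nat m') mod (2 * Z.of_nat M) =? 0)%Z = Nat.eqb m' m2).
  { unfold m2; destruct (Nat.eqb_spec m 0) as [->|Hm0].
    - rewrite mod_eqb_small by lia. destruct (Nat.eqb_spec m' 0); apply Z.eqb_eq || apply Z.eqb_neq; lia.
    - destruct (Nat.eqb_spec m' (2 * M - m)) as [->|Hne].
      + replace (Z.of_nat m + Z.of_nat (2 * M - m))%Z with (2 * Z.of_nat M)%Z by lia.
        now rewrite Z_mod_same_full.
      + apply Z.eqb_neq. intros E. apply Z.mod_divide in E; [|lia]. destruct E as [q Hq].
        assert (C : (q <= 0 \/ q = 1 \/ 2 <= q)%Z) by lia.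
        destruct C as [C|[C|C]]; [|subst; lia|].
        * assert (q * (2 * Z.of_nat M) <= 0 * (2 * Z.of_nat M))%Z by (apply Z.mul_le_mono_nonneg_r; lia). lia.
        * assert (2 * (2 * Z.of_nat M) <= q * (2 * Z.of_nat M))%Z by (apply Z.mul_le_mono_nonneg_r; lia). lia. }
  rewrite E.
  destruct (Nat.eqb_spec m' m); destruct (Nat.eqb m' m2); destruct (Z.eqb_spec (Z.of_nat m - Z.of_nat m') 0); try lia; ring.
Qed.

Lemma x_kernel i i' : (0 < i < M)%nat -> (0 < i' < M)%nat ->
  lsum (seq 1 (M - 1)) (fun j => ts M j i * ts M j i') = if Nat.eqb i i' then INR M / 2 else 0.
Proof.
intros Hi Hi'. rewrite <- (x_orth M HM i i' Hi Hi').
assert (ES : seq 0 M = 0%nat :: seq 1 (M - 1))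
        by (replace M with (S (M - 1)) at 1 by lia; reflexivity).
rewrite ES, lsum_cons, !ts_0 by exact HM.
rewrite Rmult_0_l, Rplus_0_l. apply lsum_ext; intros j _.
now rewrite !(ts_sym M HM j).
Qed.

(** The cosine kernel reproduces only even functions and the sine kernel only interior values;
    evenness and the zeros at both ends supply the rest. *)
Lemma fourier_inversion g p : grid_class M g -> (snd p <= M)%nat -> ev M 0 (hat M g) p = g p.
Proof.
intros Hg. assert (Hev := ev_grid_class (hat M g)).
destruct p as [m i]; cbn [snd]; intros Hi.
assert (HP : forall q, (q < 2 * M)%nat -> ev M 0 (hat M g) (q, i) = g (q, i)).
2:{ assert (Hr : forall h, grid_class M h -> h (m, i) = h ((m mod (2 * M))%nat, i)).
    { intros h [Hp _ _ _]. assert (Em := Nat.div_mod_eq m (2 * M)).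
      set (r := (m mod (2 * M))%nat) in *; set (q := (m / (2 * M))%nat) in *.
      replace m with (r + q * (2 * M))%nat by lia. clearbody q r; clear Em.
      induction q as [|q IH]; [now rewrite Nat.mul_0_l, Nat.add_0_r|].
      replace (r + S q * (2 * M))%nat with ((r + q * (2 * M)) + 2 * M)%nat by lia.
      now rewrite Hp. }
    rewrite (Hr _ Hev), (Hr _ Hg). apply HP. apply Nat.mod_upper_bound; lia. }
clear m; intros m Hm.
destruct Hg as [G1 G2 G3 G4], Hev as [E1 E2 E3 E4].
destruct (Nat.eq_dec i 0) as [->|Hi0]; [now rewrite G3, E3|].
destruct (Nat.eq_dec i M) as [->|HiM]; [now rewrite G4, E4|].
assert (Hi' : (0 < i < M)%nat) by lia.
unfold ev, hat.
transitivity (avg M (fun p' => g p' * (lsum (seq 0 (S M)) (fun k => tc M k m * tc M k (fst p') / cc M k)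
    * (2 * lsum (seq 1 (M - 1)) (fun j => ts M j i * ts M j (snd p')))))).
- transitivity (lsum (Md M) (fun a => avg M (fun p' => g p' * ((tc M (fst a) m * tc M (fst a) (fst p') / cc M (fst a)) * (2 * (ts M (snd a) i * ts M (snd a) (snd p'))))))).
  + apply lsum_ext; intros a _.
    transitivity ((bas M 0 a (m, i) / mu M a) * avg M (fun p' => g p' * bas M 0 a p')).
    * generalize (mu_bounds a); intros; field; lra.
    * rewrite <- avg_scal; apply avg_ext; intros p' _. rewrite !bas0; unfold mu; cbn [fst snd].
      assert (0 < cc M (fst a)) by (generalize (mu_bounds a); unfold mu; lra). field; lra.
  + rewrite <- avg_lsum; apply avg_ext; intros p' _.
    rewrite lsum_scal; f_equal. unfold Md.
    rewrite (lsum_prod_mult _ _ (fun k => tc M k m * tc M k (fst p') / cc M k) (fun j => 2 * (ts M j i * ts M j (snd p')))).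
    now rewrite lsum_scal.
- unfold avg, Pt. rewrite lsum_list_prod, lsum_exchange, (lsum_single _ _ i).
  + rewrite (lsum_ext _ _ (fun m' => / (2 * INR M) * (g (m', i) * lsum (seq 0 (S M)) (fun k => tc M k m * tc M k m' / cc M k)))).
    * rewrite lsum_scal, (lsum_tau_kernel (fun m' => g (m', i))) by (auto; intros; now apply G2). field; lra.
    * intros m' _; cbn [fst snd]. rewrite x_kernel, Nat.eqb_refl by lia. unfold wpt. field; lra.
  + apply seq_NoDup.
  + apply in_seq; lia.
  + intros i' Hi'2 Hne; apply in_seq in Hi'2; apply lsum_zero; intros m' _; cbn [fst snd].
    destruct (Nat.eq_dec i' 0) as [->|H0]; [rewrite G3; ring|].
    rewrite x_kernel by lia. destruct (Nat.eqb_spec i i'); [congruence|ring].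
Qed.

Lemma ev_shift s c m i r : ev M s c ((m + r)%nat, i) = ev M (s + INR r * (PI / INR M)) c (m, i).
Proof.
unfold ev; apply lsum_ext; intros a _; unfold bas; cbn [fst snd]; rewrite plus_INR.
do 2 f_equal. f_equal. field; lra.
Qed.

Lemma thq_cos k : thq M k = 2 - 2 * cos (INR k * (PI / INR M)).
Proof.
unfold thq. replace (INR k * (PI / INR M)) with (2 * (PI * INR k / (2 * INR M))) by (field; lra).
rewrite cos_2a_sin. ring.
Qed.

(** Expanding the square leaves twice the mean square minus twice the correlation with the translate
    by one time step, which [parseval_ev] diagonalises with factor [cos(k PI / M)]. *)
Lemma avg_diff_ev c :
  avg M (fun p => (ev M 0 c (S (fst p), snd p) - ev M 0 c p) ^ 2)
  = lsum (Md M) (fun a => mu M a * thq M (fst a) * c a ^ 2).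
Proof.
rewrite (avg_ext _ (fun p => (ev M 0 c ((fst p + 1)%nat, snd p) * ev M 0 c ((fst p + 1)%nat, snd p) + ev M 0 c p * ev M 0 c p)
   - 2 * (ev M 0 c p * ev M (0 + INR 1 * (PI / INR M)) c p))).
2:{ intros [m i] _; cbn [fst snd]. rewrite <- ev_shift. replace (S m) with (m + 1)%nat by lia. ring. }
rewrite avg_minus, avg_plus, avg_scal.
rewrite (avg_shift 1 (fun p => ev M 0 c p * ev M 0 c p)).
2:{ intros; now rewrite (gc_period _ _ (ev_grid_class c)). }
rewrite (parseval_ev (0 + INR 1 * (PI / INR M))), parseval, <- lsum_scal, <- lsum_plus, <- lsum_minus.
apply lsum_ext; intros a _. rewrite thq_cos. cbn [INR]. rewrite Rplus_0_l, Rmult_1_l. ring.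
Qed.

Lemma ev_second_diff c m i :
  ev M 0 c (S (S m), i) - 2 * ev M 0 c (S m, i) + ev M 0 c (m, i)
  = - ev M 0 (fun a => thq M (fst a) * c a) (S m, i).
Proof.
unfold ev. rewrite <- lsum_scal, <- lsum_opp, <- lsum_minus, <- lsum_plus.
apply lsum_ext; intros a _. rewrite !bas0; unfold tc; cbn [fst snd]. rewrite thq_cos, !S_INR.
replace (PI * INR (fst a) * (INR m + 1 + 1) / INR M)
  with (PI * INR (fst a) * (INR m + 1) / INR M + INR (fst a) * (PI / INR M)) by (field; lra).
replace (PI * INR (fst a) * INR m / INR M)
  with (PI * INR (fst a) * (INR m + 1) / INR M - INR (fst a) * (PI / INR M)) by (field; lra).
rewrite cos_plus, cos_minus. ring.
Qed.

Lemma avg_diff2_ev c :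
  avg M (fun p => (ev M 0 c (S (S (fst p)), snd p) - 2 * ev M 0 c (S (fst p), snd p) + ev M 0 c p) ^ 2)
  = lsum (Md M) (fun a => mu M a * thq M (fst a) ^ 2 * c a ^ 2).
Proof.
set (c1 := fun a => thq M (fst a) * c a).
rewrite (avg_ext _ (fun p => (fun q => ev M 0 c1 q * ev M 0 c1 q) ((fst p + 1)%nat, snd p))).
2:{ intros [m i] _; cbn [fst snd]. rewrite ev_second_diff. fold c1.
    replace (m + 1)%nat with (S m) by lia. ring. }
rewrite (avg_shift 1 (fun q => ev M 0 c1 q * ev M 0 c1 q)).
2:{ intros; now rewrite (gc_period _ _ (ev_grid_class c1)). }
rewrite parseval; apply lsum_ext; intros; unfold c1; ring.
Qed.

(** A third difference is the first difference of second differences, and a second difference only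
    multiplies the coefficients by [- thq], up to a shift of one step. *)
Lemma avg_diff3_ev c :
  avg M (fun p => (ev M 0 c (S (S (S (fst p))), snd p) - 3 * ev M 0 c (S (S (fst p)), snd p)
                    + 3 * ev M 0 c (S (fst p), snd p) - ev M 0 c p) ^ 2)
  = lsum (Md M) (fun a => mu M a * thq M (fst a) ^ 3 * c a ^ 2).
Proof.
set (c1 := fun a => thq M (fst a) * c a).
rewrite (avg_ext _ (fun p => (fun q => (ev M 0 c1 (S (fst q), snd q) - ev M 0 c1 q) ^ 2) ((fst p + 1)%nat, snd p))).
2:{ intros [m i] _; cbn [fst snd].
    assert (H1 := ev_second_diff c m i). assert (H2 := ev_second_diff c (S m) i). fold c1 in H1, H2.
    replace (m + 1)%nat with (S m) by lia.
    replace (ev M 0 c (S (S (S m)), i) - 3 * ev M 0 c (S (S m), i) + 3 * ev M 0 c (S m, i) - ev M 0 c (m, i))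
      with ((ev M 0 c (S (S (S m)), i) - 2 * ev M 0 c (S (S m), i) + ev M 0 c (S m, i))
           - (ev M 0 c (S (S m), i) - 2 * ev M 0 c (S m, i) + ev M 0 c (m, i))) by ring.
    rewrite H1, H2. ring. }
rewrite (avg_shift 1 (fun q => (ev M 0 c1 (S (fst q), snd q) - ev M 0 c1 q) ^ 2)).
2:{ intros; cbn [fst snd]. rewrite (gc_period _ _ (ev_grid_class c1)).
    replace (S (m + 2 * M))%nat with (S m + 2 * M)%nat by lia.
    now rewrite (gc_period _ _ (ev_grid_class c1)). }
rewrite avg_diff_ev; apply lsum_ext; intros; unfold c1; ring.
Qed.

(** Under Dirichlet conditions there is no translation in [x] to use as in time, so the Gram matrix
    of the differenced modes is computed directly. *)
Lemma avg_xdiff_ev c :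
  avg M (fun p => (ev M 0 c (fst p, S (snd p)) - ev M 0 c p) ^ 2)
  = lsum (Md M) (fun a => mu M a * thq M (snd a) * c a ^ 2).
Proof.
set (X := fun (a p : nat * nat) => tc M (fst a) (fst p) * (ts M (snd a) (S (snd p)) - ts M (snd a) (snd p))).
rewrite (avg_ext _ (fun p => lsum (Md M) (fun a => lsum (Md M) (fun b => (c a * c b) * (X a p * X b p))))).
2:{ intros [m i] _; cbn [fst snd]. unfold ev. rewrite <- lsum_minus. cbn [pow]. rewrite Rmult_1_r.
    rewrite <- lsum_scal_r; apply lsum_ext; intros a _.
    rewrite <- lsum_scal; apply lsum_ext; intros b _. rewrite !bas0; unfold X; cbn [fst snd]. ring. }
assert (HX : forall a b, In a (Md M) -> In b (Md M) -> avg M (fun p => X a p * X b p)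
   = if Nat.eqb (fst a) (fst b) && Nat.eqb (snd a) (snd b) then mu M a * thq M (snd a) else 0).
{ intros [k j] [k' j']; rewrite !in_Md; cbn [fst snd]; intros Ha Hb. unfold avg.
  pose (F := fun m => tc M k m * cos (PI * INR k' * INR m / INR M + 0)).
  pose (G := fun i => (ts M j (S i) - ts M j i) * (ts M j' (S i) - ts M j' i)).
  rewrite (lsum_ext _ _ (fun p => / (2 * INR M * INR M) * (F (fst p) * G (snd p)))).
  2:{ intros p _; unfold F, G, wpt, X, tc; cbn [fst snd]. rewrite Rplus_0_r. ring. }
  rewrite lsum_scal; unfold Pt; rewrite lsum_prod_mult; unfold F, G; rewrite tau_orth, x_orth_diff by lia.
  unfold mu, thq; cbn [fst]. rewrite cos_0.
  destruct (Nat.eqb_spec k k') as [<-|]; cbn [andb]; [|field; lra].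
  destruct (Nat.eqb j j'); field; lra. }
rewrite avg_lsum; apply lsum_ext; intros a Ha.
rewrite avg_lsum, (lsum_single _ _ a).
- rewrite avg_scal, HX by exact Ha. rewrite !Nat.eqb_refl; cbn [andb]; ring.
- apply NoDup_Md.
- exact Ha.
- intros b Hb Hne. rewrite avg_scal, HX by assumption.
  destruct a as [k j], b as [k' j']; cbn [fst snd].
  destruct (Nat.eqb_spec k k') as [->|]; cbn [andb]; [|ring].
  destruct (Nat.eqb_spec j j') as [->|]; [now elim Hne|ring].
Qed.

End Grid.

(** * Elementary inequalities and summable weights *)

(** Half of Jordan's slope, enough to give [thq_bounds] the lower constant 1. Up to [PI/3] the
    derivative is at least 1/2; beyond it monotonicity suffices. *)
Lemma sin_ge_linear x : 0 <= x <= PI / 2 -> x / PI <= sin x.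
Proof.
intros [H0 H1]. assert (HP := PI_RGT_0).
destruct (Rle_dec x (PI / 3)) as [H|H].
- assert (HP2 := PI2_3_2).
  assert (x / PI <= x / 2).
  { unfold Rdiv; apply Rmult_le_compat_l; [exact H0|]. apply Rinv_le_contravar; lra. }
  destruct (MVT_gen sin 0 x cos) as [c [Hc E]].
  + intros; apply is_derive_sin.
  + intros; apply continuity_pt_filterlim, continuous_sin.
  + rewrite Rmin_left, Rmax_right in Hc by lra.
    assert (cos (PI / 3) <= cos c) by (apply cos_decr_1; lra).
    rewrite cos_PI3 in H3. rewrite sin_0 in E. nra.
- assert (x / PI <= / 2).
  { apply Rmult_le_reg_r with PI; [lra|]. field_simplify; lra. }
  assert (sin (PI / 3) <= sin x) by (apply sin_incr_1; lra).
  rewrite sin_PI3 in H3. assert (1 <= sqrt 3) by (rewrite <- sqrt_1; apply sqrt_le_1_alt; lra). lra.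
Qed.

Lemma thq_bounds M k : (2 <= M)%nat -> (k <= M)%nat ->
  INR k ^ 2 <= INR M ^ 2 * thq M k <= 16 * INR k ^ 2.
Proof.
intros HM Hk. assert (Mpos : 0 < INR M) by (apply lt_0_INR; lia).
assert (HP := PI_RGT_0). assert (HP4 := PI_4).
assert (K0 := pos_INR k). assert (K1 := le_INR _ _ Hk).
unfold thq. set (x := PI * INR k / (2 * INR M)).
assert (Hx : x * (2 * INR M) = PI * INR k) by (unfold x; field; lra).
assert (0 <= x) by (unfold x; apply Rdiv_le_0_compat; nra).
assert (x <= PI / 2).
{ unfold x; apply Rmult_le_reg_r with (2 * INR M); [lra|]. field_simplify; nra. }
assert (L := sin_ge_linear x (conj H H0)).
assert (U : sin x <= x) by (destruct (Req_dec x 0) as [->|]; [rewrite sin_0; lra|apply Rlt_le, sin_lt_x; lra]).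
assert (Ex : x / PI = INR k / (2 * INR M)) by (unfold x; field; lra).
assert (L2 : INR k <= INR M * (2 * sin x)).
{ rewrite Ex in L. apply Rmult_le_compat_l with (r := 2 * INR M) in L; [|lra].
  replace (2 * INR M * (INR k / (2 * INR M))) with (INR k) in L by (field; lra). lra. }
assert (U2 : INR M * (2 * sin x) <= 4 * INR k) by nra.
replace (INR M ^ 2 * (2 * sin x) ^ 2) with ((INR M * (2 * sin x)) ^ 2) by ring.
nra.
Qed.

Lemma sum_inv_sq K : lsum (seq 0 K) (fun k => / (1 + INR k) ^ 2) <= 2.
Proof.
assert (H : lsum (seq 0 K) (fun k => / (1 + INR k) ^ 2) <= 2 - 2 / (1 + INR K)).
{ induction K as [|K IH]; [cbn; lra|].
  rewrite lsum_seq_S, S_INR. assert (H := pos_INR K).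
  assert (/ (1 + INR K) ^ 2 <= 2 / (1 + INR K) - 2 / (1 + (INR K + 1))).
  { replace (2 / (1 + INR K) - 2 / (1 + (INR K + 1))) with (2 / ((1 + INR K) * (2 + INR K))) by (field; lra).
    apply Rmult_le_reg_r with ((1 + INR K) ^ 2 * (2 + INR K)); [nra|].
    field_simplify; nra. }
  lra. }
assert (0 < 2 / (1 + INR K)); [|lra].
apply Rdiv_lt_0_compat; generalize (pos_INR K); lra.
Qed.

Lemma sum_lorentz J s L : lsum (seq s L) (fun j => / (1 + (INR j - INR J) ^ 2)) <= 8.
Proof.
(* A bounded increasing function whose unit increments dominate the summand up to the factor 4; its
   total variation 2 gives the bound 8. As [j - J] is an integer, no unit step straddles 0. *)
set (g := fun x => x / (1 + Rabs x)).
assert (Hg : forall x, -1 <= g x <= 1).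
{ intros x; unfold g. assert (H := Rabs_pos x). assert (H1 := Rle_abs x). assert (H2 := Rle_abs (- x)).
  rewrite Rabs_Ropp in H2.
  split; apply Rmult_le_reg_r with (1 + Rabs x); try lra; field_simplify; lra. }
assert (Hstep : forall j, / (1 + (INR j - INR J) ^ 2) <= 4 * (g (INR j + 1 - INR J) - g (INR j - INR J))).
{ intros j. set (x := INR j - INR J). replace (INR j + 1 - INR J) with (x + 1) by (unfold x; ring).
  assert (Hc : 0 <= x \/ x <= -1).
  { destruct (le_lt_dec J j) as [H|H].
    - left; unfold x; apply le_INR in H; lra.
    - right; unfold x. apply le_INR in H. rewrite S_INR in H. lra. }
  unfold g; destruct Hc as [Hc|Hc].
  - rewrite !Rabs_pos_eq by lra.
    replace ((x + 1) / (1 + (x + 1)) - x / (1 + x)) with (/ ((1 + x) * (2 + x))) by (field; lra).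
    apply Rmult_le_reg_r with ((1 + x ^ 2) * ((1 + x) * (2 + x))); [nra|].
    field_simplify; nra.
  - rewrite !Rabs_left1 by lra.
    replace ((x + 1) / (1 + - (x + 1)) - x / (1 + - x)) with (/ (- x * (1 - x))) by (field; lra).
    apply Rmult_le_reg_r with ((1 + x ^ 2) * (- x * (1 - x))); [nra|].
    field_simplify; nra. }
assert (H : lsum (seq s L) (fun j => / (1 + (INR j - INR J) ^ 2)) <= 4 * (g (INR (s + L) - INR J) - g (INR s - INR J))).
{ revert s; induction L as [|L IH]; intros s.
  - cbn [seq]. rewrite Nat.add_0_r. cbn. lra.
  - cbn [seq]. rewrite lsum_cons. specialize (IH (S s)). specialize (Hstep s).
    rewrite S_INR in IH. replace (S s + L)%nat with (s + S L)%nat in IH by lia. lra. }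
generalize (Hg (INR (s + L) - INR J)) (Hg (INR s - INR J)); lra.
Qed.

(* Summable weights: [J k] is the integer nearest to [om n k], so the modes with [j = J k] are the nearly resonant ones. *)
Definition rho1 (J : nat -> nat) (a : nat * nat) : R :=
  / ((1 + INR (fst a)) ^ 2 * (1 + (INR (snd a) - INR (J (fst a))) ^ 2)).

Lemma rho1_pos J a : 0 < rho1 J a.
Proof.
unfold rho1. apply Rinv_0_lt_compat, Rmult_lt_0_compat;
  [|generalize (pow2_ge_0 (INR (snd a) - INR (J (fst a)))); intros; lra].
assert (H := pos_INR (fst a)); apply pow_lt; lra.
Qed.

Lemma sum_rho1 J K s L : lsum (list_prod (seq 0 K) (seq s L)) (rho1 J) <= 16.
Proof.
rewrite lsum_list_prod.
apply Rle_trans with (lsum (seq 0 K) (fun k => / (1 + INR k) ^ 2 * 8)).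
- apply lsum_le; intros k _. assert (Hk := pos_INR k).
  rewrite (lsum_ext _ _ (fun j => / (1 + INR k) ^ 2 * / (1 + (INR j - INR (J k)) ^ 2))).
  + rewrite lsum_scal. apply Rmult_le_compat_l; [|apply sum_lorentz].
    apply Rlt_le, Rinv_0_lt_compat, pow_lt; lra.
  + intros j _; unfold rho1; cbn [fst snd]. apply Rinv_mult.
- rewrite lsum_scal_r. generalize (sum_inv_sq K); lra.
Qed.

(** * Small divisors *)

(* Symbol of [om^2 n^2 d_t^2 - d_x^2] on [cos (k t) sin (j x)]; the resonant modes [isV] are [j = n k]. *)
Definition lam (n : nat) (om : R) (a : nat * nat) : R :=
  INR (snd a) ^ 2 - om ^ 2 * INR n ^ 2 * INR (fst a) ^ 2.
Definition isV (n : nat) (a : nat * nat) : bool := Nat.eqb (snd a) (n * fst a).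

Section SmallDivisors.
Variables (n : nat) (om ga : R) (J : nat -> nat).
Hypothesis Hn : (1 <= n)%nat.
Hypothesis Hom : / 2 <= om <= 3 / 2.
Hypothesis Hga : 0 < ga <= 3 / 2.
Hypothesis HW : in_W ga om.
Hypothesis HJ : forall k, Rabs (INR (J k) - om * INR n * INR k) <= / 2.

Lemma lam_factor a : lam n om a = (INR (snd a) - om * INR n * INR (fst a)) * (INR (snd a) + om * INR n * INR (fst a)).
Proof. unfold lam; ring. Qed.

Let n1 : 1 <= INR n.
Proof. apply le_INR in Hn; exact Hn. Qed.

(** Away from the nearest integer [J k] the first factor of [lam] is at least half the distance
    [|j - J k|], and the second is at least [(1 + k)/2]. *)
Lemma lam_good k j : (1 <= j)%nat -> j <> J k ->
  (INR j - INR (J k)) ^ 2 * (1 + INR k) ^ 2 / 16 <= lam n om (k, j) ^ 2 /\ 1 <= (INR j - INR (J k)) ^ 2.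
Proof.
intros Hj HjJ. assert (Hk := pos_INR k). assert (Hj1 : 1 <= INR j) by (apply le_INR in Hj; exact Hj).
rewrite lam_factor; cbn [fst snd].
specialize (HJ k). set (D := INR j - INR (J k)) in *.
assert (HD : 1 <= Rabs D).
{ unfold D. destruct (Nat.lt_total j (J k)) as [H|[H|H]]; [|easy|];
  apply le_INR in H; rewrite S_INR in H; [rewrite Rabs_left1|rewrite Rabs_pos_eq]; lra. }
set (A := INR j - om * INR n * INR k).
assert (HA : / 2 * Rabs D <= Rabs A).
{ unfold A. replace (INR j - om * INR n * INR k) with (D + (INR (J k) - om * INR n * INR k)) by (unfold D; ring).
  assert (H := Rabs_triang (D + (INR (J k) - om * INR n * INR k)) (- (INR (J k) - om * INR n * INR k))).
  rewrite Rabs_Ropp in H.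
  replace (D + (INR (J k) - om * INR n * INR k) + - (INR (J k) - om * INR n * INR k)) with D in H by ring.
  lra. }
set (B := INR j + om * INR n * INR k).
assert (HB : (1 + INR k) / 2 <= B).
{ unfold B. assert (/ 2 * 1 * INR k <= om * INR n * INR k).
  { apply Rmult_le_compat_r; [exact Hk|]. apply Rmult_le_compat; lra. }
  lra. }
split.
- replace ((A * B) ^ 2) with (Rabs A ^ 2 * B ^ 2) by (rewrite pow2_abs; ring).
  replace (D ^ 2 * (1 + INR k) ^ 2 / 16) with ((/ 2 * Rabs D) ^ 2 * ((1 + INR k) / 2) ^ 2)
    by (replace (D ^ 2) with (Rabs D ^ 2) by apply pow2_abs; field).
  apply Rmult_le_compat; try apply pow2_ge_0; apply pow_incr; lra.
- rewrite <- pow2_abs. nra.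
Qed.

(** The Diophantine condition at [l = n k] loses a factor [l], which the sum [j + om l] restores:
    the divisor is bounded below uniformly in [k]. Moreover [j] and [n k] are distinct integers
    while [j] is within 1/2 of [om n k], so [|om - 1| n k >= 1/2]: this happens only at high
    frequency. *)
Lemma lam_bad k j : (1 <= j)%nat -> j = J k -> j <> (n * k)%nat ->
  ga ^ 2 / 4 <= lam n om (k, j) ^ 2 /\ 1 <= (2 * (om - 1) * INR n) ^ 2 * INR k ^ 2.
Proof.
intros Hj HjJ HjV. assert (Hj1 : 1 <= INR j) by (apply le_INR in Hj; exact Hj).
specialize (HJ k); rewrite <- HjJ in HJ.
destruct k as [|k'].
{ cbn [INR] in HJ. rewrite Rmult_0_r, Rminus_0_r, Rabs_pos_eq in HJ; lra. }
set (k := S k') in *.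
assert (Hk1 : 1 <= INR k) by (unfold k; rewrite S_INR; generalize (pos_INR k'); lra).
assert (El : INR (n * k) = INR n * INR k) by apply mult_INR.
assert (Hl : (1 <= n * k)%nat) by (unfold k; nia).
assert (H := HW (n * k)%nat j Hl HjV). rewrite El in H.
set (l := INR n * INR k) in *. assert (Hl1 : 1 <= l) by (unfold l; nra).
rewrite lam_factor; cbn [fst snd].
replace (om * INR n * INR k) with (om * l) in * by (unfold l; ring).
split.
- assert (ga / 2 <= Rabs ((INR j - om * l) * (INR j + om * l))).
  { rewrite Rabs_mult, (Rabs_pos_eq (INR j + om * l)) by nra.
    rewrite Rabs_minus_sym.
    apply Rle_trans with (ga / l * (l / 2)); [apply Req_le; field; lra|].
    apply Rmult_le_compat; [apply Rdiv_le_0_compat; lra|lra|apply Rge_le; exact H|nra]. }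
  rewrite <- (pow2_abs (_ * _)). nra.
- assert (HD : 1 <= Rabs (INR j - l)).
  { rewrite <- El. destruct (Nat.lt_total j (n * k)) as [H1|[H1|H1]]; [|easy|];
    apply le_INR in H1; rewrite S_INR in H1; [rewrite Rabs_left1|rewrite Rabs_pos_eq]; lra. }
  assert (HD2 : / 2 <= Rabs ((om - 1) * l)).
  { assert (T := Rabs_triang (INR j - om * l) ((om - 1) * l)).
    replace (INR j - om * l + (om - 1) * l) with (INR j - l) in T by ring. lra. }
  replace ((2 * (om - 1) * INR n) ^ 2 * INR k ^ 2) with (4 * ((om - 1) * l) ^ 2) by (unfold l; ring).
  rewrite <- (pow2_abs ((om - 1) * l)). nra.
Qed.

Lemma lam_cases M a : In a (Md M) -> isV n a = false ->
  (snd a <> J (fst a) /\ (INR (snd a) - INR (J (fst a))) ^ 2 * (1 + INR (fst a)) ^ 2 / 16 <= lam n om a ^ 2 /\ 1 <= (INR (snd a) - INR (J (fst a))) ^ 2) \/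
  (snd a = J (fst a) /\ ga ^ 2 / 4 <= lam n om a ^ 2 /\ 1 <= (2 * (om - 1) * INR n) ^ 2 * INR (fst a) ^ 2).
Proof.
destruct a as [k j]; rewrite in_Md; unfold isV; cbn [fst snd]; intros Ha HV.
apply Nat.eqb_neq in HV.
destruct (Nat.eq_dec j (J k)) as [H|H]; [right|left]; (split; [exact H|]).
- apply lam_bad; (lia || assumption).
- apply lam_good; (lia || assumption).
Qed.

(** Good modes have divisor at least 1/4, and [ga/6 <= 1/4] because [ga <= 3/2]. *)
Lemma lam_nonzero M a : In a (Md M) -> isV n a = false -> ga ^ 2 / 36 <= lam n om a ^ 2.
Proof.
intros Ha HV; destruct (lam_cases M a Ha HV) as [(_ & H1 & H2)|(_ & H1 & _)]; [|nra].
assert (Hk := pos_INR (fst a)). assert (1 <= (1 + INR (fst a)) ^ 2) by nra.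
assert (1 <= (INR (snd a) - INR (J (fst a))) ^ 2 * (1 + INR (fst a)) ^ 2) by nra. nra.
Qed.

Lemma lam_T1 M a : In a (Md M) -> isV n a = false -> / lam n om a ^ 2 <= 36 / ga ^ 2.
Proof.
intros Ha HV; assert (H := lam_nonzero M a Ha HV).
replace (36 / ga ^ 2) with (/ (ga ^ 2 / 36)) by (field; lra).
apply Rinv_le_contravar; [|exact H]. assert (0 < ga ^ 2) by (apply pow_lt; lra). lra.
Qed.

(** Giving up one time derivative makes the inverse divisors summable, hence gives sup bounds: for
    each [k] only [j = J k] is bad, and there [rho1] is [1/(1 + k)^2]. *)
Lemma lam_T2 M a : In a (Md M) -> isV n a = false ->
  / lam n om a ^ 2 <= 72 / ga ^ 2 * (1 + INR (fst a) ^ 2) * rho1 J a.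
Proof.
intros Ha HV. assert (Hk := pos_INR (fst a)).
assert (G2 : 0 < ga ^ 2) by (apply pow_lt; lra).
assert (K2 : 1 <= (1 + INR (fst a)) ^ 2) by nra.
destruct (lam_cases M a Ha HV) as [(_ & H1 & H2)|(E & H1 & _)].
- set (D := (INR (snd a) - INR (J (fst a))) ^ 2) in *.
  apply Rle_trans with (32 * rho1 J a).
  + unfold rho1; fold D.
    replace (32 * / ((1 + INR (fst a)) ^ 2 * (1 + D))) with (/ ((1 + INR (fst a)) ^ 2 * (1 + D) / 32)) by (field; nra).
    apply Rinv_le_contravar; nra.
  + apply Rmult_le_compat_r; [apply Rlt_le, rho1_pos|].
    assert (ga ^ 2 <= 9 / 4) by nra.
    assert (32 <= 72 / ga ^ 2).
    { apply Rmult_le_reg_r with (ga ^ 2); [exact G2|]. field_simplify; lra. }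
    assert (0 <= INR (fst a) ^ 2) by apply pow2_ge_0. nra.
- apply Rle_trans with (4 / ga ^ 2).
  + replace (4 / ga ^ 2) with (/ (ga ^ 2 / 4)) by (field; lra). apply Rinv_le_contravar; lra.
  + unfold rho1; rewrite E, Rminus_diag.
    replace (72 / ga ^ 2 * (1 + INR (fst a) ^ 2) * / ((1 + INR (fst a)) ^ 2 * (1 + 0 ^ 2)))
      with (4 / ga ^ 2 * (18 * (1 + INR (fst a) ^ 2) / (1 + INR (fst a)) ^ 2)) by (field; split; lra).
    rewrite <- (Rmult_1_r (4 / ga ^ 2)) at 1. apply Rmult_le_compat_l; [apply Rdiv_le_0_compat; lra|].
    apply Rmult_le_reg_r with ((1 + INR (fst a)) ^ 2); [lra|]. field_simplify; nra.
Qed.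

(** At a bad mode [1 <= (2 |om - 1| n k)^2], so the loss [4/ga^2] may be multiplied by this
    quantity: [1/ga] then appears only together with [|om - 1| n], at the price of one time
    derivative. *)
Lemma lam_T3 M a : In a (Md M) -> isV n a = false ->
  / lam n om a ^ 2 <= 16 + 16 * ((om - 1) * INR n / ga) ^ 2 * INR (fst a) ^ 2.
Proof.
intros Ha HV. assert (Hk := pos_INR (fst a)).
assert (G2 : 0 < ga ^ 2) by (apply pow_lt; lra).
assert (K2 : 1 <= (1 + INR (fst a)) ^ 2) by nra.
assert (P : 0 <= 16 * ((om - 1) * INR n / ga) ^ 2 * INR (fst a) ^ 2).
{ apply Rmult_le_pos; [|apply pow2_ge_0]. apply Rmult_le_pos; [lra|apply pow2_ge_0]. }
destruct (lam_cases M a Ha HV) as [(_ & H1 & H2)|(E & H1 & H2)].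
- assert (/ lam n om a ^ 2 <= / (/ 16)) by (apply Rinv_le_contravar; nra).
  rewrite Rinv_inv in H. lra.
- apply Rle_trans with (4 / ga ^ 2).
  + replace (4 / ga ^ 2) with (/ (ga ^ 2 / 4)) by (field; lra). apply Rinv_le_contravar; lra.
  + replace (16 * ((om - 1) * INR n / ga) ^ 2 * INR (fst a) ^ 2)
      with (4 / ga ^ 2 * ((2 * (om - 1) * INR n) ^ 2 * INR (fst a) ^ 2)) in * by (field; lra).
    assert (0 <= 4 / ga ^ 2) by (apply Rdiv_le_0_compat; lra). nra.
Qed.

End SmallDivisors.

Lemma nearest_nat_exists x : 0 <= x -> exists J : nat, Rabs (INR J - x) <= / 2.
Proof.
intros Hx. destruct (nfloor_ex (x + / 2)) as [J [H1 H2]]; [lra|].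
exists J. apply Rabs_le_between; lra.
Qed.

(** * Sequential compactness for coordinatewise convergence *)

Lemma incr_ge_id (s : nat -> nat) : (forall q, (s q < s (S q))%nat) -> forall q, (q <= s q)%nat.
Proof. intros H q; induction q as [|q IH]; [lia|]; specialize (H q); lia. Qed.

Lemma bounded_subsequence (y : nat -> R) (B : R) :
  (forall q, Rabs (y q) <= B) ->
  exists (s : nat -> nat) (l : R), (forall q, (s q < s (S q))%nat) /\ is_lim_seq (fun q => y (s q)) l.
Proof.
intros HB.
destruct (Bolzano_Weierstrass y (fun x => - B <= x <= B) (compact_P3 (- B) B)) as [l Hl].
{ intros q; now apply Rabs_le_between. }
assert (Hc : forall e N, 0 < e -> exists q, (N <= q)%nat /\ Rabs (y q - l) < e).
{ intros e N He.
  destruct (Hl (disc l (mkposreal e He)) N) as [q [Hq1 Hq2]].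
  - exists (mkposreal e He); intros z Hz; exact Hz.
  - exists q; split; [exact Hq1|exact Hq2]. }
destruct (functional_choice (fun (N q : nat) => (N <= snd (of_nat q))%nat /\ Rabs (y (snd (of_nat q)) - l) < / (INR N + 1)))
  as [c Hcc].
{ intros N. destruct (Hc (/ (INR N + 1)) N) as [q Hq].
  - apply Rinv_0_lt_compat; generalize (pos_INR N); lra.
  - exists (to_nat (0%nat, q)); now rewrite cancel_of_to. }
pose (nx := fun N => snd (of_nat (c N))).
pose (s := fix s q := match q with O => nx O | S q' => nx (S (s q')) end).
assert (Hs : forall q, (s q < s (S q))%nat).
{ intros q; cbn [s]. destruct (Hcc (S (s q))) as [H _]. unfold nx; lia. }
exists s, l; split; [exact Hs|].
apply is_lim_seq_spec; intros e.
destruct (nfloor_ex (/ e)) as [N [_ HN]]; [apply Rlt_le, Rinv_0_lt_compat, cond_pos|].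
exists (S N); intros q Hq. destruct q as [|q]; [lia|].
cbn [s]. destruct (Hcc (S (s q))) as [_ H]. fold (nx (S (s q))) in H.
eapply Rlt_trans; [exact H|].
rewrite <- (Rinv_inv e). apply Rinv_lt_contravar.
- apply Rmult_lt_0_compat; [apply Rinv_0_lt_compat, cond_pos|]. generalize (pos_INR (S (s q))); lra.
- assert (H1 := incr_ge_id s Hs q). assert (H2 : (N <= S (s q))%nat) by lia.
  apply le_INR in H2. lra.
Qed.

Lemma diagonal_subsequence (x : nat -> nat -> R) (B : nat -> R) :
  (forall q i, Rabs (x q i) <= B i) ->
  exists (s : nat -> nat) (l : nat -> R), (forall q, (s q < s (S q))%nat) /\
    forall i, is_lim_seq (fun q => x (s q) i) (l i).
Proof.
intros HB.
(* Choosing an extraction for every pair of a current subsequence and a coordinate lets the nested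
   subsequences be defined by plain recursion. *)
assert (Hex : forall (tl : (nat -> nat) * nat), exists r : nat -> nat,
   (forall q, (r q < r (S q))%nat) /\
   exists l : R, is_lim_seq (fun q => x (fst tl (r q)) (snd tl)) l).
{ intros [t i]; cbn [fst snd].
  destruct (bounded_subsequence (fun q => x (t q) i) (B i)) as (r & l & H1 & H2); [intros; apply HB|].
  exists r; split; [exact H1|exists l; exact H2]. }
destruct (functional_choice _ Hex) as [rr Hrr].
pose (sg := fix sg i := match i with O => fun q : nat => q | S i' => fun q => sg i' (rr (sg i', i') q) end).
assert (Hr : forall i q, (rr (sg i, i) q < rr (sg i, i) (S q))%nat) by (intros i; apply (Hrr (sg i, i))).
assert (Hsg : forall i q q', (q < q')%nat -> (sg i q < sg i q')%nat).
{ assert (M : forall f : nat -> nat, (forall q, (f q < f (S q))%nat) -> forall q q', (q < q')%nat -> (f q < f q')%nat).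
  { intros f Hf q q' Hq; induction Hq as [|q' Hq IH]; [apply Hf|]. specialize (Hf q'); lia. }
  induction i as [|i IH]; intros q q' Hq; [exact Hq|].
  cbn [sg]. apply IH. now apply M. }
assert (Hfac : forall i q, (i <= q)%nat -> exists r, (q <= r)%nat /\ sg q q = sg i r).
{ intros i q Hq.
  assert (G : forall p r0, exists r, (r0 <= r)%nat /\ sg (p + i)%nat r0 = sg i r).
  { induction p as [|p IH]; intros r0; [exists r0; split; [lia|reflexivity]|].
    cbn [Nat.add sg]. destruct (IH (rr (sg (p + i)%nat, (p + i)%nat) r0)) as [r [H1 H2]].
    exists r; split; [|exact H2].
    assert (H3 := incr_ge_id _ (Hr (p + i)%nat) r0). lia. }
  destruct (G (q - i)%nat q) as [r [H1 H2]]. exists r; split; [exact H1|].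
  now replace (q - i + i)%nat with q in H2 by lia. }
assert (Hl : forall i, exists l : R, is_lim_seq (fun q => x (sg (S i) q) i) l).
{ intros i; apply (Hrr (sg i, i)). }
destruct (functional_choice _ Hl) as [l Hll].
exists (fun q => sg q q), l; split.
- intros q. cbn [sg].
  assert (H1 := incr_ge_id _ (Hr q) (S q)).
  apply Hsg; lia.
- intros i. specialize (Hll i). apply is_lim_seq_spec in Hll. apply is_lim_seq_spec. intros e.
  destruct (Hll e) as [N HN]. exists (Nat.max N (S i)). intros q Hq.
  destruct (Hfac (S i) q) as [r [H1 H2]]; [lia|]. rewrite H2. apply HN; lia.
Qed.

Definition coord_lim (x : nat -> nat * nat -> R) (l : nat * nat -> R) : Prop :=
  forall a, is_lim_seq (fun q => x q a) (l a).

Lemma coord_subsequence (x : nat -> nat * nat -> R) (B : nat * nat -> R) :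
  (forall q a, Rabs (x q a) <= B a) ->
  exists (s : nat -> nat) (l : nat * nat -> R), (forall q, (s q < s (S q))%nat) /\
    coord_lim (fun q => x (s q)) l.
Proof.
intros HB.
destruct (diagonal_subsequence (fun q i => x q (of_nat i)) (fun i => B (of_nat i))) as (s & l & Hs & Hl).
- intros; apply HB.
- exists s, (fun a => l (to_nat a)); split; [exact Hs|].
  intros a. specialize (Hl (to_nat a)). cbn beta in Hl. now rewrite cancel_of_to in Hl.
Qed.

(** Direct method of the calculus of variations: a minimising sequence has a coordinatewise
    convergent subsequence, whose limit stays in [K] by the last hypothesis. It serves both the
    W-equation and the Nehari problem. *)
Lemma coord_minimum (K : (nat * nat -> R) -> Prop) (Q : (nat * nat -> R) -> R) (B : nat * nat -> R) (m : R) :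
  (exists x, K x) ->
  (forall x, K x -> forall a, Rabs (x a) <= B a) ->
  (forall x, K x -> m <= Q x) ->
  (forall x l, (forall q, K (x q)) -> coord_lim x l -> K l /\ is_lim_seq (fun q => Q (x q)) (Q l)) ->
  exists x0, K x0 /\ forall x, K x -> Q x0 <= Q x.
Proof.
intros [x1 H1] HB Hm Hc.
destruct (completeness (fun z => exists x, K x /\ z = - Q x)) as [b [Hb1 Hb2]].
{ exists (- m); intros z [x [Hx ->]]. specialize (Hm x Hx); lra. }
{ exists (- Q x1), x1; auto. }
destruct (functional_choice (fun (q : nat) x => K x /\ Q x < - b + / (INR q + 1))) as [x Hx].
{ intros q. apply Classical_Prop.NNPP; intros H.
  assert (He : 0 < / (INR q + 1)) by (apply Rinv_0_lt_compat; generalize (pos_INR q); lra).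
  assert (b <= b - / (INR q + 1)); [|lra].
  apply Hb2; intros z [x [Hx ->]].
  destruct (Rlt_dec (Q x) (- b + / (INR q + 1))) as [L|L]; [|lra].
  elim H; exists x; auto. }
destruct (coord_subsequence x B) as (s & l & Hs & Hl).
{ intros q; apply HB, Hx. }
destruct (Hc (fun q => x (s q)) l) as [Kl Ql]; [intros; apply Hx|exact Hl|].
exists l; split; [exact Kl|].
intros y Hy.
assert (L : Q l <= - b).
{ apply (is_lim_seq_le (fun q => Q (x (s q))) (fun q => - b + / (INR q + 1)) (Q l) (- b)).
  - intros q. destruct (Hx (s q)) as [_ H]. assert (H2 := incr_ge_id s Hs q). apply le_INR in H2.
    apply Rlt_le; eapply Rlt_le_trans; [exact H|]. apply Rplus_le_compat_l.
    apply Rinv_le_contravar; generalize (pos_INR q); lra.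
  - exact Ql.
  - replace (Finite (- b)) with (Rbar_plus (- b) 0) by (cbn; f_equal; ring).
    apply is_lim_seq_plus'; [apply is_lim_seq_const|].
    replace (Finite 0) with (Rbar_inv p_infty) by reflexivity.
    apply is_lim_seq_inv; [|easy].
    apply is_lim_seq_plus with p_infty 1; [apply is_lim_seq_INR|apply is_lim_seq_const|easy]. }
assert (- Q y <= b) by (apply Hb1; exists y; auto). lra.
Qed.

Lemma is_lim_seq_lsum {T} (l : list T) (F : nat -> T -> R) (G : T -> R) :
  (forall a, In a l -> is_lim_seq (fun q => F q a) (G a)) ->
  is_lim_seq (fun q => lsum l (F q)) (lsum l G).
Proof.
induction l as [|a l IH]; intros H.
- apply is_lim_seq_const.
- rewrite lsum_cons. apply (is_lim_seq_ext (fun q => F q a + lsum l (F q))); [reflexivity|].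
  apply is_lim_seq_plus'; [apply H; left; reflexivity|apply IH; intros b Hb; apply H; right; exact Hb].
Qed.

Lemma is_lim_seq_pow2 (u : nat -> R) (l : R) : is_lim_seq u l -> is_lim_seq (fun q => u q ^ 2) (l ^ 2).
Proof.
intros H. apply (is_lim_seq_ext (fun q => u q * u q)); [intros; ring|].
replace (l ^ 2) with (l * l) by ring. now apply is_lim_seq_mult'.
Qed.

Lemma is_lim_seq_comp_cont (f : R -> R) (u : nat -> R) (l : R) :
  continuous f l -> is_lim_seq u l -> is_lim_seq (fun q => f (u q)) (f l).
Proof. intros Hf Hu. apply (is_lim_seq_continuous f u l); [apply continuity_pt_filterlim; exact Hf|exact Hu]. Qed.

Lemma is_lim_seq_nrm {T} (l : list T) (w : T -> R) (F : nat -> T -> R) (G : T -> R) :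
  (forall a, In a l -> is_lim_seq (fun q => F q a) (G a)) ->
  is_lim_seq (fun q => nrm l w (F q)) (nrm l w G).
Proof.
intros H; unfold nrm.
apply (is_lim_seq_comp_cont sqrt); [apply continuous_sqrt|].
apply is_lim_seq_lsum; intros a Ha.
apply is_lim_seq_mult'; [apply is_lim_seq_const|apply is_lim_seq_pow2; now apply H].
Qed.

Lemma is_lim_seq_le_const (u : nat -> R) (l B : R) :
  is_lim_seq u l -> (forall q, u q <= B) -> l <= B.
Proof.
intros Hu H. exact (is_lim_seq_le u (fun _ => B) l B H Hu (is_lim_seq_const B)).
Qed.

(** * Discrete Sobolev norms *)

Definition n2 (M : nat) (g : nat * nat -> R) : R := nrm (Pt M) (wpt M) g.
(** With the factor [mu], the weight [one] gives exactly the grid norm [n2] of the function; [k2]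
    and [onek2] give the first-order Sobolev seminorm and norm in time. *)
Definition nw (M : nat) (wt c : nat * nat -> R) : R := nrm (Md M) (fun a => mu M a * wt a) c.
Definition k2 (a : nat * nat) : R := INR (fst a) ^ 2.
Definition one (a : nat * nat) : R := 1.
Definition j2 (a : nat * nat) : R := INR (snd a) ^ 2.
Definition onek2 (a : nat * nat) : R := 1 + INR (fst a) ^ 2.

(** The time step is [PI / M], so this is [PI] times a difference quotient. *)
Definition D1 (M : nat) (g : nat * nat -> R) (p : nat * nat) : R :=
  INR M * (g (S (fst p), snd p) - g p).
Definition D2 (M : nat) (g : nat * nat -> R) (p : nat * nat) : R :=
  INR M ^ 2 * (g (S (S (fst p)), snd p) - 2 * g (S (fst p), snd p) + g p).
Definition D3 (M : nat) (g : nat * nat -> R) (p : nat * nat) : R :=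
  INR M ^ 3 * (g (S (S (S (fst p))), snd p) - 3 * g (S (S (fst p)), snd p) + 3 * g (S (fst p), snd p) - g p).
Definition DX (M : nat) (g : nat * nat -> R) (p : nat * nat) : R :=
  INR M * (g (fst p, S (snd p)) - g p).

Section Level.
Variable M : nat.
Hypothesis HM : (2 <= M)%nat.

Let Mpos : 0 < INR M.
Proof. apply lt_0_INR; lia. Qed.

Lemma wpt_nonneg p : In p (Pt M) -> 0 <= wpt M p.
Proof. intros _; apply Rlt_le, wpt_pos, HM. Qed.

Lemma mu_wt_nonneg wt : (forall a, 0 <= wt a) -> forall a, In a (Md M) -> 0 <= mu M a * wt a.
Proof. intros H a _; apply Rmult_le_pos; [generalize (mu_bounds M a); lra|apply H]. Qed.

Lemma k2_nonneg a : 0 <= k2 a.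
Proof. apply pow2_ge_0. Qed.
Lemma j2_nonneg a : 0 <= j2 a.
Proof. apply pow2_ge_0. Qed.
Lemma one_nonneg (a : nat * nat) : 0 <= one a.
Proof. unfold one; lra. Qed.
Lemma onek2_nonneg a : 0 <= onek2 a.
Proof. unfold onek2; generalize (pow2_ge_0 (INR (fst a))); lra. Qed.

Lemma n2_sq g : n2 M g ^ 2 = avg M (fun p => g p ^ 2).
Proof. unfold n2; rewrite nrm_sq by apply wpt_nonneg; reflexivity. Qed.

Lemma nw_sq wt c : (forall a, 0 <= wt a) -> nw M wt c ^ 2 = lsum (Md M) (fun a => mu M a * wt a * c a ^ 2).
Proof. intros H; unfold nw; rewrite nrm_sq by now apply mu_wt_nonneg. reflexivity. Qed.

Lemma n2_nonneg g : 0 <= n2 M g.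
Proof. apply nrm_nonneg. Qed.

Lemma nw_nonneg wt c : 0 <= nw M wt c.
Proof. apply nrm_nonneg. Qed.

Lemma sq_le_of_le x y : 0 <= y -> x ^ 2 <= y ^ 2 -> x <= y.
Proof. intros; nra. Qed.

Lemma n2_cauchy_schwarz g h : Rabs (avg M (fun p => g p * h p)) <= n2 M g * n2 M h.
Proof. apply nrm_cauchy_schwarz, wpt_nonneg. Qed.

Lemma n2_triang g h : n2 M (fun p => g p + h p) <= n2 M g + n2 M h.
Proof. apply nrm_triang, wpt_nonneg. Qed.

Lemma n2_scal c g : n2 M (fun p => c * g p) = Rabs c * n2 M g.
Proof. apply nrm_scal, wpt_nonneg. Qed.

Lemma n2_le g h : (forall p, In p (Pt M) -> Rabs (g p) <= Rabs (h p)) -> n2 M g <= n2 M h.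
Proof. apply nrm_le, wpt_nonneg. Qed.

Lemma n2_ext g h : (forall p, In p (Pt M) -> g p = h p) -> n2 M g = n2 M h.
Proof. apply nrm_ext. Qed.

Lemma n2_le_scal B g h : 0 <= B -> (forall p, In p (Pt M) -> Rabs (g p) <= B * Rabs (h p)) -> n2 M g <= B * n2 M h.
Proof.
intros HB H. replace (B * n2 M h) with (n2 M (fun p => B * h p)) by (rewrite n2_scal, (Rabs_pos_eq B); lra).
apply n2_le; intros p Hp. rewrite Rabs_mult, (Rabs_pos_eq B) by exact HB. now apply H.
Qed.

Lemma n2_le_two B C g h1 h2 : 0 <= B -> 0 <= C ->
  (forall p, In p (Pt M) -> Rabs (g p) <= B * Rabs (h1 p) + C * Rabs (h2 p)) ->
  n2 M g <= B * n2 M h1 + C * n2 M h2.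
Proof.
intros HB HC H.
apply Rle_trans with (n2 M (fun p => B * Rabs (h1 p) + C * Rabs (h2 p))).
- apply n2_le; intros p Hp. rewrite (Rabs_pos_eq (_ + _)); [now apply H|].
  apply Rplus_le_le_0_compat; apply Rmult_le_pos; auto using Rabs_pos.
- eapply Rle_trans; [apply n2_triang|].
  apply Rplus_le_compat; [apply n2_le_scal|apply n2_le_scal]; auto; intros p _;
  rewrite Rabs_mult, Rabs_Rabsolu, Rabs_pos_eq by assumption; apply Rle_refl.
Qed.

Lemma n2_const_bound B g : 0 <= B -> (forall p, In p (Pt M) -> Rabs (g p) <= B) -> n2 M g <= B.
Proof.
intros HB H. apply sq_le_of_le; [exact HB|]. rewrite n2_sq, <- (avg_const M HM (B ^ 2)).
apply avg_le; [exact HM|]; intros p Hp. rewrite <- pow2_abs. apply pow_incr; split; [apply Rabs_pos|now apply H].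
Qed.

Lemma nw_triang wt c d : (forall a, 0 <= wt a) -> nw M wt (fun a => c a + d a) <= nw M wt c + nw M wt d.
Proof. intros H; apply nrm_triang; now apply mu_wt_nonneg. Qed.

Lemma nw_triang_minus wt c d : (forall a, 0 <= wt a) -> nw M wt (fun a => c a - d a) <= nw M wt c + nw M wt d.
Proof. intros H; apply nrm_triang_minus; now apply mu_wt_nonneg. Qed.

Lemma nw_scal wt s c : (forall a, 0 <= wt a) -> nw M wt (fun a => s * c a) = Rabs s * nw M wt c.
Proof. intros H; apply nrm_scal; now apply mu_wt_nonneg. Qed.

Lemma nw_ext wt c d : (forall a, In a (Md M) -> c a = d a) -> nw M wt c = nw M wt d.
Proof. apply nrm_ext. Qed.

Lemma nw_le_scal B wt wt' c d : (forall a, 0 <= wt a) -> (forall a, 0 <= wt' a) -> 0 <= B ->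
  (forall a, In a (Md M) -> wt a * c a ^ 2 <= B ^ 2 * (wt' a * d a ^ 2)) ->
  nw M wt c <= B * nw M wt' d.
Proof.
intros Hw Hw' HB H. apply sq_le_of_le; [apply Rmult_le_pos; [exact HB|apply nw_nonneg]|].
rewrite Rpow_mult_distr, !nw_sq by assumption. rewrite <- lsum_scal. apply lsum_le; intros a Ha.
specialize (H a Ha). generalize (mu_bounds M a); intros [H1 H2].
replace (mu M a * wt a * c a ^ 2) with (mu M a * (wt a * c a ^ 2)) by ring.
replace (B ^ 2 * (mu M a * wt' a * d a ^ 2)) with (mu M a * (B ^ 2 * (wt' a * d a ^ 2))) by ring.
apply Rmult_le_compat_l; [lra|exact H].
Qed.

Lemma n2_ev c : n2 M (ev M 0 c) = nw M one c.
Proof.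
unfold n2, nw, nrm; f_equal.
change (avg M (fun p => ev M 0 c p ^ 2) = lsum (Md M) (fun a => mu M a * one a * c a ^ 2)).
rewrite (avg_ext M _ (fun p => ev M 0 c p * ev M 0 c p)) by (intros; ring).
rewrite parseval by exact HM. apply lsum_ext; intros; unfold one; ring.
Qed.

Lemma ev_plus s c d p : ev M s (fun a => c a + d a) p = ev M s c p + ev M s d p.
Proof. unfold ev; rewrite <- lsum_plus; apply lsum_ext; intros; ring. Qed.

Lemma ev_minus s c d p : ev M s (fun a => c a - d a) p = ev M s c p - ev M s d p.
Proof. unfold ev; rewrite <- lsum_minus; apply lsum_ext; intros; ring. Qed.

Lemma ev_scal s x c p : ev M s (fun a => x * c a) p = x * ev M s c p.
Proof. unfold ev; rewrite <- lsum_scal; apply lsum_ext; intros; ring. Qed.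

Lemma ev_ext s c d p : (forall a, In a (Md M) -> c a = d a) -> ev M s c p = ev M s d p.
Proof. intros H; unfold ev; apply lsum_ext; intros a Ha; now rewrite H. Qed.

(** Norm equivalence with constants free of [M]: by [avg_diff_ev] the squared norm has symbol
    [M^2 thq], which [thq_bounds] places between [k^2] and [16 k^2]. *)
Lemma D1_ev_bounds c : nw M k2 c <= n2 M (D1 M (ev M 0 c)) <= 4 * nw M k2 c.
Proof.
assert (E : n2 M (D1 M (ev M 0 c)) ^ 2 = lsum (Md M) (fun a => mu M a * (INR M ^ 2 * thq M (fst a)) * c a ^ 2)).
{ rewrite n2_sq. unfold D1.
  rewrite (avg_ext M _ (fun p => INR M ^ 2 * (ev M 0 c (S (fst p), snd p) - ev M 0 c p) ^ 2)) by (intros; ring).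
  rewrite avg_scal, avg_diff_ev, <- lsum_scal by exact HM. apply lsum_ext; intros; ring. }
assert (P := nw_nonneg k2 c). assert (P' := n2_nonneg (D1 M (ev M 0 c))).
split; apply sq_le_of_le; try lra.
- rewrite E, nw_sq by apply k2_nonneg. apply lsum_le; intros a Ha. apply in_Md in Ha.
  destruct (thq_bounds M (fst a) HM (proj1 Ha)) as [H _]. generalize (mu_bounds M a); intros [H1 H2].
  apply Rmult_le_compat_r; [apply pow2_ge_0|]. apply Rmult_le_compat_l; [lra|exact H].
- rewrite E, Rpow_mult_distr, nw_sq by apply k2_nonneg. rewrite <- lsum_scal. apply lsum_le; intros a Ha. apply in_Md in Ha.
  destruct (thq_bounds M (fst a) HM (proj1 Ha)) as [_ H]. generalize (mu_bounds M a); intros [H1 H2].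
  replace (4 ^ 2 * (mu M a * k2 a * c a ^ 2)) with (mu M a * (16 * INR (fst a) ^ 2) * c a ^ 2) by (unfold k2; ring).
  apply Rmult_le_compat_r; [apply pow2_ge_0|]. apply Rmult_le_compat_l; [lra|exact H].
Qed.

(** Reduces Sobolev bounds for [phi(u)] to pointwise bounds of its finite differences, which only
    use Lipschitz-type properties of [phi]. *)
Lemma nw_hat_D1 g : grid_class M g -> nw M k2 (hat M g) <= n2 M (D1 M g).
Proof.
intros Hg. destruct (D1_ev_bounds (hat M g)) as [H _]. eapply Rle_trans; [exact H|].
apply Req_le, n2_ext; intros [m i] Hp; apply in_Pt in Hp; unfold D1; cbn [fst snd] in *.
rewrite !fourier_inversion by (cbn [snd]; lia || assumption). reflexivity.
Qed.

Lemma nw_hat_0 g : grid_class M g -> nw M one (hat M g) = n2 M g.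
Proof.
intros Hg. rewrite <- n2_ev. apply n2_ext; intros [m i] Hp; apply in_Pt in Hp; cbn [fst snd] in *.
now rewrite fourier_inversion by (cbn [snd]; lia || assumption).
Qed.

Lemma nw_onek2_sq c : nw M onek2 c ^ 2 = nw M one c ^ 2 + nw M k2 c ^ 2.
Proof.
rewrite !nw_sq by (apply onek2_nonneg || apply one_nonneg || apply k2_nonneg).
rewrite <- lsum_plus; apply lsum_ext; intros; unfold onek2, one, k2; ring.
Qed.

Lemma nw_hat_onek2 g B : grid_class M g -> 0 <= B -> n2 M g <= B -> n2 M (D1 M g) <= B -> nw M onek2 (hat M g) <= 2 * B.
Proof.
intros Hg HB H1 H2. apply sq_le_of_le; [lra|]. rewrite nw_onek2_sq, nw_hat_0 by exact Hg.
assert (H3 := nw_hat_D1 g Hg). assert (P1 := n2_nonneg g). assert (P2 := nw_nonneg k2 (hat M g)). nra.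
Qed.

Lemma nw_one_le_onek2 c : nw M one c <= nw M onek2 c.
Proof.
apply sq_le_of_le; [apply nw_nonneg|]. rewrite nw_onek2_sq. generalize (pow2_ge_0 (nw M k2 c)); lra.
Qed.

Lemma nw_k2_le_onek2 c : nw M k2 c <= nw M onek2 c.
Proof.
apply sq_le_of_le; [apply nw_nonneg|]. rewrite nw_onek2_sq. generalize (pow2_ge_0 (nw M one c)); lra.
Qed.

Lemma bas_bound s a p : Rabs (bas M s a p) <= 1.
Proof.
unfold bas. rewrite Rabs_mult. rewrite <- (Rmult_1_r 1).
apply Rmult_le_compat; try apply Rabs_pos; apply Rabs_le; [apply COS_bound|apply SIN_bound].
Qed.

Lemma ev_bound s c p : Rabs (ev M s c p) <= lsum (Md M) (fun a => Rabs (c a)).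
Proof.
unfold ev. eapply Rle_trans; [apply lsum_abs|]. apply lsum_le; intros a _.
rewrite Rabs_mult. rewrite <- (Rmult_1_r (Rabs (c a))) at 2.
apply Rmult_le_compat_l; [apply Rabs_pos|apply bas_bound].
Qed.

(** Cauchy-Schwarz against a summable weight [r]; with the weights at hand this is the Sobolev
    embedding into absolutely convergent series. *)
Lemma lsum_abs_weighted (c d r : nat * nat -> R) (l : list (nat * nat)) B :
  0 <= B -> (forall a, In a l -> 0 <= r a) ->
  (forall a, In a l -> c a ^ 2 <= r a * d a ^ 2) ->
  lsum l r <= B ^ 2 ->
  lsum l (fun a => Rabs (c a)) <= B * sqrt (lsum l (fun a => d a ^ 2)).
Proof.
intros HB Hr Hc HS.
apply Rle_trans with (lsum l (fun a => sqrt (r a) * Rabs (d a))).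
- apply lsum_le; intros a Ha. rewrite <- (sqrt_pow2 (Rabs (d a))) by apply Rabs_pos.
  rewrite <- sqrt_mult by (auto; apply pow2_ge_0).
  rewrite <- (sqrt_pow2 (Rabs (c a))) by apply Rabs_pos.
  apply sqrt_le_1_alt. rewrite !pow2_abs. now apply Hc.
- assert (H := lsum_cauchy_schwarz l (fun a => sqrt (r a)) (fun a => Rabs (d a))).
  cbn beta in H.
  rewrite (lsum_ext l (fun a => sqrt (r a) ^ 2) r) in H by (intros a Ha; rewrite pow2_sqrt; auto).
  rewrite (lsum_ext l (fun a => Rabs (d a) ^ 2) (fun a => d a ^ 2)) in H by (intros; apply pow2_abs).
  assert (P : 0 <= lsum l (fun a => d a ^ 2)) by (apply lsum_nonneg; intros; apply pow2_ge_0).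
  apply sq_le_of_le; [apply Rmult_le_pos; [exact HB|apply sqrt_pos]|].
  rewrite Rpow_mult_distr, pow2_sqrt by exact P.
  eapply Rle_trans; [exact H|]. apply Rmult_le_compat_r; assumption.
Qed.

Lemma lsum_nw wt c : (forall a, 0 <= wt a) ->
  sqrt (lsum (Md M) (fun a => (sqrt (wt a) * c a) ^ 2)) <= 2 * nw M wt c.
Proof.
intros H. apply sq_le_of_le; [generalize (nw_nonneg wt c); lra|].
rewrite pow2_sqrt by (apply lsum_nonneg; intros; apply pow2_ge_0).
rewrite Rpow_mult_distr, nw_sq by exact H. rewrite <- lsum_scal. apply lsum_le; intros a Ha.
rewrite Rpow_mult_distr, pow2_sqrt by apply H.
generalize (mu_bounds M a); intros [H1 H2].
assert (0 <= wt a * c a ^ 2) by (apply Rmult_le_pos; [apply H|apply pow2_ge_0]). nra.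
Qed.

End Level.

(** * Lyapunov-Schmidt reduction *)

Definition inMd (M : nat) (a : nat * nat) : bool :=
  Nat.leb (fst a) M && Nat.ltb 0 (snd a) && Nat.ltb (snd a) M.
Definition inV (M n : nat) (a : nat * nat) : bool := inMd M a && isV n a.
Definition inW (M n : nat) (a : nat * nat) : bool := inMd M a && negb (isV n a).
Definition supp (s : nat * nat -> bool) (c : nat * nat -> R) : Prop := forall a, s a = false -> c a = 0.
Definition vadd (c d : nat * nat -> R) (a : nat * nat) : R := c a + d a.
Definition vsub (c d : nat * nat -> R) (a : nat * nat) : R := c a - d a.

Lemma inMd_spec M a : inMd M a = true <-> In a (Md M).
Proof.
unfold inMd. rewrite in_Md, !andb_true_iff, Nat.leb_le, !Nat.ltb_lt. tauto.
Qed.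

Lemma inV_true M n a : inV M n a = true -> In a (Md M) /\ isV n a = true.
Proof. unfold inV; rewrite andb_true_iff, inMd_spec; tauto. Qed.

Lemma inW_true M n a : inW M n a = true -> In a (Md M) /\ isV n a = false.
Proof. unfold inW; rewrite andb_true_iff, inMd_spec, negb_true_iff; tauto. Qed.

Lemma inV_inW M n a : In a (Md M) -> inW M n a = negb (inV M n a).
Proof. intros H; unfold inV, inW; apply inMd_spec in H; rewrite H; cbn; reflexivity. Qed.

Lemma sum_inv_k2 K : lsum (seq 1 K) (fun k => / INR k ^ 2) <= 2.
Proof.
rewrite <- (seq_shift K 0), lsum_map.
rewrite (lsum_ext _ _ (fun k => / (1 + INR k) ^ 2)) by (intros; rewrite S_INR; f_equal; f_equal; ring).
apply sum_inv_sq.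
Qed.

(** V is one-dimensional: each [k] carries at most the mode [j = n k], and [k = 0] none because
    [j >= 1]. *)
Lemma lsum_V_le M n (F : nat -> R) : (forall k, 0 <= F k) ->
  lsum (Md M) (fun a => if isV n a then F (fst a) else 0) <= lsum (seq 1 M) F.
Proof.
intros HF. unfold Md. rewrite lsum_list_prod. cbn [seq]. rewrite lsum_cons.
rewrite (lsum_zero (seq 1 (M - 1))).
- rewrite Rplus_0_l. apply lsum_le; intros k _.
  destruct (in_dec Nat.eq_dec (n * k)%nat (seq 1 (M - 1))) as [Hi|Hi].
  + rewrite (lsum_single _ _ (n * k)%nat); [|apply seq_NoDup|exact Hi|].
    * unfold isV; cbn [fst snd]; rewrite Nat.eqb_refl; apply Rle_refl.
    * intros j _ Hj; unfold isV; cbn [fst snd]. destruct (Nat.eqb_spec j (n * k)); [easy|reflexivity].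
  + rewrite lsum_zero; [apply HF|]. intros j Hj; unfold isV; cbn [fst snd].
    destruct (Nat.eqb_spec j (n * k)) as [->|]; [easy|reflexivity].
- intros j Hj; apply in_seq in Hj; unfold isV; cbn [fst snd].
  destruct (Nat.eqb_spec j (n * 0)); [lia|reflexivity].
Qed.

(* Stated through finite differences because it is applied to the values of [phi] on a grid. *)
Record nonlin (phi : R -> R) (A : R) : Prop := {
  nl_zero : phi 0 = 0;
  nl_cont : forall x, continuous phi x;
  nl_lip : forall x y, Rabs x <= 7 -> Rabs y <= 7 -> Rabs (phi x - phi y) <= A * Rabs (x - y);
  nl_four : forall x1 x2 y1 y2, Rabs x1 <= 7 -> Rabs x2 <= 7 -> Rabs y1 <= 7 -> Rabs y2 <= 7 ->
    Rabs ((phi x1 - phi x2) - (phi y1 - phi y2))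
    <= A * Rabs ((x1 - x2) - (y1 - y2)) + A * Rabs (y1 - y2) * (Rabs (x1 - y1) + Rabs (x2 - y2)) }.

Section Reduction.
Variables (M n : nat) (om ga : R) (J : nat -> nat) (phi : R -> R) (A : R).
Hypothesis HM : (2 <= M)%nat.
Hypothesis Hn : (1 <= n)%nat.
Hypothesis Hom : / 2 <= om <= 3 / 2.
Hypothesis Hga : 0 < ga <= 3 / 2.
Hypothesis HW : in_W ga om.
Hypothesis HJ : forall k, Rabs (INR (J k) - om * INR n * INR k) <= / 2.
Hypothesis Homn : Rabs (om - 1) * INR n <= ga.
Hypothesis HA0 : 0 <= A.
Hypothesis HA : 5000 * A <= ga.
Hypothesis Hphi : nonlin phi A.

(** Solves [lam w + g = 0] on W; the sign is included, so the W-equation reads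
    [w = Tinv (fhat (v + w))]. *)
Definition Tinv (g : nat * nat -> R) (a : nat * nat) : R :=
  if inW M n a then - g a / lam n om a else 0.
Definition nv (v : nat * nat -> R) : R := nw M k2 v.
Definition fhat (c : nat * nat -> R) : nat * nat -> R := hat M (fun p => phi (ev M 0 c p)).

Lemma lam_W_neq0 a : inW M n a = true -> lam n om a <> 0.
Proof.
intros H; apply inW_true in H; destruct H as [H1 H2] .
assert (L := lam_nonzero n om ga J Hn Hom Hga HW HJ M a H1 H2).
intros E; rewrite E in L. assert (0 < ga ^ 2) by (apply pow_lt; lra). lra.
Qed.

Lemma T_sq_le (r : R) g a : 0 <= r -> In a (Md M) -> (isV n a = false -> / lam n om a ^ 2 <= r) ->
  Tinv g a ^ 2 <= r * g a ^ 2.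
Proof.
intros Hr Ha H. unfold Tinv. destruct (inW M n a) eqn:E.
- assert (Hl := lam_W_neq0 a E). apply inW_true in E.
  replace ((- g a / lam n om a) ^ 2) with (/ lam n om a ^ 2 * g a ^ 2) by (field; exact Hl).
  apply Rmult_le_compat_r; [apply pow2_ge_0|tauto].
- rewrite pow_i by lia. apply Rmult_le_pos; [exact Hr|apply pow2_ge_0].
Qed.

Lemma nw_T1 wt g : (forall a, 0 <= wt a) -> nw M wt (Tinv g) <= 6 / ga * nw M wt g.
Proof.
intros Hw. apply nw_le_scal; auto; [apply Rdiv_le_0_compat; lra|].
intros a Ha.
assert (P : 0 <= 36 / ga ^ 2) by (apply Rdiv_le_0_compat; [lra|apply pow_lt; lra]).
assert (H := T_sq_le (36 / ga ^ 2) g a P Ha (lam_T1 n om ga J Hn Hom Hga HW HJ M a Ha)).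
replace ((6 / ga) ^ 2 * (wt a * g a ^ 2)) with (wt a * (36 / ga ^ 2 * g a ^ 2)) by (field; lra).
apply Rmult_le_compat_l; auto.
Qed.

Lemma l1_T2 g : lsum (Md M) (fun a => Rabs (Tinv g a)) <= 68 / ga * nw M onek2 g.
Proof.
assert (P : 0 < ga ^ 2) by (apply pow_lt; lra).
(* The weight sums to at most [72 * 16 / ga^2], and [72 * 16 = 1152 <= 34^2]; a further factor 2
   comes from [mu >= 1/4]. *)
eapply Rle_trans; [apply (lsum_abs_weighted (Tinv g) (fun a => sqrt (onek2 a) * g a) (fun a => 72 / ga ^ 2 * rho1 J a) (Md M) (34 / ga))|].
- apply Rdiv_le_0_compat; lra.
- intros a _. apply Rmult_le_pos; [apply Rdiv_le_0_compat; lra|apply Rlt_le, rho1_pos].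
- intros a Ha. rewrite Rpow_mult_distr, pow2_sqrt by apply onek2_nonneg.
  assert (Q : 0 <= 72 / ga ^ 2 * onek2 a * rho1 J a).
  { apply Rmult_le_pos; [|apply Rlt_le, rho1_pos]. apply Rmult_le_pos; [apply Rdiv_le_0_compat; lra|apply onek2_nonneg]. }
  assert (H := T_sq_le _ g a Q Ha (lam_T2 n om ga J Hn Hom Hga HW HJ M a Ha)).
  eapply Rle_trans; [exact H|]. apply Req_le; ring.
- rewrite lsum_scal. assert (S16 := sum_rho1 J (S M) 1 (M - 1)).
  change (list_prod (seq 0 (S M)) (seq 1 (M - 1))) with (Md M) in S16.
  replace ((34 / ga) ^ 2) with (72 / ga ^ 2 * (1156 / 72)) by (field; lra).
  apply Rmult_le_compat_l; [apply Rdiv_le_0_compat; lra|lra].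
- assert (H := lsum_nw M onek2 g onek2_nonneg).
  replace (68 / ga * nw M onek2 g) with (34 / ga * (2 * nw M onek2 g)) by (field; lra).
  apply Rmult_le_compat_l; [apply Rdiv_le_0_compat; lra|exact H].
Qed.

(** No [1/ga] is left: in [lam_T3] the quotient [|om - 1| n / ga] is at most 1 by [Homn]. *)
Lemma nw_T3 g : nw M one (Tinv g) <= 4 * nw M onek2 g.
Proof.
apply nw_le_scal; auto using one_nonneg, onek2_nonneg; [lra|].
intros a Ha.
assert (P : 0 <= 16 * onek2 a) by (generalize (onek2_nonneg a); lra).
assert (H := T_sq_le (16 * onek2 a) g a P Ha).
unfold one; rewrite Rmult_1_l. replace (4 ^ 2 * (onek2 a * g a ^ 2)) with (16 * onek2 a * g a ^ 2) by ring.
apply H. intros HV.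
eapply Rle_trans; [apply (lam_T3 n om ga J Hn Hom Hga HW HJ M a Ha HV)|].
unfold onek2. assert (((om - 1) * INR n / ga) ^ 2 <= 1).
{ rewrite <- pow2_abs. apply Rle_trans with (1 ^ 2); [|lra]. apply pow_incr; split; [apply Rabs_pos|].
  unfold Rdiv; rewrite !Rabs_mult, (Rabs_pos_eq (INR n)) by apply pos_INR.
  rewrite (Rabs_pos_eq (/ ga)) by (apply Rlt_le, Rinv_0_lt_compat; lra).
  apply Rmult_le_reg_r with ga; [lra|]. rewrite Rmult_assoc, Rinv_l; lra. }
assert (P2 := pow2_ge_0 (INR (fst a))).
set (q := ((om - 1) * INR n / ga) ^ 2) in *. set (K := INR (fst a) ^ 2) in *. clearbody q K. nra.
Qed.

Lemma T_linear g h a : Tinv (fun b => g b - h b) a = Tinv g a - Tinv h a.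
Proof. unfold Tinv; destruct (inW M n a); unfold Rdiv; ring. Qed.

Lemma supp_V_k v a : supp (inV M n) v -> In a (Md M) -> v a = 0 \/ (1 <= INR (fst a) /\ isV n a = true).
Proof.
intros Hv Ha. destruct (inV M n a) eqn:E; [right|left; now apply Hv].
apply inV_true in E; destruct E as [_ E]. split; [|exact E].
apply in_Md in Ha. unfold isV in E; apply Nat.eqb_eq in E.
destruct a as [k j]; cbn [fst snd] in *. destruct k; [lia|]. rewrite S_INR; generalize (pos_INR k); lra.
Qed.

Lemma nv_nonneg v : 0 <= nv v.
Proof. apply nw_nonneg. Qed.

(** Embedding for functions of the single index [k >= 1], hence uniform in [n] and [M]: the weights
    [1/k^2] sum to at most [2 <= (3/2)^2], and [mu >= 1/4] doubles the constant. *)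
Lemma l1_V v : supp (inV M n) v -> lsum (Md M) (fun a => Rabs (v a)) <= 3 * nv v.
Proof.
intros Hv.
eapply Rle_trans; [apply (lsum_abs_weighted v (fun a => sqrt (k2 a) * v a) (fun a => if isV n a then / INR (fst a) ^ 2 else 0) (Md M) (3 / 2))|].
- lra.
- intros a Ha. destruct (isV n a) eqn:E; [|lra]. apply Rlt_le, Rinv_0_lt_compat, pow_lt.
  apply in_Md in Ha. unfold isV in E; apply Nat.eqb_eq in E. apply lt_0_INR. destruct (fst a); lia.
- intros a Ha. destruct (supp_V_k v a Hv Ha) as [E|[E1 E2]].
  + rewrite E, pow_i, Rmult_0_r, pow_i, Rmult_0_r by lia; lra.
  + rewrite E2, Rpow_mult_distr, pow2_sqrt by apply k2_nonneg. unfold k2. apply Req_le; field. lra.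
- eapply Rle_trans; [apply (lsum_V_le M n (fun k => / INR k ^ 2))|].
  + intros k. destruct k as [|k]; [cbn [INR]; rewrite pow_i, Rinv_0 by lia; lra|].
    apply Rlt_le, Rinv_0_lt_compat, pow_lt, lt_0_INR; lia.
  + generalize (sum_inv_k2 M); lra.
- assert (H := lsum_nw M k2 v k2_nonneg). unfold nv; lra.
Qed.

Lemma ev_V_bound v s p : supp (inV M n) v -> Rabs (ev M s v p) <= 3 * nv v.
Proof. intros Hv; eapply Rle_trans; [apply ev_bound|apply l1_V, Hv]. Qed.

Lemma nw_one_V v : supp (inV M n) v -> nw M one v <= nv v.
Proof.
intros Hv; unfold nv. rewrite <- (Rmult_1_l (nw M k2 v)).
apply nw_le_scal; auto using one_nonneg, k2_nonneg; [lra|]. intros a Ha.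
unfold one, k2. destruct (supp_V_k v a Hv Ha) as [E|[E _]]; [rewrite E, pow_i by lia; lra|].
generalize (pow2_ge_0 (v a)); intros. assert (1 <= INR (fst a) ^ 2) by nra. nra.
Qed.

Lemma nw_onek2_V v : supp (inV M n) v -> nw M onek2 v <= 2 * nv v.
Proof.
intros Hv; unfold nv.
apply nw_le_scal; auto using onek2_nonneg, k2_nonneg; [lra|]. intros a Ha.
unfold onek2, k2. destruct (supp_V_k v a Hv Ha) as [E|[E _]]; [rewrite E, pow_i by lia; lra|].
generalize (pow2_ge_0 (v a)); intros. assert (1 <= INR (fst a) ^ 2) by nra. nra.
Qed.

Lemma supp_add s c d : supp s c -> supp s d -> supp s (vadd c d).
Proof. intros H1 H2 a Ha; unfold vadd; rewrite H1, H2 by exact Ha; ring. Qed.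
Lemma supp_sub s c d : supp s c -> supp s d -> supp s (vsub c d).
Proof. intros H1 H2 a Ha; unfold vsub; rewrite H1, H2 by exact Ha; ring. Qed.

(** The sup bound is imposed separately because it costs the estimate [l1_T2]. With [Vball] it
    confines [v + w] to [[-7, 7]], where the bounds on [phi] hold. *)
Definition Wball (w : nat * nat -> R) : Prop :=
  supp (inW M n) w /\ nw M onek2 w <= 1 /\ forall p, Rabs (ev M 0 w p) <= 1.
Definition Vball (v : nat * nat -> R) : Prop := supp (inV M n) v /\ nv v <= 2.
Definition Sol (v w : nat * nat -> R) : Prop :=
  Wball w /\ forall a, w a = Tinv (fhat (vadd v w)) a.

Lemma ev_V_6 v p : Vball v -> Rabs (ev M 0 v p) <= 6.
Proof. intros [H1 H2]; generalize (ev_V_bound v 0 p H1); lra. Qed.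

Lemma ev_sum_7 v w p : Vball v -> Wball w -> Rabs (ev M 0 (vadd v w) p) <= 7.
Proof.
intros Hv (_ & _ & Hw). unfold vadd; rewrite ev_plus.
eapply Rle_trans; [apply Rabs_triang|]. generalize (ev_V_6 v p Hv) (Hw p); lra.
Qed.

Lemma grid_class_phi c : grid_class M (fun p => phi (ev M 0 c p)).
Proof. apply grid_class_comp; [apply Hphi|apply ev_grid_class, HM]. Qed.

Lemma n2_phi_diff c d : (forall p, Rabs (ev M 0 c p) <= 7) -> (forall p, Rabs (ev M 0 d p) <= 7) ->
  n2 M (fun p => phi (ev M 0 c p) - phi (ev M 0 d p)) <= A * nw M one (vsub c d).
Proof.
intros Hc Hd. rewrite <- n2_ev by exact HM. apply n2_le_scal; [exact HM|exact HA0|].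
intros p _. unfold vsub; rewrite ev_minus. now apply Hphi.
Qed.

Lemma ev_0 p : ev M 0 (fun _ => 0) p = 0.
Proof. unfold ev; apply lsum_zero; intros; ring. Qed.

(** Since [phi 0 = 0], both [phi(u)] and its time difference are pointwise at most [A] times those
    of [u]. The 8 is the 4 of [D1_ev_bounds] times the 2 of [nw_hat_onek2]. *)
Lemma fhat_bound c : (forall p, Rabs (ev M 0 c p) <= 7) -> nw M onek2 (fhat c) <= 8 * A * nw M onek2 c.
Proof.
intros Hc. replace (8 * A * nw M onek2 c) with (2 * (A * (4 * nw M onek2 c))) by ring.
assert (P := nw_nonneg M onek2 c).
apply nw_hat_onek2; [exact HM|apply grid_class_phi|apply Rmult_le_pos; lra| |].
- assert (H := n2_phi_diff c (fun _ => 0) Hc).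
  rewrite (n2_ext M _ (fun p => phi (ev M 0 c p) - phi (ev M 0 (fun _ => 0) p))).
  2:{ intros p _; rewrite ev_0, (nl_zero _ _ Hphi); ring. }
  eapply Rle_trans; [apply H; intros; rewrite ev_0, Rabs_R0; lra|].
  apply Rmult_le_compat_l; [exact HA0|].
  rewrite (nw_ext M _ _ c) by (intros; unfold vsub; ring).
  generalize (nw_one_le_onek2 M c); lra.
- eapply Rle_trans; [apply (n2_le_scal M HM A _ (D1 M (ev M 0 c)) HA0)|].
  + intros p _. unfold D1. rewrite !Rabs_mult, (Rabs_pos_eq (INR M)) by apply pos_INR.
    assert (H := nl_lip _ _ Hphi (ev M 0 c (S (fst p), snd p)) (ev M 0 c p) (Hc _) (Hc _)).
    generalize (pos_INR M); intros; nra.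
  + apply Rmult_le_compat_l; [exact HA0|].
    destruct (D1_ev_bounds M HM c) as [_ H]. generalize (nw_k2_le_onek2 M c); lra.
Qed.

Lemma onek2_sum v w : Vball v -> Wball w -> nw M onek2 (vadd v w) <= 5.
Proof.
intros [Hv1 Hv2] (_ & Hw & _). unfold vadd. eapply Rle_trans; [apply nw_triang, onek2_nonneg|].
generalize (nw_onek2_V v Hv1); lra.
Qed.

Lemma supp_T g : supp (inW M n) (Tinv g).
Proof. intros a Ha; unfold Tinv; now rewrite Ha. Qed.

Lemma T_maps_ball v w : Vball v -> Wball w -> Wball (Tinv (fhat (vadd v w))).
Proof.
intros Hv Hw.
assert (H1 := fhat_bound (vadd v w) (fun p => ev_sum_7 v w p Hv Hw)).
assert (H2 := onek2_sum v w Hv Hw).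
assert (H3 : nw M onek2 (fhat (vadd v w)) <= 40 * A) by nra.
assert (P := nw_nonneg M onek2 (fhat (vadd v w))).
assert (AG : A / ga <= / 5000).
{ apply Rmult_le_reg_r with ga; [lra|]. field_simplify; lra. }
split; [apply supp_T|split].
- eapply Rle_trans; [apply nw_T1, onek2_nonneg|].
  apply Rle_trans with (6 / ga * (40 * A)); [apply Rmult_le_compat_l; [apply Rdiv_le_0_compat; lra|exact H3]|].
  replace (6 / ga * (40 * A)) with (240 * (A / ga)) by (field; lra). lra.
- intros p. eapply Rle_trans; [apply ev_bound|]. eapply Rle_trans; [apply l1_T2|].
  apply Rle_trans with (68 / ga * (40 * A)); [apply Rmult_le_compat_l; [apply Rdiv_le_0_compat; lra|exact H3]|].
  replace (68 / ga * (40 * A)) with (2720 * (A / ga)) by (field; lra). lra.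
Qed.

Lemma hat_minus g h a : hat M (fun p => g p - h p) a = hat M g a - hat M h a.
Proof.
unfold hat. rewrite (avg_ext M _ (fun p => g p * bas M 0 a p - h p * bas M 0 a p)) by (intros; ring).
rewrite avg_minus. unfold Rdiv; ring.
Qed.

Lemma T_hat_one g : grid_class M g -> nw M one (Tinv (hat M g)) <= 6 / ga * n2 M g.
Proof. intros Hg. rewrite <- (nw_hat_0 M HM g Hg). apply nw_T1, one_nonneg. Qed.

Lemma grid_class_minus g h : grid_class M g -> grid_class M h -> grid_class M (fun p => g p - h p).
Proof.
intros [G1 G2 G3 G4] [H1 H2 H3 H4]; split; intros; [now rewrite G1, H1|now rewrite G2, H2|rewrite G3, H3; ring|rewrite G4, H4; ring].
Qed.

(** The contraction is measured in the plain square norm, where [phi] acts as a Lipschitz map; the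
    stronger norms only serve to keep the ball invariant. The rate is [6 A / ga <= 6/5000]. *)
Lemma T_fhat_diff v1 w1 v2 w2 : Vball v1 -> Wball w1 -> Vball v2 -> Wball w2 ->
  nw M one (vsub (Tinv (fhat (vadd v1 w1))) (Tinv (fhat (vadd v2 w2))))
  <= / 800 * nw M one (vsub (vadd v1 w1) (vadd v2 w2)).
Proof.
intros Hv1 Hw1 Hv2 Hw2.
rewrite (nw_ext M _ _ (Tinv (hat M (fun p => phi (ev M 0 (vadd v1 w1) p) - phi (ev M 0 (vadd v2 w2) p))))).
2:{ intros a _. unfold vsub. rewrite <- T_linear. unfold Tinv, fhat. destruct (inW M n a); [|reflexivity].
    now rewrite hat_minus. }
eapply Rle_trans; [apply T_hat_one, grid_class_minus; apply grid_class_phi|].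
assert (H := n2_phi_diff (vadd v1 w1) (vadd v2 w2) (fun p => ev_sum_7 v1 w1 p Hv1 Hw1) (fun p => ev_sum_7 v2 w2 p Hv2 Hw2)).
assert (AG : A / ga <= / 5000).
{ apply Rmult_le_reg_r with ga; [lra|]. field_simplify; lra. }
assert (P := nw_nonneg M one (vsub (vadd v1 w1) (vadd v2 w2))).
apply Rle_trans with (6 / ga * (A * nw M one (vsub (vadd v1 w1) (vadd v2 w2)))).
- apply Rmult_le_compat_l; [apply Rdiv_le_0_compat; lra|exact H].
- replace (6 / ga * (A * nw M one (vsub (vadd v1 w1) (vadd v2 w2)))) with (6 * (A / ga) * nw M one (vsub (vadd v1 w1) (vadd v2 w2))) by (field; lra).
  apply Rmult_le_compat_r; lra.
Qed.

Lemma vadd_sub_same v w1 w2 : nw M one (vsub (vadd v w1) (vadd v w2)) = nw M one (vsub w1 w2).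
Proof. apply nw_ext; intros; unfold vsub, vadd; ring. Qed.

Lemma coord_bound wt c a : (forall b, In b (Md M) -> 1 <= wt b) -> (forall b, 0 <= wt b) -> In a (Md M) -> Rabs (c a) <= 2 * nw M wt c.
Proof.
clear HA HA0 Hga. intros Hw Hw0 Ha. apply sq_le_of_le; [generalize (nw_nonneg M wt c); lra|].
rewrite pow2_abs, Rpow_mult_distr, nw_sq by assumption.
assert (H := lsum_term_le (Md M) (fun b => mu M b * wt b * c b ^ 2) a).
generalize (mu_bounds M a); intros [H1 H2]. specialize (Hw a Ha).
assert (c a ^ 2 / 4 <= mu M a * wt a * c a ^ 2).
{ generalize (pow2_ge_0 (c a)); intros. assert (/ 4 <= mu M a * wt a) by nra. nra. }
assert (mu M a * wt a * c a ^ 2 <= lsum (Md M) (fun b => mu M b * wt b * c b ^ 2)).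
{ apply H; [|exact Ha]. intros b _. apply Rmult_le_pos; [|apply pow2_ge_0]. apply Rmult_le_pos; [generalize (mu_bounds M b); lra|apply Hw0]. }
lra.
Qed.

Lemma is_lim_seq_ev s x l p : coord_lim x l -> is_lim_seq (fun q => ev M s (x q) p) (ev M s l p).
Proof.
intros H; unfold ev; apply is_lim_seq_lsum; intros a _.
apply is_lim_seq_mult'; [apply H|apply is_lim_seq_const].
Qed.

Lemma is_lim_seq_avg (g : nat -> nat * nat -> R) (h : nat * nat -> R) :
  (forall p, is_lim_seq (fun q => g q p) (h p)) -> is_lim_seq (fun q => avg M (g q)) (avg M h).
Proof.
intros H; unfold avg; apply is_lim_seq_lsum; intros p _.
apply is_lim_seq_mult'; [apply is_lim_seq_const|apply H].
Qed.

Lemma is_lim_seq_T v x l a : coord_lim x l ->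
  is_lim_seq (fun q => Tinv (fhat (vadd v (x q))) a) (Tinv (fhat (vadd v l)) a).
Proof.
intros H. unfold Tinv. destruct (inW M n a); [|apply is_lim_seq_const].
apply is_lim_seq_mult'; [|apply is_lim_seq_const].
apply (is_lim_seq_opp _ (fhat (vadd v l) a)).
unfold fhat, hat. apply is_lim_seq_mult'; [|apply is_lim_seq_const].
apply is_lim_seq_avg; intros p. apply is_lim_seq_mult'; [|apply is_lim_seq_const].
apply is_lim_seq_comp_cont; [apply Hphi|]. apply is_lim_seq_ev.
intros b; unfold vadd. apply is_lim_seq_plus'; [apply is_lim_seq_const|apply H].
Qed.

Lemma coord_lim_supp s x l : (forall q, supp s (x q)) -> coord_lim x l -> supp s l.
Proof.
intros H Hl a Ha. assert (L := Hl a).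
assert (E := is_lim_seq_ext (fun q => x q a) (fun _ => 0) (l a) (fun q => H q a Ha) L).
apply is_lim_seq_unique in E. rewrite Lim_seq_const in E. congruence.
Qed.

Lemma is_lim_seq_nw wt x l : coord_lim x l -> is_lim_seq (fun q => nw M wt (x q)) (nw M wt l).
Proof. intros H; apply is_lim_seq_nrm; intros; apply H. Qed.

Lemma Wball_closed x l : (forall q, Wball (x q)) -> coord_lim x l -> Wball l.
Proof.
intros H Hl; split; [|split].
- apply (coord_lim_supp _ x); [intros; apply H|exact Hl].
- apply (is_lim_seq_le_const (fun q => nw M onek2 (x q))); [now apply is_lim_seq_nw|intros; apply H].
- intros p. apply (is_lim_seq_le_const (fun q => Rabs (ev M 0 (x q) p))); [|intros; apply H].
  apply (is_lim_seq_abs _ (ev M 0 l p)). now apply is_lim_seq_ev.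
Qed.

(* A minimiser of [|w - F w|] on the ball is a fixed point because the contraction would decrease it. *)
Lemma Sol_exists v : Vball v -> exists w, Sol v w.
Proof.
intros Hv.
set (Fv := fun w => Tinv (fhat (vadd v w))).
destruct (coord_minimum Wball (fun w => nw M one (vsub w (Fv w))) (fun _ => 2) 0) as (w & Hw & Hmin).
- exists (fun _ => 0). split; [intros a _; reflexivity|split].
  + unfold nw; rewrite nrm_zero; [lra|reflexivity].
  + intros p; rewrite ev_0, Rabs_R0; lra.
- intros w (H1 & H2 & _) a. destruct (inW M n a) eqn:E.
  + apply inW_true in E. eapply Rle_trans; [apply (coord_bound onek2); [|apply onek2_nonneg|apply E]|lra].
    intros b _; unfold onek2; generalize (pow2_ge_0 (INR (fst b))); lra.
  + rewrite (H1 a E), Rabs_R0; lra.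
- intros; apply nw_nonneg.
- intros x l Hx Hl; split; [now apply (Wball_closed x)|].
  apply is_lim_seq_nw. intros a. unfold vsub, Fv. apply is_lim_seq_minus'; [apply Hl|now apply is_lim_seq_T].
- exists w; split; [exact Hw|].
  assert (H1 := Hmin (Fv w) (T_maps_ball v w Hv Hw)).
  assert (H2 := T_fhat_diff v w v (Fv w) Hv Hw Hv (T_maps_ball v w Hv Hw)).
  rewrite vadd_sub_same in H2. fold (Fv w) (Fv (Fv w)) in H2.
  assert (P := nw_nonneg M one (vsub w (Fv w))).
  assert (Z : nw M one (vsub w (Fv w)) = 0) by lra.
  intros a. fold (Fv w). destruct (inW M n a) eqn:E.
  + apply inW_true in E.
    assert (C := coord_bound one (vsub w (Fv w)) a (fun _ _ => Rle_refl 1) one_nonneg (proj1 E)).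
    rewrite Z, Rmult_0_r in C. unfold vsub in C. generalize (Rabs_pos (w a - Fv w a)); intros.
    assert (Rabs (w a - Fv w a) = 0) by lra. apply Rabs_eq_0 in H0. lra.
  + destruct Hw as [Hw _]. rewrite (Hw a E). unfold Fv, Tinv; now rewrite E.
Qed.

Lemma Sol_zero : Sol (fun _ => 0) (fun _ => 0).
Proof.
split.
- split; [intros a _; reflexivity|split].
  + unfold nw; rewrite nrm_zero; [lra|reflexivity].
  + intros p; rewrite ev_0, Rabs_R0; lra.
- intros a. unfold Tinv, fhat, hat. destruct (inW M n a); [|reflexivity].
  rewrite (avg_ext M _ (fun _ => 0)).
  + rewrite avg_const by exact HM. unfold Rdiv; ring.
  + intros p _. rewrite (ev_ext M _ _ (fun _ => 0)) by (intros; unfold vadd; ring).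
    rewrite ev_0, (nl_zero _ _ Hphi); ring.
Qed.

(** The contraction absorbs the [w] part of the right-hand side. For [v1 = v2] this is uniqueness of
    [w] on the modes of the grid. *)
Lemma Sol_lipschitz v1 w1 v2 w2 : Vball v1 -> Vball v2 -> Sol v1 w1 -> Sol v2 w2 ->
  nw M one (vsub w1 w2) <= nw M one (vsub v1 v2).
Proof.
intros Hv1 Hv2 [Hw1 E1] [Hw2 E2].
assert (H := T_fhat_diff v1 w1 v2 w2 Hv1 Hw1 Hv2 Hw2).
rewrite (nw_ext M _ _ (vsub w1 w2)) in H by (intros; unfold vsub; now rewrite <- E1, <- E2).
assert (T := nw_triang M one (vsub v1 v2) (vsub w1 w2) one_nonneg).
rewrite (nw_ext M one (vsub (vadd v1 w1) (vadd v2 w2)) (fun a => vsub v1 v2 a + vsub w1 w2 a)) in H by (intros; unfold vsub, vadd; ring).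
generalize (nw_nonneg M one (vsub v1 v2)) (nw_nonneg M one (vsub w1 w2)); intros; lra.
Qed.

Definition gap (v w : nat * nat -> R) (p : nat * nat) : R :=
  phi (ev M 0 (vadd v w) p) - phi (ev M 0 v p).

Lemma gap_diff_bound v1 w1 v2 w2 : Vball v1 -> Vball v2 -> Wball w1 -> Wball w2 ->
  n2 M (fun p => gap v1 w1 p - gap v2 w2 p)
  <= 2 * A * nw M one (vsub w1 w2) + 6 * A * nv (vsub v1 v2) * nw M one w2.
Proof.
intros Hv1 Hv2 Hw1 Hw2.
assert (Hs : supp (inV M n) (vsub v1 v2)) by (apply supp_sub; [apply Hv1|apply Hv2]).
assert (P := nv_nonneg (vsub v1 v2)).
rewrite <- !n2_ev by exact HM. apply n2_le_two; [exact HM|lra|apply Rmult_le_pos; lra|].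
intros p _. unfold gap.
assert (B1 := ev_V_6 v1 p Hv1). assert (B2 := ev_V_6 v2 p Hv2).
(* The second difference is taken at [v1 + w1, v1, v2 + w2, v2]. The difference of the [v] enters
   twice, each time with sup bound [3 nv], hence the 6; the bound 1 on [w2] absorbs the remaining
   product. *)
eapply Rle_trans; [apply (nl_four _ _ Hphi); [now apply ev_sum_7|lra|now apply ev_sum_7|lra]|].
assert (B3 := ev_V_bound (vsub v1 v2) 0 p Hs).
destruct Hw2 as (_ & _ & Hw2). specialize (Hw2 p).
unfold vadd, vsub in *; rewrite !ev_plus, !ev_minus in *.
replace (ev M 0 v1 p + ev M 0 w1 p - ev M 0 v1 p - (ev M 0 v2 p + ev M 0 w2 p - ev M 0 v2 p))
  with (ev M 0 w1 p - ev M 0 w2 p) by ring.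
replace (ev M 0 v2 p + ev M 0 w2 p - ev M 0 v2 p) with (ev M 0 w2 p) by ring.
replace (ev M 0 v1 p + ev M 0 w1 p - (ev M 0 v2 p + ev M 0 w2 p))
  with ((ev M 0 v1 p - ev M 0 v2 p) + (ev M 0 w1 p - ev M 0 w2 p)) by ring.
assert (T := Rabs_triang (ev M 0 v1 p - ev M 0 v2 p) (ev M 0 w1 p - ev M 0 w2 p)).
set (a1 := Rabs (ev M 0 v1 p - ev M 0 v2 p)) in *. set (a2 := Rabs (ev M 0 w1 p - ev M 0 w2 p)) in *.
set (a3 := Rabs (ev M 0 w2 p)) in *. set (a4 := Rabs (_ + _)) in *.
assert (0 <= a1) by apply Rabs_pos. assert (0 <= a2) by apply Rabs_pos. assert (0 <= a3) by apply Rabs_pos.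
set (N := nv _) in *.
assert (a3 * (a4 + a1) <= a2 + 6 * N * a3).
{ apply Rle_trans with (a3 * (6 * N + a2)); [apply Rmult_le_compat_l; lra|]. nra. }
replace (A * a2 + A * a3 * (a4 + a1)) with (A * (a2 + a3 * (a4 + a1))) by ring.
replace (2 * A * a2 + 6 * A * N * a3) with (A * (2 * a2 + 6 * N * a3)) by ring.
apply Rmult_le_compat_l; lra.
Qed.

(* The off-resonant part of [phi(v)] costs no small divisor: [lam_T3] trades it for one derivative. *)
Lemma T_phi_V v1 v2 : Vball v1 -> Vball v2 ->
  nw M one (Tinv (hat M (fun p => phi (ev M 0 v1 p) - phi (ev M 0 v2 p)))) <= 416 * A * nv (vsub v1 v2).
Proof.
intros Hv1 Hv2.
assert (Hs : supp (inV M n) (vsub v1 v2)) by (apply supp_sub; [apply Hv1|apply Hv2]).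
assert (P := nv_nonneg (vsub v1 v2)).
eapply Rle_trans; [apply nw_T3|].
assert (B1 : forall p, Rabs (ev M 0 v1 p) <= 7) by (intros p; generalize (ev_V_6 v1 p Hv1); lra).
assert (B2 : forall p, Rabs (ev M 0 v2 p) <= 7) by (intros p; generalize (ev_V_6 v2 p Hv2); lra).
assert (H : nw M onek2 (hat M (fun p => phi (ev M 0 v1 p) - phi (ev M 0 v2 p))) <= 2 * (52 * A * nv (vsub v1 v2))); [|lra].
assert (AN : 0 <= A * nv (vsub v1 v2)) by (apply Rmult_le_pos; assumption).
apply nw_hat_onek2; [exact HM|apply grid_class_minus; apply grid_class_phi|lra| |].
- eapply Rle_trans; [now apply n2_phi_diff|]. generalize (nw_one_V _ Hs); intros.
  apply Rle_trans with (A * nv (vsub v1 v2)); [apply Rmult_le_compat_l; lra|lra].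
- apply Rle_trans with (A * n2 M (D1 M (ev M 0 (vsub v1 v2))) + 6 * A * nv (vsub v1 v2) * n2 M (D1 M (ev M 0 v2))).
  + apply n2_le_two; [exact HM|exact HA0|apply Rmult_le_pos; lra|].
    intros p _. unfold D1.
    set (p' := (S (fst p), snd p)).
    replace (INR M * (phi (ev M 0 v1 p') - phi (ev M 0 v2 p') - (phi (ev M 0 v1 p) - phi (ev M 0 v2 p))))
      with (INR M * ((phi (ev M 0 v1 p') - phi (ev M 0 v1 p)) - (phi (ev M 0 v2 p') - phi (ev M 0 v2 p)))) by ring.
    rewrite !Rabs_mult, (Rabs_pos_eq (INR M)) by apply pos_INR.
    assert (F := nl_four _ _ Hphi (ev M 0 v1 p') (ev M 0 v1 p) (ev M 0 v2 p') (ev M 0 v2 p) (B1 _) (B1 _) (B2 _) (B2 _)).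
    assert (C1 := ev_V_bound (vsub v1 v2) 0 p' Hs). assert (C2 := ev_V_bound (vsub v1 v2) 0 p Hs).
    unfold vsub in *; rewrite !ev_minus in *.
    replace (ev M 0 v1 p' - ev M 0 v2 p' - (ev M 0 v1 p - ev M 0 v2 p))
      with (ev M 0 v1 p' - ev M 0 v1 p - (ev M 0 v2 p' - ev M 0 v2 p)) by ring.
    set (b1 := Rabs (ev M 0 v1 p' - ev M 0 v1 p - (ev M 0 v2 p' - ev M 0 v2 p))) in *.
    set (b2 := Rabs (ev M 0 v2 p' - ev M 0 v2 p)) in *. set (N := nv _) in *.
    assert (0 <= b2) by apply Rabs_pos.
    assert (A * b2 * (Rabs (ev M 0 v1 p' - ev M 0 v2 p') + Rabs (ev M 0 v1 p - ev M 0 v2 p)) <= A * b2 * (6 * N)).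
    { apply Rmult_le_compat_l; [apply Rmult_le_pos; lra|lra]. }
    apply Rle_trans with (INR M * (A * b1 + A * b2 * (6 * N))).
    * apply Rmult_le_compat_l; [apply pos_INR|lra].
    * apply Req_le; ring.
  + destruct (D1_ev_bounds M HM (vsub v1 v2)) as [_ H1]. destruct (D1_ev_bounds M HM v2) as [_ H2].
    fold (nv (vsub v1 v2)) in H1. fold (nv v2) in H2. destruct Hv2 as [_ Hv2].
    apply Rle_trans with (A * (4 * nv (vsub v1 v2)) + 6 * A * nv (vsub v1 v2) * 8).
    * apply Rplus_le_compat; [apply Rmult_le_compat_l; lra|]. apply Rmult_le_compat_l; [|lra].
      rewrite Rmult_assoc; apply Rmult_le_pos; lra.
    * lra.
Qed.

(** Splitting [phi(v + w)] into [phi(v)] and [gap]: the first part goes through [T_phi_V] without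
    [1/ga]; the second pays [6/ga], but [gap] already carries the factor [A] times a norm of [w],
    and [A/ga] is tiny. *)
Lemma Sol_refined_step v1 w1 v2 w2 : Vball v1 -> Vball v2 -> Sol v1 w1 -> Sol v2 w2 ->
  nw M one (vsub w1 w2) <= 416 * A * nv (vsub v1 v2)
     + / 400 * nw M one (vsub w1 w2) + / 100 * nv (vsub v1 v2) * nw M one w2.
Proof.
intros Hv1 Hv2 [Hw1 E1] [Hw2 E2].
set (g1 := fun p => phi (ev M 0 v1 p) - phi (ev M 0 v2 p)).
set (g2 := fun p => gap v1 w1 p - gap v2 w2 p).
assert (P := nv_nonneg (vsub v1 v2)). assert (P1 := nw_nonneg M one (vsub w1 w2)). assert (P2 := nw_nonneg M one w2).
assert (Hg2 : grid_class M g2) by (apply grid_class_minus; apply grid_class_minus; apply grid_class_phi).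
rewrite (nw_ext M _ (vsub w1 w2) (fun a => Tinv (hat M g1) a + Tinv (hat M g2) a)) at 1.
- eapply Rle_trans; [apply nw_triang, one_nonneg|].
  rewrite Rplus_assoc. apply Rplus_le_compat; [now apply T_phi_V|].
  eapply Rle_trans; [now apply T_hat_one|].
  assert (H := gap_diff_bound v1 w1 v2 w2 Hv1 Hv2 Hw1 Hw2). fold g2 in H.
  assert (AG : A / ga <= / 5000).
  { apply Rmult_le_reg_r with ga; [lra|]. field_simplify; lra. }
  assert (AG0 : 0 <= A / ga) by (apply Rdiv_le_0_compat; lra).
  eapply Rle_trans; [apply Rmult_le_compat_l; [apply Rdiv_le_0_compat; lra|exact H]|].
  set (X := nw M one (vsub w1 w2)) in *. set (Y := nv (vsub v1 v2)) in *. set (Z := nw M one w2) in *.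
  replace (6 / ga * (2 * A * X + 6 * A * Y * Z)) with (12 * (A / ga) * X + 36 * (A / ga) * (Y * Z)) by (field; lra).
  assert (0 <= Y * Z) by (apply Rmult_le_pos; assumption). nra.
- intros a _. unfold vsub. rewrite E1, E2. unfold Tinv. destruct (inW M n a); [|ring].
  unfold fhat, g1, g2, gap. rewrite !hat_minus. unfold Rdiv; ring.
Qed.

Lemma vsub_0 wt v : nw M wt (vsub v (fun _ => 0)) = nw M wt v.
Proof. apply nw_ext; intros; unfold vsub; ring. Qed.

Lemma Vball_0 : Vball (fun _ => 0).
Proof.
split; [intros a _; reflexivity|]. unfold nv, nw; rewrite nrm_zero; [lra|reflexivity].
Qed.

(** Comparison with the zero solution: [w] has size [A] instead of [A/ga]. *)
Lemma Sol_small v w : Vball v -> Sol v w -> nw M one w <= 840 * A.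
Proof.
intros Hv Hs.
assert (H := Sol_refined_step v w _ _ Hv Vball_0 Hs Sol_zero).
unfold nv in H; rewrite !vsub_0 in H. fold (nv v) in H.
assert (Z : nw M one (fun _ => 0) = 0) by (unfold nw; rewrite nrm_zero; reflexivity).
rewrite Z in H. destruct Hv as [_ Hv]. assert (P := nv_nonneg v).
assert (A * nv v <= A * 2) by (apply Rmult_le_compat_l; lra). lra.
Qed.

(** The feedback of W on the V-equation is of order [A^2], free of [ga]: one factor [A] comes from
    [phi], the other from [Sol_small] and its Lipschitz analogue. *)
Lemma gap_lipschitz v1 w1 v2 w2 : Vball v1 -> Vball v2 -> Sol v1 w1 -> Sol v2 w2 ->
  n2 M (fun p => gap v1 w1 p - gap v2 w2 p) <= 6000 * A ^ 2 * nv (vsub v1 v2).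
Proof.
intros Hv1 Hv2 Hs1 Hs2.
assert (H1 := Sol_refined_step v1 w1 v2 w2 Hv1 Hv2 Hs1 Hs2).
assert (H2 := Sol_small v2 w2 Hv2 Hs2).
assert (H3 := gap_diff_bound v1 w1 v2 w2 Hv1 Hv2 (proj1 Hs1) (proj1 Hs2)).
assert (P := nv_nonneg (vsub v1 v2)). assert (P1 := nw_nonneg M one (vsub w1 w2)).
set (X := nw M one (vsub w1 w2)) in *. set (Y := nv (vsub v1 v2)) in *. set (Z := nw M one w2) in *.
assert (YZ : Y * Z <= 840 * (A * Y)) by nra.
assert (X <= 450 * (A * Y)) by lra.
assert (A * X <= 450 * (A ^ 2 * Y)) by nra.
assert (A * (Y * Z) <= 840 * (A ^ 2 * Y)) by nra.
assert (0 <= A ^ 2 * Y) by (apply Rmult_le_pos; [apply pow2_ge_0|lra]). lra.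
Qed.

End Reduction.

(** * Symmetry of the resonant modes *)

(** The reflection exchanges the abscissas 0 and [M], of which the average contains only the first;
    the zeros at both ends make this harmless. *)
Lemma avg_reflect M g : (2 <= M)%nat -> (forall m, g (m, 0%nat) = 0) -> (forall m, g (m, M) = 0) ->
  avg M (fun p => g (fst p, (M - snd p)%nat)) = avg M g.
Proof.
intros HM H0 H1. unfold avg, Pt. rewrite !lsum_list_prod. apply lsum_ext; intros m _.
cbn [fst snd].
set (w := wpt M (m, 0%nat)).
change (lsum (seq 0 M) (fun i => w * g (m, (M - i)%nat)) = lsum (seq 0 M) (fun i => w * g (m, i))).
rewrite !lsum_scal; f_equal.
rewrite <- (lsum_seq_rev M (fun i => g (m, i))).
assert (E := lsum_seq_shift M (fun i => g (m, (M - i)%nat))). cbn beta in E.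
rewrite E, Nat.sub_0_r, Nat.sub_diag, H0, H1. ring.
Qed.

(** For [j = n k] the time shift by [n PI] gives the sign [(-1)^(nk)] and the reflection gives
    [-(-1)^(nk)]; the product is always [-1]. *)
Lemma ev_V_antisym M n v m i : (2 <= M)%nat -> supp (inV M n) v -> (i <= M)%nat ->
  ev M 0 v ((m + n * M)%nat, (M - i)%nat) = - ev M 0 v (m, i).
Proof.
intros HM Hv Hi. assert (Mpos : 0 < INR M) by (apply lt_0_INR; lia).
unfold ev; rewrite <- lsum_opp; apply lsum_ext; intros a Ha.
destruct (inV M n a) eqn:E; [|rewrite (Hv a E); ring].
apply inV_true in E; destruct E as [_ E]; unfold isV in E; apply Nat.eqb_eq in E.
rewrite !bas0; unfold tc, ts; cbn [fst snd]. rewrite E. set (k := fst a).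
set (x := PI * INR k * INR m / INR M). set (y := PI * INR (n * k) * INR i / INR M).
set (z := IZR (Z.of_nat (n * k)) * PI).
replace (PI * INR k * INR (m + n * M) / INR M) with (x + z)
  by (unfold x, z; rewrite <- INR_IZR_INZ, plus_INR, !mult_INR; field; lra).
replace (PI * INR (n * k) * INR (M - i) / INR M) with (z - y)
  by (unfold y, z; rewrite <- INR_IZR_INZ, minus_INR by exact Hi; field; lra).
assert (Sz : sin z = 0) by (apply sin_eq_0_1; eexists; reflexivity).
assert (Cz : cos z ^ 2 = 1) by (generalize (sin2_cos2 z); unfold Rsqr; rewrite Sz; intros; lra).
rewrite cos_plus, sin_minus, Sz.
replace (v a * ((cos x * cos z - sin x * 0) * (0 * cos y - cos z * sin y)))
  with (- (v a * (cos x * sin y)) * cos z ^ 2) by ring.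
rewrite Cz; ring.
Qed.

(* The substitution [(m,i) -> (m + nM, M - i)] maps every resonant [v] to [-v]. *)
Lemma avg_even_V M n (E : R -> R) v h : (2 <= M)%nat -> supp (inV M n) v -> supp (inV M n) h ->
  (forall y, E (- y) = E y) -> avg M (fun p => E (ev M 0 v p) * ev M 0 h p) = 0.
Proof.
intros HM Hv Hh HE.
set (g := fun p => E (ev M 0 v p) * ev M 0 h p).
assert (Z1 : forall m, g (m, 0%nat) = 0) by (intros; unfold g; rewrite (gc_zero _ _ (ev_grid_class M HM h)); ring).
assert (Z2 : forall m, g (m, M) = 0) by (intros; unfold g; rewrite (gc_end _ _ (ev_grid_class M HM h)); ring).
assert (P : forall m i, g ((m + 2 * M)%nat, i) = g (m, i)).
{ intros; unfold g. now rewrite (gc_period _ _ (ev_grid_class M HM h)), (gc_period _ _ (ev_grid_class M HM v)). }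
assert (H1 := avg_reflect M g HM Z1 Z2).
rewrite <- (avg_shift M (n * M) (fun p => g (fst p, (M - snd p)%nat))) in H1 by (intros; cbn [fst snd]; apply P).
cbn [fst snd] in H1.
assert (H2 : avg M (fun p => g ((fst p + n * M)%nat, (M - snd p)%nat)) = - avg M g); [|lra].
replace (- avg M g) with ((-1) * avg M g) by ring. rewrite <- avg_scal. apply avg_ext; intros [m i] Hp.
apply in_Pt in Hp; cbn [fst snd] in *. unfold g. rewrite !(ev_V_antisym M n) by (assumption || lia).
rewrite HE; ring.
Qed.

(** * The reduced functional and its derivative *)

Section Energy.
Variables (M n : nat) (om ga : R) (J : nat -> nat) (phi : R -> R) (A : R).
Hypothesis HM : (2 <= M)%nat.
Hypothesis Hn : (1 <= n)%nat.
Hypothesis Hom : / 2 <= om <= 3 / 2.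
Hypothesis Hga : 0 < ga <= 3 / 2.
Hypothesis HW : in_W ga om.
Hypothesis HJ : forall k, Rabs (INR (J k) - om * INR n * INR k) <= / 2.
Hypothesis Homn : Rabs (om - 1) * INR n <= ga.
Hypothesis HA0 : 0 <= A.
Hypothesis HA : 5000 * A <= ga.
Hypothesis Hphi : nonlin phi A.
Variables (Hp E psi : R -> R) (A' eps : R) (d : nat).
Hypothesis Hprim : forall x h, Rabs x <= 7 -> Rabs (x + h) <= 7 -> Rabs (Hp (x + h) - Hp x - phi x * h) <= A * h ^ 2.
Hypothesis Heps : eps = (om ^ 2 - 1) * INR n ^ 2.
Hypothesis Heps0 : eps <> 0.
Hypothesis Hdec : forall y, phi y = E y + eps * y ^ d + psi y.
Hypothesis HE : forall y, E (- y) = E y.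
Hypothesis HA'0 : 0 <= A'.
Hypothesis Hpsi : forall x y, Rabs x <= 7 -> Rabs y <= 7 -> Rabs (psi x - psi y) <= A' * Rabs (x - y).
Hypothesis Hpsi0 : psi 0 = 0.
Variable wf : (nat * nat -> R) -> nat * nat -> R.
Hypothesis Hwf : forall v, Vball M n v -> Sol M n om phi v (wf v).

Definition En (c : nat * nat -> R) : R :=
  / 2 * lsum (Md M) (fun a => mu M a * lam n om a * c a ^ 2) + avg M (fun p => Hp (ev M 0 c p)).
Definition dEn (c h : nat * nat -> R) : R :=
  lsum (Md M) (fun a => mu M a * lam n om a * (c a * h a)) + avg M (fun p => phi (ev M 0 c p) * ev M 0 h p).
Definition ip (v h : nat * nat -> R) : R := lsum (Md M) (fun a => mu M a * k2 a * (v a * h a)).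
Definition rr (v h : nat * nat -> R) : R :=
  / eps * avg M (fun p => (gap M phi v (wf v) p + psi (ev M 0 v p)) * ev M 0 h p).
(** On V the symbol is [lam = - eps k^2], so the factor [- / eps] normalises the quadratic part to
    [nv^2 / 2], whatever the sign of [eps]. *)
Definition Psi (v : nat * nat -> R) : R := - / eps * En (vadd v (wf v)).
Definition dPsi (v h : nat * nat -> R) : R :=
  ip v h - avg M (fun p => ev M 0 v p ^ d * ev M 0 h p) - rr v h.

(** The constant contains the sum of all [|lam|] and depends on [M]. It serves only
    differentiability on a fixed grid and enters none of the uniform bounds. *)
Lemma En_taylor c h : (forall p, Rabs (ev M 0 c p) <= 7) -> (forall p, Rabs (ev M 0 (vadd c h) p) <= 7) ->
  Rabs (En (vadd c h) - En c - dEn c h) <= (lsum (Md M) (fun a => Rabs (lam n om a)) + A) * nw M one h ^ 2.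
Proof.
intros Hc Hch.
set (L := lsum (Md M) (fun a => Rabs (lam n om a))).
replace (En (vadd c h) - En c - dEn c h) with
  (/ 2 * lsum (Md M) (fun a => mu M a * lam n om a * h a ^ 2)
   + avg M (fun p => Hp (ev M 0 c p + ev M 0 h p) - Hp (ev M 0 c p) - phi (ev M 0 c p) * ev M 0 h p)).
2:{ unfold En, dEn. rewrite !avg_minus by exact HM.
    rewrite (avg_ext M (fun p => Hp (ev M 0 (vadd c h) p)) (fun p => Hp (ev M 0 c p + ev M 0 h p)))
      by (intros; unfold vadd; now rewrite ev_plus).
    replace (lsum (Md M) (fun a => mu M a * lam n om a * vadd c h a ^ 2)) with
     (lsum (Md M) (fun a => mu M a * lam n om a * c a ^ 2) + 2 * lsum (Md M) (fun a => mu M a * lam n om a * (c a * h a))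
      + lsum (Md M) (fun a => mu M a * lam n om a * h a ^ 2)).
    - field.
    - rewrite <- lsum_scal, <- !lsum_plus. apply lsum_ext; intros; unfold vadd; ring. }
eapply Rle_trans; [apply Rabs_triang|].
rewrite Rmult_plus_distr_r. apply Rplus_le_compat.
- rewrite Rabs_mult, (Rabs_pos_eq (/ 2)) by lra.
  assert (HL : Rabs (lsum (Md M) (fun a => mu M a * lam n om a * h a ^ 2)) <= L * nw M one h ^ 2).
  { rewrite nw_sq by apply one_nonneg. eapply Rle_trans; [apply lsum_abs|]. rewrite <- lsum_scal.
    apply lsum_le; intros a Ha. generalize (mu_bounds M a); intros Hmu.
    rewrite !Rabs_mult, (Rabs_pos_eq (mu M a)) by lra. rewrite (Rabs_pos_eq (h a ^ 2)) by apply pow2_ge_0.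
    replace (L * (mu M a * one a * h a ^ 2)) with (mu M a * L * h a ^ 2) by (unfold one; ring).
    apply Rmult_le_compat_r; [apply pow2_ge_0|]. apply Rmult_le_compat_l; [lra|].
    apply (lsum_term_le (Md M) (fun a => Rabs (lam n om a))); [intros; apply Rabs_pos|exact Ha]. }
  generalize (Rabs_pos (lsum (Md M) (fun a => mu M a * lam n om a * h a ^ 2))); lra.
- eapply Rle_trans; [apply avg_abs, HM|]. rewrite <- n2_ev, n2_sq, <- avg_scal by exact HM.
  apply avg_le; [exact HM|]. intros p _. apply Hprim; [apply Hc|]. rewrite <- ev_plus. apply Hch.
Qed.

Lemma dEn_add c h1 h2 : dEn c (vadd h1 h2) = dEn c h1 + dEn c h2.
Proof.
unfold dEn.
rewrite (lsum_ext (Md M) (fun a => mu M a * lam n om a * (c a * vadd h1 h2 a))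
  (fun a => mu M a * lam n om a * (c a * h1 a) + mu M a * lam n om a * (c a * h2 a))) by (intros; unfold vadd; ring).
rewrite (avg_ext M (fun p => phi (ev M 0 c p) * ev M 0 (vadd h1 h2) p)
  (fun p => phi (ev M 0 c p) * ev M 0 h1 p + phi (ev M 0 c p) * ev M 0 h2 p))
  by (intros; unfold vadd; rewrite ev_plus; ring).
rewrite lsum_plus, avg_plus. ring.
Qed.

Lemma dEn_coef c h : dEn c h = lsum (Md M) (fun a => mu M a * ((lam n om a * c a + fhat M phi c a) * h a)).
Proof.
unfold dEn, fhat. rewrite avg_hat, <- lsum_plus. apply lsum_ext; intros; ring.
Qed.

(** The W-equation is the vanishing of the energy derivative in the directions of W. *)
Lemma dEn_W v w h : Vball M n v -> Sol M n om phi v w -> supp (inW M n) h -> dEn (vadd v w) h = 0.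
Proof.
intros [Hv _] [_ Hw] Hh. rewrite dEn_coef. apply lsum_zero; intros a Ha.
destruct (inW M n a) eqn:EW; [|rewrite (Hh a EW); ring].
unfold vadd at 1. rewrite (Hw a). unfold Tinv; rewrite EW.
assert (E0 : inV M n a = false) by (rewrite (inV_inW M n a Ha) in EW; now destruct (inV M n a)).
rewrite (Hv a E0). field.
exact (lam_W_neq0 M n om ga J Hn Hom Hga HW HJ a EW).
Qed.

Lemma dEn_V v w h : Wball M n w -> supp (inV M n) h ->
  dEn (vadd v w) h = - eps * ip v h + avg M (fun p => phi (ev M 0 (vadd v w) p) * ev M 0 h p).
Proof.
intros [Hw _] Hh. unfold dEn, ip. f_equal. rewrite <- lsum_scal. apply lsum_ext; intros a Ha.
destruct (inV M n a) eqn:EV; [|rewrite (Hh a EV); ring].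
assert (EW : inW M n a = false) by (rewrite (inV_inW M n a Ha), EV; reflexivity).
unfold vadd. rewrite (Hw a EW). apply inV_true in EV; destruct EV as [_ EV]; unfold isV in EV; apply Nat.eqb_eq in EV.
unfold lam, k2; rewrite EV, mult_INR, Heps. ring.
Qed.

(** Splitting [phi(v + w)] into [gap], the even part [E], the power [eps y^d] and [psi]: the even
    part averages to zero by [avg_even_V], and division by [eps] gives the power coefficient 1. *)
Lemma dPsi_dEn v h : Vball M n v -> supp (inV M n) h -> dPsi v h = - / eps * dEn (vadd v (wf v)) h.
Proof.
intros Hv Hh. assert (Hs := Hwf v Hv). rewrite dEn_V by (assumption || apply Hs).
assert (HZ := avg_even_V M n E v h HM (proj1 Hv) Hh HE).
assert (D : avg M (fun p => phi (ev M 0 (vadd v (wf v)) p) * ev M 0 h p)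
   = avg M (fun p => (gap M phi v (wf v) p + psi (ev M 0 v p)) * ev M 0 h p)
     + eps * avg M (fun p => ev M 0 v p ^ d * ev M 0 h p) + avg M (fun p => E (ev M 0 v p) * ev M 0 h p)).
{ rewrite <- avg_scal, <- !avg_plus. apply avg_ext; intros p _. unfold gap.
  rewrite (Hdec (ev M 0 v p)). ring. }
rewrite D, HZ. unfold dPsi, rr. field. exact Heps0.
Qed.

(** [Psi] is differentiable although [wf] is only known to be Lipschitz: the increment of [wf] lies
    in W, where [dEn] vanishes, so it contributes only to the quadratic error. *)
Lemma Psi_taylor : exists C, 0 <= C /\ forall v h, Vball M n v -> supp (inV M n) h -> Vball M n (vadd v h) ->
  Rabs (Psi (vadd v h) - Psi v - dPsi v h) <= C * nv M h ^ 2.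
Proof.
set (L := lsum (Md M) (fun a => Rabs (lam n om a))).
assert (HL : 0 <= L) by (apply lsum_nonneg; intros; apply Rabs_pos).
exists (/ Rabs eps * (4 * (L + A))). split.
{ apply Rmult_le_pos; [apply Rlt_le, Rinv_0_lt_compat, Rabs_pos_lt, Heps0|lra]. }
intros v h Hv Hh Hvh.
assert (S1 := Hwf v Hv). assert (S2 := Hwf _ Hvh).
rewrite dPsi_dEn by assumption.
set (w := wf v) in *. set (w' := wf (vadd v h)) in *.
(* [eta] is the full increment from [v + w] to [(v + h) + w']. *)
set (c := vadd v w). set (eta := vadd h (vsub w' w)).
assert (Ec : vadd c eta = vadd (vadd v h) w').
{ apply functional_extensionality; intros a; unfold c, eta, vadd, vsub; ring. }
assert (T := En_taylor c eta). rewrite Ec in T. fold L in T.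
assert (T' : Rabs (En (vadd (vadd v h) w') - En c - dEn c eta) <= (L + A) * nw M one eta ^ 2).
{ apply T; intros p; [apply (ev_sum_7 M n)|apply (ev_sum_7 M n)]; try assumption; [apply S1|apply S2]. }
assert (Z : dEn c (vsub w' w) = 0) by (apply dEn_W; [exact Hv|exact S1|apply supp_sub; [apply S2|apply S1]]).
unfold eta in T' at 1. rewrite dEn_add, Z in T'.
rewrite Rplus_0_r in T'.
unfold Psi. fold w w' c.
replace (- / eps * En (vadd (vadd v h) w') - - / eps * En c - - / eps * dEn c h)
  with (- / eps * (En (vadd (vadd v h) w') - En c - dEn c h)) by ring.
rewrite Rabs_mult, Rabs_Ropp, Rabs_inv, Rmult_assoc.
apply Rmult_le_compat_l; [apply Rlt_le, Rinv_0_lt_compat, Rabs_pos_lt, Heps0|].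
eapply Rle_trans; [exact T'|].
assert (B : nw M one eta <= 2 * nv M h).
{ unfold eta, vadd. eapply Rle_trans; [apply nw_triang, one_nonneg|].
  assert (H1 := nw_one_V M n HM Hn h Hh).
  assert (H2 := Sol_lipschitz M n om ga J phi A HM Hn Hom Hga HW HJ HA0 HA Hphi _ _ _ _ Hvh Hv S2 S1).
  fold w' w in H2.
  rewrite (nw_ext M one (vsub (vadd v h) v) h) in H2 by (intros; unfold vsub, vadd; ring).
  change (nw M one (fun a => vsub w' w a)) with (nw M one (vsub w' w)). lra. }
assert (P := nw_nonneg M one eta).
assert (nw M one eta ^ 2 <= 4 * nv M h ^ 2) by nra.
replace (4 * (L + A) * nv M h ^ 2) with ((L + A) * (4 * nv M h ^ 2)) by ring.
apply Rmult_le_compat_l; lra.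
Qed.

Lemma rr_lipschitz v1 v2 h : Vball M n v1 -> Vball M n v2 -> supp (inV M n) h ->
  Rabs (rr v1 h - rr v2 h) <= (6000 * A ^ 2 + A') / Rabs eps * nv M (vsub v1 v2) * nv M h.
Proof.
intros Hv1 Hv2 Hh.
assert (Hs : supp (inV M n) (vsub v1 v2)) by (apply supp_sub; [apply Hv1|apply Hv2]).
unfold rr. rewrite <- Rmult_minus_distr_l, <- avg_minus, Rabs_mult, Rabs_inv.
set (q := fun p => (gap M phi v1 (wf v1) p - gap M phi v2 (wf v2) p) + (psi (ev M 0 v1 p) - psi (ev M 0 v2 p))).
rewrite (avg_ext M _ (fun p => q p * ev M 0 h p)) by (intros; unfold q; ring).
assert (H1 := n2_cauchy_schwarz M HM q (ev M 0 h)). rewrite n2_ev in H1 by exact HM.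
assert (H2 := nw_one_V M n HM Hn h Hh).
assert (H3 : n2 M q <= (6000 * A ^ 2 + A') * nv M (vsub v1 v2)).
{ unfold q. eapply Rle_trans; [apply n2_triang, HM|]. rewrite Rmult_plus_distr_r. apply Rplus_le_compat.
  - exact (gap_lipschitz M n om ga J phi A HM Hn Hom Hga HW HJ Homn HA0 HA Hphi _ _ _ _ Hv1 Hv2 (Hwf _ Hv1) (Hwf _ Hv2)).
  - eapply Rle_trans; [apply (n2_le_scal M HM A' _ (ev M 0 (vsub v1 v2)) HA'0)|].
    + intros p _. unfold vsub; rewrite ev_minus.
      apply Hpsi; [generalize (ev_V_6 M n HM Hn v1 p Hv1)|generalize (ev_V_6 M n HM Hn v2 p Hv2)]; lra.
    + rewrite n2_ev by exact HM. apply Rmult_le_compat_l; [exact HA'0|]. now apply (nw_one_V M n). }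
assert (P1 := nv_nonneg M h). assert (P2 := n2_nonneg M q). assert (P3 := nw_nonneg M one h).
replace ((6000 * A ^ 2 + A') / Rabs eps * nv M (vsub v1 v2) * nv M h)
  with (/ Rabs eps * ((6000 * A ^ 2 + A') * nv M (vsub v1 v2) * nv M h)) by (unfold Rdiv; ring).
apply Rmult_le_compat_l; [apply Rlt_le, Rinv_0_lt_compat, Rabs_pos_lt, Heps0|].
eapply Rle_trans; [exact H1|]. apply Rmult_le_compat; assumption.
Qed.

(** [wf] is an arbitrary choice of solutions, so its vanishing at 0 is deduced from uniqueness, and
    only on the modes of the grid. *)
Lemma rr_zero h : rr (fun _ => 0) h = 0.
Proof.
assert (B0 := Vball_0 M n).
assert (S0 := Sol_zero M n om phi A HM Hphi).
assert (L := Sol_lipschitz M n om ga J phi A HM Hn Hom Hga HW HJ HA0 HA Hphi _ _ _ _ B0 B0 (Hwf _ B0) S0).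
assert (Z : nw M one (vsub (fun _ : nat * nat => 0) (fun _ => 0)) = 0).
{ unfold nw; apply nrm_zero. intros; unfold vsub; ring. }
rewrite Z in L.
assert (W0 : forall a, In a (Md M) -> wf (fun _ => 0) a = 0).
{ intros a Ha. assert (C := coord_bound M one (vsub (wf (fun _ => 0)) (fun _ => 0)) a (fun _ _ => Rle_refl 1) one_nonneg Ha).
  unfold vsub in C at 1. rewrite Rminus_0_r in C. generalize (Rabs_pos (wf (fun _ => 0) a)); intros.
  assert (X : Rabs (wf (fun _ => 0) a) = 0) by lra. now apply Rabs_eq_0. }
unfold rr. rewrite (avg_ext M _ (fun _ => 0)); [rewrite avg_const by exact HM; ring|].
intros p _. unfold gap. rewrite (ev_ext M 0 (vadd (fun _ => 0) (wf (fun _ => 0))) (fun _ => 0)).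
- rewrite ev_0, Hpsi0. ring.
- intros a Ha; unfold vadd; rewrite W0 by exact Ha; ring.
Qed.

Lemma rr_linear v s h1 h2 : rr v (fun a => h1 a + s * h2 a) = rr v h1 + s * rr v h2.
Proof.
unfold rr. set (q := fun p => gap M phi v (wf v) p + psi (ev M 0 v p)).
rewrite (avg_ext M (fun p => _ * ev M 0 (fun a => h1 a + s * h2 a) p) (fun p => q p * ev M 0 h1 p + s * (q p * ev M 0 h2 p))).
- rewrite avg_plus, avg_scal. unfold q; ring.
- intros p _. rewrite (ev_plus M 0 h1 (fun a => s * h2 a)), ev_scal. unfold q; ring.
Qed.

(** The derivative of [En] vanishes on V by criticality and on W by the W-equation; testing with a
    single mode isolates its coefficient. *)
Lemma critical_equation v : Vball M n v -> (forall h, supp (inV M n) h -> dPsi v h = 0) ->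
  forall a, In a (Md M) -> lam n om a * vadd v (wf v) a + fhat M phi (vadd v (wf v)) a = 0.
Proof.
intros Hv Hcr a Ha. set (c := vadd v (wf v)).
assert (Hd : forall h, supp (inV M n) h \/ supp (inW M n) h -> dEn c h = 0).
{ intros h [Hh|Hh]; [|now apply dEn_W, Hh; [exact Hv|apply Hwf]].
  assert (H := Hcr h Hh). rewrite dPsi_dEn in H by assumption.
  apply Rmult_integral in H; destruct H as [H|H]; [|exact H].
  exfalso; apply (Rinv_neq_0_compat _ Heps0); lra. }
assert (H := Hd (fun b => if inMd M b && (Nat.eqb (fst b) (fst a) && Nat.eqb (snd b) (snd a)) then 1 else 0)).
rewrite dEn_coef, (lsum_single _ _ a) in H.
- assert (Ea : inMd M a = true) by now apply inMd_spec. rewrite Ea, !Nat.eqb_refl in H; cbn [andb] in H.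
  generalize (mu_bounds M a); intros.
  assert (X : mu M a * ((lam n om a * c a + fhat M phi c a) * 1) = 0).
  { apply H. destruct (inV M n a) eqn:EV; [left|right]; intros b Hb;
    destruct (Nat.eqb_spec (fst b) (fst a)) as [E1|]; destruct (Nat.eqb_spec (snd b) (snd a)) as [E2|];
    rewrite ?andb_false_r; try reflexivity;
    (assert (b = a) by (destruct a, b; cbn in *; congruence)); subst b; [congruence|].
    assert (X := inV_inW M n a Ha). rewrite EV in X. cbn in X. congruence. }
  apply Rmult_integral in X; destruct X; lra.
- apply NoDup_Md.
- exact Ha.
- intros b _ Hb. destruct (Nat.eqb_spec (fst b) (fst a)) as [E1|]; destruct (Nat.eqb_spec (snd b) (snd a)) as [E2|];
  rewrite ?andb_false_r; try ring.
  elim Hb; destruct a, b; cbn in *; congruence.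
Qed.

End Energy.

Definition vscal (s : R) (v : nat * nat -> R) (a : nat * nat) : R := s * v a.

Lemma is_derive_quadratic (f : R -> R) (s l C dl : R) : 0 < dl -> 0 <= C ->
  (forall t, Rabs t < dl -> Rabs (f (s + t) - f s - t * l) <= C * t ^ 2) -> is_derive f s l.
Proof.
intros Hdl HC H. apply is_derive_Reals. intros e He.
assert (Hd : 0 < Rmin dl (e / (C + 1))) by (apply Rmin_pos; [exact Hdl|apply Rdiv_lt_0_compat; lra]).
exists (mkposreal _ Hd). intros t Ht0 Ht. cbn [pos] in Ht.
assert (Ht1 : Rabs t < dl) by (eapply Rlt_le_trans; [exact Ht|apply Rmin_l]).
assert (Ht2 : Rabs t < e / (C + 1)) by (eapply Rlt_le_trans; [exact Ht|apply Rmin_r]).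
specialize (H t Ht1).
replace ((f (s + t) - f s) / t - l) with ((f (s + t) - f s - t * l) / t) by (field; exact Ht0).
assert (Pt : 0 < Rabs t) by now apply Rabs_pos_lt.
unfold Rdiv. rewrite Rabs_mult, Rabs_inv.
apply Rle_lt_trans with (C * Rabs t).
- apply Rmult_le_reg_r with (Rabs t); [exact Pt|]. rewrite Rmult_assoc, Rinv_l by lra.
  rewrite <- (pow2_abs t) in H. lra.
- apply Rmult_lt_compat_r with (r := C + 1) in Ht2; [|lra].
  replace (e / (C + 1) * (C + 1)) with e in Ht2 by (field; lra). nra.
Qed.

(** Convexity: [z^k] lies above its tangent at [r]. The truncated exponent at [k = 0] is multiplied
    by [INR 0]. *)
Lemma pow_tangent (z r : R) (k : nat) : 0 <= z -> 0 < r -> r ^ k + INR k * r ^ (k - 1) * (z - r) <= z ^ k.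
Proof.
intros Hz Hr. induction k as [|k IH]; [cbn; lra|].
replace (S k - 1)%nat with k by lia. rewrite S_INR.
assert (P := pow_lt r k Hr).
destruct k as [|k'].
{ cbn [INR pow]. lra. }
replace (S k' - 1)%nat with k' in IH by lia.
assert (P' := pow_lt r k' Hr). assert (IK := pos_INR (S k')).
set (K := INR (S k')) in *.
apply Rmult_le_compat_l with (r := z) in IH; [|exact Hz].
change (z ^ S (S k')) with (z * z ^ S k').
change (r ^ S (S k')) with (r * (r * r ^ k')). change (r ^ S k') with (r * r ^ k') in *.
set (q := r ^ k') in *.
assert (0 <= K * q * (z - r) ^ 2) by (apply Rmult_le_pos; [apply Rmult_le_pos; lra|apply pow2_ge_0]).
nra.
Qed.

Lemma cos_3a y : cos (3 * y) = 4 * cos y ^ 3 - 3 * cos y.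
Proof.
replace (3 * y) with (2 * y + y) by ring. rewrite cos_plus, cos_2a_cos, sin_2a.
assert (H := sin2_cos2 y). unfold Rsqr in H.
replace (2 * sin y * cos y * sin y) with (2 * cos y * (sin y * sin y)) by ring.
replace (sin y * sin y) with (1 - cos y * cos y) by lra. ring.
Qed.

(** * The competitor [cos t sin(n x)] and the weight of the first mode *)

Section Moments.
Variables M n : nat.
Hypothesis Hn : (1 <= n)%nat.
Hypothesis HM4 : (4 * n <= M)%nat.

Let HM : (2 <= M)%nat.
Proof. lia. Qed.
Let Mpos : 0 < INR M.
Proof. apply lt_0_INR; lia. Qed.

Lemma tau_cos_zero (z : nat) : (0 < z < 2 * M)%nat ->
  lsum (seq 0 (2 * M)) (fun m => cos (PI * INR z * INR m / INR M)) = 0.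
Proof.
intros Hz. rewrite (lsum_ext _ _ (fun m => cos (2 * PI * IZR (Z.of_nat z) * INR m / INR (2 * M) + 0))).
- apply cos_sum_zero; [lia|]. intros D; apply Z.divide_pos_le in D; lia.
- intros m _. rewrite INR_2M, <- INR_IZR_INZ. f_equal. field; lra.
Qed.

Lemma x_cos_zero (z : nat) : (0 < z < M)%nat ->
  lsum (seq 0 M) (fun m => cos (2 * (PI * INR z * INR m / INR M))) = 0.
Proof.
intros Hz. rewrite (lsum_ext _ _ (fun m => cos (2 * PI * IZR (Z.of_nat z) * INR m / INR M + 0))).
- apply cos_sum_zero; [lia|]. intros D; apply Z.divide_pos_le in D; lia.
- intros m _. rewrite <- INR_IZR_INZ. f_equal. field; lra.
Qed.

Lemma cos4_expand x : cos x ^ 4 = 3 / 8 + / 2 * cos (2 * x) + / 8 * cos (2 * (2 * x)).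
Proof. rewrite !cos_2a_cos. field. Qed.

Lemma cos6_expand x :
  cos x ^ 6 = 5 / 16 + 15 / 32 * cos (2 * x) + 3 / 16 * cos (2 * (2 * x)) + / 32 * cos (3 * (2 * x)).
Proof. rewrite cos_3a, !cos_2a_cos. field. Qed.

Lemma sin4_expand x : sin x ^ 4 = 3 / 8 - / 2 * cos (2 * x) + / 8 * cos (2 * (2 * x)).
Proof. rewrite (cos_2a_cos (2 * x)), !cos_2a_sin. field. Qed.

Lemma sin6_expand x :
  sin x ^ 6 = 5 / 16 - 15 / 32 * cos (2 * x) + 3 / 16 * cos (2 * (2 * x)) - / 32 * cos (3 * (2 * x)).
Proof. rewrite cos_3a, (cos_2a_cos (2 * x)), !cos_2a_sin. field. Qed.

Lemma sum_cos4 : lsum (seq 0 (2 * M)) (fun m => tc M 1 m ^ 4) = 2 * INR M * (3 / 8).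
Proof.
rewrite (lsum_ext _ _ (fun m => 3 / 8 + / 2 * cos (PI * INR 2 * INR m / INR M) + / 8 * cos (PI * INR 4 * INR m / INR M))).
- rewrite !lsum_plus, !lsum_scal, !tau_cos_zero, lsum_const, length_seq, INR_2M by lia. ring.
- intros m _. unfold tc. rewrite cos4_expand.
  replace (2 * (2 * (PI * INR 1 * INR m / INR M))) with (PI * INR 4 * INR m / INR M) by (cbn [INR]; field; lra).
  replace (2 * (PI * INR 1 * INR m / INR M)) with (PI * INR 2 * INR m / INR M) by (cbn [INR]; field; lra).
  reflexivity.
Qed.

Lemma sum_cos6 : lsum (seq 0 (2 * M)) (fun m => tc M 1 m ^ 6) = 2 * INR M * (5 / 16).
Proof.
rewrite (lsum_ext _ _ (fun m => 5 / 16 + 15 / 32 * cos (PI * INR 2 * INR m / INR M) + 3 / 16 * cos (PI * INR 4 * INR m / INR M)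
   + / 32 * cos (PI * INR 6 * INR m / INR M))).
- rewrite !lsum_plus, !lsum_scal, !tau_cos_zero, lsum_const, length_seq, INR_2M by lia. ring.
- intros m _. unfold tc. rewrite cos6_expand.
  replace (3 * (2 * (PI * INR 1 * INR m / INR M))) with (PI * INR 6 * INR m / INR M) by (cbn [INR]; field; lra).
  replace (2 * (2 * (PI * INR 1 * INR m / INR M))) with (PI * INR 4 * INR m / INR M) by (cbn [INR]; field; lra).
  replace (2 * (PI * INR 1 * INR m / INR M)) with (PI * INR 2 * INR m / INR M) by (cbn [INR]; field; lra).
  reflexivity.
Qed.

Lemma sum_sin4 : lsum (seq 0 M) (fun i => ts M n i ^ 4) = INR M * (3 / 8).
Proof.
rewrite (lsum_ext _ _ (fun m => 3 / 8 - / 2 * cos (2 * (PI * INR n * INR m / INR M)) + / 8 * cos (2 * (PI * INR (2 * n) * INR m / INR M)))).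
- rewrite lsum_plus, lsum_minus, !lsum_scal, !x_cos_zero, lsum_const, length_seq by lia. ring.
- intros m _. unfold ts. rewrite sin4_expand.
  replace (2 * (2 * (PI * INR n * INR m / INR M))) with (2 * (PI * INR (2 * n) * INR m / INR M)) by (rewrite mult_INR; cbn [INR]; field; lra).
  reflexivity.
Qed.

(** The frequencies [n, 2n, 3n] are below [M], so nothing is aliased and the grid sum gives the
    exact integral mean; this is where [4n <= M] enters. *)
Lemma sum_sin6 : lsum (seq 0 M) (fun i => ts M n i ^ 6) = INR M * (5 / 16).
Proof.
rewrite (lsum_ext _ _ (fun m => 5 / 16 - 15 / 32 * cos (2 * (PI * INR n * INR m / INR M))
   + 3 / 16 * cos (2 * (PI * INR (2 * n) * INR m / INR M)) - / 32 * cos (2 * (PI * INR (3 * n) * INR m / INR M)))).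
- rewrite lsum_minus, lsum_plus, lsum_minus, !lsum_scal, !x_cos_zero, lsum_const, length_seq by lia. ring.
- intros m _. unfold ts. rewrite sin6_expand.
  replace (3 * (2 * (PI * INR n * INR m / INR M))) with (2 * (PI * INR (3 * n) * INR m / INR M)) by (rewrite mult_INR; cbn [INR]; field; lra).
  replace (2 * (2 * (PI * INR n * INR m / INR M))) with (2 * (PI * INR (2 * n) * INR m / INR M)) by (rewrite mult_INR; cbn [INR]; field; lra).
  reflexivity.
Qed.

Definition mode1 (a : nat * nat) : R := if Nat.eqb (fst a) 1 && Nat.eqb (snd a) n then 1 else 0.

Lemma in_Md_mode1 : In (1%nat, n) (Md M).
Proof. apply in_Md; cbn [fst snd]; lia. Qed.

Lemma inV_mode1 : inV M n (1%nat, n) = true.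
Proof.
unfold inV. assert (H := in_Md_mode1). apply inMd_spec in H. rewrite H. unfold isV; cbn [fst snd andb].
apply Nat.eqb_eq; lia.
Qed.

Lemma mode1_neq a : a <> (1%nat, n) -> mode1 a = 0.
Proof.
intros H. unfold mode1. destruct (Nat.eqb_spec (fst a) 1); destruct (Nat.eqb_spec (snd a) n); try reflexivity.
elim H; destruct a; cbn in *; congruence.
Qed.

Lemma mode1_eq : mode1 (1%nat, n) = 1.
Proof. unfold mode1; cbn [fst snd]; rewrite !Nat.eqb_refl; reflexivity. Qed.

Lemma ev_mode1 p : ev M 0 mode1 p = tc M 1 (fst p) * ts M n (snd p).
Proof.
unfold ev. rewrite (lsum_single _ _ (1%nat, n)).
- rewrite mode1_eq, bas0; cbn [fst snd]; ring.
- apply NoDup_Md.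
- apply in_Md_mode1.
- intros b _ Hb. rewrite mode1_neq by exact Hb. ring.
Qed.

Lemma supp_mode1 : supp (inV M n) mode1.
Proof. intros a Ha. apply mode1_neq. intros ->. rewrite inV_mode1 in Ha; discriminate. Qed.

Lemma nv_mode1 : nv M mode1 ^ 2 = / 4.
Proof.
unfold nv. rewrite nw_sq by apply k2_nonneg. rewrite (lsum_single _ _ (1%nat, n)).
- rewrite mode1_eq, mu_mid by lia. unfold k2; cbn [fst INR]. field.
- apply NoDup_Md.
- apply in_Md_mode1.
- intros b _ Hb. rewrite mode1_neq by exact Hb. ring.
Qed.

Lemma avg_mode1 r : avg M (fun p => ev M 0 mode1 p ^ r)
  = / (2 * INR M * INR M) * (lsum (seq 0 (2 * M)) (fun m => tc M 1 m ^ r) * lsum (seq 0 M) (fun i => ts M n i ^ r)).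
Proof.
unfold avg, Pt. rewrite <- lsum_prod_mult, <- lsum_scal. apply lsum_ext; intros p _.
rewrite ev_mode1, Rpow_mult_distr. reflexivity.
Qed.

(* The moments of order 4 and 6 and convexity bound all higher even moments from below. *)
Lemma moment_mode1 (k : nat) : 9 / 64 * (25 / 36) ^ k <= avg M (fun p => ev M 0 mode1 p ^ (2 * k + 4)).
Proof.
assert (A4 : avg M (fun p => ev M 0 mode1 p ^ 4) = 9 / 64)
  by (rewrite avg_mode1, sum_cos4, sum_sin4; field; lra).
assert (A6 : avg M (fun p => ev M 0 mode1 p ^ 6) = 25 / 256)
  by (rewrite avg_mode1, sum_cos6, sum_sin6; field; lra).
(* The ratio of the sixth to the fourth moment, that is the mean of [x^2] under the weight [x^4].
   With the tangent at this point the linear term drops out and Jensen's inequality results. *)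
set (r := 25 / 36).
apply Rle_trans with (avg M (fun p => (r ^ k - INR k * r ^ (k - 1) * r) * ev M 0 mode1 p ^ 4 + INR k * r ^ (k - 1) * ev M 0 mode1 p ^ 6)).
- rewrite avg_plus, !avg_scal, A4, A6. unfold r; lra.
- apply avg_le; [exact HM|]. intros p _. set (x := ev M 0 mode1 p).
  assert (T := pow_tangent (x ^ 2) r k (pow2_ge_0 x) ltac:(unfold r; lra)).
  replace (x ^ (2 * k + 4)) with (x ^ 4 * (x ^ 2) ^ k) by (rewrite <- pow_mult, <- pow_add; f_equal; lia).
  replace ((r ^ k - INR k * r ^ (k - 1) * r) * x ^ 4 + INR k * r ^ (k - 1) * x ^ 6)
    with (x ^ 4 * (r ^ k + INR k * r ^ (k - 1) * (x ^ 2 - r))) by ring.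
  apply Rmult_le_compat_l; [|exact T]. replace (x ^ 4) with ((x ^ 2) ^ 2) by ring. apply pow2_ge_0.
Qed.

(** Telescoping with half-integer endpoints; the sharp value 2/3 is needed for the constant 5/3 in
    the final comparison. *)
Lemma sum_inv_k2_tail K : lsum (seq 2 K) (fun k => / INR k ^ 2) <= 2 / 3.
Proof.
assert (H : forall s, (2 <= s)%nat -> lsum (seq s K) (fun k => / INR k ^ 2) <= / (INR s - / 2) - / (INR (s + K) - / 2)).
{ clear. induction K as [|K IH]; intros s Hs.
  - cbn [seq]. rewrite Nat.add_0_r. cbn. lra.
  - cbn [seq]. rewrite lsum_cons. specialize (IH (S s) ltac:(lia)).
    replace (S s + K)%nat with (s + S K)%nat in IH by lia. rewrite S_INR in IH.
    assert (2 <= INR s) by (apply (le_INR 2) in Hs; cbn [INR] in Hs; lra).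
    assert (/ INR s ^ 2 <= / (INR s - / 2) - / (INR s + 1 - / 2)); [|lra].
    replace (/ (INR s - / 2) - / (INR s + 1 - / 2)) with (/ ((INR s - / 2) * (INR s + / 2))) by (field; lra).
    apply Rinv_le_contravar; nra. }
specialize (H 2%nat ltac:(lia)). cbn [INR] in H.
assert (0 < / (INR (2 + K) - / 2)).
{ apply Rinv_0_lt_compat. rewrite plus_INR; cbn [INR]; generalize (pos_INR K); lra. }
replace (/ (1 + 1 - / 2)) with (2 / 3) in H by field. lra.
Qed.

(* The l1 norm of the modes [k >= 2]; 8/3 < (1633/1000)^2. *)
Lemma l1_V_tail v : supp (inV M n) v ->
  lsum (Md M) (fun a => Rabs (v a)) <= Rabs (v (1%nat, n)) + 1633 / 1000 * nv M v.
Proof.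
intros Hv.
set (v' := fun a => v a - v (1%nat, n) * mode1 a).
apply Rle_trans with (lsum (Md M) (fun a => Rabs (v (1%nat, n)) * mode1 a) + lsum (Md M) (fun a => Rabs (v' a))).
- rewrite <- lsum_plus. apply lsum_le; intros a _. unfold v'.
  assert (T := Rabs_triang (v (1%nat, n) * mode1 a) (v a - v (1%nat, n) * mode1 a)).
  replace (v (1%nat, n) * mode1 a + (v a - v (1%nat, n) * mode1 a)) with (v a) in T by ring.
  rewrite Rabs_mult in T. rewrite (Rabs_pos_eq (mode1 a)) in T; [exact T|].
  unfold mode1; destruct (_ && _); lra.
- apply Rplus_le_compat.
  + rewrite (lsum_single _ _ (1%nat, n)); [rewrite mode1_eq; lra|apply NoDup_Md|apply in_Md_mode1|].
    intros b _ Hb. rewrite mode1_neq by exact Hb. ring.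
  + eapply Rle_trans; [apply (lsum_abs_weighted v' (fun a => sqrt (mu M a * k2 a) * v a)
       (fun a => if isV n a then (if Nat.leb (fst a) 1 then 0 else 4 * / INR (fst a) ^ 2) else 0) (Md M) (1633 / 1000))|].
    * lra.
    * intros a _. destruct (isV n a); [|lra]. destruct (Nat.leb_spec (fst a) 1); [lra|].
      apply Rmult_le_pos; [lra|]. apply Rlt_le, Rinv_0_lt_compat, pow_lt, lt_0_INR; lia.
    * intros a Ha. rewrite Rpow_mult_distr, pow2_sqrt.
      2:{ apply Rmult_le_pos; [generalize (mu_bounds M a); lra|apply k2_nonneg]. }
      destruct (supp_V_k M n HM Hn v a Hv Ha) as [E|[E1 E2]].
      -- assert (E' : v' a = 0).
         { unfold v'. rewrite E. destruct (Nat.eq_dec (fst a) 1) as [F1|F1]; [destruct (Nat.eq_dec (snd a) n) as [F2|F2]|].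
           - assert (a = (1%nat, n)) by (destruct a; cbn in *; congruence). subst a. rewrite E; ring.
           - rewrite mode1_neq; [ring|]. intros ->; now apply F2.
           - rewrite mode1_neq; [ring|]. intros ->; now apply F1. }
         rewrite E', E, !pow_i by lia. rewrite !Rmult_0_r; lra.
      -- rewrite E2. unfold isV in E2; apply Nat.eqb_eq in E2. destruct (Nat.leb_spec (fst a) 1) as [L|L].
         ++ assert (F : a = (1%nat, n)).
            { apply (INR_le 1) in E1. destruct a as [k j]; cbn [fst snd] in *. assert (k = 1%nat) by lia. subst k. f_equal; lia. }
            subst a. unfold v'. rewrite mode1_eq, Rmult_1_r, Rminus_diag, pow_i by lia. lra.
         ++ unfold v'. rewrite mode1_neq by (intros ->; cbn in L; lia). rewrite Rmult_0_r, Rminus_0_r.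
            assert (Hk : (fst a < M)%nat).
            { apply in_Md in Ha. nia. }
            destruct a as [k j]; cbn [fst snd] in *. rewrite mu_mid by lia. unfold k2; cbn [fst].
            apply Req_le. field. lra.
    * eapply Rle_trans; [apply (lsum_V_le M n (fun k => if Nat.leb k 1 then 0 else 4 * / INR k ^ 2))|].
      -- intros k. destruct (Nat.leb_spec k 1); [lra|]. apply Rmult_le_pos; [lra|]. apply Rlt_le, Rinv_0_lt_compat, pow_lt, lt_0_INR; lia.
      -- replace (seq 1 M) with (1%nat :: seq 2 (M - 1)) by (replace M with (S (M - 1)) at 2 by lia; reflexivity).
         rewrite lsum_cons. cbn [Nat.leb]. rewrite (lsum_ext (seq 2 (M - 1)) _ (fun k => 4 * / INR k ^ 2)).
         ++ rewrite lsum_scal. generalize (sum_inv_k2_tail (M - 1)); lra.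
         ++ intros k Hk; apply in_seq in Hk. destruct (Nat.leb_spec k 1); [lia|reflexivity].
    * apply Rmult_le_compat_l; [lra|]. unfold nv, nw, nrm. apply Req_le; f_equal. apply lsum_ext; intros a _.
      rewrite Rpow_mult_distr, pow2_sqrt; [reflexivity|].
      apply Rmult_le_pos; [generalize (mu_bounds M a); lra|apply k2_nonneg].
Qed.

(** For [k >= 2] one has [1 <= k^2 / 4]: without its first mode, [v] has a mean square of at most a
    quarter of [nv^2]. *)
Lemma nw_one_V_tail v : supp (inV M n) v -> nw M one v ^ 2 <= / 4 * v (1%nat, n) ^ 2 + / 4 * nv M v ^ 2.
Proof.
intros Hv. unfold nv. rewrite !nw_sq by (apply one_nonneg || apply k2_nonneg).
rewrite <- lsum_scal.
apply Rle_trans with (lsum (Md M) (fun a => / 4 * v (1%nat, n) ^ 2 * mode1 a + / 4 * (mu M a * k2 a * v a ^ 2))).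
- apply lsum_le; intros a Ha. unfold one. generalize (mu_bounds M a); intros Hmu.
  assert (P : 0 <= v a ^ 2) by apply pow2_ge_0.
  destruct (supp_V_k M n HM Hn v a Hv Ha) as [E|[E1 E2]].
  + rewrite E, pow_i by lia. rewrite !Rmult_0_r, Rplus_0_r. apply Rmult_le_pos; [|unfold mode1; destruct (_ && _); lra].
    apply Rmult_le_pos; [lra|apply pow2_ge_0].
  + unfold isV in E2; apply Nat.eqb_eq in E2. destruct (Nat.eq_dec (fst a) 1) as [L|L].
    * assert (F : a = (1%nat, n)) by (destruct a as [k j]; cbn [fst snd] in *; subst k; f_equal; lia).
      subst a. rewrite mode1_eq, mu_mid by lia. unfold k2; cbn [fst INR]. lra.
    * rewrite mode1_neq by (intros ->; now apply L). unfold k2.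
      apply (INR_le 1) in E1. assert (K2 : (2 <= fst a)%nat) by lia. apply (le_INR 2) in K2. cbn [INR] in K2.
      assert (4 <= INR (fst a) ^ 2) by nra.
      assert (0 <= mu M a * v a ^ 2) by (apply Rmult_le_pos; lra). nra.
- rewrite lsum_plus. apply Rplus_le_compat_r. rewrite (lsum_single _ _ (1%nat, n)).
  + rewrite mode1_eq; lra.
  + apply NoDup_Md.
  + apply in_Md_mode1.
  + intros b _ Hb. rewrite mode1_neq by exact Hb. ring.
Qed.

End Moments.

Lemma continuity_pt_lipschitz (f : R -> R) (s dl L : R) : 0 < dl -> 0 <= L ->
  (forall t, Rabs (t - s) < dl -> Rabs (f t - f s) <= L * Rabs (t - s)) -> continuity_pt f s.
Proof.
intros Hdl HL H e He.
exists (Rmin dl (e / (L + 1))). split; [apply Rmin_pos; [exact Hdl|apply Rdiv_lt_0_compat; lra]|].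
intros t [_ Ht]. cbn in *. unfold R_dist in *.
assert (H1 : Rabs (t - s) < dl) by (eapply Rlt_le_trans; [exact Ht|apply Rmin_l]).
assert (H2 : Rabs (t - s) < e / (L + 1)) by (eapply Rlt_le_trans; [exact Ht|apply Rmin_r]).
eapply Rle_lt_trans; [now apply H|].
apply Rmult_lt_compat_r with (r := L + 1) in H2; [|lra].
replace (e / (L + 1) * (L + 1)) with e in H2 by (field; lra).
generalize (Rabs_pos (t - s)); nra.
Qed.

Lemma pow_ge_1_bound x k : 1 <= x -> 1 + INR k * (x - 1) <= x ^ k.
Proof.
intros Hx. assert (H := pow_tangent x 1 k ltac:(lra) ltac:(lra)). rewrite !pow1 in H. lra.
Qed.

(** Follows from the Bernoulli-type inequality [(1 + x)^k (1 - k x) <= 1], proved by induction. *)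
Lemma pow_1_plus_le x k : 0 <= x -> INR k * x <= / 2 -> (1 + x) ^ k <= 2.
Proof.
intros Hx Hk.
assert (H : (1 + x) ^ k * (1 - INR k * x) <= 1).
{ induction k as [|k IH]; [cbn; lra|].
  rewrite S_INR in *. assert (IK := pos_INR k).
  assert (P : 0 < (1 + x) ^ k) by (apply pow_lt; lra).
  assert (0 <= INR k * x) by nra.
  specialize (IH ltac:(lra)).
  change ((1 + x) ^ S k) with ((1 + x) * (1 + x) ^ k).
  set (q := (1 + x) ^ k) in *.
  assert ((1 + x) * (1 - (INR k + 1) * x) <= 1 - INR k * x) by nra.
  assert (q * ((1 + x) * (1 - (INR k + 1) * x)) <= q * (1 - INR k * x)) by (apply Rmult_le_compat_l; lra).
  lra. }
assert (P : 0 < (1 + x) ^ k) by (apply pow_lt; lra). nra.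
Qed.

(** * Minimisation on the Nehari set *)

Section Nehari.
Variables M n e : nat.
Hypothesis Hn : (1 <= n)%nat.
Hypothesis HM4 : (4 * n <= M)%nat.
Hypothesis He : (2 <= e)%nat.
Variables (Psi : (nat * nat -> R) -> R) (rr : (nat * nat -> R) -> (nat * nat -> R) -> R) (kap : R).

Definition Gd (v h : nat * nat -> R) : R := avg M (fun p => ev M 0 v p ^ (2 * e + 1) * ev M 0 h p).
Definition dP (v h : nat * nat -> R) : R := ip M v h - Gd v h - rr v h.

Hypothesis HT : exists C, 0 <= C /\ forall v h, Vball M n v -> supp (inV M n) h -> Vball M n (vadd v h) ->
  Rabs (Psi (vadd v h) - Psi v - dP v h) <= C * nv M h ^ 2.
Hypothesis HL : forall v1 v2 h, Vball M n v1 -> Vball M n v2 -> supp (inV M n) h ->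
  Rabs (rr v1 h - rr v2 h) <= kap * nv M (vsub v1 v2) * nv M h.
Hypothesis H0 : forall h, rr (fun _ => 0) h = 0.
Hypothesis Hlin : forall v s h1 h2, rr v (fun a => h1 a + s * h2 a) = rr v h1 + s * rr v h2.
Hypothesis Hk : 0 <= kap <= / (60 * (INR e + 1)).

Let HM : (2 <= M)%nat.
Proof. lia. Qed.

Let e2 : 2 <= INR e.
Proof. apply (le_INR 2) in He. exact He. Qed.

Let k180 : kap <= / 180.
Proof. eapply Rle_trans; [apply Hk|]. apply Rinv_le_contravar; lra. Qed.

Lemma supp_scal s v : supp (inV M n) v -> supp (inV M n) (vscal s v).
Proof. intros Hv a Ha; unfold vscal; rewrite (Hv a Ha); ring. Qed.

Lemma nv_scal s v : nv M (vscal s v) = Rabs s * nv M v.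
Proof. unfold nv, vscal; apply nw_scal, k2_nonneg. Qed.

Lemma ip_self v : ip M v v = nv M v ^ 2.
Proof. unfold ip, nv; rewrite nw_sq by apply k2_nonneg. apply lsum_ext; intros; ring. Qed.

Lemma ip_scal_l s v h : ip M (vscal s v) h = s * ip M v h.
Proof. unfold ip; rewrite <- lsum_scal; apply lsum_ext; intros; unfold vscal; ring. Qed.

Lemma rr_comb v h1 s h2 : rr v (vadd h1 (vscal s h2)) = rr v h1 + s * rr v h2.
Proof. exact (Hlin v s h1 h2). Qed.

Lemma vscal_as_comb s h : vscal s h = vadd (fun _ => 0) (vscal s h).
Proof. apply functional_extensionality; intros; unfold vadd; ring. Qed.

Lemma rr_r0 v : rr v (fun _ => 0) = 0.
Proof.
assert (H := Hlin v 1 (fun _ => 0) (fun _ => 0)). cbn beta in H.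
replace (fun _ : nat * nat => 0 + 1 * 0) with (fun _ : nat * nat => 0) in H
  by (apply functional_extensionality; intros; ring). lra.
Qed.

Lemma rr_scal v s h : rr v (vscal s h) = s * rr v h.
Proof. rewrite vscal_as_comb, rr_comb, rr_r0; ring. Qed.

Lemma Gd_scal v s h : Gd v (vscal s h) = s * Gd v h.
Proof.
unfold Gd; rewrite <- avg_scal; apply avg_ext; intros. unfold vscal; rewrite ev_scal; ring.
Qed.

Lemma dP_scal v s h : dP v (vscal s h) = s * dP v h.
Proof.
unfold dP. rewrite rr_scal, Gd_scal.
replace (ip M v (vscal s h)) with (s * ip M v h) by (unfold ip; rewrite <- lsum_scal; apply lsum_ext; intros; unfold vscal; ring).
ring.
Qed.

Lemma Gd_scal_l s v h : Gd (vscal s v) h = s ^ (2 * e + 1) * Gd v h.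
Proof.
unfold Gd; rewrite <- avg_scal; apply avg_ext; intros. unfold vscal; rewrite ev_scal, Rpow_mult_distr; ring.
Qed.

Lemma rr_bound v h : Vball M n v -> supp (inV M n) h -> Rabs (rr v h) <= kap * nv M v * nv M h.
Proof.
intros Hv Hh. assert (H := HL v (fun _ => 0) h Hv (Vball_0 M n) Hh). rewrite H0, Rminus_0_r in H.
unfold nv in H at 1. rewrite vsub_0 in H. exact H.
Qed.

(** Radial derivative of [Psi]; its nonzero zeros form the Nehari set. *)
Definition Nh (v : nat * nat -> R) : R := dP v v.

Lemma dP_ray s v : supp (inV M n) v ->
  dP (vscal s v) v = s * nv M v ^ 2 - s ^ (2 * e + 1) * Gd v v - rr (vscal s v) v.
Proof. intros Hv; unfold dP; rewrite ip_scal_l, ip_self, Gd_scal_l; ring. Qed.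

Lemma Nh_ray s v : supp (inV M n) v ->
  Nh (vscal s v) = s * (s * nv M v ^ 2 - s ^ (2 * e + 1) * Gd v v - rr (vscal s v) v).
Proof. intros Hv; unfold Nh; rewrite dP_scal, dP_ray by exact Hv; ring. Qed.

Lemma Vball_scal s v : supp (inV M n) v -> Rabs s * nv M v <= 2 -> Vball M n (vscal s v).
Proof. intros Hv H; split; [now apply supp_scal|now rewrite nv_scal]. Qed.

Lemma vscal_1 v : vscal 1 v = v.
Proof. apply functional_extensionality; intros; unfold vscal; ring. Qed.

Lemma vscal_0 v : vscal 0 v = fun _ => 0.
Proof. apply functional_extensionality; intros; unfold vscal; ring. Qed.

Lemma Rabs_near s t c : 0 <= c -> Rabs s * c < 2 -> Rabs t < (2 - Rabs s * c) / (c + 1) -> Rabs (s + t) * c <= 2.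
Proof.
intros Hc H Ht. apply Rmult_lt_compat_r with (r := c + 1) in Ht; [|lra].
replace ((2 - Rabs s * c) / (c + 1) * (c + 1)) with (2 - Rabs s * c) in Ht by (field; lra).
assert (T := Rabs_triang s t). assert (P := Rabs_pos t). nra.
Qed.

Lemma ray_derive s v : supp (inV M n) v -> Rabs s * nv M v < 2 ->
  is_derive (fun s => Psi (vscal s v)) s (dP (vscal s v) v).
Proof.
intros Hv Hs. assert (P := nv_nonneg M v). destruct HT as [C [HC HCT]].
apply (is_derive_quadratic _ s _ (C * nv M v ^ 2) ((2 - Rabs s * nv M v) / (nv M v + 1))).
- apply Rdiv_lt_0_compat; lra.
- apply Rmult_le_pos; [exact HC|apply pow2_ge_0].
- intros t Ht.
  assert (E : vscal (s + t) v = vadd (vscal s v) (vscal t v)).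
  { apply functional_extensionality; intros; unfold vadd, vscal; ring. }
  assert (B : Vball M n (vscal (s + t) v)) by (apply Vball_scal; [exact Hv|now apply Rabs_near]).
  rewrite E in *. rewrite <- dP_scal.
  assert (T := HCT (vscal s v) (vscal t v) (Vball_scal s v Hv (Rlt_le _ _ Hs)) (supp_scal t v Hv) B).
  rewrite nv_scal in T. rewrite Rpow_mult_distr, pow2_abs in T. lra.
Qed.

Lemma Nh_ray_continuous s v : supp (inV M n) v -> Rabs s * nv M v < 2 ->
  continuity_pt (fun s => Nh (vscal s v)) s.
Proof.
intros Hv Hs. assert (P := nv_nonneg M v).
assert (Hr : continuity_pt (fun s => rr (vscal s v) v) s).
{ apply (continuity_pt_lipschitz _ s ((2 - Rabs s * nv M v) / (nv M v + 1)) (kap * nv M v * nv M v)).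
  - apply Rdiv_lt_0_compat; lra.
  - apply Rmult_le_pos; [apply Rmult_le_pos|]; lra.
  - intros t Ht.
    assert (B : Vball M n (vscal t v)).
    { apply Vball_scal; [exact Hv|]. replace t with (s + (t - s)) by ring. now apply Rabs_near. }
    eapply Rle_trans; [apply HL; [exact B|apply Vball_scal; [exact Hv|lra]|exact Hv]|].
    replace (nv M (vsub (vscal t v) (vscal s v))) with (Rabs (t - s) * nv M v).
    + apply Req_le; ring.
    + rewrite <- nv_scal. f_equal. apply functional_extensionality; intros; unfold vsub, vscal; ring. }
assert (C : forall k, continuity_pt (fun s => s ^ k) s) by (intros k; apply derivable_continuous_pt, derivable_pt_pow).
apply continuity_pt_ext with (fun s => s ^ 1 * (s ^ 1 * nv M v ^ 2 - s ^ (2 * e + 1) * Gd v v - rr (vscal s v) v)).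
{ intros t. rewrite Nh_ray by exact Hv. ring. }
apply continuity_pt_mult; [apply C|].
apply continuity_pt_minus; [|exact Hr].
apply continuity_pt_minus; (apply continuity_pt_mult; [apply C|apply continuity_pt_const; intros ? ?; reflexivity]).
Qed.

Lemma Nh_ray_zero s1 s2 v : supp (inV M n) v -> 0 < s1 < s2 -> s2 * nv M v < 2 ->
  0 < Nh (vscal s1 v) -> Nh (vscal s2 v) < 0 -> exists s, s1 <= s <= s2 /\ Nh (vscal s v) = 0.
Proof.
intros Hv Hs Hb H1 H2. assert (P := nv_nonneg M v).
destruct (IVT_interv (fun s => - Nh (vscal s v)) s1 s2) as [z [Hz1 Hz2]].
- intros t Ht. apply continuity_pt_opp, Nh_ray_continuous; [exact Hv|]. rewrite Rabs_pos_eq by lra. nra.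
- lra.
- lra.
- lra.
- exists z; split; [exact Hz1|lra].
Qed.

Lemma Gd_self_pow v : Gd v v = avg M (fun p => ev M 0 v p ^ (2 * e + 2)).
Proof.
unfold Gd; apply avg_ext; intros. replace (2 * e + 2)%nat with (S (2 * e + 1)) by lia. cbn [pow]; ring.
Qed.

Lemma Gd_self_bound v S : 0 <= S -> (forall p, Rabs (ev M 0 v p) <= S) -> Gd v v <= (S ^ 2) ^ e * nw M one v ^ 2.
Proof.
intros HS H. rewrite Gd_self_pow, <- n2_ev, n2_sq, <- avg_scal by exact HM. apply avg_le; [exact HM|]. intros p _.
replace (ev M 0 v p ^ (2 * e + 2)) with ((ev M 0 v p ^ 2) ^ e * ev M 0 v p ^ 2) by (rewrite <- pow_mult, <- pow_add; f_equal; lia).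
apply Rmult_le_compat_r; [apply pow2_ge_0|]. apply pow_incr; split; [apply pow2_ge_0|].
rewrite <- pow2_abs. apply pow_incr; split; [apply Rabs_pos|apply H].
Qed.

Lemma Gd_self_9 v : supp (inV M n) v -> Gd v v <= (9 * nv M v ^ 2) ^ e * nv M v ^ 2.
Proof.
intros Hv. assert (P := nv_nonneg M v).
eapply Rle_trans; [apply (Gd_self_bound v (3 * nv M v)); [lra|intros; now apply (ev_V_bound M n)]|].
replace ((3 * nv M v) ^ 2) with (9 * nv M v ^ 2) by ring.
apply Rmult_le_compat_l; [apply pow_le; generalize (pow2_ge_0 (nv M v)); lra|].
assert (P1 := nw_nonneg M one v). apply pow_incr; split; [exact P1|now apply (nw_one_V M n)].
Qed.

Lemma pow_small_e x : 0 <= x <= / 4 -> x ^ e <= / 16.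
Proof.
intros Hx. replace e with (2 + (e - 2))%nat by lia. rewrite pow_add.
assert (x ^ 2 <= / 16) by nra.
assert (x ^ (e - 2) <= 1). { rewrite <- (pow1 (e - 2)). apply pow_incr; lra. }
assert (0 <= x ^ 2) by apply pow2_ge_0. assert (0 <= x ^ (e - 2)) by (apply pow_le; lra). nra.
Qed.

(** Near 0 the quadratic part dominates: with [9 nv^2 <= 1/4] and [e >= 2] the power term is at most
    [nv^2 / 16] and the remainder at most [nv^2 / 180]. The Nehari set thus stays away from 0. *)
Lemma Nh_pos_small v : supp (inV M n) v -> 0 < nv M v -> nv M v ^ 2 <= / 36 -> 0 < Nh v.
Proof.
intros Hv Hp Hs. unfold Nh, dP. rewrite ip_self.
assert (B : Vball M n v) by (split; [exact Hv|nra]).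
assert (R1 := rr_bound v v B Hv). apply Rabs_le_between in R1.
assert (G1 := Gd_self_9 v Hv).
assert (X := pow_small_e (9 * nv M v ^ 2) ltac:(nra)).
assert (P2 : 0 < nv M v ^ 2) by nra.
set (a := nv M v ^ 2) in *.
assert ((9 * a) ^ e * a <= / 16 * a) by (apply Rmult_le_compat_r; lra).
replace (kap * nv M v * nv M v) with (kap * a) in R1 by (unfold a; ring).
assert (kap * a <= / 180 * a) by (apply Rmult_le_compat_r; lra). lra.
Qed.

Lemma energy_bound v : supp (inV M n) v -> nv M v < 2 ->
  Rabs (Psi v - Psi (fun _ => 0) - (/ 2 * nv M v ^ 2 - Gd v v / INR (2 * e + 2))) <= kap * nv M v ^ 2.
Proof.
intros Hv Hb. assert (P := nv_nonneg M v).
set (a := nv M v ^ 2). set (G := Gd v v).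
assert (HN : 0 < INR (2 * e + 2)) by (apply lt_0_INR; lia).
(* [Psi] along the ray minus its unperturbed model; only the remainder [rr] survives in the
   derivative, so the mean value theorem gives the bound. *)
set (chi := fun s => Psi (vscal s v) - (/ 2 * s ^ 2 * a - s ^ (2 * e + 2) * (G / INR (2 * e + 2)))).
assert (D : forall s, 0 <= s <= 1 -> is_derive chi s (- rr (vscal s v) v)).
{ intros s Hs. unfold chi.
  assert (Db := ray_derive s v Hv ltac:(rewrite Rabs_pos_eq by lra; nra)). rewrite dP_ray in Db by exact Hv.
  fold a G in Db.
  assert (Dp : is_derive (fun s => / 2 * s ^ 2 * a - s ^ (2 * e + 2) * (G / INR (2 * e + 2))) s (s * a - s ^ (2 * e + 1) * G)).
  { auto_derive; [exact I|].
    replace (Init.Nat.pred (e + (e + 0) + 2)) with (2 * e + 1)%nat by lia.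
    change (e + (e + 0) + 2)%nat with (2 * e + 2)%nat. field. lra. }
  assert (Dm := is_derive_minus _ _ _ _ _ Db Dp).
  replace (- rr (vscal s v) v) with
    (minus (s * a - s ^ (2 * e + 1) * G - rr (vscal s v) v) (s * a - s ^ (2 * e + 1) * G)); [exact Dm|].
  unfold minus, plus, opp; cbn; ring. }
destruct (MVT_gen chi 0 1 (fun s => - rr (vscal s v) v)) as [c [Hc E]].
- rewrite Rmin_left, Rmax_right by lra. intros s Hs; apply D; lra.
- rewrite Rmin_left, Rmax_right by lra. intros s Hs.
  apply continuity_pt_filterlim. apply (ex_derive_continuous chi). eexists; apply D; lra.
- rewrite Rmin_left, Rmax_right in Hc by lra.
  unfold chi in E. rewrite vscal_1, vscal_0, !pow1, (pow_i (2 * e + 2)) in E by lia.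
  replace (Psi v - Psi (fun _ => 0) - (/ 2 * a - G / INR (2 * e + 2))) with (- rr (vscal c v) v * (1 - 0)) by lra.
  rewrite Rminus_0_r, Rmult_1_r, Rabs_Ropp.
  eapply Rle_trans; [apply rr_bound; [apply Vball_scal; [exact Hv|rewrite Rabs_pos_eq by lra; nra]|exact Hv]|].
  rewrite nv_scal, Rabs_pos_eq by lra. unfold a.
  replace (kap * (c * nv M v) * nv M v) with (kap * (c * nv M v ^ 2)) by ring.
  apply Rmult_le_compat_l; [lra|]. generalize (pow2_ge_0 (nv M v)); nra.
Qed.

(** Ratio of energy to [nv^2] on the unperturbed Nehari set, where [Gd v v = nv^2]. *)
Definition thN : R := / 2 - / INR (2 * e + 2).

Lemma thN_bounds : / 3 <= thN <= / 2.
Proof.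
unfold thN. assert (6 <= INR (2 * e + 2)) by (rewrite plus_INR, mult_INR; cbn [INR]; lra).
assert (/ INR (2 * e + 2) <= / 6) by (apply Rinv_le_contravar; lra).
assert (0 < / INR (2 * e + 2)) by (apply Rinv_0_lt_compat; lra). lra.
Qed.

Lemma nehari_G v : Vball M n v -> Nh v = 0 -> Rabs (Gd v v - nv M v ^ 2) <= kap * nv M v ^ 2.
Proof.
intros Hv H. unfold Nh, dP in H. rewrite ip_self in H.
replace (Gd v v - nv M v ^ 2) with (- rr v v) by lra. rewrite Rabs_Ropp.
eapply Rle_trans; [apply rr_bound; [exact Hv|apply Hv]|]. apply Req_le; ring.
Qed.

Lemma nehari_energy v : supp (inV M n) v -> nv M v < 2 -> Nh v = 0 ->
  Rabs (Psi v - Psi (fun _ => 0) - thN * nv M v ^ 2) <= 2 * kap * nv M v ^ 2.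
Proof.
intros Hv Hb H.
assert (H1 := energy_bound v Hv Hb). assert (H2 := nehari_G v (conj Hv (Rlt_le _ _ Hb)) H).
apply Rabs_le_between in H1. apply Rabs_le_between in H2. apply Rabs_le.
unfold thN. set (a := nv M v ^ 2) in *. set (G := Gd v v) in *.
assert (HN : 6 <= INR (2 * e + 2)) by (rewrite plus_INR, mult_INR; cbn [INR]; lra).
set (N := INR (2 * e + 2)) in *.
assert (P : 0 < / N <= 1).
{ split; [apply Rinv_0_lt_compat; lra|]. rewrite <- Rinv_1. apply Rinv_le_contravar; lra. }
assert (A0 : 0 <= a) by apply pow2_ge_0.
unfold Rdiv in H1. assert (0 <= kap * a) by (apply Rmult_le_pos; lra).
assert (- (kap * a) <= (G - a) * / N <= kap * a) by nra. nra.
Qed.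

(** Above 1 this is Bernoulli with an exponent at least 5; below 1 one compares with [t^2]. What
    matters is that 3/2 exceeds the slope 1 of the quadratic part. *)
Lemma pow_slope t : / 2 <= t -> (t - 1) ^ 2 * (3 / 2) <= (t ^ (2 * e + 1) - 1) * (t - 1).
Proof.
intros Ht. assert (S0 : 0 <= (t - 1) ^ 2) by apply pow2_ge_0. destruct (Rle_dec 1 t) as [L|L].
- assert (Q := pow_ge_1_bound t (2 * e + 1) L).
  assert (I5 : 5 <= INR (2 * e + 1)) by (rewrite plus_INR, mult_INR; cbn [INR]; lra).
  assert (5 * (t - 1) <= INR (2 * e + 1) * (t - 1)) by (apply Rmult_le_compat_r; lra).
  assert (5 * (t - 1) * (t - 1) <= (t ^ (2 * e + 1) - 1) * (t - 1)) by (apply Rmult_le_compat_r; lra). lra.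
- assert (t ^ (2 * e + 1) <= t ^ 2).
  { replace (2 * e + 1)%nat with (2 + (2 * e - 1))%nat by lia. rewrite pow_add.
    rewrite <- (Rmult_1_r (t ^ 2)) at 2. apply Rmult_le_compat_l; [apply pow2_ge_0|].
    rewrite <- (pow1 (2 * e - 1)). apply pow_incr; lra. }
  assert ((1 - t ^ 2) * (1 - t) <= (1 - t ^ (2 * e + 1)) * (1 - t)) by (apply Rmult_le_compat_r; lra).
  assert (3 / 2 * (t - 1) ^ 2 <= (1 + t) * (t - 1) ^ 2) by (apply Rmult_le_compat_r; lra). lra.
Qed.

Lemma vsub_scal_self t v : nv M (vsub (vscal t v) v) = Rabs (t - 1) * nv M v.
Proof. rewrite <- nv_scal; f_equal; apply functional_extensionality; intros; unfold vsub, vscal; ring. Qed.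

(** On the Nehari set [Gd v v] is within [nv^2 / 180] of [nv^2], so along the ray the power term, of
    slope at least 3/2, beats the linear one: the radial derivative is positive before [t = 1] and
    negative after. *)
Lemma nehari_slope v t : supp (inV M n) v -> nv M v <= 3 / 2 -> Nh v = 0 -> / 2 <= t <= 5 / 4 ->
  dP (vscal t v) v * (t - 1) <= - / 4 * nv M v ^ 2 * (t - 1) ^ 2.
Proof.
intros Hv Hb Hz Ht. assert (P := nv_nonneg M v).
assert (Bv : Vball M n v) by (split; [exact Hv|lra]).
assert (HG := nehari_G v Bv Hz). apply Rabs_le_between in HG.
unfold Nh, dP in Hz. rewrite ip_self in Hz.
rewrite dP_ray by exact Hv.
assert (Bt : Rabs t * nv M v <= 2) by (rewrite Rabs_pos_eq by lra; nra).
assert (HR := HL (vscal t v) v v (Vball_scal t v Hv Bt) Bv Hv). rewrite vsub_scal_self in HR.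
replace (kap * (Rabs (t - 1) * nv M v) * nv M v) with (kap * nv M v ^ 2 * Rabs (t - 1)) in HR by ring.
set (a := nv M v ^ 2) in *. set (G := Gd v v) in *.
assert (A0 : 0 <= a) by apply pow2_ge_0.
set (dr := rr (vscal t v) v - rr v v) in *.
replace (t * a - t ^ (2 * e + 1) * G - rr (vscal t v) v) with ((t - 1) * a - (t ^ (2 * e + 1) - 1) * G - dr)
  by (unfold dr; lra).
assert (HD : Rabs (dr * (t - 1)) <= kap * a * (t - 1) ^ 2).
{ rewrite Rabs_mult, <- (pow2_abs (t - 1)).
  replace (kap * a * Rabs (t - 1) ^ 2) with (kap * a * Rabs (t - 1) * Rabs (t - 1)) by ring.
  apply Rmult_le_compat_r; [apply Rabs_pos|exact HR]. }
apply Rabs_le_between in HD.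
assert (HG2 := pow_slope t (proj1 Ht)).
assert (ka : kap * a <= / 180 * a) by (apply Rmult_le_compat_r; lra).
assert (S0 : 0 <= (t - 1) ^ 2) by apply pow2_ge_0.
assert (H1 : 179 / 180 * a * ((t - 1) ^ 2 * (3 / 2)) <= G * ((t ^ (2 * e + 1) - 1) * (t - 1))).
{ apply Rmult_le_compat; [lra|lra|lra|exact HG2]. }
assert (H2 : kap * a * (t - 1) ^ 2 <= / 180 * a * (t - 1) ^ 2) by (apply Rmult_le_compat_r; lra).
assert (H3 : 0 <= a * (t - 1) ^ 2) by (apply Rmult_le_pos; lra).
replace (((t - 1) * a - (t ^ (2 * e + 1) - 1) * G - dr) * (t - 1))
  with (a * (t - 1) ^ 2 - G * ((t ^ (2 * e + 1) - 1) * (t - 1)) - dr * (t - 1)) by ring.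
lra.
Qed.

Lemma nehari_ray_max v s : supp (inV M n) v -> nv M v <= 3 / 2 -> Nh v = 0 ->
  / 2 <= s <= 5 / 4 -> Psi (vscal s v) <= Psi v.
Proof.
intros Hv Hb Hz Hs. assert (P := nv_nonneg M v).
assert (Bt : forall t, / 2 <= t <= 5 / 4 -> Rabs t * nv M v < 2) by (intros t Ht; rewrite Rabs_pos_eq by lra; nra).
assert (Sgn : forall t, / 2 <= t <= 5 / 4 -> dP (vscal t v) v * (t - 1) <= 0).
{ intros t Ht. eapply Rle_trans; [now apply nehari_slope|].
  assert (0 <= nv M v ^ 2 * (t - 1) ^ 2) by (apply Rmult_le_pos; apply pow2_ge_0). lra. }
destruct (MVT_gen (fun s => Psi (vscal s v)) 1 s (fun s => dP (vscal s v) v)) as [c [Hc E]].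
- intros t Ht. apply ray_derive; [exact Hv|]. apply Bt.
  destruct (Rle_dec 1 s); [rewrite Rmin_left, Rmax_right in Ht by lra|rewrite Rmin_right, Rmax_left in Ht by lra]; lra.
- intros t Ht. apply continuity_pt_filterlim. apply (ex_derive_continuous (fun s => Psi (vscal s v))).
  eexists. apply ray_derive; [exact Hv|]. apply Bt.
  destruct (Rle_dec 1 s); [rewrite Rmin_left, Rmax_right in Ht by lra|rewrite Rmin_right, Rmax_left in Ht by lra]; lra.
- rewrite vscal_1 in E.
  assert (dP (vscal c v) v * (s - 1) <= 0); [|lra].
  destruct (Rle_dec 1 s) as [L|L]; [rewrite Rmin_left, Rmax_right in Hc by lra|rewrite Rmin_right, Rmax_left in Hc by lra];
  (assert (Q := Sgn c ltac:(lra)); destruct (Req_dec c 1) as [->|Hc1];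
   [ replace (dP (vscal 1 v) v) with 0 by (rewrite vscal_1; exact (eq_sym Hz)); lra |]).
  + assert (dP (vscal c v) v <= 0) by nra. nra.
  + assert (0 <= dP (vscal c v) v) by nra. nra.
Qed.

(** The set is closed under coordinatewise limits. The lower bound keeps limits away from 0 and, by
    [Nh_pos_small], holds at every Nehari point with [nv > 0]; the upper bound gives compactness and
    is strict at the minimiser. *)
Definition NehS (v : nat * nat -> R) : Prop :=
  supp (inV M n) v /\ / 36 <= nv M v ^ 2 <= 9 / 4 /\ Nh v = 0.

Lemma NehS_nv v : NehS v -> / 6 <= nv M v <= 3 / 2.
Proof. intros (_ & H & _). assert (P := nv_nonneg M v). nra. Qed.

Lemma dP_bound v h : Vball M n v -> supp (inV M n) h -> Rabs (dP v h) <= (2 + 6 ^ (2 * e + 1) + 2 * kap) * nv M h.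
Proof.
intros Hv Hh. unfold dP. assert (P := nv_nonneg M h). assert (Pv := nv_nonneg M v).
assert (B1 : Rabs (ip M v h) <= 2 * nv M h).
{ unfold ip. eapply Rle_trans.
  - apply (nrm_cauchy_schwarz (Md M) (fun a => mu M a * k2 a)). apply mu_wt_nonneg, k2_nonneg.
  - apply Rmult_le_compat_r; [exact P|apply Hv]. }
assert (B2 : Rabs (Gd v h) <= 6 ^ (2 * e + 1) * nv M h).
{ unfold Gd. eapply Rle_trans; [apply n2_cauchy_schwarz, HM|]. rewrite n2_ev by exact HM.
  apply Rmult_le_compat; [apply n2_nonneg|apply nw_nonneg| |now apply (nw_one_V M n)].
  apply n2_const_bound; [exact HM|apply pow_le; lra|]. intros p _. rewrite <- RPow_abs. apply pow_incr; split; [apply Rabs_pos|].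
  now apply (ev_V_6 M n). }
assert (B3 := rr_bound v h Hv Hh).
assert (kap * nv M v * nv M h <= 2 * kap * nv M h).
{ apply Rmult_le_compat_r; [exact P|]. destruct Hv as [_ Hv]. nra. }
replace (ip M v h - Gd v h - rr v h) with (ip M v h + (- Gd v h + - rr v h)) by ring.
eapply Rle_trans; [apply Rabs_triang|].
assert (T := Rabs_triang (- Gd v h) (- rr v h)). rewrite !Rabs_Ropp in T. lra.
Qed.

Lemma nv_lim x l : coord_lim x l -> is_lim_seq (fun q => nv M (vsub (x q) l)) 0.
Proof.
intros H. replace (Finite 0) with (Finite (nv M (vsub l l))).
- apply is_lim_seq_nw. intros a. unfold vsub. apply is_lim_seq_minus'; [apply H|apply is_lim_seq_const].
- f_equal. unfold nv, nw. apply nrm_zero. intros; unfold vsub; ring.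
Qed.

Lemma is_lim_seq_0_scal (u : nat -> R) c : is_lim_seq u 0 -> is_lim_seq (fun q => c * u q) 0.
Proof.
intros H. replace (Finite 0) with (Finite (c * 0)) by (f_equal; ring).
apply is_lim_seq_mult'; [apply is_lim_seq_const|exact H].
Qed.

Lemma is_lim_seq_of_bound (u b : nat -> R) (l : R) :
  (forall q, Rabs (u q - l) <= b q) -> is_lim_seq b 0 -> is_lim_seq u l.
Proof.
intros H Hb. apply (is_lim_seq_ext (fun q => (u q - l) + l)); [intros; ring|].
replace (Finite l) with (Finite (0 + l)) by (f_equal; ring).
apply is_lim_seq_plus'; [|apply is_lim_seq_const].
apply is_lim_seq_abs_0. apply (is_lim_seq_le_le (fun _ => 0) _ b); [|apply is_lim_seq_const|exact Hb].
intros q; split; [apply Rabs_pos|apply H].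
Qed.

Lemma Psi_lim x l : (forall q, Vball M n (x q)) -> Vball M n l -> coord_lim x l ->
  is_lim_seq (fun q => Psi (x q)) (Psi l).
Proof.
intros Hx Hl H. destruct HT as [C [HC HCT]].
set (K := 2 + 6 ^ (2 * e + 1) + 2 * kap).
apply (is_lim_seq_of_bound _ (fun q => (4 * C + K) * nv M (vsub (x q) l))).
- intros q. set (h := vsub (x q) l).
  assert (E : vadd l h = x q) by (apply functional_extensionality; intros; unfold h, vadd, vsub; ring).
  assert (Hh : supp (inV M n) h) by (apply supp_sub; [apply Hx|apply Hl]).
  assert (T := HCT l h Hl Hh). rewrite E in T. specialize (T (Hx q)).
  assert (D := dP_bound l h Hl Hh). fold K in D.
  assert (P := nv_nonneg M h).
  assert (B : nv M h <= 4).
  { unfold h, nv, vsub. eapply Rle_trans; [apply nw_triang_minus, k2_nonneg|].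
    destruct (Hx q) as [_ B1]; destruct Hl as [_ B2]. unfold nv in B1, B2. lra. }
  assert (Tr := Rabs_triang (Psi (x q) - Psi l - dP l h) (dP l h)).
  replace (Psi (x q) - Psi l - dP l h + dP l h) with (Psi (x q) - Psi l) in Tr by ring.
  assert (C * nv M h ^ 2 <= 4 * C * nv M h).
  { replace (4 * C * nv M h) with (C * (4 * nv M h)) by ring. apply Rmult_le_compat_l; [exact HC|nra]. }
  lra.
- apply is_lim_seq_0_scal. now apply nv_lim.
Qed.

Lemma Nh_lim x l : (forall q, Vball M n (x q)) -> Vball M n l -> coord_lim x l ->
  is_lim_seq (fun q => Nh (x q)) (Nh l).
Proof.
intros Hx Hl H. unfold Nh, dP.
apply is_lim_seq_minus'; [apply is_lim_seq_minus'|].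
- apply is_lim_seq_lsum; intros a _. apply is_lim_seq_mult'; [apply is_lim_seq_const|]. apply is_lim_seq_mult'; apply H.
- apply is_lim_seq_avg; intros p. apply is_lim_seq_mult'; [|now apply is_lim_seq_ev].
  apply (is_lim_seq_comp_cont (fun z => z ^ (2 * e + 1))); [|now apply is_lim_seq_ev].
  apply continuity_pt_filterlim, derivable_continuous_pt, derivable_pt_pow.
- apply (is_lim_seq_of_bound _ (fun q => (4 * kap) * nv M (vsub (x q) l))).
  + intros q. set (h := vsub (x q) l).
    assert (Hh : supp (inV M n) h) by (apply supp_sub; [apply Hx|apply Hl]).
    assert (E : x q = vadd l (vscal 1 h)) by (apply functional_extensionality; intros; unfold h, vadd, vscal, vsub; ring).
    assert (R1 := HL (x q) l (x q) (Hx q) Hl (proj1 (Hx q))).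
    assert (R2 : rr l (x q) = rr l l + 1 * rr l h) by (rewrite E at 1; apply rr_comb).
    assert (R3 := rr_bound l h Hl Hh). fold h in R1.
    assert (P := nv_nonneg M h). destruct (Hx q) as [_ B1]. destruct Hl as [_ B2].
    replace (rr (x q) (x q) - rr l l) with ((rr (x q) (x q) - rr l (x q)) + rr l h) by lra.
    eapply Rle_trans; [apply Rabs_triang|].
    assert (kap * nv M h * nv M (x q) <= 2 * kap * nv M h).
    { replace (2 * kap * nv M h) with (kap * nv M h * 2) by ring. apply Rmult_le_compat_l; [apply Rmult_le_pos; lra|exact B1]. }
    assert (kap * nv M l * nv M h <= 2 * kap * nv M h).
    { apply Rmult_le_compat_r; [exact P|]. assert (kap * nv M l <= kap * 2) by (apply Rmult_le_compat_l; lra). lra. }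
    lra.
  + apply is_lim_seq_0_scal. now apply nv_lim.
Qed.

(** The competitor is the multiple of the first mode lying on the Nehari set. The last inequality,
    from the moment bound, limits its norm and hence the minimal energy. *)
Lemma test_point : exists v, NehS v /\ nv M v ^ 2 <= 1 /\ 9 / 4 * (25 / 9) ^ (e - 1) * (nv M v ^ 2) ^ e <= 1 + kap.
Proof.
set (y := mode1 n). assert (Hy : supp (inV M n) y) by (apply supp_mode1; assumption).
assert (Ny : nv M y ^ 2 = / 4) by (apply nv_mode1; assumption).
assert (Py := nv_nonneg M y).
assert (Ny' : nv M y = / 2) by nra.
assert (Gy : 9 / 64 * (25 / 36) ^ (e - 1) <= Gd y y).
{ rewrite Gd_self_pow. replace (2 * e + 2)%nat with (2 * (e - 1) + 4)%nat by lia. apply moment_mode1; assumption. }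
(* The moment bound [9/64 (25/36)^(e-1)] times [4^(e+1)], which converts powers of [s] into powers
   of [nv^2 = s^2 / 4]. *)
set (q := 9 / 4 * (25 / 9) ^ (e - 1)).
assert (Q1 : 9 / 4 <= q).
{ unfold q. assert (1 <= (25 / 9) ^ (e - 1)) by (apply pow_R1_Rle; lra). lra. }
(* [Gd (s y) (s y)] in terms of the squared norm [b = s^2/4]. *)
assert (GQ : forall s, q * (s ^ 2 / 4) ^ e * (s ^ 2 / 4) <= s ^ (2 * e + 2) * Gd y y).
{ intros s. apply Rle_trans with (s ^ (2 * e + 2) * (9 / 64 * (25 / 36) ^ (e - 1))).
  - apply Req_le. unfold q.
    replace (s ^ (2 * e + 2)) with ((s ^ 2) ^ e * s ^ 2) by (rewrite <- pow_mult, <- pow_add; f_equal; lia).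
    unfold Rdiv at 3. rewrite Rpow_mult_distr.
    replace ((/ 4) ^ e) with (/ 4 * (/ 4) ^ (e - 1)) by (replace e with (S (e - 1)) at 2 by lia; reflexivity).
    replace ((25 / 36) ^ (e - 1)) with ((25 / 9) ^ (e - 1) * (/ 4) ^ (e - 1)) by (rewrite <- Rpow_mult_distr; f_equal; field).
    field.
  - apply Rmult_le_compat_l; [|exact Gy]. replace (s ^ (2 * e + 2)) with ((s ^ (e + 1)) ^ 2) by (rewrite <- pow_mult; f_equal; lia).
    apply pow2_ge_0. }
(* At [s = 1/3] the squared norm is 1/36 and [Nh_pos_small] applies; at [s = 2] the norm is 1, and
   [q >= 9/4] makes the power term win. *)
destruct (Nh_ray_zero (/ 3) 2 y Hy) as [s [Hs Hz]].
- lra.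
- rewrite Ny'; lra.
- apply Nh_pos_small; [now apply supp_scal| |].
  + rewrite nv_scal, Rabs_pos_eq, Ny' by lra. lra.
  + rewrite nv_scal, Rabs_pos_eq, Ny' by lra. lra.
- rewrite Nh_ray by exact Hy. rewrite Ny.
  assert (R1 := rr_bound (vscal 2 y) y (Vball_scal 2 y Hy ltac:(rewrite Rabs_pos_eq by lra; lra)) Hy).
  rewrite nv_scal, (Rabs_pos_eq 2), Ny' in R1 by lra. apply Rabs_le_between in R1.
  assert (G2 := GQ 2). replace (2 ^ 2 / 4) with 1 in G2 by field. rewrite pow1 in G2.
  replace (2 ^ (2 * e + 2)) with (2 * 2 ^ (2 * e + 1)) in G2 by (replace (2 * e + 2)%nat with (S (2 * e + 1)) by lia; reflexivity).
  lra.
- exists (vscal s y).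
  assert (Nb : nv M (vscal s y) ^ 2 = s ^ 2 / 4) by (rewrite nv_scal, Rabs_pos_eq, Ny' by lra; field).
  assert (Bs : Vball M n (vscal s y)) by (apply Vball_scal; [exact Hy|rewrite Rabs_pos_eq, Ny' by lra; lra]).
  split; [split; [now apply supp_scal|split; [rewrite Nb; nra|exact Hz]]|split; [rewrite Nb; nra|]].
  assert (HG := nehari_G _ Bs Hz). rewrite Nb in *. apply Rabs_le_between in HG.
  assert (EG : Gd (vscal s y) (vscal s y) = s ^ (2 * e + 2) * Gd y y).
  { rewrite Gd_scal, Gd_scal_l. replace (2 * e + 2)%nat with (S (2 * e + 1)) by lia. cbn [pow]; ring. }
  rewrite EG in HG. assert (G2 := GQ s). fold q.
  assert (Pb : 0 < s ^ 2 / 4) by nra. set (b := s ^ 2 / 4) in *.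
  apply Rmult_le_reg_r with b; [exact Pb|]. lra.
Qed.

Theorem nehari_minimizer : exists v, NehS v /\ nv M v < 3 / 2 /\ / 180 <= Rabs (v (1%nat, n)) /\
  forall h, supp (inV M n) h -> dP v h = 0.
Proof.
destruct test_point as (y & Hy & Hy1 & Hyq).
destruct (coord_minimum NehS Psi (fun _ => 9 / 2) (Psi (fun _ => 0))) as (v & Hv & Hmin).
- exists y; exact Hy.
- intros x Hx a. assert (B := NehS_nv x Hx). destruct Hx as (Hx & _ & _).
  destruct (inMd M a) eqn:Ea.
  + apply inMd_spec in Ea. assert (L := l1_V M n HM Hn x Hx).
    assert (T := lsum_term_le (Md M) (fun a => Rabs (x a)) a (fun b _ => Rabs_pos (x b)) Ea). cbn beta in T. lra.
  + rewrite (Hx a); [rewrite Rabs_R0; lra|unfold inV; now rewrite Ea].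
- intros x Hx. assert (B := NehS_nv x Hx). destruct Hx as (Hx & _ & Hz).
  assert (T := nehari_energy x Hx ltac:(lra) Hz). apply Rabs_le_between in T.
  assert (Th := thN_bounds). assert (0 <= nv M x ^ 2) by apply pow2_ge_0. nra.
- intros x l Hx Hl.
  assert (Bx : forall q, Vball M n (x q)) by (intros q; split; [apply Hx|generalize (NehS_nv _ (Hx q)); lra]).
  assert (Sl : supp (inV M n) l) by (apply (coord_lim_supp _ x); [intros; apply Hx|exact Hl]).
  assert (Ln : is_lim_seq (fun q => nv M (x q) ^ 2) (nv M l ^ 2)) by (apply is_lim_seq_pow2, is_lim_seq_nw, Hl).
  assert (L1 : nv M l ^ 2 <= 9 / 4) by (apply (is_lim_seq_le_const _ _ _ Ln); intros q; apply (Hx q)).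
  assert (L2 : / 36 <= nv M l ^ 2).
  { apply (is_lim_seq_le (fun _ => / 36) (fun q => nv M (x q) ^ 2) (/ 36) (nv M l ^ 2)); [intros q; apply (Hx q)|apply is_lim_seq_const|exact Ln]. }
  assert (Bl : Vball M n l) by (split; [exact Sl|generalize (nv_nonneg M l); nra]).
  split; [|now apply Psi_lim].
  split; [exact Sl|split; [lra|]].
  assert (L := Nh_lim x l Bx Bl Hl).
  assert (E := is_lim_seq_ext _ (fun _ => 0) (Nh l) (fun q => proj2 (proj2 (Hx q))) L).
  apply is_lim_seq_unique in E. rewrite Lim_seq_const in E. congruence.
- assert (Bv := NehS_nv v Hv). assert (By := NehS_nv y Hy).
  (* On the Nehari set the energy is [thN nv^2] up to [2 kap nv^2], so minimality becomes a
     comparison of norms; 15 suffices since [thN >= 1/3] and [kap <= 1/180]. *)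
  assert (Ev : nv M v ^ 2 <= (1 + 15 * kap) * nv M y ^ 2).
  { assert (T1 := nehari_energy v (proj1 Hv) ltac:(lra) (proj2 (proj2 Hv))).
    assert (T2 := nehari_energy y (proj1 Hy) ltac:(lra) (proj2 (proj2 Hy))).
    assert (Hm := Hmin y Hy). assert (Th := thN_bounds). apply Rabs_le_between in T1. apply Rabs_le_between in T2.
    set (a := nv M v ^ 2) in *. set (b := nv M y ^ 2) in *. assert (0 <= a) by apply pow2_ge_0. assert (0 <= b) by apply pow2_ge_0.
    assert (I1 : (thN - 2 * kap) * a <= (thN + 2 * kap) * b) by lra.
    assert (I2 : thN + 2 * kap <= (1 + 15 * kap) * (thN - 2 * kap)) by nra.
    assert (I3 : (thN + 2 * kap) * b <= (1 + 15 * kap) * (thN - 2 * kap) * b) by (apply Rmult_le_compat_r; assumption).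
    apply Rmult_le_reg_l with (thN - 2 * kap); lra. }
  assert (Hstrict : nv M v < 3 / 2).
  { assert (nv M v ^ 2 <= 1 + 15 / 180) by nra. nra. }
  exists v; split; [exact Hv|split; [exact Hstrict|split]].
  + (* If the first mode were small, [Gd v v] would be too small compared with the test function. *)
    apply Rnot_lt_le; intros Hx1.
    set (a := nv M v ^ 2) in *. set (b := nv M y ^ 2) in *.
    assert (Bb : Vball M n v) by (split; [apply Hv|lra]).
    assert (HG := nehari_G v Bb (proj2 (proj2 Hv))). apply Rabs_le_between in HG. fold a in HG.
    (* As [nv >= 1/6], a first coefficient below 1/180 is at most [nv / 30], and
       [1.633 + 1/30 <= 5/3]. The square 25/9 equals the base of the powers in [test_point], so they
       cancel for every [e]. *)
    assert (Hsup : forall p, Rabs (ev M 0 v p) <= 5 / 3 * nv M v).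
    { intros p. eapply Rle_trans; [apply ev_bound|]. eapply Rle_trans; [apply (l1_V_tail M n Hn HM4); apply Hv|]. lra. }
    assert (G1 := Gd_self_bound v (5 / 3 * nv M v) ltac:(lra) Hsup).
    assert (N1 := nw_one_V_tail M n Hn HM4 v (proj1 Hv)). fold a in N1.
    assert (X2 : v (1%nat, n) ^ 2 <= a / 900).
    { rewrite <- pow2_abs. unfold a. generalize (Rabs_pos (v (1%nat, n))); nra. }
    replace ((5 / 3 * nv M v) ^ 2) with (25 / 9 * a) in G1 by (unfold a; field).
    assert (a0 : 0 < a) by (unfold a; nra). assert (b0 : 0 < b) by (unfold b; nra).
    assert (Pa : 0 < (25 / 9 * a) ^ e) by (apply pow_lt; lra).
    assert (G2 : Gd v v <= (25 / 9 * a) ^ e * (26 / 100 * a)).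
    { eapply Rle_trans; [exact G1|]. apply Rmult_le_compat_l; lra. }
    assert (I1 : 179 / 180 <= (25 / 9 * a) ^ e * (26 / 100)).
    { apply Rmult_le_reg_r with a; [exact a0|]. assert (kap * a <= / 180 * a) by (apply Rmult_le_compat_r; lra). lra. }
    assert (I2 : (25 / 9 * a) ^ e <= 25 / 9 * (25 / 9) ^ (e - 1) * ((1 + 15 * kap) ^ e * b ^ e)).
    { rewrite Rpow_mult_distr.
      replace ((25 / 9) ^ e) with (25 / 9 * (25 / 9) ^ (e - 1)) by (replace e with (S (e - 1)) at 2 by lia; reflexivity).
      apply Rmult_le_compat_l; [apply Rmult_le_pos; [lra|apply pow_le; lra]|].
      rewrite <- Rpow_mult_distr. apply pow_incr; lra. }
    (* The factor [e + 1] in the hypothesis on [kap] keeps this accumulated loss bounded whatever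
       [e]. *)
    assert (I3 : (1 + 15 * kap) ^ e <= 2).
    { apply pow_1_plus_le; [lra|]. destruct Hk as [_ Hk2].
      apply Rmult_le_compat_l with (r := 60 * (INR e + 1)) in Hk2; [|lra]. rewrite Rinv_r in Hk2 by lra. nra. }
    assert (P9 : 0 < (25 / 9) ^ (e - 1)) by (apply pow_lt; lra).
    assert (Pb : 0 < b ^ e) by (apply pow_lt; lra).
    set (z := (25 / 9) ^ (e - 1) * b ^ e) in *.
    assert (Pz : 0 < z) by (unfold z; apply Rmult_lt_0_compat; assumption).
    assert (I4 : 9 / 4 * z <= 1 + / 180) by (unfold z; lra).
    (* The chain ends at [179/180 <= 26/100 * 25/9 * 2 * 4/9 * (1 + 1/180)], about 0.65, a
       contradiction. *)
    assert (I5 : 25 / 9 * (25 / 9) ^ (e - 1) * ((1 + 15 * kap) ^ e * b ^ e) <= 25 / 9 * (2 * z)).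
    { replace (25 / 9 * (25 / 9) ^ (e - 1) * ((1 + 15 * kap) ^ e * b ^ e)) with (25 / 9 * ((1 + 15 * kap) ^ e * z)) by (unfold z; ring).
      apply Rmult_le_compat_l; [lra|]. apply Rmult_le_compat_r; lra. }
    lra.
  + (* The minimiser is critical: compare with the nearby Nehari points s(v + t h), s -> 1. *)
    assert (Main : forall h, supp (inV M n) h -> 0 <= dP v h).
    { intros h Hh. apply Rnot_lt_le; intros Hneg.
      assert (Bb : Vball M n v) by (split; [apply Hv|lra]).
      destruct HT as [C [HC HCT]].
      set (c := - dP v h). assert (Hc : 0 < c) by (unfold c; lra).
      assert (Ph := nv_nonneg M h).
      set (Nhh := nv M h) in *.
      assert (Cd : continuity_pt (fun s => dP (vscal s v) h) 1).
      { apply continuity_pt_ext with (fun s => s ^ 1 * ip M v h - s ^ (2 * e + 1) * Gd v h - rr (vscal s v) h).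
        { intros s. unfold dP. rewrite ip_scal_l, Gd_scal_l. ring. }
        assert (Cp : forall k, continuity_pt (fun s => s ^ k) 1) by (intros k; apply derivable_continuous_pt, derivable_pt_pow).
        apply continuity_pt_minus.
        - apply continuity_pt_minus; (apply continuity_pt_mult; [apply Cp|apply continuity_pt_const; intros ? ?; reflexivity]).
        - apply (continuity_pt_lipschitz _ 1 (/ 4) (kap * nv M v * Nhh)); [lra|apply Rmult_le_pos; [apply Rmult_le_pos|]; lra|].
          intros t Ht. apply Rabs_lt_between in Ht. rewrite vscal_1.
          eapply Rle_trans; [apply HL; [apply Vball_scal; [apply Hv|rewrite Rabs_pos_eq by lra; nra]|exact Bb|exact Hh]|].
          rewrite vsub_scal_self. apply Req_le; unfold Nhh; ring. }
      destruct (Cd (c / 2) ltac:(lra)) as [dl [Hdl Cd']].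
      set (eta := Rmin (dl / 2) (/ 20)).
      assert (Heta : 0 < eta <= / 20) by (unfold eta; split; [apply Rmin_pos; lra|apply Rmin_r]).
      assert (Heta2 : eta < dl) by (unfold eta; generalize (Rmin_l (dl / 2) (/ 20)); lra).
      assert (HdP : forall s, 1 - eta <= s <= 1 + eta -> dP (vscal s v) h <= - (c / 2)).
      { intros s Hs. destruct (Req_dec s 1) as [->|Hs1].
        - rewrite vscal_1. unfold c; lra.
        - specialize (Cd' s). cbn in Cd'. unfold R_dist in Cd'. rewrite vscal_1 in Cd'.
          assert (Q : Rabs (dP (vscal s v) h - dP v h) < c / 2).
          { apply Cd'. split; [split; [exact I|intros E; apply Hs1; symmetry; exact E]|]. apply Rabs_lt_between; lra. }
          apply Rabs_lt_between in Q. unfold c in *; lra. }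
      assert (Sgn : 0 < Nh (vscal (1 - eta) v) /\ Nh (vscal (1 + eta) v) < 0).
      { assert (F1 := nehari_slope v (1 - eta) (proj1 Hv) ltac:(lra) (proj2 (proj2 Hv)) ltac:(lra)).
        assert (F2 := nehari_slope v (1 + eta) (proj1 Hv) ltac:(lra) (proj2 (proj2 Hv)) ltac:(lra)).
        unfold Nh. rewrite !dP_scal.
        assert (a0 : 0 < nv M v ^ 2 * eta ^ 2) by (apply Rmult_lt_0_compat; apply pow_lt; lra).
        set (u1 := dP (vscal (1 - eta) v) v) in *. set (u2 := dP (vscal (1 + eta) v) v) in *.
        assert (U1 : 0 < u1 * eta) by lra. assert (U2 : u2 * eta < 0) by lra.
        assert (V1 : 0 < u1) by (apply Rmult_lt_reg_r with eta; lra).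
        assert (V2 : u2 < 0) by (apply Rmult_lt_reg_r with eta; lra).
        split; nra. }
      set (tq := fun q : nat => / (INR q + 1) * / (1 + Nhh) * / 20).
      assert (Htq : forall q, 0 < tq q /\ tq q * Nhh <= / 20).
      { intros q. unfold tq. assert (Q0 := pos_INR q).
        assert (0 < / (INR q + 1) <= 1).
        { split; [apply Rinv_0_lt_compat; lra|]. rewrite <- Rinv_1. apply Rinv_le_contravar; lra. }
        assert (P1 : 0 < / (1 + Nhh)) by (apply Rinv_0_lt_compat; lra).
        assert (P2 : / (1 + Nhh) * Nhh <= 1).
        { apply Rmult_le_reg_l with (1 + Nhh); [lra|]. rewrite <- Rmult_assoc, Rinv_r; lra. }
        assert (0 <= / (1 + Nhh) * Nhh) by (apply Rmult_le_pos; lra).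
        split; [apply Rmult_lt_0_compat; [apply Rmult_lt_0_compat|]; lra|].
        replace (/ (INR q + 1) * / (1 + Nhh) * / 20 * Nhh) with (/ 20 * (/ (INR q + 1) * (/ (1 + Nhh) * Nhh))) by ring.
        assert (/ (INR q + 1) * (/ (1 + Nhh) * Nhh) <= 1 * 1) by (apply Rmult_le_compat; lra). lra. }
      assert (Ltq : is_lim_seq tq 0).
      { unfold tq. apply (is_lim_seq_ext (fun q => (/ (1 + Nhh) * / 20) * / (INR q + 1))); [intros; ring|].
        apply is_lim_seq_0_scal. replace (Finite 0) with (Rbar_inv p_infty) by reflexivity.
        apply is_lim_seq_inv; [|easy]. apply is_lim_seq_plus with p_infty 1; [apply is_lim_seq_INR|apply is_lim_seq_const|easy]. }
      set (xq := fun q => vadd v (vscal (tq q) h)).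
      assert (Sx : forall q, supp (inV M n) (xq q)) by (intros q; apply supp_add; [apply Hv|now apply supp_scal]).
      assert (Nx : forall q, nv M (xq q) <= nv M v + / 20).
      { intros q. assert (T := nw_triang M k2 v (vscal (tq q) h) k2_nonneg).
        change (nv M (xq q) <= nv M v + nv M (vscal (tq q) h)) in T.
        rewrite nv_scal, Rabs_pos_eq in T by (apply Rlt_le, Htq). fold Nhh in T. generalize (proj2 (Htq q)); lra. }
      assert (Lx : forall s, coord_lim (fun q => vscal s (xq q)) (vscal s v)).
      { intros s a. unfold vscal, xq, vadd.
        replace (Finite (s * v a)) with (Finite (s * (v a + 0 * h a))) by (f_equal; ring).
        apply is_lim_seq_mult'; [apply is_lim_seq_const|]. apply is_lim_seq_plus'; [apply is_lim_seq_const|].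
        unfold vscal. apply is_lim_seq_mult'; [exact Ltq|apply is_lim_seq_const]. }
      assert (Bs : forall s q, 1 - eta <= s <= 1 + eta -> Vball M n (vscal s (xq q)) /\ Rabs s * nv M (xq q) < 2).
      { intros s q Hs. assert (Q := Nx q). assert (Q0 := nv_nonneg M (xq q)).
        assert (Rabs s * nv M (xq q) < 2) by (rewrite Rabs_pos_eq by lra; nra).
        split; [apply Vball_scal; [apply Sx|lra]|assumption]. }
      assert (L1 := Nh_lim _ _ (fun q => proj1 (Bs (1 - eta) q ltac:(lra))) (Vball_scal (1 - eta) v (proj1 Hv) ltac:(rewrite Rabs_pos_eq by lra; nra)) (Lx (1 - eta))).
      assert (L2 := Nh_lim _ _ (fun q => proj1 (Bs (1 + eta) q ltac:(lra))) (Vball_scal (1 + eta) v (proj1 Hv) ltac:(rewrite Rabs_pos_eq by lra; nra)) (Lx (1 + eta))).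
      destruct Sgn as [Sg1 Sg2].
      apply is_lim_seq_spec in L1. apply is_lim_seq_spec in L2. apply is_lim_seq_spec in Ltq.
      destruct (L1 (mkposreal _ Sg1)) as [Q1 HQ1].
      destruct (L2 (mkposreal (- Nh (vscal (1 + eta) v)) ltac:(lra))) as [Q2 HQ2].
      assert (Hthr : 0 < c / (4 * (C * Nhh ^ 2 * 2 + 1))).
      { apply Rdiv_lt_0_compat; [lra|]. assert (0 <= C * Nhh ^ 2) by (apply Rmult_le_pos; [exact HC|apply pow2_ge_0]). lra. }
      destruct (Ltq (mkposreal _ Hthr)) as [Q3 HQ3].
      set (q := Nat.max Q1 (Nat.max Q2 Q3)).
      specialize (HQ1 q ltac:(unfold q; lia)). specialize (HQ2 q ltac:(unfold q; lia)). specialize (HQ3 q ltac:(unfold q; lia)).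
      cbn [pos] in HQ1, HQ2, HQ3. apply Rabs_lt_between in HQ1. apply Rabs_lt_between in HQ2. rewrite Rminus_0_r in HQ3.
      apply Rabs_lt_between in HQ3.
      (* The sign change of [Nh] along the ray of [v] persists for nearby [v + t h]. Only the
         existence of such an [s] is used, so no implicit function theorem is involved. *)
      destruct (Nh_ray_zero (1 - eta) (1 + eta) (xq q) (Sx q)) as [s [Hs Hz]]; [lra| |lra|lra|].
      { assert (Q := Nx q). assert (Q0 := nv_nonneg M (xq q)). nra. }
      destruct (Bs s q Hs) as [Bsq Bsq'].
      destruct (Htq q) as [T0 T1].
      assert (Nlow : nv M v - / 20 <= nv M (xq q)).
      { assert (T := nw_triang_minus M k2 (xq q) (vscal (tq q) h) k2_nonneg).
        rewrite (nw_ext M k2 _ v) in T by (intros; unfold xq, vadd; ring).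
        fold (nv M v) (nv M (xq q)) (nv M (vscal (tq q) h)) in T. rewrite nv_scal, Rabs_pos_eq in T by lra. fold Nhh in T. lra. }
      assert (NSpos : 0 < nv M (vscal s (xq q))) by (rewrite nv_scal, Rabs_pos_eq by lra; nra).
      assert (NS : NehS (vscal s (xq q))).
      { split; [now apply supp_scal|split; [split|exact Hz]].
        - apply Rnot_lt_le; intros L. assert (X := Nh_pos_small _ (supp_scal s _ (Sx q)) NSpos ltac:(lra)). lra.
        - rewrite nv_scal, Rabs_pos_eq by lra. assert (Q := Nx q).
          assert (nv M v ^ 2 <= 1 + 15 / 180) by nra. assert (nv M v <= 105 / 100) by nra.
          assert (X1 : s * nv M (xq q) <= 105 / 100 * (110 / 100)) by (apply Rmult_le_compat; lra).
          assert (X0 : 0 <= s * nv M (xq q)) by (apply Rmult_le_pos; lra).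
          set (X := s * nv M (xq q)) in *. clearbody X. nra. }
      assert (Mn := Hmin _ NS).
      (* Now [Psi(s v) <= Psi(v) <= Psi(s (v + t h))]: the radial motion drops out and only the
         increment in the direction [h] is left, which a negative [dP] makes negative for small
         [t]. *)
      assert (Mx := nehari_ray_max v s (proj1 Hv) ltac:(lra) (proj2 (proj2 Hv)) ltac:(lra)).
      assert (EX : vscal s (xq q) = vadd (vscal s v) (vscal (s * tq q) h)).
      { apply functional_extensionality; intros; unfold xq, vadd, vscal; ring. }
      assert (T := HCT (vscal s v) (vscal (s * tq q) h) (Vball_scal s v (proj1 Hv) ltac:(rewrite Rabs_pos_eq by lra; nra)) (supp_scal _ _ Hh)).
      rewrite <- EX in T. specialize (T Bsq). rewrite dP_scal, nv_scal in T. fold Nhh in T.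
      apply Rabs_le_between in T.
      assert (D := HdP s Hs).
      rewrite Rpow_mult_distr, pow2_abs in T.
      set (t := tq q) in *.
      assert (st : 0 < s * t) by (apply Rmult_lt_0_compat; lra).
      assert (I1 : 0 <= s * t * dP (vscal s v) h + C * ((s * t) ^ 2 * Nhh ^ 2)) by lra.
      assert (I2 : s * t * (c / 2) <= C * ((s * t) ^ 2 * Nhh ^ 2)) by nra.
      assert (I3 : c / 2 <= C * Nhh ^ 2 * (s * t)).
      { apply Rmult_le_reg_l with (s * t); [exact st|].
        replace (s * t * (C * Nhh ^ 2 * (s * t))) with (C * ((s * t) ^ 2 * Nhh ^ 2)) by ring. exact I2. }
      set (X := C * Nhh ^ 2) in *. assert (X0 : 0 <= X) by (apply Rmult_le_pos; [exact HC|apply pow2_ge_0]).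
      assert (I4 : X * (s * t) <= X * (2 * t)) by (apply Rmult_le_compat_l; [exact X0|nra]).
      assert (I5 : t * (4 * (X * 2 + 1)) < c).
      { apply Rmult_lt_reg_r with (/ (4 * (X * 2 + 1))); [apply Rinv_0_lt_compat; lra|].
        rewrite Rmult_assoc, Rinv_r, Rmult_1_r by lra. apply HQ3. }
      nra. }
    intros h Hh. apply Rle_antisym; [|now apply Main].
    assert (X := Main (vscal (-1) h) (supp_scal (-1) h Hh)). rewrite dP_scal in X. lra.
Qed.

End Nehari.

(** * Regularity uniform in the grid size *)

Definition k4 (a : nat * nat) : R := INR (fst a) ^ 4.
Definition k6 (a : nat * nat) : R := INR (fst a) ^ 6.
Definition ktimes (c : nat * nat -> R) (a : nat * nat) : R := INR (fst a) * c a.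

(** Chain rules for second and third differences; the [y] will be consecutive time samples of one
    function. *)
Record nonlin_diff (phi : R -> R) (A : R) : Prop := {
  nd_two : forall y0 y1 y2, Rabs y0 <= 7 -> Rabs y1 <= 7 -> Rabs y2 <= 7 ->
    Rabs (phi y2 - 2 * phi y1 + phi y0) <= A * Rabs (y2 - 2 * y1 + y0) + A * (Rabs (y1 - y0) ^ 2 + Rabs (y2 - y1) ^ 2);
  nd_three : forall y0 y1 y2 y3, Rabs y0 <= 7 -> Rabs y1 <= 7 -> Rabs y2 <= 7 -> Rabs y3 <= 7 ->
    Rabs (phi y3 - 3 * phi y2 + 3 * phi y1 - phi y0)
    <= 160 * A * (Rabs (y3 - 3 * y2 + 3 * y1 - y0)
         + Rabs (y2 - 2 * y1 + y0) * (Rabs (y1 - y0) + Rabs (y2 - y1) + Rabs (y3 - y2))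
         + (Rabs (y1 - y0) + Rabs (y2 - y1) + Rabs (y3 - y2)) ^ 3) }.

Lemma k4_nonneg a : 0 <= k4 a.
Proof. unfold k4; replace (INR (fst a) ^ 4) with ((INR (fst a) ^ 2) ^ 2) by ring; apply pow2_ge_0. Qed.
Lemma k6_nonneg a : 0 <= k6 a.
Proof. unfold k6; replace (INR (fst a) ^ 6) with ((INR (fst a) ^ 3) ^ 2) by ring; apply pow2_ge_0. Qed.

Section Regularity.
Variable M : nat.
Hypothesis HM : (2 <= M)%nat.

Let Mpos : 0 < INR M.
Proof. apply lt_0_INR; lia. Qed.

Lemma D2_ev_bounds c : nw M k4 c <= n2 M (D2 M (ev M 0 c)) <= 16 * nw M k4 c.
Proof.
assert (E : n2 M (D2 M (ev M 0 c)) ^ 2 = lsum (Md M) (fun a => mu M a * (INR M ^ 2 * thq M (fst a)) ^ 2 * c a ^ 2)).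
{ rewrite n2_sq by exact HM. unfold D2.
  rewrite (avg_ext M _ (fun p => INR M ^ 4 * (ev M 0 c (S (S (fst p)), snd p) - 2 * ev M 0 c (S (fst p), snd p) + ev M 0 c p) ^ 2)) by (intros; ring).
  rewrite avg_scal, avg_diff2_ev, <- lsum_scal by exact HM. apply lsum_ext; intros; ring. }
assert (P := nw_nonneg M k4 c). assert (P' := n2_nonneg M (D2 M (ev M 0 c))).
split; apply sq_le_of_le; try lra.
- rewrite E, nw_sq by apply k4_nonneg. apply lsum_le; intros a Ha. apply in_Md in Ha.
  destruct (thq_bounds M (fst a) HM (proj1 Ha)) as [H _]. generalize (mu_bounds M a); intros [H1 H2].
  apply Rmult_le_compat_r; [apply pow2_ge_0|]. apply Rmult_le_compat_l; [lra|].
  unfold k4. replace (INR (fst a) ^ 4) with ((INR (fst a) ^ 2) ^ 2) by ring. apply pow_incr; split; [apply pow2_ge_0|exact H].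
- rewrite E, Rpow_mult_distr, nw_sq by apply k4_nonneg. rewrite <- lsum_scal. apply lsum_le; intros a Ha. apply in_Md in Ha.
  destruct (thq_bounds M (fst a) HM (proj1 Ha)) as [H0 H]. generalize (mu_bounds M a); intros [H1 H2].
  replace (16 ^ 2 * (mu M a * k4 a * c a ^ 2)) with (mu M a * (16 * INR (fst a) ^ 2) ^ 2 * c a ^ 2) by (unfold k4; ring).
  apply Rmult_le_compat_r; [apply pow2_ge_0|]. apply Rmult_le_compat_l; [lra|].
  apply pow_incr; split; [|exact H]. eapply Rle_trans; [apply pow2_ge_0|exact H0].
Qed.

Lemma D3_ev_bounds c : nw M k6 c <= n2 M (D3 M (ev M 0 c)) <= 64 * nw M k6 c.
Proof.
assert (E : n2 M (D3 M (ev M 0 c)) ^ 2 = lsum (Md M) (fun a => mu M a * (INR M ^ 2 * thq M (fst a)) ^ 3 * c a ^ 2)).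
{ rewrite n2_sq by exact HM. unfold D3.
  rewrite (avg_ext M _ (fun p => INR M ^ 6 * (ev M 0 c (S (S (S (fst p))), snd p) - 3 * ev M 0 c (S (S (fst p)), snd p) + 3 * ev M 0 c (S (fst p), snd p) - ev M 0 c p) ^ 2)) by (intros; ring).
  rewrite avg_scal, avg_diff3_ev, <- lsum_scal by exact HM. apply lsum_ext; intros; ring. }
assert (P := nw_nonneg M k6 c). assert (P' := n2_nonneg M (D3 M (ev M 0 c))).
split; apply sq_le_of_le; try lra.
- rewrite E, nw_sq by apply k6_nonneg. apply lsum_le; intros a Ha. apply in_Md in Ha.
  destruct (thq_bounds M (fst a) HM (proj1 Ha)) as [H _]. generalize (mu_bounds M a); intros [H1 H2].
  apply Rmult_le_compat_r; [apply pow2_ge_0|]. apply Rmult_le_compat_l; [lra|].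
  unfold k6. replace (INR (fst a) ^ 6) with ((INR (fst a) ^ 2) ^ 3) by ring. apply pow_incr; split; [apply pow2_ge_0|exact H].
- rewrite E, Rpow_mult_distr, nw_sq by apply k6_nonneg. rewrite <- lsum_scal. apply lsum_le; intros a Ha. apply in_Md in Ha.
  destruct (thq_bounds M (fst a) HM (proj1 Ha)) as [H0 H]. generalize (mu_bounds M a); intros [H1 H2].
  replace (64 ^ 2 * (mu M a * k6 a * c a ^ 2)) with (mu M a * (16 * INR (fst a) ^ 2) ^ 3 * c a ^ 2) by (unfold k6; ring).
  apply Rmult_le_compat_r; [apply pow2_ge_0|]. apply Rmult_le_compat_l; [lra|].
  apply pow_incr; split; [|exact H]. eapply Rle_trans; [apply pow2_ge_0|exact H0].
Qed.

Lemma DX_ev_bounds c : nw M j2 c <= n2 M (DX M (ev M 0 c)) <= 4 * nw M j2 c.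
Proof.
assert (E : n2 M (DX M (ev M 0 c)) ^ 2 = lsum (Md M) (fun a => mu M a * (INR M ^ 2 * thq M (snd a)) * c a ^ 2)).
{ rewrite n2_sq by exact HM. unfold DX.
  rewrite (avg_ext M _ (fun p => INR M ^ 2 * (ev M 0 c (fst p, S (snd p)) - ev M 0 c p) ^ 2)) by (intros; ring).
  rewrite avg_scal, avg_xdiff_ev, <- lsum_scal by exact HM. apply lsum_ext; intros; ring. }
assert (P := nw_nonneg M j2 c). assert (P' := n2_nonneg M (DX M (ev M 0 c))).
split; apply sq_le_of_le; try lra.
- rewrite E, nw_sq by apply j2_nonneg. apply lsum_le; intros a Ha. apply in_Md in Ha.
  destruct (thq_bounds M (snd a) HM ltac:(lia)) as [H _]. generalize (mu_bounds M a); intros [H1 H2].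
  apply Rmult_le_compat_r; [apply pow2_ge_0|]. apply Rmult_le_compat_l; [lra|exact H].
- rewrite E, Rpow_mult_distr, nw_sq by apply j2_nonneg. rewrite <- lsum_scal. apply lsum_le; intros a Ha. apply in_Md in Ha.
  destruct (thq_bounds M (snd a) HM ltac:(lia)) as [_ H]. generalize (mu_bounds M a); intros [H1 H2].
  replace (4 ^ 2 * (mu M a * j2 a * c a ^ 2)) with (mu M a * (16 * INR (snd a) ^ 2) * c a ^ 2) by (unfold j2; ring).
  apply Rmult_le_compat_r; [apply pow2_ge_0|]. apply Rmult_le_compat_l; [lra|exact H].
Qed.

Lemma nw_hat_D2 g : grid_class M g -> nw M k4 (hat M g) <= n2 M (D2 M g).
Proof.
intros Hg. destruct (D2_ev_bounds (hat M g)) as [H _]. eapply Rle_trans; [exact H|].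
apply Req_le, n2_ext; intros [m i] Hp; apply in_Pt in Hp; unfold D2; cbn [fst snd] in *.
rewrite !fourier_inversion by (cbn [snd]; lia || assumption). reflexivity.
Qed.

Lemma nw_hat_D3 g : grid_class M g -> nw M k6 (hat M g) <= n2 M (D3 M g).
Proof.
intros Hg. destruct (D3_ev_bounds (hat M g)) as [H _]. eapply Rle_trans; [exact H|].
apply Req_le, n2_ext; intros [m i] Hp; apply in_Pt in Hp; unfold D3; cbn [fst snd] in *.
rewrite !fourier_inversion by (cbn [snd]; lia || assumption). reflexivity.
Qed.

Lemma nw_hat_DX g : grid_class M g -> nw M j2 (hat M g) <= n2 M (DX M g).
Proof.
intros Hg. destruct (DX_ev_bounds (hat M g)) as [H _]. eapply Rle_trans; [exact H|].
apply Req_le, n2_ext; intros [m i] Hp; apply in_Pt in Hp; unfold DX; cbn [fst snd] in *.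
rewrite !fourier_inversion by (cbn [snd]; lia || assumption). reflexivity.
Qed.

Lemma cos_lipschitz x y : Rabs (cos x - cos y) <= Rabs (x - y).
Proof.
destruct (MVT_gen cos y x (fun z => - sin z)) as [c [_ E]].
- intros; apply is_derive_cos.
- intros; apply continuity_pt_filterlim, continuous_cos.
- rewrite E, Rabs_mult, Rabs_Ropp. rewrite <- (Rmult_1_l (Rabs (x - y))) at 2.
  apply Rmult_le_compat_r; [apply Rabs_pos|]. apply Rabs_le, SIN_bound.
Qed.

(** One time step changes the phase by [PI k / M]; the 4 bounds [PI]. *)
Lemma D1_ev_sup c p : Rabs (D1 M (ev M 0 c) p) <= 4 * lsum (Md M) (fun a => Rabs (ktimes c a)).
Proof.
unfold D1, ev. rewrite <- lsum_minus, <- lsum_scal. eapply Rle_trans; [apply lsum_abs|].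
rewrite <- lsum_scal. apply lsum_le; intros a _. rewrite !bas0; cbn [fst snd]. unfold ktimes.
set (K := INR (fst a)). assert (K0 : 0 <= K) by apply pos_INR.
replace (INR M * (c a * (tc M (fst a) (S (fst p)) * ts M (snd a) (snd p)) - c a * (tc M (fst a) (fst p) * ts M (snd a) (snd p))))
  with (c a * (ts M (snd a) (snd p) * (INR M * (tc M (fst a) (S (fst p)) - tc M (fst a) (fst p))))) by ring.
rewrite !Rabs_mult, (Rabs_pos_eq (INR M)), (Rabs_pos_eq K) by lra.
assert (T : INR M * Rabs (tc M (fst a) (S (fst p)) - tc M (fst a) (fst p)) <= 4 * K).
{ apply Rle_trans with (INR M * Rabs (PI * K * INR (S (fst p)) / INR M - PI * K * INR (fst p) / INR M)).
  - apply Rmult_le_compat_l; [lra|]. apply cos_lipschitz.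
  - rewrite S_INR. replace (PI * K * (INR (fst p) + 1) / INR M - PI * K * INR (fst p) / INR M) with (PI * K / INR M) by (field; lra).
    assert (HP := PI_RGT_0). assert (HP4 := PI_4).
    rewrite Rabs_pos_eq by (apply Rdiv_le_0_compat; [apply Rmult_le_pos; lra|lra]).
    replace (INR M * (PI * K / INR M)) with (PI * K) by (field; lra). apply Rmult_le_compat_r; lra. }
assert (S1 : Rabs (ts M (snd a) (snd p)) <= 1) by (apply Rabs_le, SIN_bound).
assert (X : Rabs (ts M (snd a) (snd p)) * (INR M * Rabs (tc M (fst a) (S (fst p)) - tc M (fst a) (fst p))) <= 1 * (4 * K)).
{ apply Rmult_le_compat; [apply Rabs_pos| |exact S1|exact T]. apply Rmult_le_pos; [lra|apply Rabs_pos]. }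
replace (4 * (K * Rabs (c a))) with (Rabs (c a) * (1 * (4 * K))) by ring.
apply Rmult_le_compat_l; [apply Rabs_pos|exact X].
Qed.

Variables (phi : R -> R) (A : R).
Hypothesis HA0 : 0 <= A.
Hypothesis Hphi : nonlin phi A.
Hypothesis Hd : nonlin_diff phi A.

Lemma n2_shift g s : (forall m i, g ((m + 2 * M)%nat, i) = g (m, i)) -> n2 M (fun p => g ((fst p + s)%nat, snd p)) = n2 M g.
Proof.
intros H. assert (P1 := n2_nonneg M g). assert (P2 := n2_nonneg M (fun p => g ((fst p + s)%nat, snd p))).
apply Rsqr_inj; try assumption. unfold Rsqr.
replace (n2 M (fun p => g ((fst p + s)%nat, snd p)) * n2 M (fun p => g ((fst p + s)%nat, snd p))) with (n2 M (fun p => g ((fst p + s)%nat, snd p)) ^ 2) by ring.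
replace (n2 M g * n2 M g) with (n2 M g ^ 2) by ring.
rewrite !n2_sq by exact HM. apply (avg_shift M s (fun p => g p ^ 2)). intros; now rewrite H.
Qed.

Lemma D1_ev_period c m i : D1 M (ev M 0 c) ((m + 2 * M)%nat, i) = D1 M (ev M 0 c) (m, i).
Proof.
unfold D1; cbn [fst snd]. replace (S (m + 2 * M)) with (S m + 2 * M)%nat by lia.
now rewrite !(gc_period _ _ (ev_grid_class M HM c)).
Qed.

Lemma n2_D1_shift c s : n2 M (fun p => D1 M (ev M 0 c) ((fst p + s)%nat, snd p)) = n2 M (D1 M (ev M 0 c)).
Proof. apply n2_shift, D1_ev_period. Qed.

Variable c : nat * nat -> R.
Hypothesis Hc : forall p, Rabs (ev M 0 c p) <= 7.
Let L := 4 * lsum (Md M) (fun a => Rabs (ktimes c a)).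

Let L_nonneg : 0 <= L.
Proof. unfold L. apply Rmult_le_pos; [lra|]. apply lsum_nonneg; intros; apply Rabs_pos. Qed.

Lemma fhat_D2 : nw M k4 (fhat M phi c) <= A * (16 * nw M k4 c + 8 * L * nw M k2 c).
Proof.
unfold fhat. eapply Rle_trans; [apply nw_hat_D2, grid_class_comp; [apply Hphi|apply ev_grid_class, HM]|].
set (u := ev M 0 c).
set (sh := fun s p => D1 M u ((fst p + s)%nat, snd p)).
(* In each squared first difference one factor is bounded in sup by [L], the other stays in the
   square norm; its shift in time does not change that norm. *)
apply Rle_trans with (n2 M (fun p => A * Rabs (D2 M u p) + (A * L * Rabs (sh 0%nat p) + A * L * Rabs (sh 1%nat p)))).
- apply n2_le; [exact HM|]. intros [m i] _. unfold sh, D1, D2; cbn [fst snd].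
  replace (m + 0)%nat with m by lia. replace (m + 1)%nat with (S m) by lia.
  assert (T := nd_two _ _ Hd (u (m, i)) (u (S m, i)) (u (S (S m), i)) (Hc _) (Hc _) (Hc _)).
  assert (S0 := D1_ev_sup c (m, i)). assert (S1 := D1_ev_sup c (S m, i)). fold L u in S0, S1.
  unfold D1 in S0, S1; cbn [fst snd] in S0, S1.
  rewrite Rabs_mult, (Rabs_pos_eq (INR M)) in S0, S1 by lra.
  rewrite !Rabs_mult, (Rabs_pos_eq (INR M ^ 2)), (Rabs_pos_eq (INR M)) by (try apply pow2_ge_0; lra).
  set (d2 := Rabs (u (S (S m), i) - 2 * u (S m, i) + u (m, i))) in *.
  set (a0 := Rabs (u (S m, i) - u (m, i))) in *. set (a1 := Rabs (u (S (S m), i) - u (S m, i))) in *.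
  assert (0 <= a0) by apply Rabs_pos. assert (0 <= a1) by apply Rabs_pos. assert (0 <= d2) by apply Rabs_pos.
  eapply Rle_trans; [|apply Rle_abs].
  apply Rle_trans with (INR M ^ 2 * (A * d2 + A * (a0 ^ 2 + a1 ^ 2))).
  + apply Rmult_le_compat_l; [apply pow2_ge_0|exact T].
  + replace (INR M ^ 2 * (A * d2 + A * (a0 ^ 2 + a1 ^ 2)))
      with (A * (INR M ^ 2 * d2) + (A * (INR M * a0 * (INR M * a0)) + A * (INR M * a1 * (INR M * a1)))) by ring.
    apply Rplus_le_compat_l.
    rewrite !(Rmult_assoc A L).
    apply Rplus_le_compat; apply Rmult_le_compat_l; try exact HA0; apply Rmult_le_compat_r; (assumption || apply Rmult_le_pos; lra).
- assert (AL : 0 <= A * L) by (apply Rmult_le_pos; lra).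
  eapply Rle_trans; [apply n2_triang, HM|].
  assert (E1 : n2 M (fun p => A * Rabs (D2 M u p)) <= A * (16 * nw M k4 c)).
  { eapply Rle_trans; [apply (n2_le_scal M HM A _ (D2 M u) HA0); intros; rewrite Rabs_mult, Rabs_Rabsolu, (Rabs_pos_eq A) by exact HA0; apply Rle_refl|].
    apply Rmult_le_compat_l; [exact HA0|]. apply D2_ev_bounds. }
  assert (E2 : n2 M (fun p => A * L * Rabs (sh 0%nat p) + A * L * Rabs (sh 1%nat p)) <= A * L * (4 * nw M k2 c) + A * L * (4 * nw M k2 c)).
  { eapply Rle_trans; [apply (n2_le_two M HM (A * L) (A * L) _ (sh 0%nat) (sh 1%nat) AL AL)|].
    - intros p _. rewrite Rabs_pos_eq; [apply Rle_refl|]. apply Rplus_le_le_0_compat; apply Rmult_le_pos; auto using Rabs_pos.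
    - unfold sh, u. rewrite !n2_D1_shift.
      apply Rplus_le_compat; apply Rmult_le_compat_l; try exact AL; apply D1_ev_bounds, HM. }
  lra.
Qed.

(** In every product of differences all factors but one are first differences and are bounded by [L]
    in sup; the top-order term stays linear, so it can be absorbed later. *)
Lemma fhat_D3 : nw M k6 (fhat M phi c) <= 160 * A * (64 * nw M k6 c + 48 * L * nw M k4 c + 108 * L ^ 2 * nw M k2 c).
Proof.
unfold fhat. eapply Rle_trans; [apply nw_hat_D3, grid_class_comp; [apply Hphi|apply ev_grid_class, HM]|].
set (u := ev M 0 c).
set (sh := fun s p => D1 M u ((fst p + s)%nat, snd p)).
assert (A160 : 0 <= 160 * A) by lra.
assert (L2 : 0 <= 9 * L ^ 2) by (generalize (pow2_ge_0 L); lra).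
apply Rle_trans with (160 * A * n2 M (fun p => (1 * Rabs (D3 M u p) + 3 * L * Rabs (D2 M u p))
   + (9 * L ^ 2 * Rabs (sh 0%nat p) + (9 * L ^ 2 * Rabs (sh 1%nat p) + 9 * L ^ 2 * Rabs (sh 2%nat p))))).
- apply n2_le_scal; [exact HM|exact A160|]. intros [m i] _. unfold sh, D1, D2, D3; cbn [fst snd].
  replace (m + 0)%nat with m by lia. replace (m + 1)%nat with (S m) by lia. replace (m + 2)%nat with (S (S m)) by lia.
  assert (T := nd_three _ _ Hd (u (m, i)) (u (S m, i)) (u (S (S m), i)) (u (S (S (S m)), i)) (Hc _) (Hc _) (Hc _) (Hc _)).
  assert (S0 := D1_ev_sup c (m, i)). assert (S1 := D1_ev_sup c (S m, i)). assert (S2 := D1_ev_sup c (S (S m), i)). fold L u in S0, S1, S2.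
  unfold D1 in S0, S1, S2; cbn [fst snd] in S0, S1, S2.
  rewrite Rabs_mult, (Rabs_pos_eq (INR M)) in S0, S1, S2 by lra.
  assert (P3 : 0 <= INR M ^ 3) by (apply pow_le; lra).
  rewrite !Rabs_mult, (Rabs_pos_eq (INR M ^ 3)), (Rabs_pos_eq (INR M ^ 2)), (Rabs_pos_eq (INR M)) by (try apply pow2_ge_0; lra).
  set (d3 := Rabs (u (S (S (S m)), i) - 3 * u (S (S m), i) + 3 * u (S m, i) - u (m, i))) in *.
  set (d2 := Rabs (u (S (S m), i) - 2 * u (S m, i) + u (m, i))) in *.
  set (a0 := Rabs (u (S m, i) - u (m, i))) in *. set (a1 := Rabs (u (S (S m), i) - u (S m, i))) in *.
  set (a2 := Rabs (u (S (S (S m)), i) - u (S (S m), i))) in *.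
  assert (0 <= a0) by apply Rabs_pos. assert (0 <= a1) by apply Rabs_pos. assert (0 <= a2) by apply Rabs_pos.
  assert (0 <= d2) by apply Rabs_pos. assert (0 <= d3) by apply Rabs_pos.
  eapply Rle_trans; [|apply Rmult_le_compat_l; [exact A160|apply Rle_abs]].
  apply Rle_trans with (INR M ^ 3 * (160 * A * (d3 + d2 * (a0 + a1 + a2) + (a0 + a1 + a2) ^ 3))).
  + apply Rmult_le_compat_l; [exact P3|exact T].
  + set (s := INR M * a0 + INR M * a1 + INR M * a2).
    assert (s3 : 0 <= s <= 3 * L).
    { unfold s; split; [|lra]. repeat apply Rplus_le_le_0_compat; apply Rmult_le_pos; lra. }
    assert (d2' : 0 <= INR M ^ 2 * d2) by (apply Rmult_le_pos; [apply pow2_ge_0|assumption]).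
    replace (INR M ^ 3 * (160 * A * (d3 + d2 * (a0 + a1 + a2) + (a0 + a1 + a2) ^ 3)))
      with (160 * A * (INR M ^ 3 * d3 + INR M ^ 2 * d2 * s + s ^ 2 * s)) by (unfold s; ring).
    apply Rmult_le_compat_l; [exact A160|].
    assert (s ^ 2 <= 9 * L ^ 2) by nra.
    assert (INR M ^ 2 * d2 * s <= INR M ^ 2 * d2 * (3 * L)) by (apply Rmult_le_compat_l; lra).
    assert (s ^ 2 * s <= 9 * L ^ 2 * s) by (apply Rmult_le_compat_r; lra).
    unfold s in *. lra.
- apply Rmult_le_compat_l; [exact A160|].
  assert (Sh : forall s, n2 M (sh s) <= 4 * nw M k2 c).
  { intros s. unfold sh, u. rewrite n2_D1_shift. apply D1_ev_bounds, HM. }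
  eapply Rle_trans; [apply n2_triang, HM|].
  assert (E1 : n2 M (fun p => 1 * Rabs (D3 M u p) + 3 * L * Rabs (D2 M u p)) <= 1 * (64 * nw M k6 c) + 3 * L * (16 * nw M k4 c)).
  { eapply Rle_trans; [apply (n2_le_two M HM 1 (3 * L) _ (D3 M u) (D2 M u)); [lra|lra|]|].
    - intros p _. rewrite Rabs_pos_eq; [apply Rle_refl|]. apply Rplus_le_le_0_compat; apply Rmult_le_pos; try apply Rabs_pos; lra.
    - apply Rplus_le_compat; apply Rmult_le_compat_l; try lra; [apply D3_ev_bounds|apply D2_ev_bounds]. }
  assert (E2 : n2 M (fun p => 9 * L ^ 2 * Rabs (sh 1%nat p) + 9 * L ^ 2 * Rabs (sh 2%nat p)) <= 9 * L ^ 2 * (4 * nw M k2 c) + 9 * L ^ 2 * (4 * nw M k2 c)).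
  { eapply Rle_trans; [apply (n2_le_two M HM (9 * L ^ 2) (9 * L ^ 2) _ (sh 1%nat) (sh 2%nat) L2 L2)|].
    - intros p _. rewrite Rabs_pos_eq; [apply Rle_refl|]. apply Rplus_le_le_0_compat; apply Rmult_le_pos; auto using Rabs_pos.
    - apply Rplus_le_compat; apply Rmult_le_compat_l; auto. }
  assert (E3 : n2 M (fun p => 9 * L ^ 2 * Rabs (sh 0%nat p)) <= 9 * L ^ 2 * (4 * nw M k2 c)).
  { eapply Rle_trans; [apply (n2_le_scal M HM (9 * L ^ 2) _ (sh 0%nat) L2); intros; rewrite Rabs_mult, Rabs_Rabsolu, (Rabs_pos_eq (9 * L ^ 2)) by exact L2; apply Rle_refl|].
    apply Rmult_le_compat_l; auto. }
  assert (E4 := n2_triang M HM (fun p => 9 * L ^ 2 * Rabs (sh 0%nat p)) (fun p => 9 * L ^ 2 * Rabs (sh 1%nat p) + 9 * L ^ 2 * Rabs (sh 2%nat p))).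
  cbn beta in E4. lra.
Qed.

Lemma fhat_DX : nw M j2 (fhat M phi c) <= 4 * A * nw M j2 c.
Proof.
unfold fhat. eapply Rle_trans; [apply nw_hat_DX, grid_class_comp; [apply Hphi|apply ev_grid_class, HM]|].
eapply Rle_trans; [apply (n2_le_scal M HM A _ (DX M (ev M 0 c)) HA0)|].
- intros p _. unfold DX. rewrite !Rabs_mult, (Rabs_pos_eq (INR M)) by lra.
  assert (T := nl_lip _ _ Hphi (ev M 0 c (fst p, S (snd p))) (ev M 0 c p) (Hc _) (Hc _)).
  apply Rmult_le_compat_l with (r := INR M) in T; lra.
- rewrite (Rmult_comm 4 A), Rmult_assoc. apply Rmult_le_compat_l; [exact HA0|]. apply DX_ev_bounds.
Qed.

End Regularity.

Definition rho3 (a : nat * nat) : R := / (INR (snd a) ^ 2 + (1 + INR (fst a)) ^ 4).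
(** One summable weight for each source: modes off V through [lam_T2], modes on V, and the
    right-hand side [g] itself. It does not depend on [M]. *)
Definition rhot (J : nat -> nat) (n : nat) (a : nat * nat) : R :=
  rho1 J a + rho1 (fun k => n * k)%nat a + rho3 a.

Lemma rho3_pos a : 0 < rho3 a.
Proof.
unfold rho3. apply Rinv_0_lt_compat.
assert (0 < (1 + INR (fst a)) ^ 4) by (apply pow_lt; generalize (pos_INR (fst a)); lra).
generalize (pow2_ge_0 (INR (snd a))); lra.
Qed.

Lemma sum_inv_sq_shift K L : 0 < K -> lsum (seq 1 L) (fun j => / (INR j ^ 2 + K ^ 2)) <= 2 / K.
Proof.
intros HK.
assert (H : lsum (seq 1 L) (fun j => / (INR j ^ 2 + K ^ 2)) <= 2 / K - 2 / (INR L + K)).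
{ induction L as [|L IH].
  - cbn [seq INR]. rewrite Rplus_0_l. unfold lsum; cbn. lra.
  - rewrite seq_S, lsum_app, lsum_cons. cbn [Nat.add]. unfold lsum at 2; cbn [fold_right]. rewrite Rplus_0_r.
    rewrite S_INR. assert (PL := pos_INR L).
    assert (/ ((INR L + 1) ^ 2 + K ^ 2) <= 2 / (INR L + K) - 2 / (INR L + 1 + K)); [|lra].
    replace (2 / (INR L + K) - 2 / (INR L + 1 + K)) with (/ ((INR L + K) * (INR L + 1 + K) / 2)) by (field; lra).
    apply Rinv_le_contravar; [|generalize (pow2_ge_0 (INR L + 1 - K)); intros; lra].
    assert (0 < (INR L + K) * (INR L + 1 + K)) by (apply Rmult_lt_0_compat; lra). lra. }
assert (0 < 2 / (INR L + K)) by (apply Rdiv_lt_0_compat; generalize (pos_INR L); lra). lra.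
Qed.

Lemma sum_rhot J n K L : lsum (list_prod (seq 0 K) (seq 1 L)) (rhot J n) <= 36.
Proof.
unfold rhot. rewrite !lsum_plus.
assert (H1 := sum_rho1 J K 1 L). assert (H2 := sum_rho1 (fun k => n * k)%nat K 1 L).
assert (H3 : lsum (list_prod (seq 0 K) (seq 1 L)) rho3 <= 4); [|lra].
rewrite lsum_list_prod.
apply Rle_trans with (lsum (seq 0 K) (fun k => 2 * / (1 + INR k) ^ 2)).
- apply lsum_le; intros k _. unfold rho3; cbn [fst snd].
  assert (P : 0 < (1 + INR k) ^ 2) by (apply pow_lt; generalize (pos_INR k); lra).
  assert (H := sum_inv_sq_shift ((1 + INR k) ^ 2) L P).
  rewrite (lsum_ext _ _ (fun j => / (INR j ^ 2 + ((1 + INR k) ^ 2) ^ 2))) by (intros; do 2 f_equal; ring).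
  exact H.
- rewrite lsum_scal. generalize (sum_inv_sq K); lra.
Qed.

Lemma rho1_nk n k : rho1 (fun q => n * q)%nat (k, (n * k)%nat) = / (1 + INR k) ^ 2.
Proof. unfold rho1; cbn [fst snd]. rewrite Rminus_diag. f_equal. ring. Qed.

Section UniformBounds.
Variables (M n : nat) (om ga : R) (J : nat -> nat) (phi : R -> R) (A eps : R).
Hypothesis HM : (2 <= M)%nat.
Hypothesis Hn : (1 <= n)%nat.
Hypothesis Hom : / 2 <= om <= 3 / 2.
Hypothesis Hga : 0 < ga <= 3 / 2.
Hypothesis HW : in_W ga om.
Hypothesis HJ : forall k, Rabs (INR (J k) - om * INR n * INR k) <= / 2.
Hypothesis HA0 : 0 <= A.
Hypothesis HA : 1000000 * A <= ga.
Hypothesis Hphi : nonlin phi A.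
Hypothesis Hd : nonlin_diff phi A.
Hypothesis Heps : eps = (om ^ 2 - 1) * INR n ^ 2.
Hypothesis Heps0 : eps <> 0.
Variables v w : nat * nat -> R.
Hypothesis Hv : Vball M n v.
Hypothesis Hw : Sol M n om phi v w.
Let c := vadd v w.
Let g := fhat M phi c.
Hypothesis Heq : forall a, In a (Md M) -> lam n om a * c a + g a = 0.

(** From [nw onek2 g <= 40 A] and the V-equation [eps k^2 v = g]. It need not be small; only its
    independence of [M] matters. *)
Let b4 := 40 * A / Rabs eps.

Let Heps' : 0 < Rabs eps.
Proof. now apply Rabs_pos_lt. Qed.

Let b4_nonneg : 0 <= b4.
Proof. unfold b4; apply Rdiv_le_0_compat; lra. Qed.

Let Hc7 p : Rabs (ev M 0 c p) <= 7.
Proof. apply (ev_sum_7 M n); try assumption; apply Hw. Qed.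

Let AG : 0 <= A / ga <= / 1000000.
Proof.
split; [apply Rdiv_le_0_compat; lra|]. apply Rmult_le_reg_r with ga; [lra|].
unfold Rdiv; rewrite Rmult_assoc, Rinv_l; lra.
Qed.

Lemma c_on_V a : inV M n a = true -> c a = v a /\ eps * (INR (fst a) ^ 2 * v a) = g a.
Proof.
intros Ha. destruct (inV_true _ _ _ Ha) as [Hi HV].
assert (EW : inW M n a = false) by (rewrite (inV_inW M n a Hi), Ha; reflexivity).
assert (E : c a = v a) by (unfold c, vadd; rewrite (proj1 (proj1 Hw) a EW); ring).
split; [exact E|]. assert (H := Heq a Hi). rewrite E in H.
unfold isV in HV; apply Nat.eqb_eq in HV. unfold lam in H. rewrite HV, mult_INR in H. rewrite Heps. lra.
Qed.

(** On V the equation reads [eps k^2 v = g] and so gains two time derivatives. *)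
Lemma nw_V_gain wt wt' : (forall a, 0 <= wt a) -> (forall a, 0 <= wt' a) ->
  (forall a, wt a = wt' a * INR (fst a) ^ 4) -> nw M wt v <= / Rabs eps * nw M wt' g.
Proof.
intros H1 H2 H3. apply nw_le_scal; auto; [apply Rlt_le, Rinv_0_lt_compat, Heps'|].
intros a Ha. rewrite H3. destruct (inV M n a) eqn:E.
- destruct (c_on_V a E) as [_ Eg]. rewrite <- Eg. apply Req_le.
  replace ((/ Rabs eps) ^ 2) with (/ eps ^ 2) by (rewrite <- (pow2_abs eps), pow_inv; reflexivity).
  field. exact Heps0.
- rewrite (proj1 Hv a E), pow_i by lia. rewrite Rmult_0_r.
  apply Rmult_le_pos; [apply pow2_ge_0|]. apply Rmult_le_pos; [apply H2|apply pow2_ge_0].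
Qed.

Lemma g_onek2 : nw M onek2 g <= 40 * A.
Proof.
assert (H1 := fhat_bound M phi A HM HA0 Hphi c Hc7).
assert (H2 := onek2_sum M n HM Hn v w Hv (proj1 Hw)). fold c in H2. fold g in H1.
assert (A * nw M onek2 c <= A * 5) by (apply Rmult_le_compat_l; lra). lra.
Qed.

Lemma w_T a : w a = Tinv M n om g a.
Proof. apply Hw. Qed.

Lemma nw_w wt : (forall a, 0 <= wt a) -> nw M wt w <= 6 / ga * nw M wt g.
Proof.
intros H. rewrite (nw_ext M wt w (Tinv M n om g)) by (intros; apply w_T).
exact (nw_T1 M n om ga J HM Hn Hom Hga HW HJ wt g H).
Qed.

Lemma nw_c wt : (forall a, 0 <= wt a) -> nw M wt c <= nw M wt v + 6 / ga * nw M wt g.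
Proof.
intros H. unfold c, vadd. eapply Rle_trans; [apply nw_triang, H|]. generalize (nw_w wt H); lra.
Qed.

Lemma v_k4 : nw M k4 v <= b4.
Proof.
eapply Rle_trans; [apply (nw_V_gain k4 one); [apply k4_nonneg|apply one_nonneg|intros; unfold k4, one; ring]|].
assert (H1 := g_onek2). assert (H2 := nw_one_le_onek2 M g). unfold b4.
replace (40 * A / Rabs eps) with (/ Rabs eps * (40 * A)) by (field; lra).
apply Rmult_le_compat_l; [apply Rlt_le, Rinv_0_lt_compat, Heps'|lra].
Qed.

Lemma v_k6 : nw M k6 v <= b4.
Proof.
eapply Rle_trans; [apply (nw_V_gain k6 k2); [apply k6_nonneg|apply k2_nonneg|intros; unfold k6, k2; ring]|].
assert (H1 := g_onek2). assert (H2 := nw_k2_le_onek2 M g). unfold b4.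
replace (40 * A / Rabs eps) with (/ Rabs eps * (40 * A)) by (field; lra).
apply Rmult_le_compat_l; [apply Rlt_le, Rinv_0_lt_compat, Heps'|lra].
Qed.

Lemma nat_cases (a : nat * nat) : INR (fst a) = 0 \/ 1 <= INR (fst a).
Proof. destruct (fst a) as [|k]; [left; reflexivity|right; rewrite S_INR; generalize (pos_INR k); lra]. Qed.

(** Multiplication by [k] commutes with [Tinv], so [l1_V] and [l1_T2] apply to the time
    derivative. *)
Lemma l1_kc : lsum (Md M) (fun a => Rabs (ktimes c a)) <= 3 * b4 + 136 / ga * nw M k4 g.
Proof.
apply Rle_trans with (lsum (Md M) (fun a => Rabs (ktimes v a)) + lsum (Md M) (fun a => Rabs (Tinv M n om (ktimes g) a))).
- rewrite <- lsum_plus. apply lsum_le; intros a _.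
  replace (Tinv M n om (ktimes g) a) with (ktimes w a).
  + unfold ktimes, c, vadd. rewrite Rmult_plus_distr_l. apply Rabs_triang.
  + unfold ktimes. rewrite w_T. unfold Tinv. destruct (inW M n a); [unfold Rdiv; ring|ring].
- apply Rplus_le_compat.
  + eapply Rle_trans; [apply (l1_V M n HM Hn)|].
    * intros a Ha. unfold ktimes. rewrite (proj1 Hv a Ha). ring.
    * apply Rmult_le_compat_l; [lra|]. eapply Rle_trans; [|apply v_k4]. apply Req_le.
      unfold nv, nw, nrm. f_equal. apply lsum_ext; intros; unfold k2, k4, ktimes; ring.
  + eapply Rle_trans; [exact (l1_T2 M n om ga J HM Hn Hom Hga HW HJ (ktimes g))|].
    replace (136 / ga * nw M k4 g) with (68 / ga * (2 * nw M k4 g)) by (field; lra).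
    apply Rmult_le_compat_l; [apply Rdiv_le_0_compat; lra|].
    apply nw_le_scal; auto using onek2_nonneg, k4_nonneg; [lra|]. intros a _.
    unfold onek2, k4, ktimes. destruct (nat_cases a) as [E|E]; [rewrite E; ring_simplify; lra|].
    set (k := INR (fst a)) in *. assert (0 <= g a ^ 2) by apply pow2_ge_0.
    replace ((1 + k ^ 2) * (k * g a) ^ 2) with ((1 + k ^ 2) * k ^ 2 * g a ^ 2) by ring.
    replace (2 ^ 2 * (k ^ 4 * g a ^ 2)) with (4 * k ^ 2 * k ^ 2 * g a ^ 2) by ring.
    apply Rmult_le_compat_r; [assumption|]. apply Rmult_le_compat_r; [apply pow2_ge_0|]. assert (1 <= k ^ 2) by nra. lra.
Qed.

(** The unknown norm is finite on the grid and reappears on the right with a factor of order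
    [A/ga <= 10^(-6)], so it is absorbed; this holds because [fhat_D2] is linear in the second-order
    norm and in [L]. *)
Lemma g_k4 : nw M k4 g <= 600 * A * b4.
Proof.
assert (H := fhat_D2 M HM phi A HA0 Hphi Hd c Hc7). fold g in H.
set (F := nw M k4 g) in *. assert (F0 : 0 <= F) by apply nw_nonneg.
assert (H1 := l1_kc). fold F in H1. set (S := lsum (Md M) (fun a => Rabs (ktimes c a))) in *.
assert (S0 : 0 <= S) by (apply lsum_nonneg; intros; apply Rabs_pos).
assert (H2 : nw M k2 c <= 5).
{ eapply Rle_trans; [apply nw_k2_le_onek2|]. apply (onek2_sum M n HM Hn v w Hv (proj1 Hw)). }
assert (H3 := nw_c k4 k4_nonneg). fold g F in H3. assert (H4 := v_k4).
assert (K0 := nw_nonneg M k2 c).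
assert (S * nw M k2 c <= S * 5) by (apply Rmult_le_compat_l; lra).
(* With [nw k2 c <= 5]: [496 = 16 + 160 * 3] and [21856 = 16 * 6 + 160 * 136]. *)
assert (B : 16 * nw M k4 c + 8 * (4 * S) * nw M k2 c <= 496 * b4 + 21856 / ga * F).
{ replace (21856 / ga * F) with (16 * (6 / ga * F) + 160 * (136 / ga * F)) by (field; lra). lra. }
assert (A * (16 * nw M k4 c + 8 * (4 * S) * nw M k2 c) <= A * (496 * b4 + 21856 / ga * F)) by (apply Rmult_le_compat_l; lra).
replace (A * (496 * b4 + 21856 / ga * F)) with (496 * (A * b4) + 21856 * (A / ga * F)) in * by (field; lra).
assert (A / ga * F <= / 1000000 * F) by (apply Rmult_le_compat_r; lra).
assert (0 <= A * b4) by (apply Rmult_le_pos; lra). lra.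
Qed.

Lemma L_bound : 4 * lsum (Md M) (fun a => Rabs (ktimes c a)) <= 13 * b4.
Proof.
assert (H1 := l1_kc). assert (H2 := g_k4).
assert (136 / ga * nw M k4 g <= 136 / ga * (600 * A * b4)) by (apply Rmult_le_compat_l; [apply Rdiv_le_0_compat; lra|exact H2]).
replace (136 / ga * (600 * A * b4)) with (81600 * (A / ga * b4)) in * by (field; lra).
assert (A / ga * b4 <= / 1000000 * b4) by (apply Rmult_le_compat_r; lra). lra.
Qed.

Lemma c_k4 : nw M k4 c <= 2 * b4.
Proof.
assert (H3 := nw_c k4 k4_nonneg). assert (H2 := g_k4). assert (H4 := v_k4).
assert (6 / ga * nw M k4 g <= 6 / ga * (600 * A * b4)) by (apply Rmult_le_compat_l; [apply Rdiv_le_0_compat; lra|exact H2]).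
replace (6 / ga * (600 * A * b4)) with (3600 * (A / ga * b4)) in * by (field; lra).
assert (A / ga * b4 <= / 1000000 * b4) by (apply Rmult_le_compat_r; lra). lra.
Qed.

Definition b6 : R := 200 * A * (64 * b4 + 100000 * b4 ^ 2).

Lemma g_k6 : nw M k6 g <= b6.
Proof.
assert (H := fhat_D3 M HM phi A HA0 Hphi Hd c Hc7). fold g in H.
set (F := nw M k6 g) in *. assert (F0 : 0 <= F) by apply nw_nonneg.
assert (HL := L_bound). set (L := 4 * lsum (Md M) (fun a => Rabs (ktimes c a))) in *.
assert (L0 : 0 <= L).
{ unfold L; apply Rmult_le_pos; [lra|]. apply lsum_nonneg; intros; apply Rabs_pos. }
assert (H2 : nw M k2 c <= 5).
{ eapply Rle_trans; [apply nw_k2_le_onek2|]. apply (onek2_sum M n HM Hn v w Hv (proj1 Hw)). }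
assert (K0 := nw_nonneg M k2 c). assert (K4 := nw_nonneg M k4 c). assert (C4 := c_k4).
assert (H3 := nw_c k6 k6_nonneg). fold g F in H3. assert (H4 := v_k6).
assert (LC : L * nw M k4 c <= 13 * b4 * (2 * b4)) by (apply Rmult_le_compat; lra).
assert (L2 : L ^ 2 * nw M k2 c <= (13 * b4) ^ 2 * 5).
{ apply Rmult_le_compat; [apply pow2_ge_0|exact K0|apply pow_incr; lra|exact H2]. }
assert (B : 64 * nw M k6 c + 48 * L * nw M k4 c + 108 * L ^ 2 * nw M k2 c <= 384 / ga * F + (64 * b4 + 100000 * b4 ^ 2)).
{ replace (384 / ga * F) with (64 * (6 / ga * F)) by (field; lra).
  generalize (pow2_ge_0 b4); intros. lra. }
assert (B' := Rmult_le_compat_l (160 * A) _ _ ltac:(lra) B).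
replace (160 * A * (384 / ga * F + (64 * b4 + 100000 * b4 ^ 2)))
  with (61440 * (A / ga * F) + 160 * (A * (64 * b4 + 100000 * b4 ^ 2))) in B' by (field; lra).
assert (A / ga * F <= / 1000000 * F) by (apply Rmult_le_compat_r; lra).
unfold b6. assert (0 <= A * (64 * b4 + 100000 * b4 ^ 2)).
{ apply Rmult_le_pos; [lra|]. generalize (pow2_ge_0 b4); lra. }
lra.
Qed.

(** One [x] derivative: on V it is [n] times the time derivative, and off V it is absorbed through
    [A/ga]. *)
Lemma g_j2 : nw M j2 g <= 9 * A * INR n.
Proof.
assert (H := fhat_DX M HM phi A HA0 Hphi c Hc7). fold g in H.
set (F := nw M j2 g) in *. assert (F0 : 0 <= F) by apply nw_nonneg.
assert (H3 := nw_c j2 j2_nonneg). fold g F in H3.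
assert (N0 := pos_INR n).
assert (Hvj : nw M j2 v <= INR n * nv M v).
{ apply nw_le_scal; auto using j2_nonneg, k2_nonneg. intros a Ha. unfold j2, k2.
  destruct (supp_V_k M n HM Hn v a (proj1 Hv) Ha) as [E|[_ E]].
  - rewrite E, pow_i by lia. lra.
  - unfold isV in E; apply Nat.eqb_eq in E. rewrite E, mult_INR. apply Req_le; ring. }
assert (INR n * nv M v <= INR n * 2) by (apply Rmult_le_compat_l; [exact N0|apply Hv]).
assert (B : A * nw M j2 c <= A * (INR n * 2 + 6 / ga * F)) by (apply Rmult_le_compat_l; lra).
replace (A * (INR n * 2 + 6 / ga * F)) with (2 * (A * INR n) + 6 * (A / ga * F)) in B by (field; lra).
assert (A / ga * F <= / 1000000 * F) by (apply Rmult_le_compat_r; lra).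
assert (0 <= A * INR n) by (apply Rmult_le_pos; lra). lra.
Qed.

Definition Kb : R := 4 * (2 * (1 + om ^ 2 * INR n ^ 2) ^ 2 * (288 / ga ^ 2 + 16) + 32).
(** Majorant with total bounded independently of [M]; together with [rhot] it gives absolute
    summability of the coefficients weighted by two derivatives, with uniform tails. [Kb] collects
    constants depending on [om], [n], [ga]. *)
Definition Tb (a : nat * nat) : R :=
  Kb * (mu M a * ((1 + INR (fst a) ^ 6 + INR (snd a) ^ 2) * g a ^ 2 + INR (fst a) ^ 6 * v a ^ 2)).

Let G2 : 0 < ga ^ 2.
Proof. apply pow_lt; lra. Qed.

Lemma Kb_nonneg : 0 <= Kb.
Proof.
unfold Kb. assert (0 <= 288 / ga ^ 2) by (apply Rdiv_le_0_compat; lra).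
assert (0 <= (1 + om ^ 2 * INR n ^ 2) ^ 2 * (288 / ga ^ 2 + 16)) by (apply Rmult_le_pos; [apply pow2_ge_0|lra]). lra.
Qed.

Lemma Tb_nonneg a : 0 <= Tb a.
Proof.
unfold Tb. apply Rmult_le_pos; [apply Kb_nonneg|]. apply Rmult_le_pos; [generalize (mu_bounds M a); lra|].
assert (K6 := k6_nonneg a). unfold k6 in K6.
apply Rplus_le_le_0_compat; apply Rmult_le_pos; try apply pow2_ge_0; [|exact K6].
generalize (pow2_ge_0 (INR (snd a))); lra.
Qed.

Lemma sum_Tb : lsum (Md M) Tb <= Kb * ((40 * A) ^ 2 + b6 ^ 2 + (9 * A * INR n) ^ 2 + b4 ^ 2).
Proof.
unfold Tb. rewrite lsum_scal. apply Rmult_le_compat_l; [apply Kb_nonneg|].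
rewrite (lsum_ext _ _ (fun a => mu M a * one a * g a ^ 2 + mu M a * k6 a * g a ^ 2 + mu M a * j2 a * g a ^ 2 + mu M a * k6 a * v a ^ 2))
  by (intros; unfold one, k6, j2; ring).
rewrite !lsum_plus, <- !nw_sq by (apply one_nonneg || apply k6_nonneg || apply j2_nonneg).
assert (H1 := g_onek2). assert (H2 := nw_one_le_onek2 M g).
repeat apply Rplus_le_compat; apply pow_incr; (split; [apply nw_nonneg|]); [lra|apply g_k6|apply g_j2|apply v_k6].
Qed.

(** On V the bound on [k^6 v^2] leaves room for the weight [1/(1 + k)^2]; off V [lam_T2] spends one
    time derivative of [g]. *)
Lemma one_plus_k2_bound a : In a (Md M) ->
  ((1 + INR (fst a) ^ 2) * c a) ^ 2 <= (288 / ga ^ 2 + 16) * rhot J n a * ((1 + INR (fst a) ^ 6) * g a ^ 2 + INR (fst a) ^ 6 * v a ^ 2).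
Proof.
intros Ha. assert (R1 := rho1_pos J a). assert (R2 := rho1_pos (fun k => n * k)%nat a). assert (R3 := rho3_pos a).
assert (P288 : 0 <= 288 / ga ^ 2) by (apply Rdiv_le_0_compat; lra).
assert (K6 := k6_nonneg a). unfold k6 in K6. set (k := INR (fst a)) in *.
assert (X1 : 0 <= (1 + k ^ 6) * g a ^ 2) by (apply Rmult_le_pos; [lra|apply pow2_ge_0]).
assert (X2 : 0 <= k ^ 6 * v a ^ 2) by (apply Rmult_le_pos; [lra|apply pow2_ge_0]).
destruct (inV M n a) eqn:E.
- assert (Ec := proj1 (c_on_V a E)). destruct (inV_true _ _ _ E) as [_ HV].
  assert (Hk1 : 1 <= k).
  { destruct (nat_cases a) as [Z|Z]; [|exact Z]. exfalso. apply in_Md in Ha. unfold isV in HV; apply Nat.eqb_eq in HV.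
    change 0 with (INR 0) in Z. apply INR_eq in Z. rewrite Z in HV. lia. }
  assert (Er : rho1 (fun q => n * q)%nat a = / (1 + k) ^ 2).
  { unfold isV in HV; apply Nat.eqb_eq in HV. destruct a as [ka ja]; cbn [fst snd] in *. rewrite HV. apply rho1_nk. }
  rewrite Ec.
  assert (S1 : ((1 + k ^ 2) * v a) ^ 2 <= 16 * / (1 + k) ^ 2 * (k ^ 6 * v a ^ 2)).
  { replace (((1 + k ^ 2) * v a) ^ 2) with ((1 + k ^ 2) ^ 2 * v a ^ 2) by ring.
    replace (16 * / (1 + k) ^ 2 * (k ^ 6 * v a ^ 2)) with (16 * / (1 + k) ^ 2 * k ^ 6 * v a ^ 2) by ring.
    apply Rmult_le_compat_r; [apply pow2_ge_0|].
    assert (Q : 0 < (1 + k) ^ 2) by (apply pow_lt; lra).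
    apply Rmult_le_reg_r with ((1 + k) ^ 2); [exact Q|].
    replace (16 * / (1 + k) ^ 2 * k ^ 6 * (1 + k) ^ 2) with (16 * k ^ 6) by (field; lra).
    assert (B1 : (1 + k ^ 2) * (1 + k) <= 4 * k ^ 3) by nra.
    replace ((1 + k ^ 2) ^ 2 * (1 + k) ^ 2) with (((1 + k ^ 2) * (1 + k)) ^ 2) by ring.
    replace (16 * k ^ 6) with ((4 * k ^ 3) ^ 2) by ring. apply pow_incr; split; [nra|exact B1]. }
  eapply Rle_trans; [exact S1|]. unfold rhot. rewrite Er in *.
  apply Rmult_le_compat; [|exact X2| |lra].
  + apply Rmult_le_pos; lra.
  + apply Rmult_le_compat; lra.
- assert (EW : inW M n a = true) by (rewrite (inV_inW M n a Ha), E; reflexivity).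
  destruct (inW_true _ _ _ EW) as [_ HV].
  assert (Ec : c a = - g a / lam n om a).
  { unfold c, vadd. rewrite (proj1 Hv a E), w_T. unfold Tinv; rewrite EW. ring. }
  assert (Hl := lam_W_neq0 M n om ga J Hn Hom Hga HW HJ a EW).
  assert (T2 := lam_T2 n om ga J Hn Hom Hga HW HJ M a Ha HV). fold k in T2.
  rewrite Ec. replace (((1 + k ^ 2) * (- g a / lam n om a)) ^ 2) with (/ lam n om a ^ 2 * ((1 + k ^ 2) ^ 2 * g a ^ 2)) by (field; exact Hl).
  assert (Q0 : 0 <= (1 + k ^ 2) ^ 2 * g a ^ 2) by (apply Rmult_le_pos; apply pow2_ge_0).
  eapply Rle_trans; [apply Rmult_le_compat_r; [exact Q0|exact T2]|].
  replace (72 / ga ^ 2 * (1 + k ^ 2) * rho1 J a * ((1 + k ^ 2) ^ 2 * g a ^ 2))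
    with (72 / ga ^ 2 * rho1 J a * ((1 + k ^ 2) ^ 3 * g a ^ 2)) by ring.
  apply Rle_trans with (72 / ga ^ 2 * rho1 J a * (4 * (1 + k ^ 6) * g a ^ 2)).
  + apply Rmult_le_compat_l; [apply Rmult_le_pos; [apply Rdiv_le_0_compat; lra|lra]|].
    apply Rmult_le_compat_r; [apply pow2_ge_0|].
    set (x := k ^ 2). assert (0 <= x) by apply pow2_ge_0. replace (k ^ 6) with (x ^ 3) by (unfold x; ring).
    assert (0 <= (x - 1) ^ 2 * (x + 1)) by (apply Rmult_le_pos; [apply pow2_ge_0|lra]). nra.
  + replace (72 / ga ^ 2 * rho1 J a * (4 * (1 + k ^ 6) * g a ^ 2)) with (288 / ga ^ 2 * rho1 J a * ((1 + k ^ 6) * g a ^ 2)) by (field; lra).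
    unfold rhot. apply Rmult_le_compat; [apply Rmult_le_pos; lra|exact X1| |lra].
    apply Rmult_le_compat; lra.
Qed.

Lemma mode_bound a : In a (Md M) ->
  ((1 + INR (fst a) ^ 2 + INR (snd a) ^ 2) * c a) ^ 2 <= rhot J n a * Tb a.
Proof.
intros Ha. assert (H1 := one_plus_k2_bound a Ha). assert (Q := Heq a Ha).
assert (R1 := rho1_pos J a). assert (R2 := rho1_pos (fun k => n * k)%nat a). assert (R3 := rho3_pos a).
assert (P288 : 0 <= 288 / ga ^ 2) by (apply Rdiv_le_0_compat; lra).
assert (K6 := k6_nonneg a). unfold k6 in K6.
assert (H2 : g a ^ 2 <= 16 * rhot J n a * ((1 + INR (fst a) ^ 6 + INR (snd a) ^ 2) * g a ^ 2)).
{ set (k := INR (fst a)) in *. set (j := INR (snd a)).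
  assert (kp : 0 <= k) by apply pos_INR.
  assert (J2 : 0 <= j ^ 2) by apply pow2_ge_0.
  assert (D : j ^ 2 + (1 + k) ^ 4 <= 16 * (1 + k ^ 6 + j ^ 2)).
  { assert (B1 : (1 + k) ^ 4 <= 8 * (1 + k ^ 4)).
    { assert ((1 + k) ^ 2 <= 2 * (1 + k ^ 2)) by (generalize (pow2_ge_0 (k - 1)); intros; lra).
      assert (((1 + k) ^ 2) ^ 2 <= (2 * (1 + k ^ 2)) ^ 2) by (apply pow_incr; split; [apply pow2_ge_0|assumption]). generalize (pow2_ge_0 (k ^ 2 - 1)); intros; lra. }
    assert (B2 : k ^ 4 <= 1 + k ^ 6).
    { set (x := k ^ 2). assert (0 <= x) by apply pow2_ge_0. replace (k ^ 4) with (x ^ 2) by (unfold x; ring). replace (k ^ 6) with (x ^ 3) by (unfold x; ring).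
      destruct (Rle_dec x 1); nra. }
    lra. }
  assert (E3 : rho3 a * (j ^ 2 + (1 + k) ^ 4) = 1).
  { unfold rho3. fold k j. apply Rinv_l. assert (0 < (1 + k) ^ 4) by (apply pow_lt; lra). lra. }
  assert (GG : 0 <= g a ^ 2) by apply pow2_ge_0.
  apply Rle_trans with (rho3 a * (j ^ 2 + (1 + k) ^ 4) * g a ^ 2); [rewrite E3; lra|]. rewrite <- Rmult_assoc.
  apply Rmult_le_compat_r; [exact GG|].
  apply Rle_trans with (rho3 a * (16 * (1 + k ^ 6 + j ^ 2))); [apply Rmult_le_compat_l; lra|].
  replace (16 * rhot J n a * (1 + k ^ 6 + j ^ 2)) with (rhot J n a * (16 * (1 + k ^ 6 + j ^ 2))) by ring.
  apply Rmult_le_compat_r; [lra|]. unfold rhot; lra. }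
set (k := INR (fst a)) in *. set (j := INR (snd a)) in *.
set (X := (1 + k ^ 2) * c a) in *. set (O := 1 + om ^ 2 * INR n ^ 2).
assert (O1 : 1 <= O).
{ unfold O. assert (0 <= om ^ 2 * INR n ^ 2) by (apply Rmult_le_pos; apply pow2_ge_0). lra. }
(* The equation expresses [j^2 c] through [k^2 c] and [g], so two [x] derivatives of the solution
   need only one of [g]. *)
assert (Ez : (1 + k ^ 2 + j ^ 2) * c a = X + om ^ 2 * INR n ^ 2 * (k ^ 2 * c a) - g a).
{ unfold lam in Q. fold k j in Q. unfold X. lra. }
assert (B : Rabs ((1 + k ^ 2 + j ^ 2) * c a) <= O * Rabs X + Rabs (g a)).
{ rewrite Ez. eapply Rle_trans; [apply Rabs_triang|]. rewrite Rabs_Ropp. apply Rplus_le_compat_r.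
  eapply Rle_trans; [apply Rabs_triang|]. unfold O. rewrite Rmult_plus_distr_r, Rmult_1_l. apply Rplus_le_compat_l.
  rewrite Rabs_mult, (Rabs_pos_eq (om ^ 2 * INR n ^ 2)) by (apply Rmult_le_pos; apply pow2_ge_0).
  apply Rmult_le_compat_l; [apply Rmult_le_pos; apply pow2_ge_0|]. unfold X. rewrite !Rabs_mult.
  apply Rmult_le_compat_r; [apply Rabs_pos|]. rewrite !Rabs_pos_eq by (generalize (pow2_ge_0 k); lra). lra. }
assert (B2 : ((1 + k ^ 2 + j ^ 2) * c a) ^ 2 <= 2 * (O ^ 2 * X ^ 2 + g a ^ 2)).
{ rewrite <- pow2_abs, <- (pow2_abs X), <- (pow2_abs (g a)).
  apply Rle_trans with ((O * Rabs X + Rabs (g a)) ^ 2); [apply pow_incr; split; [apply Rabs_pos|exact B]|].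
  generalize (pow2_ge_0 (O * Rabs X - Rabs (g a))); lra. }
eapply Rle_trans; [exact B2|].
set (Y := (1 + k ^ 6 + j ^ 2) * g a ^ 2 + k ^ 6 * v a ^ 2).
assert (J2 : 0 <= j ^ 2) by apply pow2_ge_0. assert (G0 : 0 <= g a ^ 2) by apply pow2_ge_0. assert (V0 : 0 <= v a ^ 2) by apply pow2_ge_0.
assert (Y1 : (1 + k ^ 6) * g a ^ 2 + k ^ 6 * v a ^ 2 <= Y) by (unfold Y; nra).
assert (Y2 : (1 + k ^ 6 + j ^ 2) * g a ^ 2 <= Y) by (unfold Y; nra).
assert (rt : 0 < rhot J n a) by (unfold rhot; lra).
assert (Y0 : 0 <= Y).
{ eapply Rle_trans; [|exact Y2]. apply Rmult_le_pos; lra. }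
assert (Z1 : X ^ 2 <= (288 / ga ^ 2 + 16) * rhot J n a * Y).
{ eapply Rle_trans; [exact H1|]. apply Rmult_le_compat_l; [apply Rmult_le_pos; lra|exact Y1]. }
assert (Z2 : g a ^ 2 <= 16 * rhot J n a * Y).
{ eapply Rle_trans; [exact H2|]. apply Rmult_le_compat_l; [lra|exact Y2]. }
assert (Z3 : O ^ 2 * X ^ 2 <= O ^ 2 * ((288 / ga ^ 2 + 16) * rhot J n a * Y)) by (apply Rmult_le_compat_l; [apply pow2_ge_0|exact Z1]).
unfold Tb. fold k j Y. generalize (mu_bounds M a); intros [Hmu _].
apply Rle_trans with (rhot J n a * (Kb * (/ 4 * Y))).
- unfold Kb. fold O. lra.
- apply Rmult_le_compat_l; [lra|]. apply Rmult_le_compat_l; [apply Kb_nonneg|]. apply Rmult_le_compat_r; [exact Y0|exact Hmu].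
Qed.

End UniformBounds.

(** * Solutions on every grid *)

(** What passes to the limit: the equation, the nonvanishing first coefficient, and a second-order
    bound whose weight [rhot] and total [Cst] do not see [M]. *)
Record grid_solution (M n : nat) (om : R) (phi : R -> R) (J : nat -> nat) (Cst : R) (c : nat * nat -> R) : Prop := {
  gs_supp : supp (inMd M) c;
  gs_eq : forall a, In a (Md M) -> lam n om a * c a + fhat M phi c a = 0;
  gs_mode : / 180 <= Rabs (c (1%nat, n));
  gs_bound : exists T : nat * nat -> R, (forall a, 0 <= T a) /\ lsum (Md M) T <= Cst /\
    forall a, In a (Md M) -> ((1 + INR (fst a) ^ 2 + INR (snd a) ^ 2) * c a) ^ 2 <= rhot J n a * T a }.

Theorem grid_solution_exists (n e : nat) (om ga eps A A' : R) (J : nat -> nat) (phi Hp E psi : R -> R) :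
  (1 <= n)%nat -> (2 <= e)%nat -> / 2 <= om <= 3 / 2 -> 0 < ga <= 3 / 2 -> in_W ga om ->
  (forall k, Rabs (INR (J k) - om * INR n * INR k) <= / 2) ->
  Rabs (om - 1) * INR n <= ga -> 0 <= A -> 1000000 * A <= ga ->
  nonlin phi A -> nonlin_diff phi A ->
  (forall x h, Rabs x <= 7 -> Rabs (x + h) <= 7 -> Rabs (Hp (x + h) - Hp x - phi x * h) <= A * h ^ 2) ->
  eps = (om ^ 2 - 1) * INR n ^ 2 -> eps <> 0 ->
  (forall y, phi y = E y + eps * y ^ (2 * e + 1) + psi y) -> (forall y, E (- y) = E y) ->
  0 <= A' -> (forall x y, Rabs x <= 7 -> Rabs y <= 7 -> Rabs (psi x - psi y) <= A' * Rabs (x - y)) -> psi 0 = 0 ->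
  (6000 * A ^ 2 + A') / Rabs eps <= / (60 * (INR e + 1)) ->
  exists Cst, forall M, (4 * n <= M)%nat -> exists c, grid_solution M n om phi J Cst c.
Proof.
intros Hn He Hom Hga HW HJ Homn HA0 HA Hphi Hd Hprim Heps Heps0 Hdec HE HA'0 Hpsi Hpsi0 Hkap.
set (b4 := 40 * A / Rabs eps).
exists (Kb n om ga * ((40 * A) ^ 2 + b6 A eps ^ 2 + (9 * A * INR n) ^ 2 + b4 ^ 2)).
intros M HM4. assert (HM : (2 <= M)%nat) by lia.
assert (HA5 : 5000 * A <= ga) by lra.
(* Outside the ball the value of [wf] is an arbitrary default; all later statements assume
   [Vball]. *)
destruct (functional_choice (fun v w => Vball M n v -> Sol M n om phi v w)) as [wf Hwf].
{ intros v. destruct (Classical_Prop.classic (Vball M n v)) as [Hv|Hv].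
  - destruct (Sol_exists M n om ga J phi A HM Hn Hom Hga HW HJ HA0 HA5 Hphi v Hv) as [w Hw]. now exists w.
  - exists (fun _ => 0); intros H; now elim Hv. }
destruct (nehari_minimizer M n e Hn HM4 He (Psi M n om Hp eps wf) (rr M phi psi eps wf)
   ((6000 * A ^ 2 + A') / Rabs eps)) as (v & Hv & Hv2 & Hv1 & Hcr).
- destruct (Psi_taylor M n om ga J phi A HM Hn Hom Hga HW HJ HA0 HA5 Hphi Hp E psi eps (2 * e + 1)
     Hprim Heps Heps0 Hdec HE wf Hwf) as [C [HC HCT]].
  exists C; split; [exact HC|]. exact HCT.
- intros v1 v2 h H1 H2 H3.
  exact (rr_lipschitz M n om ga J phi A HM Hn Hom Hga HW HJ Homn HA0 HA5 Hphi psi A' eps Heps0 HA'0 Hpsi wf Hwf v1 v2 h H1 H2 H3).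
- intros h. exact (rr_zero M n om ga J phi A HM Hn Hom Hga HW HJ HA0 HA5 Hphi psi eps Hpsi0 wf Hwf h).
- intros v s h1 h2. apply rr_linear.
- split; [|exact Hkap]. apply Rdiv_le_0_compat; [generalize (pow2_ge_0 A); lra|now apply Rabs_pos_lt].
- assert (Vv : Vball M n v) by (split; [apply Hv|lra]).
  assert (Heq := critical_equation M n om ga J phi HM Hn Hom Hga HW HJ E psi eps (2 * e + 1)
     Heps Heps0 Hdec HE wf Hwf v Vv Hcr).
  exists (vadd v (wf v)). split.
  + intros a Ha. unfold vadd. rewrite (proj1 Vv a), (proj1 (proj1 (Hwf v Vv)) a); [ring| |]; unfold inV, inW; now rewrite Ha.
  + exact Heq.
  + unfold vadd. rewrite (proj1 (proj1 (Hwf v Vv)) (1%nat, n)); [rewrite Rplus_0_r; exact Hv1|].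
    assert (X := inV_mode1 M n Hn HM4). rewrite (inV_inW M n _ (in_Md_mode1 M n Hn HM4)), X. reflexivity.
  + exists (Tb M n om ga phi v (wf v)). split; [|split].
    * intros a. now apply (Tb_nonneg M n om ga phi).
    * apply (sum_Tb M n om ga J phi A eps); try assumption. now apply Hwf.
    * intros a Ha. apply (mode_bound M n om ga J phi eps); try assumption. now apply Hwf.
Qed.

(** * Uniform limits of families closed under partial derivatives *)

Section UniformLimit.
Variable F : nat -> nat -> nat -> R -> R -> R.
Hypothesis F_cauchy : forall eta, 0 < eta -> exists Q, forall q q', (Q <= q)%nat -> (Q <= q')%nat ->
  forall p r t x, (p + r <= 2)%nat -> Rabs (F q p r t x - F q' p r t x) <= eta.
Hypothesis F_dt : forall q p r t x, is_derive (fun s => F q p r s x) t (F q (S p) r t x).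
Hypothesis F_dx : forall q p r t x, is_derive (fun y => F q p r t y) x (F q p (S r) t x).
Hypothesis F_cont : forall q p r t x, continuous (fun z : R * R => F q p r (fst z) (snd z)) (t, x).

Definition Ulim (p r : nat) (t x : R) : R := real (Lim_seq (fun q => F q p r t x)).

Lemma Ulim_spec p r t x : (p + r <= 2)%nat -> is_lim_seq (fun q => F q p r t x) (Ulim p r t x).
Proof.
intros Hpr. apply Lim_seq_correct', ex_lim_seq_cauchy_corr. intros e.
destruct (F_cauchy (e / 2) (is_pos_div_2 e)) as [Q HQ]. exists Q; intros q q' Hq Hq'.
specialize (HQ q q' Hq Hq' p r t x Hpr). generalize (cond_pos e); lra.
Qed.

Lemma Ulim_uniform eta : 0 < eta -> exists Q, forall q, (Q <= q)%nat ->
  forall p r t x, (p + r <= 2)%nat -> Rabs (F q p r t x - Ulim p r t x) <= eta.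
Proof.
intros He. destruct (F_cauchy eta He) as [Q HQ]. exists Q; intros q Hq p r t x Hpr.
assert (L : is_lim_seq (fun q' => Rabs (F q p r t x - F (q' + Q)%nat p r t x)) (Rabs (F q p r t x - Ulim p r t x))).
{ apply (is_lim_seq_abs _ (F q p r t x - Ulim p r t x)). apply is_lim_seq_minus'; [apply is_lim_seq_const|].
  apply (is_lim_seq_incr_n (fun q' => F q' p r t x) Q). now apply Ulim_spec. }
apply (is_lim_seq_le_const _ _ _ L). intros q'. apply HQ; (lia || assumption).
Qed.

Lemma Ulim_continuous p r t x : (p + r <= 2)%nat -> continuous (fun z : R * R => Ulim p r (fst z) (snd z)) (t, x).
Proof.
intros Hpr. apply filterlim_locally. intros e.
assert (He : 0 < e / 4) by (generalize (cond_pos e); lra).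
destruct (Ulim_uniform (e / 4) He) as [Q HQ]. specialize (HQ Q (Nat.le_refl Q)).
assert (H := F_cont Q p r t x). apply filterlim_locally with (eps := mkposreal _ He) in H.
apply filter_imp with (2 := H). intros z Hz.
change (Rabs (Ulim p r (fst z) (snd z) - Ulim p r t x) < e).
change (Rabs (F Q p r (fst z) (snd z) - F Q p r t x) < e / 4) in Hz.
assert (H1 := HQ p r (fst z) (snd z) Hpr). assert (H2 := HQ p r t x Hpr).
replace (Ulim p r (fst z) (snd z) - Ulim p r t x) with
  (- (F Q p r (fst z) (snd z) - Ulim p r (fst z) (snd z)) + (F Q p r (fst z) (snd z) - F Q p r t x) + (F Q p r t x - Ulim p r t x)) by ring.
apply Rabs_lt_between in Hz. apply Rabs_le_between in H1. apply Rabs_le_between in H2. apply Rabs_lt_between.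
generalize (cond_pos e); lra.
Qed.

Lemma derive_of_uniform_limit (f f' : nat -> R -> R) (g g' : R -> R) (s : R) :
  (forall q t, is_derive (f q) t (f' q t)) ->
  (forall t, is_lim_seq (fun q => f q t) (g t)) ->
  (forall eta, 0 < eta -> exists Q, forall q, (Q <= q)%nat -> forall t, Rabs (f' q t - g' t) <= eta) ->
  is_derive g s (g' s).
Proof.
intros Hd Hl Hu.
apply is_derive_Reals. intros e He.
destruct (Hu (e / 8) ltac:(lra)) as [Q HQ].
assert (Df := Hd Q s). apply is_derive_Reals in Df.
destruct (Df (e / 4) ltac:(lra)) as [dl Hdl].
exists dl. intros h Hh0 Hh. specialize (Hdl h Hh0 Hh).
assert (B : Rabs ((g (s + h) - f Q (s + h)) - (g s - f Q s)) <= e / 4 * Rabs h).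
{ assert (L : is_lim_seq (fun q => Rabs ((f (q + Q)%nat (s + h) - f Q (s + h)) - (f (q + Q)%nat s - f Q s)))
     (Rabs ((g (s + h) - f Q (s + h)) - (g s - f Q s)))).
  { apply (is_lim_seq_abs _ ((g (s + h) - f Q (s + h)) - (g s - f Q s))).
    apply is_lim_seq_minus'; (apply is_lim_seq_minus'; [|apply is_lim_seq_const]);
    apply (is_lim_seq_incr_n (fun q => f q _) Q), Hl. }
  apply (is_lim_seq_le_const _ _ _ L). intros q.
  destruct (MVT_gen (fun t => f (q + Q)%nat t - f Q t) s (s + h) (fun t => f' (q + Q)%nat t - f' Q t)) as [c [_ E]].
  - intros t _. apply (is_derive_minus (f (q + Q)%nat) (f Q)); apply Hd.
  - intros t _. apply continuity_pt_filterlim. apply (ex_derive_continuous (fun t => f (q + Q)%nat t - f Q t)).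
    eexists. apply (is_derive_minus (f (q + Q)%nat) (f Q)); apply Hd.
  - cbn beta in E.
    replace (f (q + Q)%nat (s + h) - f Q (s + h) - (f (q + Q)%nat s - f Q s)) with ((f' (q + Q)%nat c - f' Q c) * (s + h - s)) by lra.
    rewrite Rabs_mult. replace (s + h - s) with h by ring. apply Rmult_le_compat_r; [apply Rabs_pos|].
    assert (H1 := HQ (q + Q)%nat ltac:(lia) c). assert (H2 := HQ Q ltac:(lia) c).
    apply Rabs_le_between in H1. apply Rabs_le_between in H2. apply Rabs_le. lra. }
assert (H3 := HQ Q ltac:(lia) s).
replace ((g (s + h) - g s) / h - g' s) with
  (((g (s + h) - f Q (s + h)) - (g s - f Q s)) / h + (((f Q (s + h) - f Q s) / h - f' Q s) + (f' Q s - g' s))) by (field; exact Hh0).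
assert (Ph : 0 < Rabs h) by now apply Rabs_pos_lt.
assert (B' : Rabs (((g (s + h) - f Q (s + h)) - (g s - f Q s)) / h) <= e / 4).
{ unfold Rdiv at 1. rewrite Rabs_mult, Rabs_inv. apply Rmult_le_reg_r with (Rabs h); [exact Ph|].
  rewrite Rmult_assoc, Rinv_l by lra. lra. }
apply Rabs_le_between in B'. apply Rabs_lt_between in Hdl. apply Rabs_le_between in H3. apply Rabs_lt_between. lra.
Qed.

Lemma Ulim_dt p r t x : (p + r <= 1)%nat -> is_derive (fun s => Ulim p r s x) t (Ulim (S p) r t x).
Proof.
intros Hpr. apply (derive_of_uniform_limit (fun q s => F q p r s x) (fun q s => F q (S p) r s x) _ (fun s => Ulim (S p) r s x)).
- intros; apply F_dt.
- intros; apply Ulim_spec; lia.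
- intros eta He. destruct (Ulim_uniform eta He) as [Q HQ]. exists Q; intros q Hq s. apply HQ; lia.
Qed.

Lemma Ulim_dx p r t x : (p + r <= 1)%nat -> is_derive (fun y => Ulim p r t y) x (Ulim p (S r) t x).
Proof.
intros Hpr. apply (derive_of_uniform_limit (fun q y => F q p r t y) (fun q y => F q p (S r) t y) _ (fun y => Ulim p (S r) t y)).
- intros; apply F_dx.
- intros; apply Ulim_spec; lia.
- intros eta He. destruct (Ulim_uniform eta He) as [Q HQ]. exists Q; intros q Hq s. apply HQ; lia.
Qed.

(** The grid equations hold at points that change with the grid, so evaluation at moving points has
    to converge as well. *)
Lemma Ulim_moving p r (tq xq : nat -> R) (t x : R) : (p + r <= 2)%nat -> is_lim_seq tq t -> is_lim_seq xq x ->
  is_lim_seq (fun q => F q p r (tq q) (xq q)) (Ulim p r t x).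
Proof.
intros Hpr Ht Hx. apply is_lim_seq_spec. intros e.
assert (He : 0 < e / 2) by (generalize (cond_pos e); lra).
destruct (Ulim_uniform (e / 2) He) as [Q1 HQ1].
assert (C := Ulim_continuous p r t x Hpr). apply filterlim_locally with (eps := mkposreal _ He) in C.
destruct C as [dl Hdl].
apply is_lim_seq_spec in Ht. apply is_lim_seq_spec in Hx.
destruct (Ht dl) as [Q2 HQ2]. destruct (Hx dl) as [Q3 HQ3].
exists (Nat.max Q1 (Nat.max Q2 Q3)). intros q Hq.
specialize (Hdl (tq q, xq q)). cbn [fst snd] in Hdl.
assert (B : Rabs (Ulim p r (tq q) (xq q) - Ulim p r t x) < e / 2).
{ apply Hdl. split; [apply HQ2; lia|apply HQ3; lia]. }
assert (H1 := HQ1 q ltac:(lia) p r (tq q) (xq q) Hpr).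
apply Rabs_lt_between in B. apply Rabs_le_between in H1. apply Rabs_lt_between. lra.
Qed.

End UniformLimit.

(** * Trigonometric polynomials and the passage to the limit *)

(** Differentiation is a phase shift by [PI/2] times a frequency, so one formula covers all partial
    derivatives of order [p] in time and [r] in space. *)
Definition trig (M : nat) (c : nat * nat -> R) (p r : nat) (t x : R) : R :=
  lsum (Md M) (fun a => c a * (INR (fst a) ^ p * INR (snd a) ^ r) *
    (cos (INR (fst a) * t + INR p * (PI / 2)) * sin (INR (snd a) * x + INR r * (PI / 2)))).

Lemma is_derive_lsum {T} (l : list T) (f f' : T -> R -> R) t :
  (forall a, In a l -> is_derive (f a) t (f' a t)) ->
  is_derive (fun s => lsum l (fun a => f a s)) t (lsum l (fun a => f' a t)).
Proof.
induction l as [|a l IH]; intros H.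
- exact (is_derive_const 0 t).
- apply (is_derive_plus (f a) (fun s => lsum l (fun b => f b s))).
  + apply H; now left.
  + apply IH; intros b Hb; apply H; now right.
Qed.

Lemma trig_dt M c p r t x : is_derive (fun s => trig M c p r s x) t (trig M c (S p) r t x).
Proof.
unfold trig. apply (is_derive_lsum (Md M) (fun a s => c a * (INR (fst a) ^ p * INR (snd a) ^ r) *
    (cos (INR (fst a) * s + INR p * (PI / 2)) * sin (INR (snd a) * x + INR r * (PI / 2))))
   (fun a s => c a * (INR (fst a) ^ S p * INR (snd a) ^ r) *
    (cos (INR (fst a) * s + INR (S p) * (PI / 2)) * sin (INR (snd a) * x + INR r * (PI / 2))))).
intros a _.
replace (cos (INR (fst a) * t + INR (S p) * (PI / 2))) with (- sin (INR (fst a) * t + INR p * (PI / 2))).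
- auto_derive; [exact I|]. cbn [pow]. ring.
- rewrite S_INR. rewrite <- cos_shift. rewrite <- (cos_neg (INR (fst a) * t + (INR p + 1) * (PI / 2))).
  replace (PI / 2 - (INR (fst a) * t + INR p * (PI / 2))) with (- (INR (fst a) * t + (INR p + 1) * (PI / 2)) + PI) by field.
  rewrite neg_cos. ring.
Qed.

Lemma trig_dx M c p r t x : is_derive (fun y => trig M c p r t y) x (trig M c p (S r) t x).
Proof.
unfold trig. apply (is_derive_lsum (Md M) (fun a y => c a * (INR (fst a) ^ p * INR (snd a) ^ r) *
    (cos (INR (fst a) * t + INR p * (PI / 2)) * sin (INR (snd a) * y + INR r * (PI / 2))))
   (fun a y => c a * (INR (fst a) ^ p * INR (snd a) ^ S r) *
    (cos (INR (fst a) * t + INR p * (PI / 2)) * sin (INR (snd a) * y + INR (S r) * (PI / 2))))).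
intros a _.
replace (sin (INR (snd a) * x + INR (S r) * (PI / 2))) with (cos (INR (snd a) * x + INR r * (PI / 2))).
- auto_derive; [exact I|]. cbn [pow]. ring.
- rewrite S_INR. rewrite cos_sin. f_equal. field.
Qed.

Lemma continuous_lsum {U : UniformSpace} {T} (l : list T) (f : T -> U -> R) z :
  (forall a, In a l -> continuous (f a) z) -> continuous (fun y => lsum l (fun a => f a y)) z.
Proof.
induction l as [|a l IH]; intros H.
- apply continuous_const.
- apply (continuous_plus (f a) (fun y => lsum l (fun b => f b y))).
  + apply H; now left.
  + apply IH; intros b Hb; apply H; now right.
Qed.

Lemma trig_continuous M c p r t x : continuous (fun z : R * R => trig M c p r (fst z) (snd z)) (t, x).
Proof.
unfold trig. apply (continuous_lsum (Md M) (fun a z => c a * (INR (fst a) ^ p * INR (snd a) ^ r) *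
    (cos (INR (fst a) * fst z + INR p * (PI / 2)) * sin (INR (snd a) * snd z + INR r * (PI / 2))))).
intros a _. apply (continuous_mult (K := R_AbsRing)); [apply continuous_const|].
apply (continuous_mult (K := R_AbsRing)).
- apply (continuous_comp (fun z : R * R => INR (fst a) * fst z + INR p * (PI / 2)) cos); [|apply continuous_cos].
  apply (continuous_plus (V := R_NormedModule)); [|apply continuous_const].
  apply (continuous_mult (K := R_AbsRing)); [apply continuous_const|apply continuous_fst].
- apply (continuous_comp (fun z : R * R => INR (snd a) * snd z + INR r * (PI / 2)) sin); [|apply continuous_sin].
  apply (continuous_plus (V := R_NormedModule)); [|apply continuous_const].
  apply (continuous_mult (K := R_AbsRing)); [apply continuous_const|apply continuous_snd].
Qed.

Lemma incl_Md M K : (M <= K)%nat -> incl (Md M) (Md K).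
Proof. intros H a Ha. apply in_Md in Ha. apply in_Md. lia. Qed.

Lemma lsum_Md_incl M K F : (M <= K)%nat -> supp (inMd M) F -> lsum (Md K) F = lsum (Md M) F.
Proof.
intros H HF. rewrite (lsum_filter (Md K) (inMd M)).
rewrite (lsum_zero (filter (fun a => negb (inMd M a)) (Md K))).
- rewrite Rplus_0_r. apply lsum_perm, NoDup_Permutation.
  + apply NoDup_filter, NoDup_Md.
  + apply NoDup_Md.
  + intros a. rewrite filter_In, inMd_spec. split; [tauto|]. intros Ha; split; [now apply (incl_Md M K H)|exact Ha].
- intros a Ha. apply filter_In in Ha. destruct Ha as [_ Ha]. apply HF. now apply negb_true_iff.
Qed.

Definition wsec (c : nat * nat -> R) (a : nat * nat) : R := (1 + INR (fst a) ^ 2 + INR (snd a) ^ 2) * c a.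

(** Up to order two, [k^p j^r <= 1 + k^2 + j^2]: the [C^2] distance is controlled by the absolute
    sum of the weighted coefficients. *)
Lemma trig_diff_bound M M' K c c' p r t x : (M <= K)%nat -> (M' <= K)%nat ->
  supp (inMd M) c -> supp (inMd M') c' -> (p + r <= 2)%nat ->
  Rabs (trig M c p r t x - trig M' c' p r t x) <= lsum (Md K) (fun a => Rabs (wsec c a - wsec c' a)).
Proof.
intros H H' Hc Hc' Hpr. unfold trig.
rewrite <- (lsum_Md_incl M K) by (auto; intros a Ha; rewrite (Hc a Ha); ring).
rewrite <- (lsum_Md_incl M' K) by (auto; intros a Ha; rewrite (Hc' a Ha); ring).
rewrite <- lsum_minus. eapply Rle_trans; [apply lsum_abs|]. apply lsum_le; intros a _.
set (k := INR (fst a)). set (j := INR (snd a)).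
assert (k0 : 0 <= k) by apply pos_INR. assert (j0 : 0 <= j) by apply pos_INR.
set (u := cos _ * sin _).
assert (Hu : Rabs u <= 1).
{ unfold u. rewrite Rabs_mult. rewrite <- (Rmult_1_r 1).
  apply Rmult_le_compat; try apply Rabs_pos; apply Rabs_le; [apply COS_bound|apply SIN_bound]. }
replace (c a * (k ^ p * j ^ r) * u - c' a * (k ^ p * j ^ r) * u) with ((c a - c' a) * (k ^ p * j ^ r) * u) by ring.
unfold wsec; fold k j.
replace ((1 + k ^ 2 + j ^ 2) * c a - (1 + k ^ 2 + j ^ 2) * c' a) with ((c a - c' a) * (1 + k ^ 2 + j ^ 2)) by ring.
assert (B : k ^ p * j ^ r <= 1 + k ^ 2 + j ^ 2).
{ assert (k2 := pow2_ge_0 k). assert (j2 := pow2_ge_0 j). assert (Kj := pow2_ge_0 (k - j)).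
  assert (k1 := pow2_ge_0 (k - 1)). assert (j1 := pow2_ge_0 (j - 1)).
  destruct p as [|[|[|p]]]; destruct r as [|[|[|r]]]; try lia; cbn [pow]; lra. }
assert (P0 : 0 <= k ^ p * j ^ r) by (apply Rmult_le_pos; apply pow_le; assumption).
rewrite (Rabs_mult _ u), (Rabs_mult _ (k ^ p * j ^ r)), (Rabs_mult _ (1 + k ^ 2 + j ^ 2)), (Rabs_pos_eq (k ^ p * j ^ r)) by exact P0.
rewrite (Rabs_pos_eq (1 + k ^ 2 + j ^ 2)) by (generalize (pow2_ge_0 k) (pow2_ge_0 j); lra).
rewrite Rmult_assoc. apply Rmult_le_compat_l; [apply Rabs_pos|].
rewrite <- (Rmult_1_r (1 + k ^ 2 + j ^ 2)). apply Rmult_le_compat; (assumption || apply Rabs_pos).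
Qed.

Lemma ev_trig M c s m i : (2 <= M)%nat -> ev M s c (m, i) = trig M c 0 0 (PI * INR m / INR M + s) (PI * INR i / INR M).
Proof.
intros HM. assert (Mpos : 0 < INR M) by (apply lt_0_INR; lia).
unfold ev, trig. apply lsum_ext; intros a _. unfold bas, ts; cbn [fst snd pow INR].
rewrite !Rmult_1_r. f_equal. f_equal; f_equal; field; lra.
Qed.

(** Collocation: by [fourier_inversion] the equation for the coefficients is the differential
    equation at the grid points. *)
Lemma trig_grid_eq M n om phi J Cst c m i : (2 <= M)%nat -> phi 0 = 0 -> grid_solution M n om phi J Cst c -> (i <= M)%nat ->
  om ^ 2 * INR n ^ 2 * trig M c 2 0 (PI * INR m / INR M) (PI * INR i / INR M)
  - trig M c 0 2 (PI * INR m / INR M) (PI * INR i / INR M)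
  + phi (trig M c 0 0 (PI * INR m / INR M) (PI * INR i / INR M)) = 0.
Proof.
intros HM H0 [_ Heq _ _] Hi. assert (Mpos : 0 < INR M) by (apply lt_0_INR; lia).
assert (E := ev_trig M c 0 m i HM). rewrite Rplus_0_r in E. rewrite <- E.
assert (G : grid_class M (fun p => phi (ev M 0 c p))) by (apply grid_class_comp; [exact H0|apply ev_grid_class, HM]).
rewrite <- (fourier_inversion M HM _ (m, i) G Hi).
unfold ev at 1, trig. rewrite <- lsum_scal, <- lsum_minus, <- lsum_plus. apply lsum_zero; intros a Ha.
specialize (Heq a Ha). unfold fhat in Heq.
assert (Eh : hat M (fun p => phi (ev M 0 c p)) a = - lam n om a * c a) by lra. rewrite Eh.
rewrite bas0; unfold tc, ts; cbn [fst snd].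
replace (INR (fst a) * (PI * INR m / INR M) + INR 2 * (PI / 2)) with (PI * INR (fst a) * INR m / INR M + PI) by (cbn [INR]; field; lra).
replace (INR (snd a) * (PI * INR i / INR M) + INR 2 * (PI / 2)) with (PI * INR (snd a) * INR i / INR M + PI) by (cbn [INR]; field; lra).
replace (INR (fst a) * (PI * INR m / INR M) + INR 0 * (PI / 2)) with (PI * INR (fst a) * INR m / INR M) by (cbn [INR]; field; lra).
replace (INR (snd a) * (PI * INR i / INR M) + INR 0 * (PI / 2)) with (PI * INR (snd a) * INR i / INR M) by (cbn [INR]; field; lra).
rewrite neg_cos, neg_sin. unfold lam. cbn [pow]. ring.
Qed.

Lemma lsum_Md_split M K F : (M <= K)%nat ->
  lsum (Md K) F = lsum (Md M) F + lsum (filter (fun a => negb (inMd M a)) (Md K)) F.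
Proof.
intros H. rewrite (lsum_filter (Md K) (inMd M)). f_equal.
apply lsum_perm, NoDup_Permutation.
- apply NoDup_filter, NoDup_Md.
- apply NoDup_Md.
- intros a. rewrite filter_In, inMd_spec. split; [tauto|]. intros Ha; split; [now apply (incl_Md M K H)|exact Ha].
Qed.

Lemma rhot_pos J n a : 0 < rhot J n a.
Proof.
unfold rhot. generalize (rho1_pos J a) (rho1_pos (fun k => n * k)%nat a) (rho3_pos a). lra.
Qed.

Lemma rhot_tail J n eta : 0 < eta -> exists K0, forall K, (K0 <= K)%nat ->
  lsum (filter (fun a => negb (inMd K0 a)) (Md K)) (rhot J n) <= eta.
Proof.
intros He.
destruct (completeness (fun z => exists K, z = lsum (Md K) (rhot J n))) as [b [Hb1 Hb2]].
{ exists 36. intros z [K ->]. apply sum_rhot. }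
{ exists (lsum (Md 0) (rhot J n)), 0%nat. reflexivity. }
assert (HK : exists K0, b - eta < lsum (Md K0) (rhot J n)).
{ apply Classical_Prop.NNPP. intros H. assert (b <= b - eta); [|lra]. apply Hb2. intros z [K ->].
  apply Rnot_lt_le. intros L. apply H. now exists K. }
destruct HK as [K0 HK0]. exists K0. intros K H.
assert (E := lsum_Md_split K0 K (rhot J n) H).
assert (B : lsum (Md K) (rhot J n) <= b) by (apply Hb1; now exists K). lra.
Qed.

(** Cauchy-Schwarz between [rhot], whose tail is small, and the majorant [T], whose total is at most
    [Cst]. *)
Lemma grid_solution_tail M n om phi J Cst c B K0 K :
  grid_solution M n om phi J Cst c -> 0 <= B -> (M <= K)%nat ->
  lsum (filter (fun a => negb (inMd K0 a)) (Md K)) (rhot J n) <= B ^ 2 ->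
  lsum (filter (fun a => negb (inMd K0 a)) (Md K)) (fun a => Rabs (wsec c a)) <= B * sqrt Cst.
Proof.
intros [Hs _ _ (T & HT0 & HT1 & HT2)] HB HMK Hr.
set (T' := fun a => if inMd M a then T a else 0).
assert (T'0 : forall a, 0 <= T' a) by (intros a; unfold T'; destruct (inMd M a); [apply HT0|lra]).
set (l := filter _ _) in *.
eapply Rle_trans; [apply (lsum_abs_weighted (wsec c) (fun a => sqrt (T' a)) (rhot J n) l B HB)|].
- intros; apply Rlt_le, rhot_pos.
- intros a _. rewrite pow2_sqrt by apply T'0. unfold T', wsec. destruct (inMd M a) eqn:E.
  + apply HT2. now apply inMd_spec.
  + rewrite (Hs a E). rewrite Rmult_0_r, pow_i by lia. lra.
- exact Hr.
- apply Rmult_le_compat_l; [exact HB|]. apply sqrt_le_1_alt.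
  rewrite (lsum_ext l _ T') by (intros; apply pow2_sqrt, T'0).
  apply Rle_trans with (lsum (Md K) T').
  + apply lsum_incl_le; [apply NoDup_filter, NoDup_Md| |intros; apply T'0].
    intros a Ha. apply filter_In in Ha. tauto.
  + rewrite (lsum_Md_incl M K T' HMK) by (intros a Ha; unfold T'; now rewrite Ha).
    rewrite (lsum_ext (Md M) T' T); [exact HT1|]. intros a Ha. unfold T'. apply inMd_spec in Ha. now rewrite Ha.
Qed.

(** Coordinatewise convergence handles finitely many modes and the uniform tails all others, so the
    subsequence is Cauchy in the absolute sum norm. *)
Lemma cauchy_grid_solutions n om phi J Cst : (1 <= n)%nat ->
  (forall M, (4 * n <= M)%nat -> exists c, grid_solution M n om phi J Cst c) ->
  exists (Ms : nat -> nat) (cs : nat -> nat * nat -> R),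
    (forall q, (4 * n <= Ms q)%nat /\ (q <= Ms q)%nat) /\
    (forall q, grid_solution (Ms q) n om phi J Cst (cs q)) /\
    forall eta, 0 < eta -> exists Q, forall q q' K, (Q <= q)%nat -> (Q <= q')%nat ->
      (Ms q <= K)%nat -> (Ms q' <= K)%nat -> lsum (Md K) (fun a => Rabs (wsec (cs q) a - wsec (cs q') a)) <= eta.
Proof.
intros Hn H.
destruct (functional_choice (fun q c => grid_solution (4 * n + q) n om phi J Cst c)) as [c0 Hc0].
{ intros q. apply H; lia. }
destruct (coord_subsequence (fun q => wsec (c0 q)) (fun a => 1 + rhot J n a * Rabs Cst)) as (s & l & Hs & Hl).
{ intros q a. assert (R0 := rhot_pos J n a). destruct (Hc0 q) as [Hsup _ _ (T & HT0 & HT1 & HT2)].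
  assert (P : 0 <= rhot J n a * Rabs Cst) by (apply Rmult_le_pos; [lra|apply Rabs_pos]).
  destruct (inMd (4 * n + q) a) eqn:E.
  - apply inMd_spec in E. specialize (HT2 a E). fold (wsec (c0 q) a) in HT2.
    assert (T1 := lsum_term_le _ T a (fun b _ => HT0 b) E).
    assert (T2 : T a <= Rabs Cst) by (generalize (Rle_abs Cst); lra).
    assert (T3 : wsec (c0 q) a ^ 2 <= rhot J n a * Rabs Cst).
    { eapply Rle_trans; [exact HT2|]. apply Rmult_le_compat_l; lra. }
    rewrite <- pow2_abs in T3. generalize (Rabs_pos (wsec (c0 q) a)); intros.
    assert (0 <= (Rabs (wsec (c0 q) a) - 1) ^ 2) by apply pow2_ge_0. nra.
  - unfold wsec. rewrite (Hsup a E), Rmult_0_r, Rabs_R0. lra. }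
exists (fun q => (4 * n + s q)%nat), (fun q => c0 (s q)).
assert (Hsq := incr_ge_id s Hs).
split; [|split].
- intros q. specialize (Hsq q). lia.
- intros q. apply Hc0.
- intros eta He.
  assert (SC := sqrt_pos Cst).
  set (B := eta / (8 * (sqrt Cst + 1))).
  assert (HB : 0 < B) by (apply Rdiv_lt_0_compat; lra).
  destruct (rhot_tail J n (B ^ 2)) as [K0 HK0]; [now apply pow_lt|].
  assert (L : is_lim_seq (fun q => lsum (Md K0) (fun a => Rabs (wsec (c0 (s q)) a - l a))) (lsum (Md K0) (fun a => Rabs (l a - l a)))).
  { apply is_lim_seq_lsum. intros a _. apply (is_lim_seq_abs _ (l a - l a)). apply is_lim_seq_minus'; [apply Hl|apply is_lim_seq_const]. }
  rewrite (lsum_zero (Md K0)) in L by (intros; rewrite Rminus_diag; apply Rabs_R0).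
  apply is_lim_seq_spec in L. destruct (L (mkposreal (eta / 4) ltac:(lra))) as [Q HQ]. cbn [pos] in HQ.
  exists Q. intros q q' K Hq Hq' HK HK'.
  assert (BS : B * sqrt Cst <= eta / 8).
  { unfold B. apply Rmult_le_reg_r with (8 * (sqrt Cst + 1)); [lra|].
    replace (eta / (8 * (sqrt Cst + 1)) * sqrt Cst * (8 * (sqrt Cst + 1))) with (eta * sqrt Cst) by (field; lra).
    replace (eta / 8 * (8 * (sqrt Cst + 1))) with (eta * (sqrt Cst + 1)) by field. nra. }
  set (D := fun a => Rabs (wsec (c0 (s q)) a - wsec (c0 (s q')) a)).
  assert (D0 : forall a, 0 <= D a) by (intros; apply Rabs_pos).
  set (K' := Nat.max K K0).
  apply Rle_trans with (lsum (Md K') D).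
  { apply lsum_incl_le; [apply NoDup_Md|apply incl_Md; unfold K'; lia|intros; apply D0]. }
  rewrite (lsum_Md_split K0 K') by (unfold K'; lia).
  assert (H1 : lsum (Md K0) D <= eta / 4 + eta / 4).
  { apply Rle_trans with (lsum (Md K0) (fun a => Rabs (wsec (c0 (s q)) a - l a)) + lsum (Md K0) (fun a => Rabs (wsec (c0 (s q')) a - l a))).
    - rewrite <- lsum_plus. apply lsum_le; intros a _. unfold D.
      replace (wsec (c0 (s q)) a - wsec (c0 (s q')) a) with ((wsec (c0 (s q)) a - l a) + - (wsec (c0 (s q')) a - l a)) by ring.
      eapply Rle_trans; [apply Rabs_triang|]. rewrite Rabs_Ropp. apply Rle_refl.
    - assert (G1 := HQ q Hq). assert (G2 := HQ q' Hq'). rewrite Rminus_0_r in G1, G2.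
      apply Rabs_lt_between in G1. apply Rabs_lt_between in G2. lra. }
  assert (H2 : lsum (filter (fun a => negb (inMd K0 a)) (Md K')) D <= eta / 8 + eta / 8).
  { assert (HK'' := HK0 K' ltac:(unfold K'; lia)).
    assert (T1 := grid_solution_tail _ _ _ _ _ _ _ B K0 K' (Hc0 (s q)) (Rlt_le _ _ HB) ltac:(unfold K'; lia) HK'').
    assert (T2 := grid_solution_tail _ _ _ _ _ _ _ B K0 K' (Hc0 (s q')) (Rlt_le _ _ HB) ltac:(unfold K'; lia) HK'').
    eapply Rle_trans; [|apply Rplus_le_compat; eapply Rle_trans; [exact T1|exact BS|exact T2|exact BS]].
    rewrite <- lsum_plus. apply lsum_le; intros a _. unfold D.
    eapply Rle_trans; [apply Rabs_triang|]. rewrite Rabs_Ropp. apply Rle_refl. }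
  lra.
Qed.

(** Rounding down keeps the index of an abscissa at most [Ms q], as the equation on the grid
    requires. *)
Lemma grid_points_converge (Ms : nat -> nat) t : 0 <= t -> (forall q, (1 <= Ms q)%nat /\ (q <= Ms q)%nat) ->
  exists mq : nat -> nat, (forall q, INR (mq q) <= t * INR (Ms q) / PI) /\
    is_lim_seq (fun q => PI * INR (mq q) / INR (Ms q)) t.
Proof.
intros Ht HMs. assert (HP := PI_RGT_0).
destruct (functional_choice (fun q m => INR m <= t * INR (Ms q) / PI < INR m + 1)) as [mq Hmq].
{ intros q. destruct (nfloor_ex (t * INR (Ms q) / PI)) as [m Hm]; [apply Rdiv_le_0_compat; [apply Rmult_le_pos; [exact Ht|apply pos_INR]|exact HP]|now exists m]. }
exists mq. split; [intros q; apply Hmq|].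
apply (is_lim_seq_of_bound _ (fun q => PI * (2 * / (INR q + 1)))).
- intros q. destruct (Hmq q) as [H1 H2]. destruct (HMs q) as [M1 M2].
  apply le_INR in M1. apply le_INR in M2. cbn [INR] in M1. set (N := INR (Ms q)) in *. set (m := INR (mq q)) in *.
  assert (Q0 := pos_INR q).
  assert (E : t = PI / N * (t * N / PI)) by (field; lra).
  assert (PN : 0 < PI / N) by (apply Rdiv_lt_0_compat; lra).
  replace (PI * m / N) with (PI / N * m) by (field; lra).
  rewrite E at 1. rewrite <- Rmult_minus_distr_l, Rabs_mult, (Rabs_pos_eq (PI / N)) by lra.
  rewrite Rabs_left1 by lra.
  apply Rle_trans with (PI / N * 1); [apply Rmult_le_compat_l; lra|]. rewrite Rmult_1_r. unfold Rdiv. apply Rmult_le_compat_l; [lra|].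
  replace (2 * / (INR q + 1)) with (/ ((INR q + 1) / 2)) by (field; lra). apply Rinv_le_contravar; lra.
- apply is_lim_seq_0_scal, is_lim_seq_0_scal. replace (Finite 0) with (Rbar_inv p_infty) by reflexivity.
  apply is_lim_seq_inv; [|easy]. apply is_lim_seq_plus with p_infty 1; [apply is_lim_seq_INR|apply is_lim_seq_const|easy].
Qed.

Theorem limit_solution n om phi J Cst : (1 <= n)%nat -> phi 0 = 0 -> (forall y, continuous phi y) ->
  (forall M, (4 * n <= M)%nat -> exists c, grid_solution M n om phi J Cst c) ->
  exists U : nat -> nat -> R -> R -> R,
    (forall p r t x, (p + r <= 1)%nat -> is_derive (fun s => U p r s x) t (U (S p) r t x)) /\
    (forall p r t x, (p + r <= 1)%nat -> is_derive (fun y => U p r t y) x (U p (S r) t x)) /\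
    (forall p r t x, (p + r <= 2)%nat -> continuous (fun z : R * R => U p r (fst z) (snd z)) (t, x)) /\
    (forall t x, 0 <= x <= PI -> om ^ 2 * INR n ^ 2 * U 2%nat 0%nat t x - U 0%nat 2%nat t x + phi (U 0%nat 0%nat t x) = 0) /\
    (forall t, U 0%nat 0%nat t 0 = 0 /\ U 0%nat 0%nat t PI = 0) /\
    (forall t x, U 0%nat 0%nat (- t) x = U 0%nat 0%nat t x) /\
    (forall t x, U 0%nat 0%nat (t + 2 * PI) x = U 0%nat 0%nat t x) /\
    (forall al, (forall t x, 0 <= x <= PI -> U 0%nat 0%nat (t + al) x = U 0%nat 0%nat t x) -> cos al = 1).
Proof.
intros Hn Hphi0 Hphi Hex.
destruct (cauchy_grid_solutions n om phi J Cst Hn Hex) as (Ms & cs & HMs & Hsol & Hcau).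
set (F := fun q p r t x => trig (Ms q) (cs q) p r t x).
assert (F_cauchy : forall eta, 0 < eta -> exists Q, forall q q', (Q <= q)%nat -> (Q <= q')%nat ->
  forall p r t x, (p + r <= 2)%nat -> Rabs (F q p r t x - F q' p r t x) <= eta).
{ intros eta He. destruct (Hcau eta He) as [Q HQ]. exists Q. intros q q' Hq Hq' p r t x Hpr.
  eapply Rle_trans; [apply (trig_diff_bound (Ms q) (Ms q') (Nat.max (Ms q) (Ms q'))); [lia|lia|apply Hsol|apply Hsol|exact Hpr]|].
  apply HQ; lia. }
assert (F_dt : forall q p r t x, is_derive (fun s => F q p r s x) t (F q (S p) r t x)) by (intros; apply trig_dt).
assert (F_dx : forall q p r t x, is_derive (fun y => F q p r t y) x (F q p (S r) t x)) by (intros; apply trig_dx).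
assert (F_cont : forall q p r t x, continuous (fun z : R * R => F q p r (fst z) (snd z)) (t, x)) by (intros; apply trig_continuous).
set (U := Ulim F).
assert (Uspec := Ulim_spec F F_cauchy).
(* Transfers evenness, periodicity and, with [sg = 0], the boundary values from the polynomials to
   the limit. *)
assert (Ueq : forall p r t x p' r' t' x' sg, (p + r <= 2)%nat -> (p' + r' <= 2)%nat ->
  (forall q, F q p r t x = sg * F q p' r' t' x') -> U p r t x = sg * U p' r' t' x').
{ intros p r t x p' r' t' x' sg H1 H2 HE.
  assert (L1 := Uspec p r t x H1). assert (L2 := Uspec p' r' t' x' H2).
  apply (is_lim_seq_ext _ (fun q => sg * F q p' r' t' x')) in L1; [|exact HE].
  assert (L3 : is_lim_seq (fun q => sg * F q p' r' t' x') (sg * Ulim F p' r' t' x')) by (apply is_lim_seq_mult'; [apply is_lim_seq_const|exact L2]).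
  apply is_lim_seq_unique in L1. apply is_lim_seq_unique in L3. unfold U. congruence. }
exists U.
split; [intros; now apply Ulim_dt|].
split; [intros; now apply Ulim_dx|].
split; [intros; now apply Ulim_continuous|].
assert (Even : forall p t x, (p = 0%nat \/ p = 2%nat) -> forall r, (p + r <= 2)%nat -> U p r (- t) x = U p r t x).
{ intros p t x Hp r Hr. rewrite <- (Rmult_1_l (U p r t x)). apply Ueq; [exact Hr|exact Hr|]. intros q. rewrite Rmult_1_l.
  unfold F, trig. apply lsum_ext; intros a _. f_equal. f_equal.
  replace (INR (fst a) * - t + INR p * (PI / 2)) with (- (INR (fst a) * t - INR p * (PI / 2))) by ring.
  rewrite cos_neg. destruct Hp as [-> | ->]; cbn [INR].
  - f_equal; ring.
  - replace (INR (fst a) * t - (1 + 1) * (PI / 2)) with (INR (fst a) * t - PI) by field.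
    replace (INR (fst a) * t + (1 + 1) * (PI / 2)) with (INR (fst a) * t + PI) by field.
    rewrite cos_minus, cos_plus, sin_PI. ring. }
(* Grid times are indexed by naturals, so the equation is first obtained for [t >= 0] and then
   extended by evenness. *)
assert (PDEpos : forall t x, 0 <= t -> 0 <= x <= PI -> om ^ 2 * INR n ^ 2 * U 2%nat 0%nat t x - U 0%nat 2%nat t x + phi (U 0%nat 0%nat t x) = 0).
{ intros t x Ht Hx. assert (HP := PI_RGT_0).
  assert (HMs' : forall q, (1 <= Ms q)%nat /\ (q <= Ms q)%nat) by (intros q; specialize (HMs q); lia).
  destruct (grid_points_converge Ms t Ht HMs') as (mq & _ & Lm).
  destruct (grid_points_converge Ms x (proj1 Hx) HMs') as (iq & Hiq & Li).
  set (tq := fun q => PI * INR (mq q) / INR (Ms q)) in *. set (xq := fun q => PI * INR (iq q) / INR (Ms q)) in *.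
  assert (Mv := Ulim_moving F F_cauchy F_cont).
  assert (L : is_lim_seq (fun q => om ^ 2 * INR n ^ 2 * F q 2%nat 0%nat (tq q) (xq q) - F q 0%nat 2%nat (tq q) (xq q) + phi (F q 0%nat 0%nat (tq q) (xq q)))
     (om ^ 2 * INR n ^ 2 * U 2%nat 0%nat t x - U 0%nat 2%nat t x + phi (U 0%nat 0%nat t x))).
  { apply is_lim_seq_plus'; [apply is_lim_seq_minus'; [apply is_lim_seq_mult'; [apply is_lim_seq_const|]|]|].
    - apply Mv; [lia|exact Lm|exact Li].
    - apply Mv; [lia|exact Lm|exact Li].
    - apply is_lim_seq_comp_cont; [apply Hphi|]. apply Mv; [lia|exact Lm|exact Li]. }
  apply (is_lim_seq_ext _ (fun _ => 0)) in L.
  - apply is_lim_seq_unique in L. rewrite Lim_seq_const in L. injection L as L. lra.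
  - intros q. unfold F, tq, xq. apply (trig_grid_eq _ _ _ _ J Cst); [specialize (HMs q); lia|exact Hphi0|apply Hsol|].
    apply INR_le. eapply Rle_trans; [apply Hiq|]. destruct (HMs' q) as [M1 _]. apply le_INR in M1. cbn [INR] in M1.
    apply Rmult_le_reg_r with PI; [exact HP|]. unfold Rdiv. rewrite Rmult_assoc, Rinv_l by lra. nra. }
split.
{ intros t x Hx. destruct (Rle_dec 0 t) as [Ht|Ht]; [now apply PDEpos|].
  assert (E := PDEpos (- t) x ltac:(lra) Hx). rewrite !Even in E by (try lia; auto). exact E. }
split.
{ assert (Z : forall t y, (forall j, sin (INR j * y + INR 0 * (PI / 2)) = 0) -> U 0%nat 0%nat t y = 0).
  { intros t y Hy. rewrite <- (Rmult_0_l (U 0%nat 0%nat t y)). apply Ueq; [lia|lia|]. intros q. rewrite Rmult_0_l.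
    unfold F, trig. apply lsum_zero; intros a _. rewrite Hy. ring. }
  intros t. split; apply Z; intros j; cbn [INR].
  - replace (INR j * 0 + 0 * (PI / 2)) with 0 by field. apply sin_0.
  - replace (INR j * PI + 0 * (PI / 2)) with (IZR (Z.of_nat j) * PI) by (rewrite <- INR_IZR_INZ; field).
    apply sin_eq_0_1. eexists; reflexivity. }
split; [intros; apply Even; [now left|lia]|].
split.
{ intros t x. rewrite <- (Rmult_1_l (U 0%nat 0%nat t x)). apply Ueq; [lia|lia|]. intros q. rewrite Rmult_1_l. unfold F, trig.
  apply lsum_ext; intros a _. f_equal. f_equal. cbn [INR].
  replace (INR (fst a) * (t + 2 * PI) + 0 * (PI / 2)) with (INR (fst a) * t + 0 * (PI / 2) + 2 * INR (fst a) * PI) by ring.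
  apply cos_period. }
intros al Hal.
(* Compare the Fourier coefficient of the mode (1,n) of [u] and of its translate. *)
destruct (Req_dec (cos al) 1) as [E|Hne]; [exact E|exfalso].
assert (Hlt : cos al < 1) by (generalize (COS_bound al); lra).
(* The first coefficient is at least 1/180 and [mu] is 1/4, so the correlation drops by at least
   [(1 - cos al)/720], more than the allowed [2 eta = (1 - cos al)/2000]. *)
set (eta := (1 - cos al) / 4000).
assert (He : 0 < eta) by (unfold eta; lra).
destruct (Ulim_uniform F F_cauchy eta He) as [Q HQ]. specialize (HQ Q (Nat.le_refl Q)).
set (M := Ms Q) in *. set (c := cs Q) in *.
assert (HM4 : (4 * n <= M)%nat) by apply HMs. assert (HM : (2 <= M)%nat) by lia.
assert (Mpos : 0 < INR M) by (apply lt_0_INR; lia). assert (HP := PI_RGT_0).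
assert (E1 : avg M (fun p => ev M 0 (mode1 n) p * ev M 0 c p) - avg M (fun p => ev M 0 (mode1 n) p * ev M al c p)
   = / 4 * c (1%nat, n) * (1 - cos al)).
{ rewrite parseval, parseval_ev by exact HM. rewrite <- lsum_minus, (lsum_single _ _ (1%nat, n)).
  - rewrite mode1_eq, mu_mid by lia. cbn [fst INR]. rewrite (Rmult_1_l al). ring.
  - apply NoDup_Md.
  - now apply in_Md_mode1.
  - intros b _ Hb. rewrite mode1_neq by exact Hb. ring. }
assert (E2 : Rabs (/ 4 * c (1%nat, n) * (1 - cos al)) <= 2 * eta).
{ rewrite <- E1, <- avg_minus by exact HM. eapply Rle_trans; [apply avg_abs, HM|].
  rewrite <- (avg_const M HM (2 * eta)). apply avg_le; [exact HM|]. intros [m i] Hp. apply in_Pt in Hp; cbn [fst snd] in Hp.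
  rewrite <- Rmult_minus_distr_l, Rabs_mult. rewrite <- (Rmult_1_l (2 * eta)).
  apply Rmult_le_compat; try apply Rabs_pos.
  - rewrite ev_mode1 by lia. rewrite Rabs_mult. rewrite <- (Rmult_1_r 1).
    apply Rmult_le_compat; try apply Rabs_pos; apply Rabs_le; [apply COS_bound|apply SIN_bound].
  - rewrite !ev_trig by exact HM. rewrite Rplus_0_r.
    set (t := PI * INR m / INR M). set (x := PI * INR i / INR M).
    assert (Hx : 0 <= x <= PI).
    { unfold x. assert (I0 := pos_INR i). assert (I1 : INR i <= INR M) by (apply le_INR; lia). split.
      - apply Rdiv_le_0_compat; [apply Rmult_le_pos; lra|lra].
      - apply Rmult_le_reg_r with (INR M); [lra|]. unfold Rdiv. rewrite Rmult_assoc, Rinv_l by lra. nra. }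
    assert (H1 := HQ 0%nat 0%nat t x ltac:(lia)). assert (H2 := HQ 0%nat 0%nat (t + al) x ltac:(lia)).
    fold U in H1, H2. rewrite (Hal t x Hx) in H2. unfold F in H1, H2. fold M c in H1, H2.
    apply Rabs_le_between in H1. apply Rabs_le_between in H2. apply Rabs_le. lra. }
assert (G := gs_mode _ _ _ _ _ _ _ (Hsol Q)). fold c in G.
rewrite !Rabs_mult, (Rabs_pos_eq (/ 4)), (Rabs_pos_eq (1 - cos al)) in E2 by lra.
assert (/ 180 * (1 - cos al) <= Rabs (c (1%nat, n)) * (1 - cos al)) by (apply Rmult_le_compat_r; lra).
unfold eta in E2. lra.
Qed.

(** * The rescaled nonlinearity *)

Lemma mean_value_bound (g g' : R -> R) (L x y : R) : (forall z, is_derive g z (g' z)) ->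
  (forall z, Rmin x y <= z <= Rmax x y -> Rabs (g' z) <= L) -> Rabs (g y - g x) <= L * Rabs (y - x).
Proof.
intros Hd HL. destruct (MVT_gen g x y g') as [c [Hc ->]].
- intros; apply Hd.
- intros z _. apply continuity_pt_filterlim. apply (ex_derive_continuous (V := R_NormedModule)). eexists; apply Hd.
- rewrite Rabs_mult. apply Rmult_le_compat_r; [apply Rabs_pos|now apply HL].
Qed.

Lemma between_abs x y z B : Rabs x <= B -> Rabs y <= B -> Rmin x y <= z <= Rmax x y -> Rabs z <= B.
Proof.
intros Hx Hy. apply Rabs_le_between in Hx. apply Rabs_le_between in Hy. intros Hz. apply Rabs_le_between.
unfold Rmin, Rmax in Hz. destruct (Rle_dec x y); lra.
Qed.

Lemma between_dist x y z : Rmin x y <= z <= Rmax x y -> Rabs (z - x) <= Rabs (y - x).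
Proof.
unfold Rmin, Rmax. intros H. destruct (Rle_dec x y).
- rewrite !Rabs_pos_eq by lra. lra.
- rewrite !Rabs_left1 by lra. lra.
Qed.

Lemma convex_abs x y s B : Rabs x <= B -> Rabs y <= B -> 0 <= s <= 1 -> Rabs (y + s * (x - y)) <= B.
Proof.
intros Hx Hy Hs. replace (y + s * (x - y)) with (s * x + (1 - s) * y) by ring.
eapply Rle_trans; [apply Rabs_triang|]. rewrite !Rabs_mult, (Rabs_pos_eq s), (Rabs_pos_eq (1 - s)) by lra.
assert (s * Rabs x <= s * B) by (apply Rmult_le_compat_l; lra).
assert ((1 - s) * Rabs y <= (1 - s) * B) by (apply Rmult_le_compat_l; lra). lra.
Qed.

Lemma lipschitz_of_derive (g g' : R -> R) L : (forall z, is_derive g z (g' z)) ->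
  (forall z, Rabs z <= 7 -> Rabs (g' z) <= L) ->
  forall x y, Rabs x <= 7 -> Rabs y <= 7 -> Rabs (g x - g y) <= L * Rabs (x - y).
Proof.
intros Hd HL x y Hx Hy. apply (mean_value_bound g g'); [exact Hd|]. intros z Hz. apply HL.
exact (between_abs y x z 7 Hy Hx Hz).
Qed.

Lemma linear_remainder (g g' : R -> R) L : (forall z, is_derive g z (g' z)) ->
  (forall x y, Rabs x <= 7 -> Rabs y <= 7 -> Rabs (g' x - g' y) <= L * Rabs (x - y)) -> 0 <= L ->
  forall x h, Rabs x <= 7 -> Rabs (x + h) <= 7 -> Rabs (g (x + h) - g x - g' x * h) <= L * h ^ 2.
Proof.
intros Hd HL L0 x h Hx Hh.
replace (g (x + h) - g x - g' x * h) with ((fun z => g z - g' x * z) (x + h) - (fun z => g z - g' x * z) x) by ring.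
replace (L * h ^ 2) with (L * Rabs h * Rabs ((x + h) - x)) by (replace (x + h - x) with h by ring; rewrite <- pow2_abs; ring).
apply (mean_value_bound (fun z => g z - g' x * z) (fun z => g' z - g' x)).
- intros z. auto_derive; [eexists; apply Hd|]. rewrite (is_derive_unique (fun y : R => g y) _ _ (Hd z)). ring.
- intros z Hz. eapply Rle_trans; [apply HL; [exact (between_abs _ _ _ 7 Hx Hh Hz)|exact Hx]|].
  apply Rmult_le_compat_l; [exact L0|]. apply between_dist in Hz. now replace (x + h - x) with h in Hz by ring.
Qed.

Lemma quadratic_remainder (g g1 g2 : R -> R) L : (forall z, is_derive g z (g1 z)) -> (forall z, is_derive g1 z (g2 z)) ->
  (forall x y, Rabs x <= 7 -> Rabs y <= 7 -> Rabs (g2 x - g2 y) <= L * Rabs (x - y)) -> 0 <= L ->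
  forall x h, Rabs x <= 7 -> Rabs (x + h) <= 7 ->
    Rabs (g (x + h) - g x - g1 x * h - g2 x * h ^ 2 / 2) <= L * Rabs h ^ 3.
Proof.
intros Hd1 Hd2 HL L0 x h Hx Hh.
set (G := fun z => g z - g1 x * z - g2 x * (z - x) ^ 2 / 2).
replace (g (x + h) - g x - g1 x * h - g2 x * h ^ 2 / 2) with (G (x + h) - G x) by (unfold G; field).
replace (L * Rabs h ^ 3) with (L * Rabs h ^ 2 * Rabs ((x + h) - x)) by (replace (x + h - x) with h by ring; ring).
apply (mean_value_bound G (fun z => g1 z - g1 x - g2 x * (z - x))).
- intros z. unfold G. auto_derive; [eexists; apply Hd1|]. rewrite (is_derive_unique (fun y : R => g y) _ _ (Hd1 z)). field.
- intros z Hz. assert (Hz7 := between_abs _ _ _ 7 Hx Hh Hz).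
  replace (g1 z) with (g1 (x + (z - x))) by (f_equal; ring).
  eapply Rle_trans; [apply (linear_remainder g1 g2 L Hd2 HL L0 x (z - x) Hx)|].
  + now replace (x + (z - x)) with z by ring.
  + apply Rmult_le_compat_l; [exact L0|]. rewrite <- pow2_abs. apply pow_incr. split; [apply Rabs_pos|].
    apply between_dist in Hz. now replace (x + h - x) with h in Hz by ring.
Qed.

Section DerivativeBounds.
Variables (phi phi1 phi2 phi3 : R -> R) (A : R).
Hypothesis D1 : forall z, is_derive phi z (phi1 z).
Hypothesis D2 : forall z, is_derive phi1 z (phi2 z).
Hypothesis D3 : forall z, is_derive phi2 z (phi3 z).
Hypothesis B1 : forall z, Rabs z <= 7 -> Rabs (phi1 z) <= A.
Hypothesis B2 : forall z, Rabs z <= 7 -> Rabs (phi2 z) <= A.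
Hypothesis B3 : forall z, Rabs z <= 7 -> Rabs (phi3 z) <= A.

Let A0 : 0 <= A.
Proof. eapply Rle_trans; [apply Rabs_pos|apply (B1 0)]. rewrite Rabs_R0; lra. Qed.

Lemma nonlin_of_derivatives : phi 0 = 0 -> nonlin phi A.
Proof.
intros H0. split; [exact H0| | |].
- intros x. apply (ex_derive_continuous (V := R_NormedModule)). eexists; apply D1.
- now apply (lipschitz_of_derive phi phi1).
- intros x1 x2 y1 y2 Hx1 Hx2 Hy1 Hy2.
  (* Both segments are traversed with one parameter, so that one mean value estimate gives the
     second difference. *)
  set (G := fun s => phi (x2 + s * (x1 - x2)) - phi (y2 + s * (y1 - y2))).
  replace (phi x1 - phi x2 - (phi y1 - phi y2)) with (G 1 - G 0)
    by (unfold G; rewrite !Rmult_1_l, !Rmult_0_l, !Rplus_0_r; replace (x2 + (x1 - x2)) with x1 by ring; replace (y2 + (y1 - y2)) with y1 by ring; ring).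
  match goal with |- _ <= ?B => replace B with (B * Rabs (1 - 0)) by (rewrite Rminus_0_r, Rabs_R1; apply Rmult_1_r) end.
  apply (mean_value_bound G (fun s => phi1 (x2 + s * (x1 - x2)) * (x1 - x2) - phi1 (y2 + s * (y1 - y2)) * (y1 - y2))).
  + intros s. unfold G. auto_derive; [repeat split; eexists; apply D1|]. rewrite !(is_derive_unique (fun y : R => phi y) _ _ (D1 _)). ring.
  + intros s. rewrite Rmin_left, Rmax_right by lra. intros Hs.
    set (P := x2 + s * (x1 - x2)). set (Q := y2 + s * (y1 - y2)).
    assert (HP : Rabs P <= 7) by now apply convex_abs.
    assert (HQ : Rabs Q <= 7) by now apply convex_abs.
    replace (phi1 P * (x1 - x2) - phi1 Q * (y1 - y2)) with (phi1 P * (x1 - x2 - (y1 - y2)) + (phi1 P - phi1 Q) * (y1 - y2)) by ring.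
    eapply Rle_trans; [apply Rabs_triang|]. rewrite !Rabs_mult. apply Rplus_le_compat.
    * apply Rmult_le_compat_r; [apply Rabs_pos|now apply B1].
    * rewrite Rmult_assoc, (Rmult_comm (Rabs (y1 - y2))), <- Rmult_assoc. apply Rmult_le_compat_r; [apply Rabs_pos|].
      eapply Rle_trans; [apply (lipschitz_of_derive phi1 phi2 A D2 B2 P Q HP HQ)|]. apply Rmult_le_compat_l; [exact A0|].
      replace (P - Q) with (s * (x1 - y1) + (1 - s) * (x2 - y2)) by (unfold P, Q; ring).
      eapply Rle_trans; [apply Rabs_triang|]. rewrite !Rabs_mult, (Rabs_pos_eq s), (Rabs_pos_eq (1 - s)) by lra.
      assert (0 <= (1 - s) * Rabs (x1 - y1)) by (apply Rmult_le_pos; [lra|apply Rabs_pos]).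
      assert (0 <= s * Rabs (x2 - y2)) by (apply Rmult_le_pos; [lra|apply Rabs_pos]). lra.
Qed.

Lemma nonlin_diff_of_derivatives : nonlin_diff phi A.
Proof.
assert (L1 := lipschitz_of_derive phi1 phi2 A D2 B2).
assert (L2 := lipschitz_of_derive phi2 phi3 A D3 B3).
split.
- intros y0 y1 y2 H0 H1 H2.
  assert (R2 := linear_remainder phi phi1 A D1 L1 A0 y1 (y2 - y1) H1).
  assert (R0 := linear_remainder phi phi1 A D1 L1 A0 y1 (y0 - y1) H1).
  replace (y1 + (y2 - y1)) with y2 in R2 by ring. replace (y1 + (y0 - y1)) with y0 in R0 by ring.
  specialize (R2 H2). specialize (R0 H0).
  replace (phi y2 - 2 * phi y1 + phi y0) with (phi1 y1 * (y2 - 2 * y1 + y0) + ((phi y2 - phi y1 - phi1 y1 * (y2 - y1)) + (phi y0 - phi y1 - phi1 y1 * (y0 - y1)))) by ring.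
  eapply Rle_trans; [apply Rabs_triang|]. apply Rplus_le_compat.
  + rewrite Rabs_mult. apply Rmult_le_compat_r; [apply Rabs_pos|now apply B1].
  + eapply Rle_trans; [apply Rabs_triang|]. rewrite !pow2_abs. replace ((y1 - y0) ^ 2) with ((y0 - y1) ^ 2) by ring. lra.
- intros y0 y1 y2 y3 H0 H1 H2 H3.
  assert (Q := fun h => quadratic_remainder phi phi1 phi2 A D1 D2 L2 A0 y0 h H0).
  assert (Q1 := Q (y1 - y0)). assert (Q2 := Q (y2 - y0)). assert (Q3 := Q (y3 - y0)). clear Q.
  replace (y0 + (y1 - y0)) with y1 in Q1 by ring. replace (y0 + (y2 - y0)) with y2 in Q2 by ring. replace (y0 + (y3 - y0)) with y3 in Q3 by ring.
  specialize (Q1 H1). specialize (Q2 H2). specialize (Q3 H3).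
  set (r1 := phi y1 - _ - _ - _) in Q1. set (r2 := phi y2 - _ - _ - _) in Q2. set (r3 := phi y3 - _ - _ - _) in Q3.
  set (e1 := y1 - y0). set (d2 := y2 - 2 * y1 + y0). set (d3 := y3 - 3 * y2 + 3 * y1 - y0).
  set (S := Rabs e1 + Rabs (y2 - y1) + Rabs (y3 - y2)).
  assert (P1 := Rabs_pos e1). assert (P2 := Rabs_pos (y2 - y1)). assert (P3 := Rabs_pos (y3 - y2)).
  assert (Pd2 := Rabs_pos d2). assert (Pd3 := Rabs_pos d3).
  assert (h1 : Rabs (y1 - y0) <= S) by (fold e1; unfold S; lra).
  assert (h2 : Rabs (y2 - y0) <= S).
  { replace (y2 - y0) with (e1 + (y2 - y1)) by (unfold e1; ring). eapply Rle_trans; [apply Rabs_triang|]. unfold S; lra. }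
  assert (h3 : Rabs (y3 - y0) <= S).
  { replace (y3 - y0) with (e1 + (y2 - y1) + (y3 - y2)) by (unfold e1; ring). eapply Rle_trans; [apply Rabs_triang|].
    generalize (Rabs_triang e1 (y2 - y1)). unfold S; lra. }
  assert (hd2 : Rabs d2 <= S).
  { replace d2 with ((y2 - y1) + - e1) by (unfold d2, e1; ring). eapply Rle_trans; [apply Rabs_triang|]. rewrite Rabs_Ropp. unfold S; lra. }
  assert (Hcube : forall h, Rabs h <= S -> A * Rabs h ^ 3 <= A * S ^ 3).
  { intros h Hh. apply Rmult_le_compat_l; [exact A0|]. apply pow_incr. split; [apply Rabs_pos|exact Hh]. }
  assert (C1 := Hcube _ h1). assert (C2 := Hcube _ h2). assert (C3 := Hcube _ h3).
  assert (Hb : Rabs e1 <= 14 /\ Rabs d2 <= 28 /\ Rabs d3 <= 56).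
  { apply Rabs_le_between in H0. apply Rabs_le_between in H1. apply Rabs_le_between in H2. apply Rabs_le_between in H3.
    unfold e1, d2, d3. repeat split; apply Rabs_le_between; lra. }
  (* This is [h3^2 - 3 h2^2 + 3 h1^2] with [h_i = y_i - y0], rewritten in the differences; the terms
     [e1^2] cancel. Bounding one factor of each remaining product gives [154 |d3|], the origin of
     160. *)
  set (q := 6 * d2 ^ 2 + 6 * e1 * d2 + d3 ^ 2 + 6 * e1 * d3 + 6 * d2 * d3).
  replace (phi y3 - 3 * phi y2 + 3 * phi y1 - phi y0) with (phi1 y0 * d3 + phi2 y0 * (q / 2) + (r3 + (- 3 * r2 + 3 * r1)))
    by (unfold r1, r2, r3, q, d3, d2, e1; field).
  assert (Hq : Rabs (q / 2) <= 6 * (Rabs d2 * S) + 154 * Rabs d3).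
  { replace (q / 2) with (3 * (d2 * d2) + (3 * (e1 * d2) + (/ 2 * (d3 * d3) + (3 * (e1 * d3) + 3 * (d2 * d3))))) by (unfold q; field).
    assert (T : forall a b c d e, Rabs (a + (b + (c + (d + e)))) <= Rabs a + (Rabs b + (Rabs c + (Rabs d + Rabs e)))).
    { intros. do 3 (eapply Rle_trans; [apply Rabs_triang|apply Rplus_le_compat_l]). apply Rabs_triang. }
    eapply Rle_trans; [apply T|]. rewrite !Rabs_mult, (Rabs_pos_eq 3), (Rabs_pos_eq (/ 2)) by lra.
    assert (S0 : Rabs e1 <= S) by exact h1. destruct Hb as (b1 & b2 & b3).
    assert (Rabs d2 * Rabs d2 <= Rabs d2 * S) by (apply Rmult_le_compat_l; lra).
    assert (Rabs e1 * Rabs d2 <= Rabs d2 * S) by (rewrite Rmult_comm; apply Rmult_le_compat_l; lra).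
    assert (Rabs d3 * Rabs d3 <= 56 * Rabs d3) by (apply Rmult_le_compat_r; lra).
    assert (Rabs e1 * Rabs d3 <= 14 * Rabs d3) by (apply Rmult_le_compat_r; lra).
    assert (Rabs d2 * Rabs d3 <= 28 * Rabs d3) by (apply Rmult_le_compat_r; lra).
    lra. }
  assert (G1 : Rabs (phi1 y0 * d3) <= A * Rabs d3) by (rewrite Rabs_mult; apply Rmult_le_compat_r; [lra|now apply B1]).
  assert (G2 : Rabs (phi2 y0 * (q / 2)) <= A * (6 * (Rabs d2 * S) + 154 * Rabs d3)).
  { rewrite Rabs_mult. apply Rmult_le_compat; [apply Rabs_pos|apply Rabs_pos|now apply B2|exact Hq]. }
  assert (G3 : Rabs (r3 + (- 3 * r2 + 3 * r1)) <= 7 * (A * S ^ 3)).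
  { eapply Rle_trans; [apply Rabs_triang|]. eapply Rle_trans; [apply Rplus_le_compat_l, Rabs_triang|].
    rewrite !Rabs_mult, (Rabs_pos_eq 3), (Rabs_left (- 3)) by lra. lra. }
  assert (0 <= A * Rabs d3) by (apply Rmult_le_pos; lra).
  assert (0 <= A * (Rabs d2 * S)) by (apply Rmult_le_pos; [lra|apply Rmult_le_pos; lra]).
  assert (0 <= A * S ^ 3) by (apply Rmult_le_pos; [lra|apply pow_le; lra]).
  eapply Rle_trans; [apply Rabs_triang|]. eapply Rle_trans; [apply Rplus_le_compat_r, Rabs_triang|].
  replace (160 * A * (Rabs d3 + Rabs d2 * S + S ^ 3)) with (160 * (A * Rabs d3) + 160 * (A * (Rabs d2 * S)) + 160 * (A * S ^ 3)) by ring.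
  lra.
Qed.

Lemma antiderivative_remainder x h : Rabs x <= 7 -> Rabs (x + h) <= 7 ->
  Rabs (RInt phi 0 (x + h) - RInt phi 0 x - phi x * h) <= A * h ^ 2.
Proof.
apply (linear_remainder (fun y => RInt phi 0 y) phi A).
- intros z. assert (Hc : forall y, continuous phi y).
  { intros y. apply (ex_derive_continuous (V := R_NormedModule)). eexists; apply D1. }
  apply is_derive_RInt with 0; [|apply Hc].
  apply filter_forall. intros y. apply (RInt_correct (V := R_CompleteNormedModule)). apply (ex_RInt_continuous (V := R_CompleteNormedModule)). intros; apply Hc.
- now apply (lipschitz_of_derive phi phi1).
- exact A0.
Qed.
End DerivativeBounds.

(** * Taylor polynomials *)

Fixpoint tay (c : nat -> R) (j : nat) (x : R) : R :=
  match j with O => 0 | S j' => tay c j' x + c j' * x ^ j' / INR (fact j') end.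

Lemma tay_derive j : forall c x, is_derive (tay c (S j)) x (tay (fun k => c (S k)) j x).
Proof.
induction j as [|j IH]; intros c x.
- apply (is_derive_ext (fun _ => c O)); [intros; cbn; field|]. cbn. auto_derive; [trivial|ring].
- cbn [tay]. change (is_derive (fun y => tay c (S j) y + c (S j) * y ^ S j / INR (fact (S j))) x
    (tay (fun k => c (S k)) j x + c (S j) * x ^ j / INR (fact j))).
  apply (is_derive_plus (V := R_NormedModule)); [apply IH|].
  assert (F1 := INR_fact_neq_0 j). assert (F2 : INR (S j) <> 0) by (apply not_0_INR; lia).
  rewrite fact_simpl, mult_INR. set (F := INR (fact j)) in *. set (N := INR (S j)) in *. set (m := S j).
  auto_derive; [trivial|]. change (c (S j) * (1 * (N * x ^ j)) * / (N * F) = c (S j) * x ^ j / F).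
 field. tauto.
Qed.

Lemma tay_0 c j : tay c (S j) 0 = c O.
Proof.
induction j as [|j IH]; [cbn; field|]. cbn [tay] in *. rewrite IH, pow_i by lia. unfold Rdiv. ring.
Qed.

Lemma tay_zero c j x : (forall k, (k < j)%nat -> c k = 0) -> tay c j x = 0.
Proof.
induction j as [|j IH]; intros H; [reflexivity|]. cbn [tay]. rewrite IH, (H j) by (intros; try apply H; lia). unfold Rdiv. ring.
Qed.

Lemma tay_even c j x : (forall k, Nat.Odd k -> (k < j)%nat -> c k = 0) -> tay c j (- x) = tay c j x.
Proof.
induction j as [|j IH]; intros H; [reflexivity|]. cbn [tay]. rewrite IH by (intros; apply H; [assumption|lia]).
destruct (Nat.Even_or_Odd j) as [[q ->]|Ho].
- rewrite (pow_mult (- x)), (pow_mult x). replace ((- x) ^ 2) with (x ^ 2) by ring. reflexivity.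
- rewrite (H j Ho) by lia. unfold Rdiv. ring.
Qed.

(** Descent from the derivative of order [m], one mean value estimate per order; the factorials that
    integration would gain are given up. All lower derivatives are treated at once. *)
Lemma taylor_bound f m K : (forall k x, (k <= m)%nat -> ex_derive_n f k x) ->
  (forall x, Rabs x <= 7 -> Rabs (Derive_n f m x) <= K) ->
  forall j i x, (i + j = m)%nat -> Rabs x <= 7 ->
    Rabs (Derive_n f i x - tay (fun k => Derive_n f (i + k) 0) j x) <= K * Rabs x ^ j.
Proof.
intros Hf HK.
assert (HK0 : 0 <= K) by (eapply Rle_trans; [apply Rabs_pos|apply (HK 0); rewrite Rabs_R0; lra]).
induction j as [|j IH]; intros i x Hij Hx.
- replace i with m by lia. cbn. rewrite Rminus_0_r, Rmult_1_r. now apply HK.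
- set (g := fun y => Derive_n f i y - tay (fun k => Derive_n f (i + k) 0) (S j) y).
  assert (G0 : g 0 = 0) by (unfold g; rewrite tay_0, Nat.add_0_r; ring).
  replace (Derive_n f i x - _) with (g x - g 0) by (rewrite G0; unfold g; ring).
  cbn [pow]. rewrite (Rmult_comm (Rabs x)), <- Rmult_assoc. rewrite <- (Rminus_0_r x) at 3.
  apply (mean_value_bound g (fun y => Derive_n f (S i) y - tay (fun k => Derive_n f (i + S k) 0) j y)).
  + intros z. apply (is_derive_minus (V := R_NormedModule)).
    * apply Derive_correct. exact (Hf (S i) z ltac:(lia)).
    * apply (tay_derive j (fun k => Derive_n f (i + k) 0)).
  + intros z Hz.
    assert (Hz7 : Rabs z <= 7) by (apply (between_abs 0 x z); [rewrite Rabs_R0; lra|exact Hx|exact Hz]).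
    assert (B := IH (S i) z ltac:(lia) Hz7).
    replace (tay (fun k => Derive_n f (i + S k) 0) j z) with (tay (fun k => Derive_n f (S i + k) 0) j z).
    2:{ clear. induction j as [|j IH]; [reflexivity|]. cbn [tay]. rewrite IH. now replace (S i + j)%nat with (i + S j)%nat by lia. }
    eapply Rle_trans; [exact B|]. apply Rmult_le_compat_l; [exact HK0|]. apply pow_incr. split; [apply Rabs_pos|].
    apply between_dist in Hz. now rewrite !Rminus_0_r in Hz.
Qed.

Lemma continuous_bounded_7 g : (forall x, continuous g x) -> exists K, 0 < K /\ forall x, Rabs x <= 7 -> Rabs (g x) <= K.
Proof.
intros Hg.
destruct (continuity_ab_maj (fun x => Rabs (g x)) (-7) 7) as [c [Hc _]]; [lra| |].
- intros x _. apply continuity_pt_filterlim. apply (continuous_comp g Rabs); [apply Hg|apply continuous_Rabs].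
- exists (Rabs (g c) + 1). split; [generalize (Rabs_pos (g c)); lra|]. intros x Hx. apply Rabs_le_between in Hx. generalize (Hc x Hx). lra.
Qed.

Lemma C2_of_family (V : nat -> nat -> R -> R -> R) :
  (forall p r t x, (p + r <= 1)%nat -> is_derive (fun s => V p r s x) t (V (S p) r t x)) ->
  (forall p r t x, (p + r <= 1)%nat -> is_derive (fun y => V p r t y) x (V p (S r) t x)) ->
  (forall p r t x, (p + r <= 2)%nat -> continuous (fun z : R * R => V p r (fst z) (snd z)) (t, x)) ->
  C2_2d (V 0%nat 0%nat) /\ pd_t (pd_t (V 0%nat 0%nat)) = V 2%nat 0%nat /\ pd_x (pd_x (V 0%nat 0%nat)) = V 0%nat 2%nat.
Proof.
intros Ht Hx Hc.
assert (Et : forall p r, (p + r <= 1)%nat -> pd_t (V p r) = V (S p) r).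
{ intros p r H. apply functional_extensionality; intros t. apply functional_extensionality; intros x.
  apply is_derive_unique. now apply Ht. }
assert (Ex : forall p r, (p + r <= 1)%nat -> pd_x (V p r) = V p (S r)).
{ intros p r H. apply functional_extensionality; intros t. apply functional_extensionality; intros x.
  apply is_derive_unique. now apply Hx. }
rewrite (Et 0%nat 0%nat), (Ex 0%nat 0%nat), (Et 1%nat 0%nat), (Ex 0%nat 1%nat) by lia.
split; [|split; reflexivity].
intros t x. unfold joint_cont.
rewrite (Et 0%nat 0%nat), (Ex 0%nat 0%nat), (Et 1%nat 0%nat), (Ex 0%nat 1%nat), (Ex 1%nat 0%nat), (Et 0%nat 1%nat) by lia.
refine (conj _ (conj _ (conj _ (conj _ (conj _ (conj _ (conj _ (conj _ (conj _ (conj _ (conj _ (conj _ _)))))))))))); try (apply Hc; lia).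
- eexists; apply (Ht 0%nat 0%nat); lia.
- eexists; apply (Hx 0%nat 0%nat); lia.
- eexists; apply (Ht 1%nat 0%nat); lia.
- eexists; apply (Hx 1%nat 0%nat); lia.
- eexists; apply (Ht 0%nat 1%nat); lia.
- eexists; apply (Hx 0%nat 1%nat); lia.
Qed.

Lemma is_derive_affine (g : R -> R) (dg k w th t : R) : is_derive g (w * t + th) dg ->
  is_derive (fun s => k * g (w * s + th)) t (k * w * dg).
Proof.
intros H. auto_derive; [exists dg; exact H|]. rewrite (is_derive_unique (fun y : R => g y) _ _ H). ring.
Qed.

Lemma cos_eq_1_period al : 0 < al < 2 * PI -> cos al <> 1.
Proof.
intros H E. assert (0 < sin (al / 2)) by (apply sin_gt_0; lra).
replace al with (2 * (al / 2)) in E by field. rewrite cos_2a_sin in E. nra.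
Qed.

(** * Undoing the scaling *)

Section Unscale.
Variables (n : nat) (om de : R) (f phi : R -> R) (U : nat -> nat -> R -> R -> R).
Hypothesis Hn : (1 <= n)%nat.
Hypothesis Hom : 0 < om.
Hypothesis Hde : 0 < de.
Hypothesis Hf : forall y, f (de * y) = de * phi y.
Hypothesis Ut : forall p r t x, (p + r <= 1)%nat -> is_derive (fun s => U p r s x) t (U (S p) r t x).
Hypothesis Ux : forall p r t x, (p + r <= 1)%nat -> is_derive (fun y => U p r t y) x (U p (S r) t x).
Hypothesis Uc : forall p r t x, (p + r <= 2)%nat -> continuous (fun z : R * R => U p r (fst z) (snd z)) (t, x).
Hypothesis Ueq : forall t x, 0 <= x <= PI ->
  om ^ 2 * INR n ^ 2 * U 2%nat 0%nat t x - U 0%nat 2%nat t x + phi (U 0%nat 0%nat t x) = 0.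
Hypothesis Ubd : forall t, U 0%nat 0%nat t 0 = 0 /\ U 0%nat 0%nat t PI = 0.
Hypothesis Uev : forall t x, U 0%nat 0%nat (- t) x = U 0%nat 0%nat t x.
Hypothesis Uper : forall t x, U 0%nat 0%nat (t + 2 * PI) x = U 0%nat 0%nat t x.
Hypothesis Umin : forall al, (forall t x, 0 <= x <= PI -> U 0%nat 0%nat (t + al) x = U 0%nat 0%nat t x) -> cos al = 1.

Lemma multiple_period k t x : U 0%nat 0%nat (t + INR k * (2 * PI)) x = U 0%nat 0%nat t x.
Proof.
induction k as [|k IH]; [f_equal; cbn; ring|]. rewrite S_INR.
replace (t + (INR k + 1) * (2 * PI)) with (t + INR k * (2 * PI) + 2 * PI) by ring. now rewrite Uper.
Qed.

(** Both members of the pair are treated at once: [m = 0] with the identity in [x], and [m = n] with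
    the reflection. *)
Lemma good_unscaled (m : nat) (sg x0 : R) : (sg = 1 /\ x0 = 0) \/ (sg = - 1 /\ x0 = PI) ->
  good_solution f (2 * PI / (INR n * om)) (fun t x => de * U 0%nat 0%nat (INR n * om * t + INR m * PI) (sg * x + x0)).
Proof.
intros Hsg. assert (HP := PI_RGT_0). set (w := INR n * om). set (th := INR m * PI).
assert (N1 : 1 <= INR n) by (apply le_INR in Hn; exact Hn).
assert (Hw : 0 < w) by (unfold w; apply Rmult_lt_0_compat; lra).
set (V := fun (p r : nat) t x => de * w ^ p * sg ^ r * U p r (w * t + th) (sg * x + x0)).
destruct (C2_of_family V) as (C2 & Vt & Vx).
- intros p r t x H. unfold V.
  replace (de * w ^ S p * sg ^ r * _) with (de * w ^ p * sg ^ r * w * U (S p) r (w * t + th) (sg * x + x0)) by (cbn [pow]; ring).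
  apply (is_derive_affine (fun s => U p r s (sg * x + x0))). now apply Ut.
- intros p r t x H. unfold V.
  replace (de * w ^ p * sg ^ S r * _) with (de * w ^ p * sg ^ r * sg * U p (S r) (w * t + th) (sg * x + x0)) by (cbn [pow]; ring).
  apply (is_derive_affine (fun y => U p r (w * t + th) y)). now apply Ux.
- intros p r t x H. unfold V.
  apply (continuous_scal_r (V := R_NormedModule) (de * w ^ p * sg ^ r) (fun z : R * R => U p r (w * fst z + th) (sg * snd z + x0))).
  apply (continuous_comp_2 (fun z : R * R => w * fst z + th) (fun z : R * R => sg * snd z + x0) (U p r)).
  + apply (continuous_plus (V := R_NormedModule)); [|apply continuous_const].
    apply (continuous_scal_r (V := R_NormedModule)), continuous_fst.
  + apply (continuous_plus (V := R_NormedModule)); [|apply continuous_const].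
    apply (continuous_scal_r (V := R_NormedModule)), continuous_snd.
  + now apply Uc.
- assert (EV : (fun t x => de * U 0%nat 0%nat (w * t + th) (sg * x + x0)) = V 0%nat 0%nat).
  { apply functional_extensionality; intros t. apply functional_extensionality; intros x. unfold V. cbn [pow]. ring. }
  rewrite EV.
  assert (Hx : forall x, 0 <= x <= PI -> 0 <= sg * x + x0 <= PI) by (intros x H; destruct Hsg as [[-> ->]|[-> ->]]; lra).
  split; [split; [exact C2|split]|split].
  + intros t x H. rewrite Vt, Vx. unfold V. cbn [pow].
    replace (de * 1 * 1 * U 0%nat 0%nat (w * t + th) (sg * x + x0)) with (de * U 0%nat 0%nat (w * t + th) (sg * x + x0)) by ring.
    rewrite Hf. assert (E := Ueq (w * t + th) (sg * x + x0) (Hx x H)).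
    assert (S2 : sg * (sg * 1) = 1) by (destruct Hsg as [[-> _]|[-> _]]; ring). rewrite S2. unfold w in *.
    replace (de * (INR n * om * (INR n * om * 1)) * 1) with (de * (om ^ 2 * INR n ^ 2)) by ring.
    match goal with |- ?G = 0 => replace G with (de * 0) by (rewrite <- E; ring) end. ring.
  + intros t. unfold V. destruct Hsg as [[-> ->]|[-> ->]].
    * rewrite Rmult_0_r, Rplus_0_r, Rmult_1_l, Rplus_0_r. destruct (Ubd (w * t + th)) as [-> ->]. split; ring.
    * rewrite Rmult_0_r, Rplus_0_l. replace (- 1 * PI + PI) with 0 by ring. destruct (Ubd (w * t + th)) as [-> ->]. split; ring.
  + intros t x _. unfold V. f_equal. replace (w * - t + th) with (- (w * t - th)) by ring. rewrite Uev.
    rewrite <- (multiple_period m (w * t - th)). f_equal. unfold th. ring.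
  + split; [|split].
    * apply Rdiv_lt_0_compat; lra.
    * intros t x _. unfold V. f_equal. rewrite <- (Uper (w * t + th)). f_equal. field. lra.
    * intros T' [HT1 HT2] Hper. apply (cos_eq_1_period (w * T')).
      { split; [now apply Rmult_lt_0_compat|]. apply (Rmult_lt_compat_l w) in HT2; [|exact Hw].
        replace (w * (2 * PI / w)) with (2 * PI) in HT2 by (field; lra). exact HT2. }
      apply Umin. intros t x H.
      (* A shorter period [T'] is pulled back to the invariance of [U] under [w T'], an angle
         strictly between 0 and [2 PI]. *)
      assert (E := Hper ((t - th) / w) (sg * (x - x0))). unfold V in E. cbn [pow] in E.
      replace (w * ((t - th) / w + T') + th) with (t + w * T') in E by (field; lra).
      replace (w * ((t - th) / w) + th) with t in E by (field; lra).
      assert (X : sg * (sg * (x - x0)) + x0 = x) by (destruct Hsg as [[-> ->]|[-> ->]]; ring).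
      rewrite X in E. apply (Rmult_eq_reg_l (de * 1 * 1)); [apply E|lra].
      destruct Hsg as [[-> ->]|[-> ->]]; lra.
Qed.
End Unscale.

(** [E] is the Taylor polynomial of degree below [d], in which only even powers survive, and [psi]
    is the remainder after degree [d]. The constants are fixed before the scale [de]. *)
Lemma scaled_nonlinearity (f : R -> R) (b : R) (p d : nat) : (4 <= p)%nat -> (p < d)%nat -> Ck (d + 1) f ->
  (forall k, (k < p)%nat -> Derive_n f k 0 = 0) -> Derive_n f d 0 = b * INR (fact d) ->
  (forall k, Nat.Odd k -> (k < d)%nat -> Derive_n f k 0 = 0) ->
  exists K K', 0 < K /\ 0 < K' /\ forall de, 0 < de <= 1 ->
    let phi := fun y => f (de * y) / de in let A := K * de ^ (p - 1) in
    nonlin phi A /\ nonlin_diff phi A /\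
    (forall x h, Rabs x <= 7 -> Rabs (x + h) <= 7 -> Rabs (RInt phi 0 (x + h) - RInt phi 0 x - phi x * h) <= A * h ^ 2) /\
    exists E psi : R -> R, (forall y, phi y = E y + b * de ^ (d - 1) * y ^ d + psi y) /\ (forall y, E (- y) = E y) /\
      (forall x y, Rabs x <= 7 -> Rabs y <= 7 -> Rabs (psi x - psi y) <= K' * de ^ d * Rabs (x - y)) /\ psi 0 = 0.
Proof.
intros Hp Hpd HC Hlow Hd Hodd.
assert (Hex : forall k x, (k <= d + 1)%nat -> ex_derive_n f k x) by (intros k x H; now apply HC).
assert (HD : forall k x, (k <= d)%nat -> is_derive (Derive_n f k) x (Derive_n f (S k) x)).
{ intros k x H. apply Derive_correct. exact (Hex (S k) x ltac:(lia)). }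
destruct (continuous_bounded_7 (Derive_n f p)) as (K1 & K1p & HK1); [intros x; apply (HC p ltac:(lia))|].
destruct (continuous_bounded_7 (Derive_n f (d + 1))) as (K2 & K2p & HK2); [intros x; apply (HC (d + 1)%nat ltac:(lia))|].
exists (K1 * 7 ^ p), (K2 * 7 ^ d).
split; [apply Rmult_lt_0_compat; [exact K1p|apply pow_lt; lra]|].
split; [apply Rmult_lt_0_compat; [exact K2p|apply pow_lt; lra]|].
intros de Hde phi A.
assert (H7 : forall y, Rabs y <= 7 -> Rabs (de * y) <= 7 * de).
{ intros y Hy. rewrite Rabs_mult, Rabs_pos_eq by lra. nra. }
assert (Hdy : forall y, Rabs y <= 7 -> Rabs (de * y) <= 7) by (intros y Hy; specialize (H7 y Hy); lra).
assert (Hsc : forall k w y, (k <= d)%nat -> is_derive (fun z => w * Derive_n f k (de * z)) y (w * de * Derive_n f (S k) (de * y))).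
{ intros k w y H. apply (is_derive_ext (fun z => w * Derive_n f k (de * z + 0))); [intros; now rewrite Rplus_0_r|].
  apply is_derive_affine. rewrite Rplus_0_r. now apply HD. }
(* Each derivative of [phi] gains a factor [de] and lowers the vanishing order by one, so all three
   have order [de^(p-1)]; [p >= 4] leaves room for three of them. *)
assert (Hder : forall i y, (1 <= i <= 3)%nat -> Rabs y <= 7 -> Rabs (de ^ (i - 1) * Derive_n f i (de * y)) <= A).
{ intros i y Hi Hy.
  assert (B := taylor_bound f p K1 (fun k x H => Hex k x ltac:(lia)) HK1 (p - i) i (de * y) ltac:(lia) (Hdy y Hy)).
  rewrite tay_zero, Rminus_0_r in B by (intros; apply Hlow; lia).
  rewrite Rabs_mult, (Rabs_pos_eq (de ^ (i - 1))) by (apply pow_le; lra).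
  apply Rle_trans with (de ^ (i - 1) * (K1 * (7 * de) ^ (p - i))).
  - apply Rmult_le_compat_l; [apply pow_le; lra|]. eapply Rle_trans; [exact B|]. apply Rmult_le_compat_l; [lra|].
    apply pow_incr. split; [apply Rabs_pos|now apply H7].
  - rewrite Rpow_mult_distr. unfold A.
    replace (de ^ (i - 1) * (K1 * (7 ^ (p - i) * de ^ (p - i)))) with (K1 * 7 ^ (p - i) * (de ^ (i - 1) * de ^ (p - i))) by ring.
    rewrite <- pow_add. replace (i - 1 + (p - i))%nat with (p - 1)%nat by lia.
    apply Rmult_le_compat_r; [apply pow_le; lra|]. apply Rmult_le_compat_l; [lra|]. apply Rle_pow; [lra|lia]. }
set (phi1 := fun y => 1 * Derive_n f 1 (de * y)). set (phi2 := fun y => de * Derive_n f 2 (de * y)).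
set (phi3 := fun y => de * de * Derive_n f 3 (de * y)).
assert (P1 : forall y, is_derive phi y (phi1 y)).
{ intros y. apply (is_derive_ext (fun z => / de * Derive_n f 0 (de * z))); [intros z; unfold phi; cbn; field; lra|].
  unfold phi1. replace (1 * Derive_n f 1 (de * y)) with (/ de * de * Derive_n f 1 (de * y)) by (rewrite Rinv_l by lra; ring). apply Hsc. lia. }
assert (P2 : forall y, is_derive phi1 y (phi2 y)).
{ intros y. unfold phi2. rewrite <- (Rmult_1_l de) at 1. apply (Hsc 1%nat 1). lia. }
assert (P3 : forall y, is_derive phi2 y (phi3 y)) by (intros y; apply (Hsc 2%nat de); lia).
assert (B1 : forall y, Rabs y <= 7 -> Rabs (phi1 y) <= A).
{ intros y Hy. apply (Hder 1%nat y); [lia|exact Hy]. }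
assert (B2 : forall y, Rabs y <= 7 -> Rabs (phi2 y) <= A).
{ intros y Hy. unfold phi2. replace de with (de ^ (2 - 1)) at 1 by apply pow_1. apply (Hder 2%nat y); [lia|exact Hy]. }
assert (B3 : forall y, Rabs y <= 7 -> Rabs (phi3 y) <= A).
{ intros y Hy. unfold phi3. replace (de * de) with (de ^ (3 - 1)) by (cbn; ring). apply (Hder 3%nat y); [lia|exact Hy]. }
assert (f0 : f 0 = 0) by (apply (Hlow 0%nat); lia).
split; [apply (nonlin_of_derivatives phi phi1 phi2 A P1 P2 B1 B2); unfold phi; rewrite Rmult_0_r, f0; field; lra|].
split; [apply (nonlin_diff_of_derivatives phi phi1 phi2 phi3 A); assumption|].
split; [intros x h; now apply (antiderivative_remainder phi phi1 A P1 B1)|].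
set (c := fun k => Derive_n f k 0).
exists (fun y => tay c d (de * y) / de), (fun y => / de * (f (de * y) - tay c (S d) (de * y))).
split; [|split; [|split]].
- intros y. unfold phi. cbn [tay]. unfold c at 3. rewrite Hd, Rpow_mult_distr.
  assert (F := INR_fact_neq_0 d). replace (de ^ d) with (de * de ^ (d - 1)) by (replace d with (S (d - 1)) at 2 by lia; reflexivity).
  field. lra.
- intros y. replace (de * - y) with (- (de * y)) by ring. now rewrite tay_even.
- apply (lipschitz_of_derive _ (fun y => Derive_n f 1 (de * y) - tay (fun k => c (S k)) d (de * y))).
  + intros y.
    assert (Q : is_derive (fun z => f z - tay c (S d) z) (de * y + 0) (Derive_n f 1 (de * y) - tay (fun k => c (S k)) d (de * y))).
    { rewrite Rplus_0_r. apply (is_derive_minus (V := R_NormedModule)); [apply (HD 0%nat); lia|apply tay_derive]. }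
    apply (is_derive_affine _ _ (/ de) de) in Q. rewrite Rinv_l, Rmult_1_l in Q by lra.
    refine (is_derive_ext _ _ _ _ _ Q). intros z. now rewrite Rplus_0_r.
  + intros y Hy.
    assert (B := taylor_bound f (d + 1) K2 Hex HK2 d 1 (de * y) ltac:(lia) (Hdy y Hy)).
    eapply Rle_trans; [exact B|]. rewrite (Rmult_assoc K2), <- Rpow_mult_distr. apply Rmult_le_compat_l; [lra|].
    apply pow_incr. split; [apply Rabs_pos|now apply H7].
- rewrite Rmult_0_r, tay_0. unfold c. cbn [Derive_n]. rewrite f0. ring.
Qed.

(** Take [l = 1]: if [om <= 3/2], the integer 0 gives the bound; otherwise the nearest integer
    differs from 1 and lies within 1/2. *)
Lemma in_W_le om ga : 0 < om -> 0 < ga -> in_W ga om -> ga <= 3 / 2.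
Proof.
intros Hom Hga HW.
assert (L : forall j, j <> 1%nat -> ga <= Rabs (om - INR j)).
{ intros j Hj. generalize (HW 1%nat j (Nat.le_refl 1) Hj). cbn [INR]. rewrite Rmult_1_r. unfold Rdiv. rewrite Rinv_1, Rmult_1_r. lra. }
destruct (Rle_dec om (3 / 2)) as [H|H].
- specialize (L 0%nat ltac:(lia)). cbn [INR] in L. rewrite Rminus_0_r, Rabs_pos_eq in L by lra. lra.
- destruct (nearest_nat_exists om) as [j Hj]; [lra|]. destruct (Nat.eq_dec j 1) as [->|Hne].
  + cbn [INR] in Hj. apply Rabs_le_between in Hj. lra.
  + specialize (L j Hne). rewrite Rabs_minus_sym in L. lra.
Qed.

(** A power at most 1/2 forces [X < 1], where lowering the exponent enlarges the power. It recovers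
    smallness of [|om - 1| n^2] from that of its power. *)
Lemma le_Rpower_of_small X s : 0 < X -> 0 < s <= 1 -> Rpower X s <= / 2 -> X <= Rpower X s.
Proof.
intros HX Hs H. unfold Rpower in *. rewrite <- (exp_ln X) at 1 by exact HX.
assert (L : s * ln X < 0) by (apply exp_lt_inv; rewrite exp_0; lra).
assert (ln X < 0) by nra.
destruct (Rle_lt_or_eq_dec (ln X) (s * ln X)) as [G|G]; [nra| |].
- now apply Rlt_le, exp_increasing.
- rewrite <- G. apply Rle_refl.
Qed.

Lemma Rpower_root_pow Y (m k : nat) : (1 <= m)%nat -> Rpower Y (/ INR m) ^ k = Rpower Y (INR k / INR m).
Proof.
intros Hm. rewrite <- Rpower_pow by apply exp_pos. rewrite Rpower_mult. f_equal. unfold Rdiv. ring.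
Qed.

Lemma Rpower_le_base q B s : 0 < q <= B -> 1 <= B -> 0 < s <= 1 -> Rpower q s <= B.
Proof.
intros Hq HB Hs. apply Rle_trans with (Rpower B s); [apply Rle_Rpower_l; lra|].
rewrite <- (Rpower_1 B) at 2 by lra. apply Rle_Rpower; lra.
Qed.

Theorem theorem4p9 :
  forall p d : nat,
    (2 <= p)%nat -> Nat.Even p -> Nat.Odd d -> (d < 2 * p - 1)%nat ->
  exists r0 : nat,
  forall (f : R -> R) (a b : R),
    Ck r0 f ->
    (forall k : nat, (k < p)%nat -> Derive_n f k 0 = 0) ->
    Derive_n f p 0 = a * INR (fact p) -> a <> 0 ->
    Derive_n f d 0 = b * INR (fact d) -> b <> 0 ->
    (forall r' : nat, Nat.Odd r' -> (r' < d)%nat -> Derive_n f r' 0 = 0) ->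
  exists C11 : R, 0 < C11 /\
  forall (omega gamma_omega : R) (n : nat),
    0 < omega ->
    is_gamma_omega omega gamma_omega ->
    (1 <= n)%nat ->
    Rpower (Rabs (omega - 1) * INR n ^ 2) ((INR p - 1) / (INR d - 1))
      / gamma_omega <= C11 ->
    (0 < b -> 1 < omega) ->
    (b < 0 -> omega < 1) ->
    exists u : R -> R -> R,
      good_solution f (2 * PI / (INR n * omega)) u /\
      good_solution f (2 * PI / (INR n * omega))
        (fun t x => u (t + PI / omega) (PI - x)).
Proof.
(* One derivative beyond [d] controls the remainder [psi] in Lipschitz norm. *)
intros p d Hp Hpe Hdo Hdp. exists (d + 1)%nat. intros f a b HC Hlow _ _ Hd Hb Hodd.
(* Equality is excluded by parity, and [d < p] would give [b = 0]. With [d < 2p - 1] it follows that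
   [p >= 4], hence [d >= 5]. *)
assert (Hpd : (p < d)%nat).
{ destruct (Nat.lt_trichotomy p d) as [H|[->|H]]; [exact H| |].
  - exfalso. now apply (Nat.Even_Odd_False d).
  - exfalso. rewrite (Hlow d H) in Hd. symmetry in Hd. apply Rmult_integral in Hd. destruct Hd as [Hd|Hd]; [now apply Hb|].
    now apply (INR_fact_neq_0 d). }
assert (Hp4 : (4 <= p)%nat) by (destruct Hpe as [q Hq]; lia).
destruct Hdo as [e He]. assert (He2 : (2 <= e)%nat) by lia.
destruct (scaled_nonlinearity f b p d Hp4 Hpd HC Hlow Hd Hodd) as (K & K' & HK & HK' & Hscaled).
assert (Ab : 0 < Rabs b) by now apply Rabs_pos_lt.
assert (Ee : 0 < INR e + 1) by (generalize (pos_INR e); lra).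
set (G := 6000 * K ^ 2 + K'). assert (HG : 0 < G) by (unfold G; generalize (pow2_ge_0 K); lra).
(* The scale below which the remainder constant of the Nehari problem, at most [G de / |b|], is
   admissible. *)
set (d0 := Rmin 1 (Rabs b / (60 * (INR e + 1)) / G)).
assert (Hd0 : 0 < d0).
{ unfold d0. apply Rmin_glb_lt; [lra|]. repeat apply Rdiv_lt_0_compat; lra. }
set (B := Rmax 1 (3 / Rabs b)).
assert (HB1 : 1 <= B) by apply Rmax_l. assert (HB3 : 3 / Rabs b <= B) by apply Rmax_r.
assert (Hd0p : 0 < d0 ^ (p - 1)) by now apply pow_lt.
(* The first entry keeps [|om - 1| n^2] below 1/2, the second forces [de <= d0], and the third gives
   [1000000 A <= ga]. *)
exists (Rmin (/ 4) (Rmin (d0 ^ (p - 1) / (2 * B)) (/ (1000000 * K * B)))). split.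
{ repeat apply Rmin_glb_lt; [lra|apply Rdiv_lt_0_compat; lra|apply Rinv_0_lt_compat; repeat apply Rmult_lt_0_compat; lra]. }
set (C := Rmin _ _).
assert (C1 : C <= / 4) by apply Rmin_l.
assert (C2 : C <= d0 ^ (p - 1) / (2 * B)) by (eapply Rle_trans; [apply Rmin_r|apply Rmin_l]).
assert (C3 : C <= / (1000000 * K * B)) by (eapply Rle_trans; [apply Rmin_r|apply Rmin_r]).
clearbody C.
intros om ga n Hom [Hga [HW _]] Hn HX Hbp Hbm.
assert (Hga2 := in_W_le om ga Hom Hga HW).
assert (N1 : 1 <= INR n) by (apply le_INR in Hn; exact Hn).
assert (N2 : INR n <= INR n ^ 2) by nra.
assert (Hom1 : om - 1 <> 0).
{ destruct (Rtotal_order b 0) as [H|[H|H]]; [specialize (Hbm H)|contradiction|specialize (Hbp H)]; lra. }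
set (X := Rabs (om - 1) * INR n ^ 2) in *.
assert (HX0 : 0 < X) by (unfold X; apply Rmult_lt_0_compat; [now apply Rabs_pos_lt|lra]).
set (s := (INR p - 1) / (INR d - 1)) in *.
assert (P4 : INR 4 <= INR p) by now apply le_INR. assert (Pd : INR p < INR d) by now apply lt_INR. cbn [INR] in P4.
assert (Hs : 0 < s <= 1).
{ unfold s. split; [apply Rdiv_lt_0_compat; lra|]. apply Rmult_le_reg_r with (INR d - 1); [lra|].
  unfold Rdiv. rewrite Rmult_assoc, Rinv_l by lra. lra. }
set (Z := Rpower X s) in *.
assert (HZ0 : 0 < Z) by apply exp_pos.
assert (HZ : Z <= C * ga).
{ apply Rmult_le_reg_r with (/ ga); [now apply Rinv_0_lt_compat|]. rewrite (Rmult_assoc C), Rinv_r, Rmult_1_r by lra. exact HX. }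
assert (HC0 : 0 < C).
{ apply Rmult_lt_reg_r with ga; [exact Hga|lra]. }
assert (HZ2 : Z <= / 2) by nra.
assert (HXZ : X <= Z) by (apply le_Rpower_of_small; assumption).
assert (Homn : Rabs (om - 1) * INR n <= X) by (unfold X; apply Rmult_le_compat_l; [apply Rabs_pos|exact N2]).
assert (Hom2 : Rabs (om - 1) <= X) by (generalize (Rabs_pos (om - 1)); nra).
assert (Hom3 : / 2 <= om <= 3 / 2).
{ assert (Rabs (om - 1) <= / 2) by lra. apply Rabs_le_between in H. lra. }
set (eps := (om ^ 2 - 1) * INR n ^ 2).
assert (Heps : eps = (om - 1) * INR n ^ 2 * (om + 1)) by (unfold eps; ring).
(* Chosen so that [eps = b q X]; the sign condition on [om - 1] makes [eps / b] positive, so that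
   its root [de] exists. *)
set (q := (om + 1) / Rabs b).
assert (Hq : 0 < q <= B).
{ unfold q. split; [apply Rdiv_lt_0_compat; lra|]. eapply Rle_trans; [|exact HB3]. unfold Rdiv.
  apply Rmult_le_compat_r; [apply Rlt_le, Rinv_0_lt_compat|]; lra. }
set (Y := q * X).
assert (HY : eps = b * Y).
{ rewrite Heps. unfold Y, q, X. destruct (Rtotal_order b 0) as [H|[H|H]]; [|contradiction|].
  - specialize (Hbm H). rewrite (Rabs_left b), (Rabs_left (om - 1)) by lra. field. lra.
  - specialize (Hbp H). rewrite (Rabs_pos_eq b), (Rabs_pos_eq (om - 1)) by lra. field. lra. }
assert (HY0 : 0 < Y) by (unfold Y; apply Rmult_lt_0_compat; lra).
set (de := Rpower Y (/ INR (d - 1))).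
assert (Hde0 : 0 < de) by apply exp_pos.
assert (Hdm : INR (d - 1) = INR d - 1) by (rewrite minus_INR by lia; reflexivity).
assert (Hdd : de ^ (d - 1) = Y).
{ unfold de. rewrite Rpower_root_pow by lia. unfold Rdiv. rewrite Rinv_r by (rewrite Hdm; lra). now apply Rpower_1. }
(* Since [de^(d-1) = q X], the power [de^(p-1)] is [(q X)^s] with the exponent [s] of the
   hypothesis: the quotient bounded by [C] is [A/ga] up to constants. *)
assert (Hdp1 : de ^ (p - 1) <= B * Z).
{ unfold de. rewrite Rpower_root_pow by lia. rewrite Hdm, minus_INR by lia. change (INR 1) with 1. fold s. unfold Y.
  rewrite <- Rpower_mult_distr by (apply Hq || exact HX0). apply Rmult_le_compat_r; [now apply Rlt_le|].
  now apply Rpower_le_base. }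
assert (HBZ : B * Z <= B * (C * ga)) by (apply Rmult_le_compat_l; lra).
assert (Hded0 : de <= d0).
{ apply Rnot_lt_le. intros H.
  assert (d0 ^ (p - 1) <= de ^ (p - 1)) by (apply pow_incr; lra).
  assert (B * (C * ga) <= B * (d0 ^ (p - 1) / (2 * B) * (3 / 2))).
  { apply Rmult_le_compat_l; [lra|]. apply Rmult_le_compat; lra. }
  replace (B * (d0 ^ (p - 1) / (2 * B) * (3 / 2))) with (3 / 4 * d0 ^ (p - 1)) in H1 by (field; lra). lra. }
assert (Hde1 : de <= 1) by (eapply Rle_trans; [exact Hded0|apply Rmin_l]).
destruct (Hscaled de (conj Hde0 Hde1)) as (Hnl & Hnd & Hpr & E & psi & Hdec & HE & Hpsi & Hpsi0). clear Hscaled.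
set (phi := fun y => f (de * y) / de) in *. set (A := K * de ^ (p - 1)) in *.
assert (HA0 : 0 <= A) by (unfold A; apply Rmult_le_pos; [lra|apply pow_le; lra]).
assert (HA : 1000000 * A <= ga).
{ unfold A. apply Rle_trans with (1000000 * (K * (B * (C * ga)))).
  - apply Rmult_le_compat_l; [lra|]. apply Rmult_le_compat_l; lra.
  - replace (1000000 * (K * (B * (C * ga)))) with (1000000 * K * B * C * ga) by ring. rewrite <- (Rmult_1_l ga) at 2.
    apply Rmult_le_compat_r; [lra|]. assert (0 < 1000000 * K * B) by (repeat apply Rmult_lt_0_compat; lra).
    apply Rle_trans with (1000000 * K * B * / (1000000 * K * B)); [apply Rmult_le_compat_l; lra|]. rewrite Rinv_r; lra. }
assert (Hkap : (6000 * A ^ 2 + K' * de ^ d) / Rabs eps <= / (60 * (INR e + 1))).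
{ rewrite HY, Rabs_mult, (Rabs_pos_eq Y) by lra.
  (* Here [d < 2p - 1] enters: [2 (p - 1) >= d] and [de <= 1]. Against [eps = b de^(d-1)] a full
     factor [de] is left. *)
  assert (A2 : A ^ 2 <= K ^ 2 * de ^ d).
  { unfold A. rewrite Rpow_mult_distr. apply Rmult_le_compat_l; [apply pow2_ge_0|]. rewrite <- pow_mult.
    replace ((p - 1) * 2)%nat with (d + ((p - 1) * 2 - d))%nat by lia. rewrite pow_add. rewrite <- (Rmult_1_r (de ^ d)) at 2.
    apply Rmult_le_compat_l; [apply pow_le; lra|]. rewrite <- (pow1 ((p - 1) * 2 - d)). apply pow_incr; lra. }
  assert (N : 6000 * A ^ 2 + K' * de ^ d <= G * (de * Y)).
  { rewrite <- Hdd. change (de * de ^ (d - 1)) with (de ^ S (d - 1)). replace (S (d - 1)) with d by lia. unfold G. lra. }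
  assert (Hde2 : de <= Rabs b / (60 * (INR e + 1)) / G) by (eapply Rle_trans; [exact Hded0|apply Rmin_r]).
  apply Rmult_le_reg_r with (Rabs b * Y); [apply Rmult_lt_0_compat; lra|].
  unfold Rdiv at 1. rewrite Rmult_assoc, Rinv_l, Rmult_1_r by (apply Rgt_not_eq, Rmult_lt_0_compat; lra).
  eapply Rle_trans; [exact N|]. rewrite <- !Rmult_assoc. apply Rmult_le_compat_r; [lra|].
  apply Rle_trans with (G * (Rabs b / (60 * (INR e + 1)) / G)); [apply Rmult_le_compat_l; lra|]. right. field. lra. }
assert (Heps0 : eps <> 0).
{ rewrite HY. apply Rmult_integral_contrapositive. split; [exact Hb|lra]. }
destruct (functional_choice (fun k j => Rabs (INR j - om * INR n * INR k) <= / 2)) as [J HJ].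
{ intros k. apply nearest_nat_exists. apply Rmult_le_pos; [apply Rmult_le_pos; lra|apply pos_INR]. }
destruct (grid_solution_exists n e om ga eps A (K' * de ^ d) J phi (fun y => RInt phi 0 y) E psi) as [Cst HCst]; try assumption.
- split; assumption.
- eapply Rle_trans; [exact Homn|]. nra.
- reflexivity.
- intros y. rewrite (Hdec y : phi y = _), HY, <- Hdd, He. reflexivity.
- apply Rmult_le_pos; [lra|apply pow_le; lra].
- destruct (limit_solution n om phi J Cst Hn (nl_zero _ _ Hnl) (nl_cont _ _ Hnl) HCst)
    as (U & Ut & Ux & Uc & Ueq & Ubd & Uev & Uper & Umin).
  assert (Hf : forall y, f (de * y) = de * phi y) by (intros y; unfold phi; field; lra).
  assert (Good := good_unscaled n om de f phi U Hn Hom Hde0 Hf Ut Ux Uc Ueq Ubd Uev Uper Umin).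
  exists (fun t x => de * U 0%nat 0%nat (INR n * om * t + INR 0 * PI) (1 * x + 0)).
  split; [apply Good; left; split; reflexivity|].
  (* The shift of [t] by [PI / om] advances the phase by [n PI]. *)
  replace (fun t x => de * U 0%nat 0%nat (INR n * om * (t + PI / om) + INR 0 * PI) (1 * (PI - x) + 0))
    with (fun t x => de * U 0%nat 0%nat (INR n * om * t + INR n * PI) (- 1 * x + PI)).
  + apply Good. right; split; reflexivity.
  + apply functional_extensionality; intros t. apply functional_extensionality; intros x.
    f_equal. f_equal; [cbn [INR]; field; lra|ring].
Qed.
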